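(* Let $d_1,d_2,\kappa\in\mathbb{N}$ with $d_1,d_2>1$ and $\kappa\le\min\{d_1,d_2\}$, and set $D=\{1,\dots,d_1\}\times\{1,\dots,d_2\}$. Let $(\mathbf{X},Y),(\mathbf{X}_1,Y_1),\dots,(\mathbf{X}_n,Y_n)$ be independent and identically distributed $[0,1]^{D}\times\{0,1\}$-valued random variables. Assume that the a posteriori probability $\eta(\mathbf{x})=\mathbf{P}\{Y=1\mid \mathbf{X}=\mathbf{x}\}$ satisfies an average-pooling model of size $\kappa^2$ with smoothness constraint $p\in[\frac12,1]$. Choose $L\ge 2$ and $K_n\in\mathbb{N}$ such that $K_n/n^{2\kappa^2+7}\to\infty$ as $n\to\infty$ and $K_n/n^{\rho}\to 0$ as $n\to\infty$ for some $\rho>0$. Choose $L_n\in\mathbb{N}$ with $L_n\ge (\log n)^{6L+2}\cdot K_n^{3/2}$, set $\lambda_n=1/L_n$, $t_n=\lceil c_5\cdot(\log n)\cdot L_n\rceil$, $\tau=\frac{1}{1+\kappa^2}$, and choose the architecture $M_1=M_{L+1}=\kappa$, $M_2=\dots=M_L=1$, $k_1=\dots=k_{L-1}=2\kappa^2$, $k_0=k_L=1$. Assume $c_5\ge \frac{1}{2c_4}$. Let $f_n$ be the over-parametrized convolutional neural network classifier learned by gradient descent described in the context, with these choices. Then for every $\epsilon>0$, $$\mathbf{P}\{f_n(\mathbf{X})\neq Y\}-\min_{f:[0,1]^{D}\to\{0,1\}}\mathbf{P}\{f(\mathbf{X})\neq Y\}\le c_6\cdot n^{-\frac{1}{2\kappa^2+2}+\epsilon}$$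 for some constant $c_6>0$ which does not depend on $d_1$, $d_2$ and $n$.
   Context: Notation: for a finite nonempty index set $J$, $[0,1]^J$ denotes the set of families $(a_j)_{j\in J}$ with $a_j\in[0,1]$. For $\mathbf{x}\in[0,1]^D$ and $(i,j)\in\mathbb{Z}^2$, $\mathbf{x}_{(i,j)+I}$ denotes the restriction of $\mathbf{x}$ to the index set $(i,j)+I$. Smoothness: for $p\in[1/2,1]$ and $C>0$, a function $f$ on a subset of $\mathbb{R}^d$ (here on $[0,1]^{J}$, identified with a subset of $\mathbb{R}^{|J|}$) is $(p,C)$-smooth if $|f(\mathbf{x})-f(\mathbf{z})|\le C\|\mathbf{x}-\mathbf{z}\|^p$ for all $\mathbf{x},\mathbf{z}$, with $\|\cdot\|$ the Euclidean norm. Average-pooling model: let $I=\{0,\dots,\kappa-1\}\times\{0,\dots,\kappa-1\}$. A function $m:[0,1]^D\to\mathbb{R}$ satisfies an average-pooling model of size $\kappa^2$ with smoothness constraint $p$ if there is a $(p,C)$-smooth function $f:[0,1]^{(1,1)+I}\to\mathbb{R}$ for some $C>0$ with $$m(\mathbf{x})=\frac{1}{(d_1-\kappa+1)(d_2-\kappa+1)}\sum_{(i,j)\in\mathbb{Z}^2:\,(i,j)+I\subseteq D} f(\mathbf{x}_{(i,j)+I}).$$ Network: $\sigma(x)=1/(1+e^{-x})$ is the logistic squasher. Given $L$, $M_1,\dots,M_{L+1}$, $k_0,\dots,k_L$, and $K_n$, for $k\in\{1,\dots,K_n\}$ define for $(i,j)\in D$: $o^{(0)}_{(i,j),1,k}=x_{i,j}$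 and for $r=1,\dots,L$, $s_2\in\{1,\dots,k_r\}$, $$o^{(r)}_{(i,j),s_2,k}=\sigma\Big(\sum_{s_1=1}^{k_{r-1}}\sum_{t_1,t_2\in\{1,\dots,M_r\},\,(i+t_1-1,j+t_2-1)\in D} w^{(r)}_{t_1,t_2,s_1,s_2,k}\, o^{(r-1)}_{(i+t_1-1,j+t_2-1),s_1,k}+w^{(r)}_{s_2,k}\Big),$$ $$f_{\mathbf{w}_k,\mathbf{w}_{bias,k}}(\mathbf{x})=\frac{1}{(d_1-M_{L+1}+1)(d_2-M_{L+1}+1)}\sum_{i=1}^{d_1-M_{L+1}+1}\sum_{j=1}^{d_2-M_{L+1}+1}o^{(L)}_{(i,j),1,k},$$ and $f_{\mathbf{w}}(\mathbf{x})=\sum_{k=1}^{K_n}w_k f_{\mathbf{w}_k,\mathbf{w}_{bias,k}}(\mathbf{x})$, where $\mathbf{w}$ is the vector of all weights $w_k$, $w^{(r)}_{t_1,t_2,s_1,s_2,k}$, $w^{(r)}_{s_2,k}$. Estimate: $c_2,c_3,c_4>0$ are fixed constants (parameters of the estimate). The initial weight vector $\mathbf{w}^{(0)}$ has $w_k=0$ for $k=1,\dots,K_n$, and all other components are independent random variables (independent of the data), uniformly distributed on $[-c_2(\log n)^2,c_2(\log n)^2]$ for the weights $w^{(r)}_{t_1,t_2,s_1,s_2,k},w^{(r)}_{s_2,k}$ with $r=2,\dots,L$, and uniformly distributed on $[-c_3(\log n)^2 n^{\tau},c_3(\log n)^2n^{\tau}]$ for $r=1$. Define $$F_n(\mathbf{w})=\frac1n\sum_{i=1}^n|Y_i-f_{\mathbf{w}}(\mathbf{X}_i)|^2+c_4\sum_{k=1}^{K_n}w_k^2,$$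 and $\mathbf{w}^{(t)}=\mathbf{w}^{(t-1)}-\lambda_n\nabla_{\mathbf{w}}F_n(\mathbf{w}^{(t-1)})$ for $t=1,\dots,t_n$. The classifier is $f_n(\mathbf{x})=1$ if $f_{\mathbf{w}^{(t_n)}}(\mathbf{x})\ge 1/2$ and $f_n(\mathbf{x})=0$ otherwise. The probability $\mathbf{P}\{f_n(\mathbf{X})\ne Y\}$ is taken over the data, the random initialization and $(\mathbf{X},Y)$. *)

(* Defs.v *)
From HB Require Import structures.
From mathcomp Require Import all_boot all_order all_algebra.
From mathcomp Require Import all_classical all_reals all_analysis.
Set Implicit Arguments. Unset Strict Implicit. Unset Printing Implicit Defensive.
Import Order.TTheory GRing.Theory Num.Theory.
Local Open Scope ring_scope.
Local Open Scope classical_set_scope.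

Section Defs.
Variable R : realType.

(* An input image x in [0,1]^D, D = {1..d1} x {1..d2}, stored as a d1-tuple
   of d2-tuples (product sigma-algebra = Borel sets of R^(d1*d2)). *)
Definition xsp (d1 d2 : nat) := d1.-tuple (d2.-tuple R).

(* x_{i,j}, 1-based indices (default 0 outside D, never used there) *)
Definition xat d1 d2 (x : xsp d1 d2) (i j : nat) : R :=
  nth 0 (nth (nseq d2 0) (map val x) i.-1) j.-1.

Definition inD (d1 d2 i j : nat) : bool := (1 <= i <= d1)%N && (1 <= j <= d2)%N.

Definition cube d1 d2 : set (xsp d1 d2) :=
  [set x | forall i j, inD d1 d2 i j -> 0 <= xat x i j <= 1].

(* (p,C)-smoothness of a function on [0,1]^{(1,1)+I}, I = {0..kappa-1}^2,
   patches being kappa x kappa matrices, Euclidean norm on R^(kappa^2). *)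
Definition smooth_patch (kappa : nat) (p C : R) (f : 'M[R]_kappa -> R) : Prop :=
  forall u v : 'M[R]_kappa,
    (forall a b, 0 <= u a b <= 1) -> (forall a b, 0 <= v a b <= 1) ->
    `|f u - f v| <= C * (Num.sqrt (\sum_a \sum_b (u a b - v a b) ^+ 2)) `^ p.

(* x_{(i,j)+I}, identified with an element of [0,1]^{(1,1)+I} by translation *)
Definition patch d1 d2 kappa (x : xsp d1 d2) (i j : nat) : 'M[R]_kappa :=
  \matrix_(a < kappa, b < kappa) xat x (i + a) (j + b).

(* average-pooling function m; the (i,j) with (i,j)+I inside D are exactly
   1 <= i <= d1-kappa+1, 1 <= j <= d2-kappa+1 *)
Definition avg_pool d1 d2 kappa (f : 'M[R]_kappa -> R) (x : xsp d1 d2) : R :=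
  ((d1 - kappa + 1) * (d2 - kappa + 1))%:R^-1 *
  \sum_(1 <= i < (d1 - kappa + 1).+1) \sum_(1 <= j < (d2 - kappa + 1).+1)
     f (patch kappa x i j).

Definition sigmoid (x : R) : R := (1 + expR (- x))^-1.

(* weights are indexed by lists of naturals:
   w_k                       = w [:: 0; k]
   w^{(r)}_{t1,t2,s1,s2,k}   = w [:: 1; r; t1; t2; s1; s2; k]
   w^{(r)}_{s2,k}            = w [:: 2; r; s2; k]
   (all other coordinates are never used by the network) *)
Definition wvec := seq nat -> R.

Fixpoint cnn_o d1 d2 (M kk : nat -> nat) (w : wvec) (x : xsp d1 d2)
    (k r i j s2 : nat) {struct r} : R :=
  match r with
  | 0 => xat x i j
  | r'.+1 =>
    sigmoid (\sum_(1 <= s1 < (kk r').+1) \sum_(1 <= t1 < (M r).+1)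
               \sum_(1 <= t2 < (M r).+1)
               (if inD d1 d2 (i + t1 - 1) (j + t2 - 1)
                then w [:: 1; r; t1; t2; s1; s2; k] *
                     cnn_o M kk w x k r' (i + t1 - 1) (j + t2 - 1) s1
                else 0)
             + w [:: 2; r; s2; k])
  end.

Definition cnn_k d1 d2 (L : nat) (M kk : nat -> nat) (w : wvec) (x : xsp d1 d2)
    (k : nat) : R :=
  ((d1 - M L.+1 + 1) * (d2 - M L.+1 + 1))%:R^-1 *
  \sum_(1 <= i < (d1 - M L.+1 + 1).+1) \sum_(1 <= j < (d2 - M L.+1 + 1).+1)
     cnn_o M kk w x k L i j 1.

Definition cnn d1 d2 (L K : nat) (M kk : nat -> nat) (w : wvec) (x : xsp d1 d2) : R :=
  \sum_(1 <= k < K.+1) w [:: 0; k] * cnn_k L M kk w x k.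

Definition Fn d1 d2 (L K : nat) (M kk : nat -> nat) (c4 : R)
    (s : seq (xsp d1 d2 * bool)) (w : wvec) : R :=
  (size s)%:R^-1 * \sum_(z <- s) ((z.2 : nat)%:R - cnn L K M kk w z.1) ^+ 2
  + c4 * \sum_(1 <= k < K.+1) (w [:: 0; k]) ^+ 2.

Definition upd (w : wvec) (i : seq nat) (v : R) : wvec :=
  fun j => if j == i then v else w j.

Definition gd_step (F : wvec -> R) (lambda : R) (w : wvec) : wvec :=
  fun i => w i - lambda * derive1 (fun v => F (upd w i v)) (w i).

Definition archM (kappa L r : nat) : nat :=
  if (r == 1)%N || (r == L.+1)%N then kappa else 1.
Definition archk (kappa L r : nat) : nat :=
  if (r == 0)%N || (r == L)%N then 1 else (2 * kappa ^ 2)%N.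

Definition bindl (A B : Type) (s : seq A) (f : A -> seq B) : seq B :=
  flatten (map f s).

(* the randomly initialized weights with the half-width of their uniform law *)
Definition init_list (L K : nat) (M kk : nat -> nat) (a1 a2 : R) : seq (seq nat * R) :=
  bindl (iota 1 L) (fun r =>
  let a := if r == 1%N then a1 else a2 in
  bindl (iota 1 (M r)) (fun t1 => bindl (iota 1 (M r)) (fun t2 =>
  bindl (iota 1 (kk r.-1)) (fun s1 => bindl (iota 1 (kk r)) (fun s2 =>
  map (fun k => ([:: 1; r; t1; t2; s1; s2; k], a)) (iota 1 K))))))
  ++
  bindl (iota 1 L) (fun r =>
  let a := if r == 1%N then a1 else a2 in
  bindl (iota 1 (kk r)) (fun s2 =>
  map (fun k => ([:: 2; r; s2; k], a)) (iota 1 K))).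

Definition sym_itv (a : R) : set R := `[-a, a].

(* expectation of h(V), V uniform on [-a,a] (point mass at 0 if a = 0) *)
Definition unif_exp (a : R) (h : R -> \bar R) : \bar R :=
  if 0 < a then (((2 * a)^-1)%:E * \int[lebesgue_measure]_(v in sym_itv a) h v)%E
  else h 0.

(* expectation over independent uniform initial weights (listed in l);
   the other coordinates (in particular all w_k) are 0 *)
Fixpoint init_exp (l : seq (seq nat * R)) (G : wvec -> \bar R) (w : wvec) : \bar R :=
  match l with
  | [::] => G w
  | (i, a) :: l' => unif_exp a (fun v => init_exp l' G (upd w i v))
  end.

(* expectation over an i.i.d. sample of size m of (X,Y), where X has law mu
   (concentrated on [0,1]^D) and P{Y = 1 | X = x} = eta x *)
Fixpoint sample_exp d1 d2 (mu : probability (xsp d1 d2) R) (eta : xsp d1 d2 -> R)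
    (m : nat) (G : seq (xsp d1 d2 * bool) -> \bar R) : \bar R :=
  match m with
  | 0 => G [::]
  | m'.+1 =>
    (\int[mu]_(x in @cube d1 d2)
       ((eta x)%:E * sample_exp mu eta m' (fun s => G ((x, true) :: s))
        + (1 - eta x)%:E * sample_exp mu eta m' (fun s => G ((x, false) :: s))))%E
  end.

Definition risk d1 d2 (mu : probability (xsp d1 d2) R) (eta : xsp d1 d2 -> R)
    (g : xsp d1 d2 -> bool) : \bar R :=
  (\int[mu]_(x in @cube d1 d2) (if g x then 1 - eta x else eta x)%:E)%E.

Definition cnn_error d1 d2 (mu : probability (xsp d1 d2) R) (eta : xsp d1 d2 -> R)
    (n L K : nat) (M kk : nat -> nat) (c4 a1 a2 lambda : R) (tn : nat) : \bar R :=
  init_exp (init_list L K M kk a1 a2)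
    (fun w0 => sample_exp mu eta n (fun s =>
       let wt := iter tn (gd_step (Fn L K M kk c4 s) lambda) w0 in
       risk mu eta (fun x => 2^-1 <= cnn L K M kk wt x)))
    (fun _ => 0).

End Defs.

(* Main.v *)
Require Import Defs.
From HB Require Import structures.
From mathcomp Require Import all_boot all_order all_algebra.
From mathcomp Require Import all_classical all_reals all_analysis.
From mathcomp Require Import measurable_realfun.
From mathcomp Require Import ring lra zify.
Import Order.TTheory GRing.Theory Num.Theory.
Import numFieldNormedType.Exports.
Local Open Scope ring_scope.
Local Open Scope classical_set_scope.
Set Implicit Arguments. Unset Strict Implicit. Unset Printing Implicit Defensive.

(* Three facts drive the proof.

   Optimization.  For fixed inner weights the regularized empirical risk is
   strongly convex in the outer weights, and it is smooth along the
   trajectory, so gradient descent decreases it, moves the weights by at most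
   O(log n) in squared norm, and in the end competes, up to 1/n, with every
   choice u of outer weights placed on the (slightly moved) initial inner
   weights.

   Approximation.  For a suitable corner the box of weights on which one
   network is exponentially close to the indicator of an orthant has
   probability of order n^(-2 kappa^2).  Importance sampling puts on the k-th
   network the outer weight (indicator of the box) / (K_n * probability) times
   the coefficient of an inclusion-exclusion interpolation of f on a grid of
   mesh n^(-tau).  The mean of the resulting function approximates the a
   posteriori probability with squared error O(n^(-tau)); by independence of
   the networks its variance, and the squared norm of u, are
   O(n^(2 kappa^2 + 2) / K_n).

   Generalization.  On cells of side n^(-tau - delta) a network is close to a
   polynomial of bounded degree with quantizable coefficients, uniformly in
   the weights met by the descent, so the logarithm of the covering number is
   n^(tau kappa^2) up to n^eps.  The variance condition of the squared loss
   then gives the fast rate n^(tau kappa^2 - 1) = n^(-tau) for the regression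
   error, hence n^(-tau / 2) for the excess misclassification risk.

   The initial weights are replaced by uniform digits, the rounding error being
   absorbed in the movement of the weights; thus only finite averages have to
   be handled and no measurability in the initial weights is needed. *)

(** * Local Taylor polynomials of the logistic function *)

(** First-layer weights range over an interval of length about n^tau, yet the constants of the
    optimization must stay polylogarithmic. They do, because a first-layer weight only multiplies an
    input in [0,1]: the expansion of a network in its weights involves the size of the weights of
    layers 2 to L alone, which is of order (log n)^2.

    Origin of the exponent 2 kappa^2 + 7: a network has 2 kappa^2 (kappa^2 + 1) first-layer weights,
    each hitting its window with probability of order n^(-tau), which gives 2 kappa^2. Two more
    powers of n pay for the squared number of grid corners, two for the drift of the inner weights;
    the rest is slack.

    Independence of d1 and d2 comes from treating networks, codes and bumps as functions of one
    patch; positions enter through an average only.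

    The trained weights are not known to depend measurably on the sample. Hence the risk is
    majorized, sample by sample, by an explicit expression built from sums and products over the
    observations, and only this majorant is integrated. *)

Section Sigmoid.
Variable R : realType.
Implicit Types (x z h : R).

Lemma sigmoid_den_gt0 z : 0 < 1 + expR (- z).
Proof. by rewrite addr_gt0 ?expR_gt0. Qed.

Lemma sigmoid_gt0 z : 0 < sigmoid z.
Proof. by rewrite invr_gt0 sigmoid_den_gt0. Qed.

Lemma sigmoid_le1 z : sigmoid z <= 1.
Proof. by rewrite invf_le1 ?sigmoid_den_gt0// lerDl expR_ge0. Qed.

Lemma sigmoid_itv z : 0 <= sigmoid z <= 1.
Proof. by rewrite (ltW (sigmoid_gt0 z)) sigmoid_le1. Qed.

Lemma sigmoid_le_exp z : sigmoid z <= expR z.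
Proof.
rewrite /sigmoid -[leRHS]invrK -expRN lef_pV2 ?posrE ?sigmoid_den_gt0 ?expR_gt0//.
by rewrite lerDr.
Qed.

Lemma sigmoid_ge_exp z : 1 - expR (- z) <= sigmoid z.
Proof.
rewrite -[sigmoid z]mul1r ler_pdivlMr ?sigmoid_den_gt0//.
have : 0 <= expR (- z) ^+ 2 by rewrite sqr_ge0.
by move=> ?; nra.
Qed.

Lemma sigmoid_lip x z : `|sigmoid x - sigmoid z| <= `|x - z|.
Proof.
wlog zx : x z / z <= x.
  move=> H; case: (leP z x) => [/H//|/ltW /H].
  by rewrite distrC [leRHS]distrC.
have ex : expR (- x) = expR (- z) * expR (z - x).
  by rewrite -expRD; congr expR; ring.
have h1 : 1 + (z - x) <= expR (z - x) by exact: expR_ge1Dx.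
have h2 : expR (z - x) <= 1 by rewrite -[leRHS]expR0 ler_expR; lra.
have p1 := sigmoid_den_gt0 x; have p2 := sigmoid_den_gt0 z.
have e1 := expR_gt0 (- z); have e2 := expR_gt0 (- x).
have -> : sigmoid x - sigmoid z =
    (expR (- z) - expR (- x)) / ((1 + expR (- x)) * (1 + expR (- z))).
  by rewrite /sigmoid; field; rewrite !gt_eqF.
have d1 : 0 <= expR (- z) - expR (- x).
  by rewrite subr_ge0 ler_expR; lra.
rewrite ger0_norm; last by rewrite divr_ge0// mulr_ge0// ltW.
rewrite ger0_norm ?subr_ge0// ler_pdivrMr ?mulr_gt0//.
rewrite ex in d1 p1 e2 *.
apply: (@le_trans _ _ (expR (- z) * (x - z))).
  by rewrite -[X in X - _]mulr1 -mulrBr ler_wpM2l ?(ltW e1)//; move: h1; clear; lra.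
rewrite mulrC ler_wpM2l//; first lra.
apply: (@le_trans _ _ (1 * (1 + expR (- z)))); first lra.
rewrite ler_wpM2r//; lra.
Qed.

Definition exp_poly q : {poly R} := \poly_(i < q.+1) (i`!%:R)^-1.

Lemma deriv_exp_poly q : deriv (exp_poly q.+1) = exp_poly q.
Proof.
apply/polyP => i; rewrite coef_deriv !coef_poly ltnS.
case: ifP => // iq; last by rewrite mul0rn.
have nf : (i`!)%:R != 0 :> R by rewrite pnatr_eq0 -lt0n fact_gt0.
have ni : i.+1%:R != 0 :> R by rewrite pnatr_eq0.
rewrite -[LHS]mulr_natr factS natrM invfM [X in X * _]mulrC.
by rewrite -mulrA mulVf// mulr1.
Qed.

Lemma exp_poly0 q : (exp_poly q).[0] = 1.
Proof.
by rewrite horner_coef0 coef_poly /= fact0 invr1.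
Qed.

(** The remainder [D p] is the derivative of [D p.+1] and vanishes at 0, so the mean value theorem
    gains one power of [|x|] per order; the factorial is given up. *)
Lemma exp_taylor q h : `|expR h - (exp_poly q).[h]| <= expR `|h| * `|h| ^+ q.+1.
Proof.
pose D q (x : R) := expR x - (exp_poly q).[x].
have dD p x : is_derive x (1:R) (D p.+1) (D p x).
  rewrite /D -(deriv_exp_poly p).
  exact: (is_deriveB (is_derive_expR x) (is_derive_poly (exp_poly p.+1) x)).
have D0 p : D p 0 = 0 by rewrite /D expR0 exp_poly0 subrr.
have step p C : 0 <= C -> (forall x, `|x| <= `|h| -> `|D p x| <= C) ->
    forall x, `|x| <= `|h| -> `|D p.+1 x| <= C * `|x|.
  move=> C0 H x xh.
  have cont a b : {within `[a, b], continuous (D p.+1)}.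
    apply: continuous_subspaceT => y; apply: differentiable_continuous.
    by apply/derivable1_diffP; case: (dD p y).
  case: (leP 0 x) => x0.
    have [c] := MVT_segment x0 (fun y _ => dD p y) (cont _ _).
    rewrite in_itv/= D0 !subr0 => /andP[c0 cx] ->.
    rewrite normrM ler_wpM2r// H// (le_trans _ xh)// !ger0_norm//.
  have [c] := MVT_segment (ltW x0) (fun y _ => dD p y) (cont _ _).
  rewrite in_itv/= D0 !sub0r => /andP[c0 cx] /eqP; rewrite eqr_oppLR => /eqP->.
  rewrite normrN normrM normrN ler_wpM2r// H// (le_trans _ xh)//.
  by rewrite !ler0_norm ?(ltW x0) ?lerN2//.
have base : forall x, `|x| <= `|h| -> `|D 0%N x| <= expR `|h| * `|x|.
  move=> x xh; rewrite /D /exp_poly.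
  have -> : (\poly_(i < 1) (i`!%:R)^-1 : {poly R}).[x] = 1.
    by rewrite horner_poly big_ord1 fact0 invr1 expr0 mulr1.
  have cont a b : {within `[a, b], continuous (@expR R)}.
    by apply: continuous_subspaceT => y; exact: continuous_expR.
  case: (leP 0 x) => x0.
    have [c] := MVT_segment x0 (fun y _ => is_derive_expR y) (cont _ _).
    rewrite in_itv/= expR0 subr0 => /andP[c0 cx] ->.
    rewrite normrM ler_wpM2r// ger0_norm ?expR_ge0// ler_expR (le_trans _ xh)//.
    by rewrite ger0_norm.
  have [c] := MVT_segment (ltW x0) (fun y _ => is_derive_expR y) (cont _ _).
  rewrite in_itv/= expR0 sub0r => /andP[c0 cx] e.
  rewrite distrC e normrM normrN ler_wpM2r// ger0_norm ?expR_ge0// ler_expR.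
  by rewrite (le_trans cx).
have main p : forall x, `|x| <= `|h| -> `|D p x| <= expR `|h| * `|h| ^+ p * `|x|.
  elim: p => [|p IH] x xh; first by rewrite expr0 mulr1 base.
  have C0 k : 0 <= expR `|h| * `|h| ^+ k by rewrite mulr_ge0 ?expR_ge0 ?exprn_ge0.
  apply: (step p _ (C0 p.+1)) => // y yh.
  by rewrite (le_trans (IH _ yh))// exprSr mulrA ler_wpM2l.
by rewrite (le_trans (main q h (lexx _)))// exprSr mulrA.
Qed.

Lemma exprn_dist (a b M : R) m : 0 <= M -> `|a| <= M -> `|b| <= M ->
  `|a ^+ m - b ^+ m| <= m%:R * M ^+ m.-1 * `|a - b|.
Proof.
move=> M0 aM bM; rewrite subrXX normrM mulrC ler_wpM2r//.
apply: (le_trans (ler_norm_sum _ _ _)).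
have -> : m%:R * M ^+ m.-1 = \sum_(i < m) M ^+ m.-1.
  by rewrite sumr_const card_ord mulr_natl.
rewrite ler_sum// => i _; rewrite normrM !normrX.
have {2}-> : m.-1 = (m.-1 - i + i)%N by have := ltn_ord i; lia.
by rewrite exprD ler_pM ?exprn_ge0// ?lerXn2r ?nnegrE.
Qed.

(** Uniformity in [z] comes from sigmoid (z + h) = sigmoid z / (1 + r (exp (-h) - 1)) with r = 1 -
    sigmoid z: the point [z] enters only through two numbers of [0,1]. Cutting both the geometric
    series and the exponential series at order [q] gives degree at most q * q. *)
Lemma sigmoid_taylor q : exists C : R, 1 <= C /\
  forall z, exists p : {poly R}, [/\ (size p <= (q * q).+1)%N,
    forall i, `|p`_i| <= C &
    forall h, `|h| <= 1 -> `|sigmoid (z + h) - p.[h]| <= C * `|h| ^+ q.+1].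
Proof.
pose e : R := expR 1.
have e1 : 1 <= e by rewrite /e -expR0 ler_expR.
have e0 : 0 <= e by exact: le_trans e1.
pose d : {poly R} := exp_poly q \Po (- 'X) - 1.
(* [Ci] bounds the coefficients, [C1] the replacement of exp (-h) - 1 by the polynomial [d], and
   [C2] the tail of the geometric series. *)
pose Ci : R := \sum_(i < (q * q).+1) \sum_(m < q.+1) `|(d ^+ m)`_i|.
pose C1 : R := \sum_(m < q.+1) m%:R * (2 * e) ^+ m.-1 * e.
pose C2 : R := e * e ^+ q.+1.
have Ci0 : 0 <= Ci by rewrite sumr_ge0// => i _; rewrite sumr_ge0.
have C10 : 0 <= C1.
  rewrite sumr_ge0// => i _; rewrite !mulr_ge0// ?exprn_ge0//; lra.
have C20 : 0 <= C2 by rewrite mulr_ge0// exprn_ge0.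
exists (1 + Ci + C1 + C2); split; first lra.
move=> z.
pose r : R := 1 - sigmoid z.
have r01 : 0 <= r <= 1 by have := sigmoid_itv z; rewrite /r; lra.
pose p : {poly R} := sigmoid z *: \sum_(m < q.+1) (- r) ^+ m *: d ^+ m.
have sd : (size d <= q.+1)%N.
  rewrite (leq_trans (size_polyD _ _))// geq_max size_polyN size_polyC oner_eq0/= andbT.
  rewrite (leq_trans (size_comp_poly_leq _ _))// size_polyN size_polyX.
  have := size_poly q.+1 (fun i => (i`!%:R)^-1 : R); rewrite -/(exp_poly q) muln1; lia.
have sp : (size p <= (q * q).+1)%N.
  rewrite (leq_trans (size_scale_leq _ _))// (leq_trans (size_sum _ _ _))//.
  apply/bigmax_leqP => i _; rewrite (leq_trans (size_scale_leq _ _))//.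
  rewrite (leq_trans (size_poly_exp_leq _ _))// ltnS leq_mul//; last by rewrite -ltnS.
  by move: sd; case: (size d).
have sz01 := sigmoid_itv z.
exists p; split => //.
  move=> i; case: (ltnP i (q * q).+1) => iq; last first.
    by rewrite nth_default ?normr0; [lra|rewrite (leq_trans sp)].
  apply: (@le_trans _ _ Ci); last lra.
  rewrite /Ci (bigD1 (Ordinal iq))//= -[leLHS]addr0 lerD//; last first.
    by rewrite sumr_ge0// => ? _; rewrite sumr_ge0.
  rewrite /p coefZ normrM coef_sum.
  apply: (@le_trans _ _ (1 * `|\sum_(m < q.+1) ((- r) ^+ m *: d ^+ m)`_i|)).
    rewrite ler_wpM2r// ger0_norm; lra.
  rewrite mul1r (le_trans (ler_norm_sum _ _ _))// ler_sum// => m _.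
  rewrite coefZ normrM -[leRHS]mul1r ler_wpM2r// normrX normrN exprn_ile1//.
  by rewrite ger0_norm; lra.
move=> h h1.
pose de : R := expR (- h) - 1.
have dh : d.[h] = (exp_poly q).[- h] - 1.
  by rewrite /d hornerD horner_comp !hornerN hornerX hornerC.
have eh : expR (- h) <= e.
  by rewrite ler_expR; move: h1; rewrite ler_norml; lra.
have eh' : expR `|h| <= e by rewrite ler_expR.
have hq : 0 <= `|h| ^+ q.+1 <= 1 by rewrite exprn_ge0// exprn_ile1.
have hde : `|de - d.[h]| <= e * `|h| ^+ q.+1.
  rewrite /de dh.
  have -> : expR (- h) - 1 - ((exp_poly q).[- h] - 1) =
            expR (- h) - (exp_poly q).[- h] by ring.
  by rewrite (le_trans (exp_taylor _ _))// normrN ler_wpM2r//; lra.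
have deb : `|de| <= e * `|h|.
  have := exp_taylor 0 (- h); rewrite normrN expr1.
  have -> : (exp_poly 0).[- h] = 1.
    by rewrite horner_poly big_ord1 fact0 invr1 expr0 mulr1.
  by move=> /le_trans; apply; rewrite ler_wpM2r.
have h0 : 0 <= `|h| by [].
have deM : `|de| <= 2 * e.
  rewrite (le_trans deb)//; apply: (@le_trans _ _ (e * 1)); last lra.
  by rewrite ler_wpM2l.
have dM : `|d.[h]| <= 2 * e.
  have -> : d.[h] = de - (de - d.[h]) by ring.
  rewrite (le_trans (ler_normB _ _))//.
  have : e * `|h| <= e * 1 by rewrite ler_wpM2l.
  have : e * `|h| ^+ q.+1 <= e * 1 by rewrite ler_wpM2l//; lra.
  lra.
have ps : p.[h] = sigmoid z * \sum_(m < q.+1) (- r) ^+ m * d.[h] ^+ m.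
  rewrite /p hornerZ horner_sum; congr (_ * _); apply: eq_bigr => m _.
  by rewrite hornerZ horner_exp.
pose X := - (r * de).
have z0 := sigmoid_den_gt0 z.
have rE : r = expR (- z) * sigmoid z.
  by rewrite /r /sigmoid; field; rewrite gt_eqF.
have den : 1 - X = sigmoid z * (1 + expR (- (z + h))).
  rewrite /X rE /de opprD expRD /sigmoid; field; by rewrite gt_eqF.
(* 1 - X = (1 - r) + r exp (-h) is a convex combination of two numbers that are at least 1/e. *)
have denge : e^-1 <= 1 - X.
  rewrite /X opprK /de.
  have : e^-1 <= expR (- h).
    by rewrite -expRN ler_expR; move: h1; rewrite ler_norml; lra.
  have : e^-1 <= 1 by rewrite invf_le1 ?(lt_le_trans _ e1).
  by nra.
have ei0 : 0 < e^-1 by rewrite invr_gt0 (lt_le_trans _ e1).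
have sE : sigmoid (z + h) = sigmoid z / (1 - X).
  rewrite den /sigmoid; field; by rewrite !gt_eqF// ?sigmoid_den_gt0.
have geo : (1 - X)^-1 - \sum_(m < q.+1) X ^+ m = X ^+ q.+1 / (1 - X).
  have := subrX1 X q.+1 => gE.
  have X1 : 1 - X != 0 by rewrite gt_eqF// (lt_le_trans ei0).
  apply: (mulIf X1); rewrite mulrBl mulVf// -mulrA mulVf// mulr1.
  have -> : (\sum_(m < q.+1) X ^+ m) * (1 - X) = - ((X - 1) * \sum_(m < q.+1) X ^+ m) by ring.
  by rewrite -gE; ring.
have Xb : `|X| <= e * `|h|.
  rewrite normrN normrM (le_trans _ deb)// -[leRHS]mul1r ler_wpM2r//.
  by rewrite ger0_norm; lra.
have t1 : `|sigmoid (z + h) - sigmoid z * \sum_(m < q.+1) X ^+ m| <= C2 * `|h| ^+ q.+1.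
  rewrite sE -mulrBr geo normrM normrM [`|(1 - X)^-1|]normfV normrX.
  have : `|X| ^+ q.+1 <= e ^+ q.+1 * `|h| ^+ q.+1.
    by rewrite -exprMn lerXn2r ?nnegrE// mulr_ge0.
  have : `|1 - X|^-1 <= e.
    rewrite -[leRHS]invrK lef_pV2 ?posrE// ?normr_gt0 ?gt_eqF// ?(lt_le_trans ei0)//.
    by rewrite (le_trans denge)// ler_norm.
  move=> q1 q2; have -> : `|sigmoid z| = sigmoid z by rewrite ger0_norm//; lra.
  apply: (@le_trans _ _ (1 * (`|X| ^+ q.+1 * `|1 - X|^-1))).
    by rewrite ler_wpM2r ?mulr_ge0 ?exprn_ge0 ?invr_ge0//; lra.
  rewrite mul1r /C2 mulrC -mulrA ler_pM ?invr_ge0 ?exprn_ge0//.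
have t2 : `|sigmoid z * \sum_(m < q.+1) X ^+ m - p.[h]| <= C1 * `|h| ^+ q.+1.
  rewrite ps -mulrBr normrM.
  apply: (@le_trans _ _ (1 * `|\sum_(m < q.+1) X ^+ m -
      \sum_(m < q.+1) (- r) ^+ m * d.[h] ^+ m|)).
    by rewrite ler_wpM2r// ger0_norm; lra.
  rewrite mul1r -sumrB (le_trans (ler_norm_sum _ _ _))// /C1 mulr_suml ler_sum// => m _.
  rewrite /X -mulNr exprMn -mulrBr normrM normrX normrN -[leRHS]mul1r.
  rewrite ler_pM ?exprn_ge0//; first by rewrite exprn_ile1// ger0_norm; lra.
  have M0 : 0 <= 2 * e by lra.
  rewrite (le_trans (exprn_dist m M0 deM dM))// -[leRHS]mulrA ler_wpM2l//.
  by rewrite mulr_ge0// exprn_ge0.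
have -> : sigmoid (z + h) - p.[h] =
  (sigmoid (z + h) - sigmoid z * \sum_(m < q.+1) X ^+ m) +
  (sigmoid z * \sum_(m < q.+1) X ^+ m - p.[h]) by ring.
rewrite (le_trans (ler_normD _ _))//.
rewrite !mulrDl; have : 0 <= Ci * `|h| ^+ q.+1 by rewrite mulr_ge0//; lra.
lra.
Qed.

Lemma sigmoid_taylor1 : exists C : R, 1 <= C /\
  forall z, exists c, `|c| <= C /\
    forall h, `|sigmoid (z + h) - sigmoid z - c * h| <= C * h ^+ 2.
Proof.
have [C [C1 H]] := sigmoid_taylor 1.
exists (1 + C); split; first lra.
move=> z; have [p [sp pC pE]] := H z.
exists p`_1; split; first by rewrite (le_trans (pC _))//; lra.
have hp h : p.[h] = p`_0 + p`_1 * h.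
  rewrite (horner_coef_wide _ sp) !big_ord_recl big_ord0 /= expr0 expr1.
  by rewrite mulr1 addr0.
have p0 : p`_0 = sigmoid z.
  have := pE 0; rewrite normr0 ler01 hp mulr0 !addr0 expr0n/= mulr0 => /(_ isT).
  by rewrite normr_le0 subr_eq0 => /eqP->.
move=> h; case: (leP `|h| 1) => h1.
  have := pE h h1; rewrite hp p0 real_normK ?num_real// opprD addrA => /le_trans; apply.
  by rewrite mulrDl mul1r lerDr sqr_ge0.
(* For |h| > 1 the remainder is at most 1 + C |h|, hence at most (1 + C) h^2. *)
have hh : 1 <= h ^+ 2 by rewrite -real_normK ?num_real// expr_ge1// ltW.
have hh2 : `|h| <= h ^+ 2.
  by rewrite -real_normK ?num_real// expr2 ler_peMl// ltW.
rewrite (le_trans (ler_normB _ _))// mulrDl mul1r lerD//.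
  rewrite (le_trans _ hh)//; have := sigmoid_itv (z + h); have := sigmoid_itv z.
  by rewrite ler_norml; lra.
by rewrite normrM ler_pM.
Qed.

End Sigmoid.

(** * Expansion of one network in its weights *)

Section CauchySchwarz.
Variable R : realType.

Lemma csq (T : Type) (r : seq T) (a b : T -> R) :
  (\sum_(i <- r) a i * b i) ^+ 2 <= (\sum_(i <- r) a i ^+ 2) * (\sum_(i <- r) b i ^+ 2).
Proof.
elim: r => [|i r IH]; first by rewrite !big_nil mul0r expr0n.
rewrite !big_cons; set S := \sum_(j <- r) a j * b j in IH *.
set A := \sum_(j <- r) a j ^+ 2 in IH *; set B := \sum_(j <- r) b j ^+ 2 in IH *.
have A0 : 0 <= A by rewrite sumr_ge0// => ? _; rewrite sqr_ge0.
have B0 : 0 <= B by rewrite sumr_ge0// => ? _; rewrite sqr_ge0.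
set x := a i; set y := b i.
suff : 2 * (x * y * S) <= x ^+ 2 * B + y ^+ 2 * A by move: IH; clear; nra.
have X0 : 0 <= x ^+ 2 * B by rewrite mulr_ge0// sqr_ge0.
have Y0 : 0 <= y ^+ 2 * A by rewrite mulr_ge0// sqr_ge0.
case: (leP 0 (x * y * S)) => [p0|n0]; last by move: X0 Y0 n0; clear; lra.
have q1 : 0 <= 2 * (x * y * S) by rewrite mulr_ge0.
have q2 : 0 <= x ^+ 2 * B + y ^+ 2 * A by rewrite addr_ge0.
rewrite -(@ler_pXn2r _ 2)// ?nnegrE//.
have : (x * y * S) ^+ 2 <= (x ^+ 2 * B) * (y ^+ 2 * A).
  have -> : (x ^+ 2 * B) * (y ^+ 2 * A) = (x * y) ^+ 2 * (A * B) by ring.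
  by rewrite exprMn ler_wpM2l// sqr_ge0.
have := sqr_ge0 (x ^+ 2 * B - y ^+ 2 * A).
set U := x ^+ 2 * B; set V := y ^+ 2 * A; set W := x * y * S.
by clear; nra.
Qed.

Lemma cs_sqrt (T : Type) (r : seq T) (a b : T -> R) :
  `|\sum_(i <- r) a i * b i| <=
  Num.sqrt (\sum_(i <- r) a i ^+ 2) * Num.sqrt (\sum_(i <- r) b i ^+ 2).
Proof.
have A0 : 0 <= \sum_(j <- r) a j ^+ 2 by rewrite sumr_ge0// => ? _; rewrite sqr_ge0.
rewrite -sqrtrM// -sqrtr_sqr ler_wsqrtr//; exact: csq.
Qed.

Lemma sum_le_sqrt (T : Type) (r : seq T) (a : T -> R) :
  \sum_(i <- r) a i <= Num.sqrt (size r)%:R * Num.sqrt (\sum_(i <- r) a i ^+ 2).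
Proof.
have := cs_sqrt r (fun=> 1) a.
under [X in `|X|]eq_bigr do rewrite mul1r.
under [X in Num.sqrt X * _]eq_bigr do rewrite expr1n.
by rewrite big_const_seq count_predT iter_addr_0; apply: le_trans; exact: ler_norm.
Qed.

End CauchySchwarz.

Section Expansion.
Variables (R : realType) (E : seq (seq nat)).
Hypothesis uE : uniq E.
Implicit Types (th d a : wvec R) (P B : R).

Definition dot a d : R := \sum_(e <- E) a e * d e.
Definition nr2 d : R := \sum_(e <- E) d e ^+ 2.
Definition nr d : R := Num.sqrt (nr2 d).

Lemma nr2_ge0 d : 0 <= nr2 d.
Proof. by rewrite sumr_ge0// => ? _; rewrite sqr_ge0. Qed.

Lemma nr_ge0 d : 0 <= nr d. Proof. exact: sqrtr_ge0. Qed.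

Lemma nr_sqr d : nr d ^+ 2 = nr2 d. Proof. by rewrite sqr_sqrtr// nr2_ge0. Qed.

Lemma coord_le_nr d e : e \in E -> `|d e| <= nr d.
Proof.
move=> eE; rewrite -sqrtr_sqr ler_wsqrtr// /nr2 (bigD1_seq e)//= lerDl.
by rewrite sumr_ge0// => ? _; rewrite sqr_ge0.
Qed.

Lemma dot_delta e d : e \in E -> dot (fun e' => (e' == e)%:R) d = d e.
Proof.
move=> eE; rewrite /dot (bigD1_seq e)//= eqxx mul1r big1 ?addr0// => i /negbTE->.
by rewrite mul0r.
Qed.

(* First-order expansion with quadratic remainder, with one constant [P] for
   both the size of the linear part and the remainder. *)
Definition expd th P (g : wvec R -> R) a :=
  (forall d, `|dot a d| <= P * nr d) /\
  (forall d, nr d <= 1 ->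
     `|g (fun e => th e + d e) - g th - dot a d| <= P * nr d ^+ 2).

Lemma expd_mono th P P' g a : P <= P' -> expd th P g a -> expd th P' g a.
Proof.
move=> PP [h1 h2]; split => d; first by rewrite (le_trans (h1 d))// ler_wpM2r ?nr_ge0.
by move=> /h2 /le_trans; apply; rewrite ler_wpM2r// sqr_ge0.
Qed.

Lemma expd_diff th P g a d : 0 <= P -> expd th P g a -> nr d <= 1 ->
  `|g (fun e => th e + d e) - g th| <= 2 * P * nr d.
Proof.
move=> P0 [h1 h2] d1; set u := g _ - g _.
have -> : u = (u - dot a d) + dot a d by rewrite subrK.
rewrite (le_trans (ler_normD _ _))// (le_trans (lerD (h2 d d1) (h1 d)))//.
have := nr_ge0 d => d0.
have : P * nr d ^+ 2 <= P * nr d by rewrite ler_wpM2l// expr2 ler_piMr.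
by clear; lra.
Qed.

Lemma expd_cst th (c : R) : expd th 0 (fun=> c) (fun=> 0).
Proof.
have h d : dot (fun=> 0) d = 0 by rewrite /dot big1// => ? _; rewrite mul0r.
by split => d; rewrite h ?subrr ?subr0 normr0 mul0r.
Qed.

Lemma expd_coord th e : e \in E -> expd th 1 (fun th => th e) (fun e' => (e' == e)%:R).
Proof.
move=> eE; split => d; first by rewrite dot_delta// mul1r coord_le_nr.
move=> _; rewrite dot_delta//.
have -> : th e + d e - th e - d e = 0 by ring.
by rewrite normr0 mul1r exprn_ge0// nr_ge0.
Qed.

Lemma dotD a b d : dot (fun e => a e + b e) d = dot a d + dot b d.
Proof. by rewrite /dot -big_split; apply: eq_bigr => i _; rewrite mulrDl. Qed.

Lemma dotZ (c : R) a d : dot (fun e => c * a e) d = c * dot a d.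
Proof. by rewrite /dot big_distrr; apply: eq_bigr => i _ /=; rewrite mulrA. Qed.

Lemma dot_sum (T : Type) (r : seq T) (a : T -> wvec R) d :
  dot (fun e => \sum_(i <- r) a i e) d = \sum_(i <- r) dot (a i) d.
Proof.
by rewrite /dot exchange_big /=; apply: eq_bigr => e _; rewrite big_distrl.
Qed.

Lemma expdD th P Q g h a b : expd th P g a -> expd th Q h b ->
  expd th (P + Q) (fun th => g th + h th) (fun e => a e + b e).
Proof.
move=> [g1 g2] [h1 h2]; split => d; rewrite dotD.
  by rewrite mulrDl (le_trans (ler_normD _ _))// lerD.
move=> d1; set u := g _; set v := h _; set u' := g _; set v' := h _.
have -> : u + v - (u' + v') - (dot a d + dot b d) =
  (u - u' - dot a d) + (v - v' - dot b d) by ring.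
by rewrite mulrDl (le_trans (ler_normD _ _))// lerD// ?g2 ?h2.
Qed.

Lemma expdZ th P g a (c : R) : 0 <= P -> expd th P g a ->
  expd th (`|c| * P) (fun th => c * g th) (fun e => c * a e).
Proof.
move=> P0 [g1 g2]; split => d; rewrite dotZ.
  by rewrite normrM -mulrA ler_wpM2l.
by move=> d1; rewrite -mulrBr -mulrBr normrM -mulrA ler_wpM2l// g2.
Qed.

Lemma expd_sum (T : eqType) (r : seq T) th P (g : T -> wvec R -> R) (a : T -> wvec R) :
  (forall i, i \in r -> expd th P (g i) (a i)) ->
  expd th ((size r)%:R * P) (fun th => \sum_(i <- r) g i th)
    (fun e => \sum_(i <- r) a i e).
Proof.
elim: r => [|i r IH] H.
  have -> : (fun th0 : wvec R => \sum_(i <- [::]) g i th0) = (fun=> 0).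
    by apply/funext => ?; rewrite big_nil.
  have -> : (fun e : seq nat => \sum_(i <- [::]) a i e) = (fun=> 0).
    by apply/funext => ?; rewrite big_nil.
  by rewrite mul0r; exact: expd_cst.
have -> : (fun th0 : wvec R => \sum_(j <- i :: r) g j th0) =
          (fun th0 => g i th0 + \sum_(j <- r) g j th0).
  by apply/funext => ?; rewrite big_cons.
have -> : (fun e : seq nat => \sum_(j <- i :: r) a j e) =
          (fun e => a i e + \sum_(j <- r) a j e).
  by apply/funext => ?; rewrite big_cons.
rewrite /= -natr1 addrC mulrDl mul1r; apply: expdD; first by apply: H; rewrite mem_head.
by apply: IH => j jr; apply: H; rewrite in_cons jr orbT.
Qed.

(** In the constant, B * P comes from the old weight, 2 * P from the product of the two increments,
    and 1 from the slope in the weight itself. This is the only rule in which the size of a weight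
    enters. *)
Lemma expd_mulw th P B g a e : e \in E -> 1 <= P -> `|th e| <= B -> `|g th| <= 1 ->
  expd th P g a ->
  expd th (B * P + 2 * P + 1) (fun th => th e * g th)
    (fun e' => th e * a e' + g th * (e' == e)%:R).
Proof.
move=> eE P1 tB gB ex; have P0 : 0 <= P by exact: le_trans P1.
have B0 : 0 <= B by exact: le_trans tB.
have [h1 h2] := ex.
split => d; have de := coord_le_nr d eE; have n0 := nr_ge0 d;
  rewrite dotD !dotZ dot_delta//.
  rewrite (le_trans (ler_normD _ _))// !normrM.
  have : `|th e| * `|dot a d| <= B * (P * nr d) by rewrite ler_pM.
  have : `|g th| * `|d e| <= 1 * nr d by rewrite ler_pM.
  have : 0 <= P * nr d by rewrite mulr_ge0.
  by rewrite mul1r !mulrDl -mulrA mul1r; lra.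
move=> d1; have g1 := expd_diff P0 ex d1.
set g' := g (fun e => _) in g1 *.
have -> : (th e + d e) * g' - th e * g th - (th e * dot a d + g th * d e) =
  th e * (g' - g th - dot a d) + d e * (g' - g th) by ring.
rewrite (le_trans (ler_normD _ _))// !normrM.
have : `|th e| * `|g' - g th - dot a d| <= B * (P * nr d ^+ 2).
  by rewrite ler_pM// h2.
have : `|d e| * `|g' - g th| <= nr d * (2 * P * nr d) by rewrite ler_pM.
have := sqr_ge0 (nr d).
by rewrite mulrCA -!expr2 !mulrDl mul1r; lra.
Qed.

(** The quadratic remainder of the sigmoid is evaluated at an increment of size at most 2 * P * nr
    d, which gives 4 * C * P ^+ 2; the slope times the remainder of [g] gives C * P, at most C * P
    ^+ 2. *)
Lemma expd_comp_sig (C : R) th P g a : 1 <= C ->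
  (forall z, exists c, `|c| <= C /\
    forall h, `|sigmoid (z + h) - sigmoid z - c * h| <= C * h ^+ 2) ->
  1 <= P -> expd th P g a ->
  exists a', expd th (5 * C * P ^+ 2) (fun th => sigmoid (g th)) a'.
Proof.
move=> C1 HC P1 ex; have P0 : 0 <= P by exact: le_trans P1.
have C0 : 0 <= C by exact: le_trans C1.
have [c [cC Hc]] := HC (g th); exists (fun e => c * a e).
have [h1 h2] := ex.
have PP : P <= P ^+ 2 by rewrite expr2 ler_peMr.
have CPP : C * P <= C * P ^+ 2 by rewrite ler_wpM2l.
have CP0 : 0 <= C * P by rewrite mulr_ge0.
split => d; have n0 := nr_ge0 d; rewrite dotZ.
  rewrite normrM (@le_trans _ _ (C * (P * nr d)))//; first by rewrite ler_pM.
  by rewrite mulrA ler_wpM2r//; move: CPP CP0; clear; lra.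
move=> d1; have g1 := expd_diff P0 ex d1.
set g' := g (fun e => _) in g1 *; pose dl := g' - g th.
have -> : sigmoid g' - sigmoid (g th) - c * dot a d =
  (sigmoid (g th + dl) - sigmoid (g th) - c * dl) + c * (g' - g th - dot a d).
  by rewrite /dl addrCA subrr addr0; ring.
rewrite (le_trans (ler_normD _ _))//.
have t1 : C * dl ^+ 2 <= 4 * (C * P ^+ 2) * nr d ^+ 2.
  have -> : 4 * (C * P ^+ 2) * nr d ^+ 2 = C * (2 * P * nr d) ^+ 2 by ring.
  rewrite ler_wpM2l// -[leLHS]real_normK ?num_real//.
  by rewrite lerXn2r ?nnegrE// !mulr_ge0.
have t2 : `|c * (g' - g th - dot a d)| <= C * P ^+ 2 * nr d ^+ 2.
  rewrite normrM (@le_trans _ _ (C * (P * nr d ^+ 2)))//.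
    by rewrite ler_pM// h2.
  by rewrite mulrA ler_wpM2r// sqr_ge0.
have -> : 5 * C * P ^+ 2 * nr d ^+ 2 =
  4 * (C * P ^+ 2) * nr d ^+ 2 + C * P ^+ 2 * nr d ^+ 2 by ring.
by rewrite lerD// (le_trans (Hc dl)).
Qed.

End Expansion.

(** * Networks as functions of a single patch *)

Section PatchNet.
Variables (R : realType) (kappa L : nat).
Implicit Types (th : wvec R) (y : 'M[R]_kappa).

(** Keys of the weights without their last entry, the number of the network, which [uo] and [blk]
    append. *)
Definition iO : seq nat := [:: 0%N].
Definition iW (r t1 t2 s1 s : nat) : seq nat := [:: 1%N; r; t1; t2; s1; s].
Definition iB (r s : nat) : seq nat := [:: 2%N; r; s].
Definition nin : nat := (2 * kappa ^ 2)%N.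
Definition pix : finType := ('I_kappa * 'I_kappa)%type.

(* Unit [s] of layer [r] of one network, as a function of one patch: since
   M_2 = ... = M_L = 1, a pooled position only sees its own patch. *)
Fixpoint net th y (r s : nat) : R :=
  match r with
  | 0 => 0
  | r'.+1 => sigmoid (
      (if r' is 0 then \sum_(p : pix) th (iW 1 p.1.+1 p.2.+1 1 s) * y p.1 p.2
       else \sum_(s1 < nin) th (iW r 1 1 s1.+1 s) * net th y r' s1.+1)
      + th (iB r s))
  end.

Lemma net1E th y s : net th y 1 s =
  sigmoid (\sum_(p : pix) th (iW 1 p.1.+1 p.2.+1 1 s) * y p.1 p.2 + th (iB 1 s)).
Proof. by []. Qed.

Lemma netSE th y r s : net th y r.+2 s =
  sigmoid (\sum_(s1 < nin) th (iW r.+2 1 1 s1.+1 s) * net th y r.+1 s1.+1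
           + th (iB r.+2 s)).
Proof. by []. Qed.

Lemma net_itv th y r s : 0 <= net th y r s <= 1.
Proof. by case: r => [|r]; [rewrite /= lexx ler01|exact: sigmoid_itv]. Qed.

Lemma net_norm th y r s : `|net th y r s| <= 1.
Proof. by have /andP[h1 h2] := net_itv th y r s; rewrite ger0_norm. Qed.

(** The weights of layers 2 to [L], kept apart because only their size enters the constants
    [netP]. *)
Definition idx_w : seq (seq nat) :=
  [seq iW r 1 1 q.1 q.2 | r <- iota 2 L.-1,
     q <- [seq (s1, s) | s1 <- iota 1 nin, s <- iota 1 nin]].
Definition idx_1 : seq (seq nat) :=
  [seq iW 1 (val q.1.1).+1 (val q.1.2).+1 1 q.2
     | q <- [seq (p, s) | p <- enum pix, s <- iota 1 nin]].
Definition idx_b : seq (seq nat) := [seq iB r s | r <- iota 1 L, s <- iota 1 nin].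
Definition idx : seq (seq nat) := undup (idx_1 ++ idx_b ++ idx_w).

Lemma uniq_idx : uniq idx. Proof. exact: undup_uniq. Qed.

Lemma iO_idx : iO \notin idx.
Proof.
rewrite /idx mem_undup !mem_cat; apply/negP => /orP[|/orP[]].
- by case/mapP.
- by case/allpairsPdep => ? [? []].
- by case/allpairsPdep => ? [? []].
Qed.

Lemma mem_idx_1 (p : pix) s : (1 <= s <= nin)%N -> iW 1 p.1.+1 p.2.+1 1 s \in idx.
Proof.
move=> hs; rewrite mem_undup !mem_cat; apply/orP; left.
apply/mapP; exists (p, s) => //; apply/allpairsP; exists (p, s); split => //=.
  by rewrite mem_enum.
by rewrite mem_iota add1n ltnS.
Qed.

Lemma mem_idx_w_w r s1 s : (2 <= r <= L)%N -> (1 <= s1 <= nin)%N -> (1 <= s <= nin)%N ->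
  iW r 1 1 s1 s \in idx_w.
Proof.
move=> hr h1 hs.
apply/allpairsPdep; exists r, (s1, s); split => //.
  by rewrite mem_iota; case: L hr => [|[|l]]; rewrite ?ltn0 /=; lia.
by apply/allpairsP; exists (s1, s); split => //=; rewrite mem_iota add1n ltnS.
Qed.

Lemma mem_idx_w r s1 s : (2 <= r <= L)%N -> (1 <= s1 <= nin)%N -> (1 <= s <= nin)%N ->
  iW r 1 1 s1 s \in idx.
Proof. by move=> *; rewrite mem_undup !mem_cat mem_idx_w_w ?orbT. Qed.

Lemma mem_idx_b r s : (1 <= r <= L)%N -> (1 <= s <= nin)%N -> iB r s \in idx.
Proof.
move=> hr hs; rewrite mem_undup !mem_cat; apply/orP; right; apply/orP; left.
by apply/allpairsP; exists (r, s); rewrite /= !mem_iota !add1n !ltnS.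
Qed.

Lemma idx_w_sub e : e \in idx_w -> e \in idx.
Proof. by move=> h; rewrite mem_undup !mem_cat h !orbT. Qed.

Fixpoint netP (C B : R) (r : nat) : R :=
  match r with
  | 0 => 1
  | 1 => 5 * C * ((#|pix|)%:R + 1) ^+ 2
  | r'.+1 => 5 * C * (nin%:R * (B * netP C B r' + 2 * netP C B r' + 1) + 1) ^+ 2
  end.

Lemma netP_ge1 C B r : 1 <= C -> 0 <= B -> 1 <= netP C B r.
Proof.
move=> C1 B0.
have h (x : R) : 0 <= x -> 1 <= 5 * C * (x + 1) ^+ 2.
  move=> x0; have : 1 <= (x + 1) ^+ 2 by rewrite expr_ge1//; lra.
  by move=> h; rewrite -[leLHS]mulr1 ler_pM//; lra.
elim: r => [|[|r] IH]; first by [].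
  by apply: h.
move: IH; rewrite [netP C B r.+2]/=.
rewrite -/(netP C B r.+1); set q := netP _ _ r.+1 => IH.
by apply: h; rewrite mulr_ge0//; have := mulr_ge0 B0 (le_trans ler01 IH); lra.
Qed.

Lemma net_expd (C B : R) th y r s : 1 <= C ->
  (forall z, exists c, `|c| <= C /\
    forall h, `|sigmoid (z + h) - sigmoid z - c * h| <= C * h ^+ 2) ->
  0 <= B -> (forall e, e \in idx_w -> `|th e| <= B) ->
  (forall a b, 0 <= y a b <= 1) ->
  (1 <= r <= L)%N -> (1 <= s <= nin)%N ->
  exists a, expd idx th (netP C B r) (fun th => net th y r s) a.
Proof.
move=> C1 HC B0 HB y01; elim: r s => [//|[|r] IH] s hr hs.
  have h1 : exists a, expd idx th ((#|pix|)%:R + 1) (fun th =>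
     \sum_(p : pix) th (iW 1 p.1.+1 p.2.+1 1 s) * y p.1 p.2 + th (iB 1 s)) a.
    have hb := expd_coord uniq_idx th (mem_idx_b hr hs).
    have -> : (#|pix|)%:R = (size (index_enum pix))%:R * 1 :> R.
      by rewrite mulr1 cardT enumT.
    have := @expd_sum R idx _ (index_enum pix) th 1
       (fun p th => th (iW 1 p.1.+1 p.2.+1 1 s) * y p.1 p.2)
       (fun p e' => y p.1 p.2 * (e' == iW 1 p.1.+1 p.2.+1 1 s)%:R).
    move=> hsum; eexists; apply: (expdD (hsum _) hb) => p _.
    have -> : (fun th : wvec R => th (iW 1 p.1.+1 p.2.+1 1 s) * y p.1 p.2) =
       (fun th => y p.1 p.2 * th (iW 1 p.1.+1 p.2.+1 1 s)).
      by apply/funext => ?; rewrite mulrC.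
    apply: (@expd_mono _ _ _ (`|y p.1 p.2| * 1)).
      by have := y01 p.1 p.2; rewrite mulr1 => /andP[? ?]; rewrite ger0_norm.
    by apply: expdZ => //; apply: (expd_coord uniq_idx); rewrite mem_idx_1.
  have [a ha] := h1; apply: (expd_comp_sig C1 HC _ ha).
  by rewrite lerDr.
have P1 := netP_ge1 r.+1 C1 B0.
have [A HA] := @choice _ _ (fun (s1 : 'I_nin) a => expd idx th (netP C B r.+1)
   (fun th => net th y r.+1 s1.+1) a) (fun s1 => IH s1.+1
   (ltac:(by clear -hr; move: hr; lia)) (ltn_ord s1)).
have h1 : exists a, expd idx th (nin%:R * (B * netP C B r.+1 + 2 * netP C B r.+1 + 1) + 1)
    (fun th => \sum_(s1 < nin) th (iW r.+2 1 1 s1.+1 s) * net th y r.+1 s1.+1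
           + th (iB r.+2 s)) a.
  have hb := expd_coord uniq_idx th (mem_idx_b hr hs).
  have szE : nin%:R = (size (index_enum 'I_nin))%:R :> R.
    by rewrite -[X in X%:R = _](card_ord nin) cardT enumT.
  have hsum := @expd_sum R idx _ (index_enum 'I_nin) th
     (B * netP C B r.+1 + 2 * netP C B r.+1 + 1)
     (fun (s1 : 'I_nin) th => th (iW r.+2 1 1 s1.+1 s) * net th y r.+1 s1.+1)
     (fun (s1 : 'I_nin) e' => th (iW r.+2 1 1 s1.+1 s) * A s1 e' +
        net th y r.+1 s1.+1 * (e' == iW r.+2 1 1 s1.+1 s)%:R).
  rewrite szE; eexists; apply: (expdD (hsum _) hb) => s1 _.
  have hw : iW r.+2 1 1 s1.+1 s \in idx_w.
    by apply: mem_idx_w_w => //; rewrite ltn_ord.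
  apply: (expd_mulw uniq_idx (idx_w_sub hw) P1 (HB _ hw)) => //.
  exact: net_norm.
have [a ha] := h1; apply: (expd_comp_sig C1 HC _ ha).
rewrite lerDr mulr_ge0//.
by have := mulr_ge0 B0 (le_trans ler01 P1); move: P1; set q := netP _ _ _; clear; lra.
Qed.

End PatchNet.

(** * Gradient descent *)

Section QuadDerivative.
Variable R : realType.

(** [gd_step] is built from one-dimensional derivatives, so expansions with a quadratic remainder
    identify the gradient and no multivariate differential calculus is required. *)
Lemma derive1_quad (g : R -> R) (v a Q : R) :
  (forall h, `|h| <= 1 -> `|g (v + h) - g v - a * h| <= Q * h ^+ 2) ->
  derive1 g v = a.
Proof.
move=> H; rewrite /derive1; apply: cvg_lim => //.
have Q0 : 0 <= Q.
  by have := H 1; rewrite normr1 lexx expr1n !mulr1 => /(_ isT) /(le_trans (normr_ge0 _)).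
apply/cvgrPdist_le => eps eps0.
near=> h.
have h0 : h != 0 by near: h; exact: nbhs_dnbhs_neq.
have h1 : `|h| <= 1.
  near: h; apply: dnbhs0_le; exact: ltr01.
have h2 : (Q + 1) * `|h| <= eps.
  rewrite mulrC -ler_pdivlMr; last by lra.
  by near: h; apply: dnbhs0_le; rewrite divr_gt0//; lra.
have e : a - h^-1 *: (g (h + v) - g v) = - (g (v + h) - g v - a * h) / h.
  rewrite addrC [g (h + v)]/= /GRing.scale/= [h + v]addrC; field; exact: h0.
rewrite e normrM normrN normfV ler_pdivrMr ?normr_gt0//.
rewrite (le_trans (H h h1))// -real_normK ?num_real// expr2 mulrA ler_wpM2r//.
by rewrite (le_trans _ h2)// ler_wpM2r// lerDl.
Unshelve. all: by end_near. Qed.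

Lemma mean_le (T : eqType) (s : seq T) (g : T -> R) (c : R) : (0 < size s)%N ->
  (forall z, z \in s -> g z <= c) -> (size s)%:R^-1 * (\sum_(z <- s) g z) <= c.
Proof.
move=> s0 H; rewrite mulrC ler_pdivrMr ?ltr0n//.
rewrite (@le_trans _ _ (\sum_(z <- s) c))//.
  by rewrite [leLHS]big_seq [leRHS]big_seq ler_sum.
by rewrite big_const_seq count_predT iter_addr_0 mulr_natr.
Qed.

Lemma mean_norm_le (T : eqType) (s : seq T) (g : T -> R) (c : R) : (0 < size s)%N ->
  (forall z, z \in s -> `|g z| <= c) -> `|(size s)%:R^-1 * (\sum_(z <- s) g z)| <= c.
Proof.
move=> s0 H; rewrite normrM ger0_norm ?invr_ge0//.
apply: (@le_trans _ _ ((size s)%:R^-1 * \sum_(z <- s) `|g z|)).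
  by rewrite ler_wpM2l ?invr_ge0// ler_norm_sum.
exact: mean_le.
Qed.

End QuadDerivative.

(** * Smoothness of the regularized risk and convergence of gradient descent *)

Section GradientDescent.
Variables (R : realType) (X : choiceType) (XX : X -> Prop).
Variables (E E2 : seq (seq nat)) (G : wvec R -> X -> R) (K : nat) (c4 : R).
Variable (s : seq (X * bool)).
Hypotheses (uE : uniq E) (OE : iO \notin E) (E2E : {subset E2 <= E}).
Hypothesis G01 : forall th x, 0 <= G th x <= 1.
Hypotheses (K1 : (1 <= K)%N) (c4_gt0 : 0 < c4) (s0 : (0 < size s)%N).
Hypothesis sX : forall z, z \in s -> XX z.1.
Variables (P B U : R).
Hypotheses (P1 : 1 <= P) (B0 : 0 <= B) (U0 : 0 <= U).
Hypothesis Gexpd : forall th x, XX x -> (forall e, e \in E2 -> `|th e| <= B) ->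
  exists a, expd E th P (G^~ x) a.
Ltac clr := clear -uE OE E2E G01 K1 c4_gt0 s0 sX P1 B0 U0 Gexpd.
Implicit Types (w : wvec R) (u : nat -> R) (D A : nat -> seq nat -> R).

Definition blk w (k : nat) : wvec R := fun e => w (rcons e k).
Definition uo w (k : nat) : R := w (rcons iO k).
Local Notation KK := (index_iota 1 K.+1).
Definition fO u w x : R := \sum_(1 <= k < K.+1) u k * G (blk w k) x.
(** Outer weights are an argument of their own, because the descent is compared with a fixed [u] on
    inner weights that keep moving. *)
Definition FO u w : R :=
  (size s)%:R^-1 * \sum_(z <- s) ((z.2 : nat)%:R - fO u w z.1) ^+ 2 +
  c4 * \sum_(1 <= k < K.+1) u k ^+ 2.
Definition FF w : R := FO (uo w) w.

Definition nn D : R := \sum_(k <- KK) (D k iO ^+ 2 + nr2 E (D k)).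
Definition sub_w w' w (k : nat) (e : seq nat) : R := w' (rcons e k) - w (rcons e k).

Lemma P0 : 0 <= P. Proof. exact: le_trans P1. Qed.
#[local] Hint Resolve P0 : core.

Lemma nn_term_ge0 D k : 0 <= D k iO ^+ 2 + nr2 E (D k).
Proof. by rewrite addr_ge0 ?sqr_ge0 ?nr2_ge0. Qed.

Lemma nn_ge0 D : 0 <= nn D.
Proof. by rewrite sumr_ge0// => k _; exact: nn_term_ge0. Qed.

Lemma nn_term_le D k : k \in KK -> D k iO ^+ 2 + nr2 E (D k) <= nn D.
Proof.
move=> kK; rewrite /nn (bigD1_seq k)//= ?iota_uniq// lerDl sumr_ge0// => i _.
exact: nn_term_ge0.
Qed.

Definition lin_f w x (a : nat -> wvec R) D : R :=
  \sum_(k <- KK) (D k iO * G (blk w k) x + uo w k * dot E (a k) (D k)).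

(** Cauchy-Schwarz over the networks costs sqrt K in the linear part only: the remainders are
    squares and add up to [nn] without loss. *)
Lemma f_expd w x : XX x ->
  (forall k, k \in KK -> `|uo w k| <= U) ->
  (forall k e, k \in KK -> e \in E2 -> `|w (rcons e k)| <= B) ->
  exists a : nat -> wvec R,
    (forall D, `|lin_f w x a D| <= (1 + U) * P * (Num.sqrt K%:R * Num.sqrt (nn D))) /\
    (forall w', nn (sub_w w' w) <= 1 ->
      `|fO (uo w') w' x - fO (uo w) w x - lin_f w x a (sub_w w' w)| <=
        (1 + U) * P * nn (sub_w w' w)).
Proof.
move=> xX uU wB.
have Hk k : exists a, k \in KK -> expd E (blk w k) P (G^~ x) a.
  case kK: (k \in KK); last by exists (fun=> 0).
  by have [b hb] := Gexpd xX (fun e eE => wB k e kK eE); exists b.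
have [a Ha] := choice Hk.
exists a; split=> [D|w' nn1].
  have sz : size KK = K by rewrite size_iota subn1.
  rewrite (le_trans (ler_norm_sum _ _ _))//.
  apply: (@le_trans _ _ (\sum_(k <- KK) (1 + U) * P * Num.sqrt (D k iO ^+ 2 + nr2 E (D k)))).
    rewrite big_seq [leRHS]big_seq ler_sum// => k kK.
    have n0 := nn_term_ge0 D k.
    have h1 : `|D k iO| <= Num.sqrt (D k iO ^+ 2 + nr2 E (D k)).
      by rewrite -sqrtr_sqr ler_wsqrtr// lerDl nr2_ge0.
    have h2 : nr E (D k) <= Num.sqrt (D k iO ^+ 2 + nr2 E (D k)).
      by rewrite ler_wsqrtr// lerDr sqr_ge0.
    set t := Num.sqrt _ in h1 h2 *.
    have t0 : 0 <= t by exact: sqrtr_ge0.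
    rewrite (le_trans (ler_normD _ _))// !normrM.
    have [g0 g1] := andP (G01 (blk w k) x).
    have q1 : `|D k iO| * `|G (blk w k) x| <= t * 1.
      by rewrite ler_pM// ger0_norm.
    have q2 : `|uo w k| * `|dot E (a k) (D k)| <= U * (P * t).
      rewrite ler_pM ?uU// (le_trans ((Ha k kK).1 _))// ler_wpM2l//.
    have q3 : t <= P * t by rewrite ler_peMl.
    have -> : (1 + U) * P * t = P * t + U * (P * t) by ring.
    by move: q1 q2 q3; rewrite mulr1; clr; lra.
  rewrite -big_distrr/= ler_wpM2l ?mulr_ge0 ?addr_ge0//.
  have := sum_le_sqrt KK (fun k => Num.sqrt (D k iO ^+ 2 + nr2 E (D k))).
  rewrite sz => /le_trans; apply; rewrite ler_wpM2l ?sqrtr_ge0// ler_wsqrtr// /nn.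
  by apply: ler_sum => k _; rewrite sqr_sqrtr// nn_term_ge0.
rewrite /fO /lin_f -!sumrB (le_trans (ler_norm_sum _ _ _))// /nn big_distrr/=.
rewrite big_seq [leRHS]big_seq ler_sum// => k kK.
have nk := nn_term_le (sub_w w' w) kK.
set D := sub_w w' w in nk nn1 *.
have n2 := nr2_ge0 E (D k).
have n0 := nr_ge0 E (D k).
have d2 := sqr_ge0 (D k iO).
have ex := Ha k kK.
have nr1 : nr E (D k) <= 1.
  by rewrite -(@ler_pXn2r _ 2)// ?nnegrE// nr_sqr expr1n; move: nk nn1 n2 d2; clr; lra.
have be : blk w' k = (fun e => blk w k e + D k e).
  by apply/funext => e; rewrite /D /sub_w /blk addrC subrK.
have g2 := expd_diff P0 ex nr1; have g3 := ex.2 _ nr1.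
rewrite -be in g2 g3.
have ue : uo w' k = uo w k + D k iO by rewrite /D /sub_w /uo addrC subrK.
rewrite ue; set g' := G (blk w' k) x in g2 g3 *; set g := G (blk w k) x in g2 g3 *.
have -> : (uo w k + D k iO) * g' - uo w k * g - (D k iO * g + uo w k * dot E (a k) (D k)) =
   D k iO * (g' - g) + uo w k * (g' - g - dot E (a k) (D k)) by ring.
rewrite (le_trans (ler_normD _ _))// !normrM.
have q1 : `|D k iO| * `|g' - g| <= `|D k iO| * (2 * P * nr E (D k)) by rewrite ler_wpM2l.
have q2 : `|uo w k| * `|g' - g - dot E (a k) (D k)| <= U * (P * nr E (D k) ^+ 2).
  by rewrite ler_pM ?uU.
have q3 : 2 * (`|D k iO| * nr E (D k)) <= D k iO ^+ 2 + nr2 E (D k).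
  rewrite -nr_sqr -[D k iO ^+ 2]real_normK ?num_real//.
  by have := sqr_ge0 (`|D k iO| - nr E (D k)); clr; nra.
have q4 : P * (2 * (`|D k iO| * nr E (D k))) <= P * (D k iO ^+ 2 + nr2 E (D k)).
  by rewrite ler_wpM2l.
rewrite nr_sqr in q2.
have q5 : 0 <= U * (P * D k iO ^+ 2) by apply: mulr_ge0 => //; apply: mulr_ge0.
have q1' : `|D k iO| * (2 * P * nr E (D k)) = P * (2 * (`|D k iO| * nr E (D k))) by ring.
rewrite q1' in q1.
have -> : (1 + U) * P * (D k iO ^+ 2 + nr2 E (D k)) =
  P * (D k iO ^+ 2 + nr2 E (D k)) + U * (P * D k iO ^+ 2) + U * (P * nr2 E (D k)) by ring.
by move: q1 q2 q4 q5; clr; lra.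
Qed.

(** One constant for the norm of the gradient and for the curvature. The factor [K] is the product
    of two quantities of order sqrt K, residual times slope in the gradient and slope squared in the
    curvature. *)
Definition Qc : R := 15 * (1 + U) ^+ 2 * P ^+ 2 * K%:R + 2 * c4 * (1 + U).

Lemma Qc_ge0 : 0 <= Qc.
Proof.
have h1 : 0 <= (1 + U) ^+ 2 by exact: sqr_ge0.
have h2 : 0 <= P ^+ 2 by exact: sqr_ge0.
have h3 : 0 <= 1 + U by rewrite addr_ge0.
rewrite /Qc addr_ge0//; last by rewrite mulr_ge0// mulr_ge0// ltW.
by apply: mulr_ge0 => //; apply: mulr_ge0 => //; apply: mulr_ge0.
Qed.

Definition AD A D : R := \sum_(k <- KK) \sum_(e <- iO :: E) A k e * D k e.

Lemma nnE D : nn D = \sum_(k <- KK) \sum_(e <- iO :: E) D k e ^+ 2.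
Proof. by apply: eq_bigr => k _; rewrite big_cons. Qed.

Lemma f_norm w x : \sum_(k <- KK) uo w k ^+ 2 <= U ^+ 2 ->
  `|fO (uo w) w x| <= Num.sqrt K%:R * U.
Proof.
move=> uU; rewrite /fO (le_trans (cs_sqrt _ _ _))// mulrC ler_pM ?sqrtr_ge0//.
  rewrite ler_wsqrtr// (@le_trans _ _ (\sum_(i <- KK) 1))//.
    apply: ler_sum => k _; have [g0 g1] := andP (G01 (blk w k) x).
    by rewrite exprn_ile1.
  by rewrite big_const_seq count_predT iter_addr_0 size_iota subn1.
by rewrite -(ger0_norm U0) -sqrtr_sqr ler_wsqrtr.
Qed.

(** The bound on [nn A] keeps a gradient step shorter than 1, so that the expansion applies to it;
    the explicit outer components of [A] are the starting point of [F_PL]. *)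
Lemma F_expd w : \sum_(k <- KK) uo w k ^+ 2 <= U ^+ 2 ->
  (forall k e, k \in KK -> e \in E2 -> `|w (rcons e k)| <= B) ->
  exists A, [/\ nn A <= Qc ^+ 2,
    forall w', nn (sub_w w' w) <= 1 ->
      `|FF w' - FF w - AD A (sub_w w' w)| <= Qc * nn (sub_w w' w) &
    forall k, A k iO = (size s)%:R^-1 * \sum_(z <- s)
       (- 2 * ((z.2 : nat)%:R - fO (uo w) w z.1) * G (blk w k) z.1) + 2 * c4 * uo w k].
Proof.
move=> u2 wB.
have uU k : k \in KK -> `|uo w k| <= U.
  move=> kK; rewrite -(@ler_pXn2r _ 2)// ?nnegrE// real_normK ?num_real//.
  rewrite (le_trans _ u2)// (bigD1_seq k)//= ?iota_uniq// lerDl sumr_ge0// => i _.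
  exact: sqr_ge0.
have Hx x : exists a : nat -> wvec R, XX x ->
    (forall D, `|lin_f w x a D| <= (1 + U) * P * (Num.sqrt K%:R * Num.sqrt (nn D))) /\
    (forall w', nn (sub_w w' w) <= 1 ->
      `|fO (uo w') w' x - fO (uo w) w x - lin_f w x a (sub_w w' w)| <=
        (1 + U) * P * nn (sub_w w' w)).
  have [xX|xX] := pselect (XX x); last by exists (fun _ _ => 0).
  by have [b hb] := f_expd xX uU wB; exists b.
have [a Ha] := choice Hx.
pose r (z : X * bool) : R := (z.2 : nat)%:R - fO (uo w) w z.1.
pose A k e : R := if e == iO then
   (size s)%:R^-1 * \sum_(z <- s) (- 2 * r z * G (blk w k) z.1) + 2 * c4 * uo w k
   else (size s)%:R^-1 * \sum_(z <- s) (- 2 * r z * (uo w k * a z.1 k e)).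
have ADE D : AD A D = (size s)%:R^-1 * \sum_(z <- s) (- 2 * r z * lin_f w z.1 (a z.1) D)
    + 2 * c4 * \sum_(k <- KK) uo w k * D k iO.
  have inner k : \sum_(e <- E) A k e * D k e =
     (size s)%:R^-1 * \sum_(z <- s) (- 2 * r z * (uo w k * dot E (a z.1 k) (D k))).
    transitivity (\sum_(e <- E) (size s)%:R^-1 *
        \sum_(z <- s) (- 2 * r z * (uo w k * (a z.1 k e * D k e)))).
      rewrite [LHS]big_seq [RHS]big_seq; apply: eq_bigr => e eE.
      rewrite /A ifF; last by apply/negbTE; apply: contraNneq OE => <-.
      rewrite -mulrA big_distrl/=; congr (_ * _); apply: eq_bigr => z _; ring.
    rewrite -big_distrr exchange_big/=; congr (_ * _); apply: eq_bigr => z _.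
    by rewrite -!big_distrr.
  rewrite /AD.
  under eq_bigr => k _ do rewrite big_cons inner /A eqxx mulrDl.
  rewrite !big_split/= addrAC; congr (_ + _); last first.
    by rewrite big_distrr; apply: eq_bigr => k _; rewrite /= mulrA.
  rewrite -big_split/=.
  transitivity (\sum_(k <- KK) (size s)%:R^-1 * \sum_(z <- s) (- 2 * r z *
     (D k iO * G (blk w k) z.1 + uo w k * dot E (a z.1 k) (D k)))).
    apply: eq_bigr => k _.
    rewrite -mulrA -mulrDr big_distrl/= -big_split/=; congr (_ * _).
    by apply: eq_bigr => z _; ring.
  rewrite -big_distrr exchange_big/=; congr (_ * _); apply: eq_bigr => z _.
  by rewrite -big_distrr.
pose sK : R := Num.sqrt K%:R.
have sK1 : 1 <= sK by rewrite /sK -[leLHS]sqrtr1 ler_wsqrtr// ler1n.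
have sK2 : sK ^+ 2 = K%:R by rewrite sqr_sqrtr.
have rb z : `|r z| <= (1 + U) * sK.
  rewrite (le_trans (ler_normB _ _))//.
  have := f_norm z.1 u2; rewrite -/sK.
  have : `|(z.2 : nat)%:R| <= 1 :> R by case: z.2; rewrite ?normr1 ?normr0.
  by move: sK1; clr; nra.
have U1 : 1 <= (1 + U) by rewrite lerDl.
have q0 : 0 <= (1 + U) * P by rewrite mulr_ge0// (le_trans _ U1).
have q1 : 1 <= (1 + U) * P by rewrite -[leLHS]mulr1 ler_pM.
have Qpos : 0 <= Qc by exact: Qc_ge0.
have lfn x D : XX x -> `|lin_f w x (a x) D| <= (1 + U) * P * (sK * Num.sqrt (nn D)).
  by move=> xX; apply: (Ha x xX).1.
exists A; split.
(* The linear form is tested on its own coefficient vector. *)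
- have h : AD A A <= Qc * Num.sqrt (nn A).
    rewrite (le_trans (ler_norm _))// ADE (le_trans (ler_normD _ _))//.
    set t := Num.sqrt _; have t0 : 0 <= t by exact: sqrtr_ge0.
    have p1 : `|(size s)%:R^-1 * \sum_(z <- s) (- 2 * r z * lin_f w z.1 (a z.1) A)| <=
       2 * ((1 + U) * sK) * ((1 + U) * P * (sK * t)).
      apply: mean_norm_le => // z zs; rewrite !normrM normrN ler_pM//.
        by rewrite (ger0_norm (ler0n _ 2)) ler_wpM2l.
      exact/lfn/sX.
    have p2 : `|2 * c4 * \sum_(k <- KK) uo w k * A k iO| <= 2 * c4 * (U * t).
      rewrite normrM ger0_norm ?mulr_ge0 ?(ltW c4_gt0)//.
      rewrite ler_wpM2l ?mulr_ge0 ?(ltW c4_gt0)//.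
      rewrite (le_trans (cs_sqrt _ _ _))// ler_pM ?sqrtr_ge0//.
        by rewrite -(ger0_norm U0) -sqrtr_sqr ler_wsqrtr.
      by rewrite ler_wsqrtr// /nn ler_sum// => k _; rewrite lerDl nr2_ge0.
    rewrite (le_trans (lerD p1 p2))// /Qc.
    have -> : 2 * ((1 + U) * sK) * ((1 + U) * P * (sK * t)) =
       2 * (1 + U) ^+ 2 * P * sK ^+ 2 * t by ring.
    rewrite sK2 [leRHS]mulrDl; apply: lerD.
      rewrite ler_wpM2r// ler_wpM2r// -!mulrA.
      have PP : P <= P ^+ 2 by rewrite expr2 ler_peMr.
      have a10 := sqr_ge0 (1 + U).
      have := ler_wpM2l a10 PP; have := mulr_ge0 a10 P0; clr; lra.
    rewrite mulrA ler_wpM2r// ler_wpM2l ?mulr_ge0 ?(ltW c4_gt0)//.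
    by rewrite lerDr.
  have e : AD A A = nn A.
    by rewrite nnE; apply: eq_bigr => k _; apply: eq_bigr => e _; rewrite expr2.
  rewrite e -{1}[nn A]sqr_sqrtr ?nn_ge0// in h.
  set t := Num.sqrt (nn A) in h.
  have t0 : 0 <= t by exact: sqrtr_ge0.
  have tQ : t <= Qc.
    case: (ltgtP 0 t) t0 => // [t0 _|<- //].
    by rewrite -(ler_pM2r t0) -expr2.
  by rewrite -[leLHS]sqr_sqrtr ?nn_ge0// lerXn2r ?nnegrE.
- move=> w' n1; set D := sub_w w' w in n1 *.
  have n0 := nn_ge0 D.
  set N := nn D in n1 n0 *.
  have -> : FF w' - FF w - AD A D =
    (size s)%:R^-1 * \sum_(z <- s) (((z.2 : nat)%:R - fO (uo w') w' z.1) ^+ 2 - r z ^+ 2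
       + 2 * r z * lin_f w z.1 (a z.1) D) + c4 * \sum_(k <- KK) D k iO ^+ 2.
    rewrite ADE /FF /FO big_split/= sumrB.
    have -> : \sum_(z <- s) (- 2 * r z * lin_f w z.1 (a z.1) D) =
      - \sum_(z <- s) (2 * r z * lin_f w z.1 (a z.1) D).
      by rewrite -sumrN; apply: eq_bigr => z _; rewrite !mulNr.
    have -> : \sum_(1 <= k < K.+1) uo w' k ^+ 2 = \sum_(k <- KK) uo w k ^+ 2 +
       2 * \sum_(k <- KK) uo w k * D k iO + \sum_(k <- KK) D k iO ^+ 2.
      rewrite big_distrr -!big_split; apply: eq_bigr => k _ /=.
      have -> : uo w' k = uo w k + D k iO by rewrite /D /sub_w /uo addrC subrK.
      ring.
    rewrite /r; ring.
  rewrite (le_trans (ler_normD _ _))// /Qc [leRHS]mulrDl; apply: lerD; last first.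
    have h0 : 0 <= \sum_(k <- KK) D k iO ^+ 2 by rewrite sumr_ge0// => *; rewrite sqr_ge0.
    rewrite ger0_norm ?mulr_ge0 ?(ltW c4_gt0)//.
    rewrite (@le_trans _ _ (c4 * N))//.
      rewrite ler_wpM2l ?(ltW c4_gt0)// /N /nn ler_sum// => k _.
      by rewrite lerDl nr2_ge0.
    rewrite ler_wpM2r// -mulrA mulrCA -[leLHS]mulr1 ler_wpM2l ?(ltW c4_gt0)//.
    by move: U1; clr; lra.
  apply: mean_norm_le => // z zs.
  have xX := sX zs.
  have e1 := (Ha z.1 xX).2 w' n1; rewrite -/D -/N in e1.
  have e2 := lfn z.1 D xX; rewrite -/N in e2.
  set l := lin_f w z.1 (a z.1) D in e1 e2 *.
  set rem := _ - _ - l in e1.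
  have -> : (z.2 : nat)%:R - fO (uo w') w' z.1 = r z - (l + rem).
    rewrite /r /rem; ring.
  have -> : (r z - (l + rem)) ^+ 2 - r z ^+ 2 + 2 * r z * l =
     - 2 * r z * rem + (l + rem) ^+ 2 by ring.
  have sN : N <= Num.sqrt N.
    rewrite -{1}[N]sqr_sqrtr// expr2 ler_piMr ?sqrtr_ge0//.
    by rewrite -[leRHS]sqrtr1 ler_wsqrtr.
  have l2 : `|l + rem| <= 2 * ((1 + U) * P) * (sK * Num.sqrt N).
    rewrite (le_trans (ler_normD _ _))// (le_trans (lerD e2 e1))//.
    have : (1 + U) * P * N <= (1 + U) * P * (sK * Num.sqrt N).
      by rewrite ler_wpM2l// (le_trans sN)// ler_peMl// sqrtr_ge0.
    by clr; lra.
  have l3 : (l + rem) ^+ 2 <= 4 * ((1 + U) ^+ 2 * P ^+ 2 * K%:R * N).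
    rewrite -[leLHS]real_normK ?num_real//.
    have -> : 4 * ((1 + U) ^+ 2 * P ^+ 2 * K%:R * N) =
       (2 * ((1 + U) * P) * (sK * Num.sqrt N)) ^+ 2.
      rewrite !exprMn sK2 sqr_sqrtr//; ring.
    by rewrite lerXn2r ?nnegrE// !mulr_ge0 ?sqrtr_ge0// (le_trans _ U1).
  have l4 : `|- 2 * r z * rem| <= 2 * ((1 + U) ^+ 2 * P ^+ 2 * K%:R * N).
    rewrite !normrM normrN (ger0_norm (ler0n _ 2)) -mulrA ler_wpM2l//.
    rewrite (@le_trans _ _ ((1 + U) * sK * ((1 + U) * P * N)))//.
      by rewrite ler_pM.
    rewrite mulrA ler_wpM2r// -sK2.
    have -> : (1 + U) * sK * ((1 + U) * P) = (1 + U) ^+ 2 * (sK * P) by ring.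
    rewrite -[leRHS]mulrA ler_wpM2l ?sqr_ge0// mulrC ler_pM// ?(le_trans _ sK1)//.
      by rewrite expr2 ler_peMr.
    by rewrite expr2 ler_peMr// (le_trans _ sK1).
  rewrite (le_trans (ler_normD _ _))// (ger0_norm (sqr_ge0 (l + rem))).
  have := mulr_ge0 (mulr_ge0 (mulr_ge0 (sqr_ge0 (1 + U)) (sqr_ge0 P)) (ler0n R K)) n0.
  have -> : 15 * (1 + U) ^+ 2 * P ^+ 2 * K%:R * N =
    15 * ((1 + U) ^+ 2 * P ^+ 2 * K%:R * N) by ring.
  move: l3 l4; set q := _ * P ^+ 2 * _ * N; clr; lra.
- by move=> k; rewrite /A eqxx.
Qed.

(* Polyak-Lojasiewicz inequality in the outer weights. *)
Lemma F_PL w A u :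
  (forall k, A k iO = (size s)%:R^-1 * \sum_(z <- s)
       (- 2 * ((z.2 : nat)%:R - fO (uo w) w z.1) * G (blk w k) z.1) + 2 * c4 * uo w k) ->
  4 * c4 * (FF w - FO u w) <= nn A.
Proof.
move=> HA.
pose v k := u k - uo w k.
(* For fixed inner weights the risk is exactly quadratic in the outer weights, so this is an
   identity. *)
have e : FO u w - FF w = \sum_(k <- KK) (A k iO * v k + c4 * v k ^+ 2) +
   (size s)%:R^-1 * \sum_(z <- s) (fO v w z.1) ^+ 2.
  have -> : \sum_(k <- KK) (A k iO * v k + c4 * v k ^+ 2) =
    (size s)%:R^-1 * \sum_(z <- s) (- 2 * ((z.2 : nat)%:R - fO (uo w) w z.1) * fO v w z.1)
    + c4 * \sum_(k <- KK) (2 * (uo w k * v k) + v k ^+ 2).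
    transitivity (\sum_(k <- KK) ((size s)%:R^-1 * \sum_(z <- s)
       (- 2 * ((z.2 : nat)%:R - fO (uo w) w z.1) * (v k * G (blk w k) z.1)) +
       c4 * (2 * (uo w k * v k) + v k ^+ 2))).
      apply: eq_bigr => k _; rewrite HA.
      have -> : \sum_(z <- s)
       (- 2 * ((z.2 : nat)%:R - fO (uo w) w z.1) * (v k * G (blk w k) z.1)) =
       v k * \sum_(z <- s) (- 2 * ((z.2 : nat)%:R - fO (uo w) w z.1) * G (blk w k) z.1).
        by rewrite big_distrr; apply: eq_bigr => z _ /=; ring.
      ring.
    rewrite [LHS]big_split/= -[X in X + _ = _]big_distrr exchange_big/=; congr (_ * _ + _).
      by apply: eq_bigr => z _; rewrite -big_distrr.
    by rewrite -big_distrr.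
  rewrite /FF /FO.
  have -> : \sum_(1 <= k < K.+1) u k ^+ 2 = \sum_(k <- KK) uo w k ^+ 2 +
      \sum_(k <- KK) (2 * (uo w k * v k) + v k ^+ 2).
    rewrite -big_split; apply: eq_bigr => k _ /=; rewrite /v; ring.
  have -> : \sum_(z <- s) ((z.2 : nat)%:R - fO u w z.1) ^+ 2 =
    \sum_(z <- s) ((z.2 : nat)%:R - fO (uo w) w z.1) ^+ 2 +
    (\sum_(z <- s) (- 2 * ((z.2 : nat)%:R - fO (uo w) w z.1) * fO v w z.1) +
     \sum_(z <- s) fO v w z.1 ^+ 2).
    rewrite -!big_split; apply: eq_bigr => z _ /=.
    have -> : fO u w z.1 = fO (uo w) w z.1 + fO v w z.1.
      rewrite /fO -big_split; apply: eq_bigr => k _ /=; rewrite /v; ring.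
    ring.
  ring.
have h1 : 0 <= (size s)%:R^-1 * \sum_(z <- s) (fO v w z.1) ^+ 2.
  by rewrite mulr_ge0 ?invr_ge0// sumr_ge0// => z _; rewrite sqr_ge0.
(* Completing the square in each [v k]: (A k iO + 2 c4 v k)^2 is nonnegative. *)
have h2 : - nn A <= 4 * c4 * \sum_(k <- KK) (A k iO * v k + c4 * v k ^+ 2).
  rewrite /nn -sumrN big_distrr/= ler_sum// => k _.
  have := nr2_ge0 E (A k); have := sqr_ge0 (A k iO + 2 * c4 * v k).
  clr; nra.
have e' : FF w - FO u w = - (FO u w - FF w) by ring.
rewrite e' e; have := mulr_ge0 (ltW c4_gt0) h1; move: h2.
by clr; lra.
Qed.

(** [U] is the radius forced by the regularizer: c4 times the squared norm of the outer weights is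
    at most the risk, which starts below 1. [TB] says that the initial range [a2] plus the distance
    travelled in [T] steps stays within [B]. *)
Variables (lam a2 : R) (T : nat) (w0 : wvec R).
Hypotheses (lam0 : 0 < lam) (Qlam : Qc * lam <= 2^-1) (c4lam : 2 * c4 * lam <= 1).
Hypothesis c4U : c4 * U ^+ 2 = 1.
Hypothesis TB : a2 + Num.sqrt (2 * T%:R * lam) <= B.
Hypothesis w0u : forall k, uo w0 k = 0.
Hypothesis w0B : forall k e, k \in KK -> e \in E2 -> `|w0 (rcons e k)| <= a2.
Local Notation wt t := (iter t (gd_step FF lam) w0).

Ltac clr ::= clear -uE OE E2E G01 K1 c4_gt0 s0 sX P1 B0 U0 Gexpd lam0 Qlam c4lam c4U TB w0u w0B.

Lemma FO_ge0 u w : 0 <= FO u w.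
Proof.
rewrite addr_ge0 ?mulr_ge0 ?invr_ge0// ?(ltW c4_gt0)// sumr_ge0// => *; exact: sqr_ge0.
Qed.

Lemma FF_outer w : c4 * \sum_(k <- KK) uo w k ^+ 2 <= FF w.
Proof. by rewrite lerDr mulr_ge0 ?invr_ge0// sumr_ge0// => *; rewrite sqr_ge0. Qed.

Lemma FF0 : FF w0 <= 1.
Proof.
rewrite /FF /FO [X in _ + c4 * X]big1 ?mulr0 ?addr0; last by move=> k _; rewrite w0u expr0n.
apply: mean_le => // z _; rewrite /fO big1 ?subr0; last by move=> k _; rewrite w0u mul0r.
by case: z.2; rewrite ?expr1n ?expr0n.
Qed.

Lemma gd_stepE w A : (forall w', nn (sub_w w' w) <= 1 ->
      `|FF w' - FF w - AD A (sub_w w' w)| <= Qc * nn (sub_w w' w)) ->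
  forall k e, k \in KK -> e \in iO :: E ->
  gd_step FF lam w (rcons e k) = w (rcons e k) - lam * A k e.
Proof.
move=> H k e kK eE; rewrite /gd_step; congr (_ - _ * _).
apply: (@derive1_quad _ _ _ _ Qc) => h h1.
set w' := upd _ _ _.
have sw k' e' : sub_w w' w k' e' = ((e' == e) && (k' == k))%:R * h.
  rewrite /sub_w /w' /upd eqseq_rcons.
  case: andP => [[/eqP-> /eqP->]|_]; last by rewrite subrr mul0r.
  by rewrite mul1r addrC addKr.
have uO : uniq (iO :: E) by rewrite /= OE.
have AE : AD A (sub_w w' w) = A k e * h.
  rewrite /AD (bigD1_seq k)//= ?iota_uniq// [X in _ + X]big1 ?addr0; last first.
    move=> k' /negbTE kk; rewrite big1// => e' _.
    by rewrite sw kk andbF mul0r mulr0.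
  rewrite (bigD1_seq e)//= sw !eqxx mul1r big1 ?addr0// => e' /negbTE ee.
  by rewrite sw ee mul0r mulr0.
have nE : nn (sub_w w' w) = h ^+ 2.
  rewrite nnE (bigD1_seq k)//= ?iota_uniq// [X in _ + X]big1 ?addr0; last first.
    move=> k' /negbTE kk; rewrite big1// => e' _.
    by rewrite sw kk andbF mul0r expr0n.
  rewrite (bigD1_seq e)//= sw !eqxx mul1r big1 ?addr0// => e' /negbTE ee.
  by rewrite sw ee mul0r expr0n.
have := H w'; rewrite AE nE -real_normK ?num_real// => /(_ (exprn_ile1 _ (normr_ge0 _) h1)).
have -> : upd w (rcons e k) (w (rcons e k)) = w.
  by apply/funext => j; rewrite /upd; case: eqP => [->|].
by rewrite real_normK ?num_real.
Qed.

(** As Qc * lam <= 1/2, one step lowers the risk by at least lam / 2 times [nn A]. This pays for the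
    squared length lam^2 * nn A of the step and, through [F_PL], for a fixed fraction of the gap to
    any [u]. *)
Lemma gd_step_descent w :
  \sum_(k <- KK) uo w k ^+ 2 <= U ^+ 2 ->
  (forall k e, k \in KK -> e \in E2 -> `|w (rcons e k)| <= B) ->
  let w' := gd_step FF lam w in
  nn (sub_w w' w) <= 2 * lam * (FF w - FF w') /\
  forall u, 2 * c4 * lam * (FF w - FO u w) <= FF w - FF w'.
Proof.
move=> u2 wB w'.
have [A [A1 A2 A3]] := F_expd u2 wB.
have st := gd_stepE A2.
have sw k e : k \in KK -> e \in iO :: E -> sub_w w' w k e = - lam * A k e.
  by move=> kK eE; rewrite /sub_w /w' st// addrAC subrr sub0r mulNr.
have nE : nn (sub_w w' w) = lam ^+ 2 * nn A.
  rewrite !nnE big_distrr/= [LHS]big_seq [RHS]big_seq; apply: eq_bigr => k kK.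
  rewrite big_distrr/= [LHS]big_seq [RHS]big_seq; apply: eq_bigr => e eE.
  by rewrite sw// exprMn sqrrN.
have AE : AD A (sub_w w' w) = - lam * nn A.
  rewrite nnE /AD big_distrr/= [LHS]big_seq [RHS]big_seq; apply: eq_bigr => k kK.
  rewrite big_distrr/= [LHS]big_seq [RHS]big_seq; apply: eq_bigr => e eE.
  by rewrite sw// mulrCA expr2.
have Q0 := Qc_ge0.
have n0 := nn_ge0 A.
have lQ : (lam * Qc) ^+ 2 <= 1.
  rewrite exprn_ile1//; first by rewrite mulr_ge0// ltW.
  by rewrite mulrC (le_trans Qlam)// invf_le1// ler1n.
have n1 : nn (sub_w w' w) <= 1.
  by rewrite nE (le_trans _ lQ)// exprMn ler_wpM2l// sqr_ge0.
have := A2 w' n1; rewrite AE nE ler_norml => /andP[_ h].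
have h' : Qc * (lam ^+ 2 * nn A) <= 2^-1 * (lam * nn A).
  have -> : Qc * (lam ^+ 2 * nn A) = (Qc * lam) * (lam * nn A) by ring.
  by rewrite ler_wpM2r// mulr_ge0// ltW.
have d1 : lam * nn A <= 2 * (FF w - FF w').
  by move: h h'; set x := lam * nn A; rewrite mulNr -/x; clr; lra.
split.
  rewrite -mulrA mulrCA expr2 -mulrA ler_wpM2l ?(ltW lam0)//.
move=> u; have := F_PL u A3 => pl.
have : lam * (4 * c4 * (FF w - FO u w)) <= lam * nn A by rewrite ler_wpM2l// ltW.
by move: d1; clr; lra.
Qed.

(** Cauchy-Schwarz over the steps in inductive form: the squared distance is at most [t] times the
    sum of the squared step lengths, which telescopes to risk differences. Position and descent are
    proved together, since the next step needs the weights to be in the region where [Gexpd]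
    applies. *)
Lemma gd_invariant t : (t <= T)%N ->
  nn (sub_w (wt t) w0) <= 2 * t%:R * lam * (FF w0 - FF (wt t)) /\
  FF (wt t) <= FF w0.
Proof.
elim: t => [|t IH] tT.
  split => //; rewrite /nn big1 ?subrr ?mulr0// => k _.
  rewrite /sub_w subrr expr0n add0r /nr2 big1// => e _.
  by rewrite subrr expr0n.
have [n1 f1] := IH (ltnW tT).
have F0 := FF0.
have Fp := FO_ge0 (uo (wt t)) (wt t); rewrite -/(FF _) in Fp.
have u2 : \sum_(k <- KK) uo (wt t) k ^+ 2 <= U ^+ 2.
  rewrite -(ler_pM2l c4_gt0) c4U; have := FF_outer (wt t).
  by move: f1 F0; clr; lra.
have tT' : (t%:R : R) <= T%:R by rewrite ler_nat ltnW.
have wB k e : k \in KK -> e \in E2 -> `|wt t (rcons e k)| <= B.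
  move=> kK eE; apply: le_trans TB.
  have -> : wt t (rcons e k) = w0 (rcons e k) + sub_w (wt t) w0 k e.
    by rewrite /sub_w addrC subrK.
  rewrite (le_trans (ler_normD _ _))// lerD// ?w0B//.
  apply: (@le_trans _ _ (Num.sqrt (nn (sub_w (wt t) w0)))).
    rewrite -sqrtr_sqr ler_wsqrtr// (le_trans _ (nn_term_le _ kK))//.
    rewrite (@le_trans _ _ (nr2 E (sub_w (wt t) w0 k)))//; last by rewrite lerDr sqr_ge0.
    rewrite /nr2 (bigD1_seq e)//= ?E2E// lerDl sumr_ge0// => *; exact: sqr_ge0.
  rewrite ler_wsqrtr// (le_trans n1)//.
  rewrite -[leRHS]mulr1 ler_pM ?mulr_ge0// ?(ltW lam0)//; first by rewrite subr_ge0.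
    by rewrite ler_wpM2r ?(ltW lam0)// ler_wpM2l.
  by move: F0 Fp; clr; lra.
have [d1 d2] := gd_step_descent u2 wB.
rewrite [iter t.+1 _ _]iterS; set w' := gd_step _ _ _ in d1 d2 *.
have mono : FF w' <= FF (wt t).
  have := d2 (uo (wt t)); rewrite -/(FF _) subrr mulr0; clr; lra.
split; last exact: le_trans f1.
case: (posnP t) => [tz|tpos].
  have e0 : wt t = w0 by rewrite tz.
  by rewrite e0 in d1; rewrite tz mulr1.
have t0 : 0 < t%:R :> R by rewrite ltr0n.
set m : R := t%:R in n1 tT' t0 *.
have -> : t.+1%:R = m + 1 by rewrite natr1.
(* Coordinatewise, m (p + q)^2 <= (m + 1) p^2 + m (m + 1) q^2, the difference being (p - m q)^2. *)
have tri : m * nn (sub_w w' w0) <=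
  (m + 1) * nn (sub_w (wt t) w0) + (m + 1) * m * nn (sub_w w' (wt t)).
  rewrite !nnE !big_distrr -big_split/= ler_sum// => k _.
  rewrite !big_distrr -big_split/= ler_sum// => e _.
  have -> : sub_w w' w0 k e = sub_w (wt t) w0 k e + sub_w w' (wt t) k e.
    rewrite /sub_w; ring.
  set p := sub_w _ _ _ _; set q := sub_w _ _ _ _.
  have := sqr_ge0 (p - m * q); clr; nra.
rewrite -(ler_pM2l t0) (le_trans tri)//.
have m1 : 0 <= m + 1 by rewrite addr_ge0// ltW.
have g1 : (m + 1) * nn (sub_w (wt t) w0) <= (m + 1) * (2 * m * lam * (FF w0 - FF (wt t))).
  by rewrite ler_wpM2l.
have g2 : (m + 1) * m * nn (sub_w w' (wt t)) <=
   (m + 1) * m * (2 * lam * (FF (wt t) - FF w')).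
  by rewrite ler_wpM2l// mulr_ge0// ltW.
rewrite (le_trans (lerD g1 g2))// le_eqVlt; apply/orP; left; apply/eqP; ring.
Qed.

Lemma gd_state t : (t <= T)%N ->
  [/\ nn (sub_w (wt t) w0) <= 2 * T%:R * lam, FF (wt t) <= 1,
     \sum_(k <- KK) uo (wt t) k ^+ 2 <= U ^+ 2 &
     forall k e, k \in KK -> e \in E2 -> `|wt t (rcons e k)| <= B].
Proof.
move=> tT; have [n1 f1] := gd_invariant tT.
have F0 := FF0.
have Fp := FO_ge0 (uo (wt t)) (wt t); rewrite -/(FF _) in Fp.
have tT' : (t%:R : R) <= T%:R by rewrite ler_nat.
have nT : nn (sub_w (wt t) w0) <= 2 * T%:R * lam.
  rewrite (le_trans n1)// -[leRHS]mulr1 ler_pM ?mulr_ge0// ?(ltW lam0)//.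
  - by rewrite subr_ge0.
  - by rewrite ler_wpM2r ?(ltW lam0)// ler_wpM2l.
  - by move: F0 Fp; clr; lra.
split=> //; first exact: le_trans F0.
  rewrite -(ler_pM2l c4_gt0) c4U; have := FF_outer (wt t).
  by move: f1 F0; clr; lra.
move=> k e kK eE; apply: le_trans TB.
have -> : wt t (rcons e k) = w0 (rcons e k) + sub_w (wt t) w0 k e.
  by rewrite /sub_w addrC subrK.
rewrite (le_trans (ler_normD _ _))// lerD// ?w0B//.
apply: (@le_trans _ _ (Num.sqrt (nn (sub_w (wt t) w0)))); last by rewrite ler_wsqrtr.
rewrite -sqrtr_sqr ler_wsqrtr// (le_trans _ (nn_term_le _ kK))//.
rewrite (@le_trans _ _ (nr2 E (sub_w (wt t) w0 k)))//; last by rewrite lerDr sqr_ge0.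
rewrite /nr2 (bigD1_seq e)//= ?E2E// lerDl sumr_ge0// => *; exact: sqr_ge0.
Qed.

(** The comparison value [FO u (wt t)] changes with [t] because the inner weights move; a bound
    uniform in [t] is enough for the excess over [Bd] to contract geometrically. *)
Lemma gd_final u Bd : 0 <= Bd -> (forall t, (t <= T)%N -> FO u (wt t) <= Bd) ->
  FF (wt T) <= Bd + (1 - 2 * c4 * lam) ^+ T.
Proof.
move=> Bd0 HB.
suff h t : (t <= T)%N -> FF (wt t) <= Bd + (1 - 2 * c4 * lam) ^+ t by exact: h.
elim: t => [|t IH] tT; first by rewrite expr0 (le_trans FF0)// lerDr.
have {}IH := IH (ltnW tT).
have [_ _ u2 wB] := gd_state (ltnW tT).
have [_ /(_ u)] := gd_step_descent u2 wB.
rewrite [iter t.+1 _ _]iterS => d.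
have b := HB t (ltnW tT).
have q0 : 0 <= 2 * c4 * lam by rewrite !mulr_ge0// ltW.
have r0 : 0 <= 1 - 2 * c4 * lam by rewrite subr_ge0.
rewrite exprS.
set q := 2 * c4 * lam in d q0 r0 IH *.
have h1 : (1 - q) * FF (wt t) <= (1 - q) * (Bd + (1 - q) ^+ t) by rewrite ler_wpM2l.
have h2 : q * FO u (wt t) <= q * Bd by rewrite ler_wpM2l.
by move: d h1 h2; clr; lra.
Qed.

End GradientDescent.

(** * Covering numbers *)

Section LocalPolynomials.
Variables (R : realType) (J : finType).
Implicit Types (z : J -> R) (A : R) (D : nat).

Definition term := (R * {ffun J -> nat})%type.
Definition ev (ts : seq term) z : R := \sum_(t <- ts) t.1 * \prod_p z p ^+ t.2 p.
Definition l1 (ts : seq term) : R := \sum_(t <- ts) `|t.1|.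
Definition degb D (ts : seq term) := all (fun t : term => [forall p, (t.2 p <= D)%N]) ts.

Definition isP D A (g : (J -> R) -> R) :=
  exists ts, [/\ degb D ts, l1 ts <= A & forall z, g z = ev ts z].

Lemma isP_mono D D' A A' g : (D <= D')%N -> A <= A' -> isP D A g -> isP D' A' g.
Proof.
move=> DD AA [ts [h1 h2 h3]]; exists ts; split => //; last exact: le_trans AA.
apply: sub_all h1 => t /forallP h; apply/forallP => p; exact: leq_trans (h p) DD.
Qed.

Lemma isP_cst (c : R) : isP 0 `|c| (fun=> c).
Proof.
exists [:: (c, [ffun=> 0%N])]; split.
- by rewrite /degb /= andbT; apply/forallP => p; rewrite ffunE.
- by rewrite /l1 big_seq1.
- by move=> z; rewrite /ev big_seq1/= big1 ?mulr1// => p _; rewrite ffunE.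
Qed.

Lemma isP_var p : isP 1 1 (fun z => z p).
Proof.
exists [:: (1, [ffun q => (q == p : nat)])]; split.
- by rewrite /degb /= andbT; apply/forallP => q; rewrite ffunE; case: eqP.
- by rewrite /l1 big_seq1 normr1.
- move=> z; rewrite /ev big_seq1/= mul1r (bigD1 p)//= ffunE eqxx expr1 big1 ?mulr1//.
  by move=> q /negbTE qp; rewrite ffunE qp.
Qed.

Lemma isPD D A A' g h : isP D A g -> isP D A' h -> isP D (A + A') (fun z => g z + h z).
Proof.
move=> [ts [a1 a2 a3]] [us [b1 b2 b3]]; exists (ts ++ us); split.
- by rewrite /degb all_cat; apply/andP.
- by rewrite /l1 big_cat lerD.
- by move=> z; rewrite /ev big_cat a3 b3.
Qed.

Lemma isPM D D' A A' g h : 0 <= A -> isP D A g -> isP D' A' h ->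
  isP (D + D') (A * A') (fun z => g z * h z).
Proof.
move=> A0 [ts [a1 a2 a3]] [us [b1 b2 b3]].
pose pr (t u : term) : term := (t.1 * u.1, [ffun p => (t.2 p + u.2 p)%N]).
exists [seq pr t u | t <- ts, u <- us]; split.
- apply/allP => x /allpairsP[[t u] /= [tt uu ->]]; apply/forallP => p.
  move/allP: a1 => /(_ _ tt)/forallP/(_ p) q1.
  move/allP: b1 => /(_ _ uu)/forallP/(_ p) q2.
  by rewrite ffunE leq_add.
- rewrite /l1 big_allpairs_dep/=.
  have -> : \sum_(t <- ts) \sum_(u <- us) `|t.1 * u.1| = l1 ts * l1 us.
    rewrite /l1 big_distrl/=; apply: eq_bigr => t _; rewrite big_distrr/=.
    by apply: eq_bigr => u _; rewrite normrM.
  by rewrite ler_pM// sumr_ge0.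
- move=> z; rewrite a3 b3 /ev big_allpairs_dep/= big_distrl/=; apply: eq_bigr => t _.
  rewrite big_distrr/=; apply: eq_bigr => u _.
  rewrite mulrACA -big_split/=; congr (_ * _); apply: eq_bigr => p _.
  by rewrite ffunE exprD.
Qed.

Lemma isPZ D A g (c : R) : isP D A g -> isP D (`|c| * A) (fun z => c * g z).
Proof. by move=> h; rewrite -[D]add0n; apply: isPM => //; exact: isP_cst. Qed.

Lemma isP_sum (T : eqType) (r : seq T) D A (g : T -> (J -> R) -> R) :
  (forall i, i \in r -> isP D A (g i)) ->
  isP D ((size r)%:R * A) (fun z => \sum_(i <- r) g i z).
Proof.
elim: r => [|i r IH] H.
  exists [::]; split => //; first by rewrite /l1 big_nil mul0r.
  by move=> z; rewrite /ev !big_nil.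
have [ts [h1 h2 h3]] : isP D (A + (size r)%:R * A) (fun z => g i z + \sum_(i <- r) g i z).
  apply: isPD; first by apply: H; rewrite mem_head.
  by apply: IH => j jr; apply: H; rewrite in_cons jr orbT.
exists ts; split => //; first by rewrite /= -natr1 mulrDl mul1r addrC.
by move=> z; rewrite big_cons h3.
Qed.

Lemma isPX D A g m : 0 <= A -> isP D A g -> isP (m * D) (A ^+ m) (fun z => g z ^+ m).
Proof.
move=> A0 gP; elim: m => [|m IH].
  rewrite mul0n expr0 -(normr1 R).
  have [ts [h1 h2 h3]] := isP_cst 1.
  by exists ts; split => // z; rewrite expr0 -h3.
have [ts [h1 h2 h3]] := isPM A0 gP IH.
by exists ts; split => // [|z]; rewrite ?exprS// -h3 exprS.
Qed.

Lemma isP_bound D A g z : isP D A g -> (forall p, 0 <= z p <= 1) -> `|g z| <= A.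
Proof.
move=> [ts [_ h2 h3]] z01; rewrite h3 (le_trans _ h2)//.
rewrite (le_trans (ler_norm_sum _ _ _))// ler_sum// => t _.
rewrite normrM -[leRHS]mulr1 ler_wpM2l//.
have h p : 0 <= z p ^+ t.2 p <= 1.
  by have /andP[? ?] := z01 p; rewrite exprn_ge0// exprn_ile1.
rewrite ger0_norm; first by rewrite prodr_ile1.
by rewrite prodr_ge0// => p _; have /andP[] := h p.
Qed.

(** Without its constant term the composition keeps the factor [A], so smallness passes to the next
    layer. *)
Lemma isP_poly D A g (q : {poly R}) (C : R) n : 0 <= A -> A <= 1 -> 0 <= C ->
  (size q <= n.+1)%N -> (forall i, `|q`_i| <= C) -> isP D A g ->
  isP (n * D) (n%:R * (C * A)) (fun z => q.[g z] - q`_0).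
Proof.
move=> A0 A1 C0 sq qC gP.
have [ts [h1 h2 h3]] : isP (n * D) ((size (index_enum 'I_n))%:R * (C * A))
    (fun z => \sum_(i < n) q`_i.+1 * g z ^+ i.+1).
  apply: (@isP_sum _ _ _ _ (fun (i : 'I_n) z => q`_i.+1 * g z ^+ i.+1)) => i _.
  apply: (@isP_mono (i.+1 * D) _ (`|q`_i.+1| * A ^+ i.+1)).
  - by rewrite leq_mul2r ltn_ord orbT.
  - by rewrite ler_pM ?exprn_ge0// exprS ler_piMr// exprn_ile1.
  - by apply: isPZ; exact: isPX.
exists ts; split => //.
  by rewrite (le_trans h2)// -[X in _ <= X%:R * _](card_ord n) cardT enumT.
move=> z; rewrite -h3 (horner_coef_wide _ sq) big_ord_recl/= expr0 mulr1 addrC addKr.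
by apply: eq_bigr => i _; rewrite /bump.
Qed.

Lemma isP_coef D A g : isP D A g ->
  exists c : {ffun J -> 'I_D.+1} -> R, (forall e, `|c e| <= A) /\
    forall z, g z = \sum_e c e * \prod_p z p ^+ e p.
Proof.
move=> [ts [h1 h2 h3]].
pose fe (t : term) : {ffun J -> 'I_D.+1} := [ffun p => inord (t.2 p)].
exists (fun e => \sum_(t <- ts | fe t == e) t.1); split => [e|z].
  rewrite (le_trans (ler_norm_sum _ _ _))// (le_trans _ h2)// /l1.
  by rewrite big_mkcond/= ler_sum// => t _; case: ifP.
rewrite h3 /ev.
under [RHS]eq_bigr => e _ do rewrite big_distrl/= big_mkcond/=.
rewrite exchange_big/= big_seq [RHS]big_seq; apply: eq_bigr => t tt.
rewrite -big_mkcond/= (big_pred1 (fe t)); last by move=> e; rewrite /= eq_sym.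
congr (_ * _); apply: eq_bigr => p _; rewrite ffunE inordK// ltnS.
by move/allP: h1 => /(_ _ tt)/forallP/(_ p).
Qed.

End LocalPolynomials.

(** * Networks on grid cells and their quantized codes *)

Section Cover.
Variables (R : realType) (kappa L : nat).
Local Notation J := (pix kappa).
Variables (q mm : nat) (C B W1 : R).
Hypotheses (mm0 : (0 < mm)%N) (C1 : 1 <= C) (B1 : 1 <= B) (W10 : 0 <= W1).
Hypothesis k1 : (1 <= kappa)%N.
Hypothesis Htaylor : forall z : R, exists p : {poly R}, [/\ (size p <= (q * q).+1)%N,
    forall i, `|p`_i| <= C &
    forall h, `|h| <= 1 -> `|sigmoid (z + h) - p.[h]| <= C * `|h| ^+ q.+1].

(** [Q1] is the growth of the degree per layer. [v1] bounds the variation of a first-layer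
    pre-activation over a cell of side 1/mm; each layer multiplies the variation by at most [Lam],
    where nin * B comes from the weighted sum and C * Q1 from the Taylor polynomial. [XX] then
    dominates the power q + 1 of the variation in every layer. *)
Definition Q1 : nat := (q * q).+1.
Definition Lam : R := C * Q1%:R * (nin kappa)%:R * B.
Definition v1 : R := (#|J|)%:R * (W1 / mm%:R).
Definition XX : R := (Lam ^+ L * v1) ^+ q.+1.
Hypothesis LV : Lam ^+ L * v1 <= 1.

Definition pt (c : {ffun J -> 'I_mm.+1}) (z : J -> R) : 'M[R]_kappa :=
  \matrix_(a, b) (((c (a, b))%:R + z (a, b)) / mm%:R).

Lemma nin_ge1 : 1 <= (nin kappa)%:R :> R.
Proof. by rewrite ler1n /nin muln_gt0 expn_gt0 k1. Qed.

Lemma Q1_ge1 : 1 <= Q1%:R :> R. Proof. by rewrite ler1n. Qed.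

Lemma v1_ge0 : 0 <= v1. Proof. by rewrite /v1 mulr_ge0// divr_ge0. Qed.

Lemma CQ_ge1 : 1 <= C * Q1%:R.
Proof. by rewrite -[leLHS]mulr1 ler_pM// Q1_ge1. Qed.

Lemma nB_ge1 : 1 <= (nin kappa)%:R * B.
Proof. by rewrite -[leLHS]mulr1 ler_pM// nin_ge1. Qed.

Lemma LamE : Lam = C * Q1%:R * ((nin kappa)%:R * B).
Proof. by rewrite /Lam mulrA. Qed.

Lemma Lam_geCQ : C * Q1%:R <= Lam.
Proof. by rewrite LamE ler_peMr ?nB_ge1// (le_trans _ CQ_ge1). Qed.

Lemma Lam_genB : (nin kappa)%:R * B <= Lam.
Proof. by rewrite LamE ler_peMl ?CQ_ge1// (le_trans _ nB_ge1). Qed.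

Lemma Lam_geC : C <= Lam.
Proof. by rewrite (le_trans _ Lam_geCQ)// ler_peMr ?Q1_ge1// (le_trans _ C1). Qed.

Lemma Lam_ge1 : 1 <= Lam. Proof. exact: le_trans Lam_geC. Qed.

Lemma Lam_v r : (r <= L)%N -> Lam ^+ r * v1 <= Lam ^+ L * v1.
Proof. by move=> rL; rewrite ler_wpM2r ?v1_ge0// ler_weXn2l// Lam_ge1. Qed.

Lemma XX_ge0 : 0 <= XX.
Proof.
by rewrite /XX exprn_ge0// mulr_ge0 ?v1_ge0// exprn_ge0// (le_trans _ Lam_ge1).
Qed.

(** A bounded constant plus a small polynomial: the next layer is expanded around the value at the
    constants, so only the small part has to be at most 1. *)
Definition unitP (o : (J -> R) -> R) r (Er : R) :=
  exists (c0 : R) (g : (J -> R) -> R), [/\ `|c0| <= C, isP (Q1 ^ r) (Lam ^+ r * v1) g &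
    forall z, (forall p, 0 <= z p <= 1) -> `|o z - (c0 + g z)| <= Er].

Lemma unit_step D v V (c : R) (g : (J -> R) -> R) : 0 <= v <= 1 -> isP D v g ->
  C * Q1%:R * v <= V ->
  exists (c0 : R) (g' : (J -> R) -> R), [/\ `|c0| <= C, isP (Q1 * D) V g' &
    forall z, (forall p, 0 <= z p <= 1) ->
      `|sigmoid (c + g z) - (c0 + g' z)| <= C * v ^+ q.+1].
Proof.
move=> /andP[v0 v1'] gP HV; have [p [sp pC pE]] := Htaylor c.
exists p`_0, (fun z => p.[g z] - p`_0); split => //.
  apply: (isP_mono (leqnn _) HV).
  have h := isP_poly v0 v1' (le_trans ler01 C1) sp pC gP.
  apply: isP_mono h; first by rewrite leq_mul2r leqnSn orbT.
  rewrite mulrA [_ * C]mulrC ler_wpM2r// ler_wpM2l ?(le_trans ler01 C1)//.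
  by rewrite ler_nat.
move=> z z01; have gb := isP_bound gP z01.
have -> : p`_0 + (p.[g z] - p`_0) = p.[g z] by ring.
rewrite (le_trans (pE _ _))//; first exact: le_trans gb v1'.
by rewrite ler_wpM2l ?(le_trans ler01 C1)// lerXn2r ?nnegrE.
Qed.

Lemma net_unitP (th : wvec R) c r s :
  (forall (p : J) s, (1 <= s <= nin kappa)%N -> `|th (iW 1 p.1.+1 p.2.+1 1 s)| <= W1) ->
  (forall e, e \in idx_w kappa L -> `|th e| <= B) ->
  (1 <= r <= L)%N -> (1 <= s <= nin kappa)%N ->
  unitP (fun z => net th (pt c z) r s) r (r%:R * Lam ^+ r * XX).
Proof.
move=> HW HB; have X0 := XX_ge0; have La1 := Lam_ge1.
have La0 : 0 <= Lam by exact: le_trans La1.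
elim: r s => [//|[|r] IH] s hr hs.
- have mmR : 0 < mm%:R :> R by rewrite ltr0n.
  pose g z : R := \sum_(p : J) (th (iW 1 p.1.+1 p.2.+1 1 s) / mm%:R) * z p.
  have gP : isP 1 v1 g.
    have -> : v1 = (size (index_enum J))%:R * (W1 / mm%:R).
      by rewrite /v1 cardT enumT.
    apply: (@isP_sum _ _ _ _ _ _ (fun (p : J) z => (th (iW 1 p.1.+1 p.2.+1 1 s) / mm%:R) * z p)).
    move=> p _; apply: (@isP_mono _ _ 1 _ (`|th (iW 1 p.1.+1 p.2.+1 1 s) / mm%:R| * 1)) => //.
      rewrite mulr1 normrM normfV (ger0_norm (ler0n _ mm)).
      by rewrite ler_wpM2r ?invr_ge0// HW.
    by apply: isPZ; exact: isP_var.
  pose c' : R := \sum_(p : J) th (iW 1 p.1.+1 p.2.+1 1 s) * ((c p)%:R / mm%:R) + th (iB 1 s).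
  have v01 : 0 <= v1 <= 1.
    rewrite v1_ge0/= (le_trans _ LV)// -[leLHS]mul1r ler_wpM2r ?v1_ge0//.
    by rewrite expr_ge1.
  have HV : C * Q1%:R * v1 <= Lam ^+ 1 * v1.
    by rewrite expr1 ler_wpM2r ?v1_ge0// Lam_geCQ.
  have [c0 [g' [h1 h2 h3]]] := unit_step c' v01 gP HV.
  exists c0, g'; split => //; first by rewrite expn1 -[Q1]muln1.
  move=> z z01; rewrite net1E.
  have -> : \sum_(p : J) th (iW 1 p.1.+1 p.2.+1 1 s) * (pt c z) p.1 p.2 + th (iB 1 s) =
     c' + g z.
    rewrite /c' /g addrAC -big_split/=; congr (_ + _); apply: eq_bigr => -[a b] _.
    by rewrite mxE/=; ring.
  rewrite (le_trans (h3 z z01))// mul1r expr1 ler_pM ?exprn_ge0 ?v1_ge0//.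
  - exact: le_trans C1.
  - exact: Lam_geC.
  - rewrite lerXn2r ?nnegrE ?v1_ge0 ?mulr_ge0 ?exprn_ge0 ?v1_ge0//.
    by rewrite -[leLHS]mul1r ler_wpM2r ?v1_ge0// expr_ge1.
- have hr' : (1 <= r.+1 <= L)%N by move: hr; lia.
  have IH' (s1 : 'I_(nin kappa)) : exists cg : R * ((J -> R) -> R),
     [/\ `|cg.1| <= C, isP (Q1 ^ r.+1) (Lam ^+ r.+1 * v1) cg.2 &
      forall z, (forall p, 0 <= z p <= 1) ->
       `|net th (pt c z) r.+1 s1.+1 - (cg.1 + cg.2 z)| <= r.+1%:R * Lam ^+ r.+1 * XX].
    by have [c0 [g H]] := IH s1.+1 hr' (ltn_ord s1); exists (c0, g).
  have [cg Hcg] := choice IH'.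
  pose w (s1 : 'I_(nin kappa)) := th (iW r.+2 1 1 s1.+1 s).
  have wB s1 : `|w s1| <= B.
    by apply: HB; apply: mem_idx_w_w => //; rewrite ltn_ord.
  pose v : R := (nin kappa)%:R * B * (Lam ^+ r.+1 * v1).
  pose g z : R := \sum_(s1 < nin kappa) w s1 * (cg s1).2 z.
  have V0 : 0 <= Lam ^+ r.+1 * v1 by rewrite mulr_ge0 ?exprn_ge0 ?v1_ge0.
  have gP : isP (Q1 ^ r.+1) v g.
    have -> : v = (size (index_enum 'I_(nin kappa)))%:R * (B * (Lam ^+ r.+1 * v1)).
      by rewrite /v -mulrA -[X in X%:R * _](card_ord (nin kappa)) cardT enumT.
    apply: (@isP_sum _ _ _ _ _ _ (fun (s1 : 'I_(nin kappa)) z => w s1 * (cg s1).2 z)).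
    move=> s1 _; have [_ h2 _] := Hcg s1.
    apply: (@isP_mono _ _ (Q1 ^ r.+1) _ (`|w s1| * (Lam ^+ r.+1 * v1))) => //.
      by rewrite ler_wpM2r.
    exact: isPZ.
  have nB0 : 0 <= (nin kappa)%:R * B by rewrite (le_trans _ nB_ge1).
  have vle : v <= Lam ^+ r.+2 * v1.
    by rewrite /v mulrA [Lam ^+ r.+2]exprS ler_wpM2r ?v1_ge0// ler_wpM2r ?exprn_ge0// Lam_genB.
  have vle2 : v <= Lam ^+ L * v1 by rewrite (le_trans vle)// Lam_v//; move: hr; lia.
  have v01 : 0 <= v <= 1 by rewrite mulr_ge0//= (le_trans vle2).
  have HV : C * Q1%:R * v <= Lam ^+ r.+2 * v1.
    by rewrite /v mulrA -LamE mulrA -exprS.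
  pose c' : R := \sum_(s1 < nin kappa) w s1 * (cg s1).1 + th (iB r.+2 s).
  have [c0 [g' [h1 h2 h3]]] := unit_step c' v01 gP HV.
  exists c0, g'; split => //.
  move=> z z01; rewrite netSE; set pre := \sum_(s1 < _) _ + _.
  (* Errors of the previous layer pass through weights bounded by [B] and through the sigmoid, which
     is 1-Lipschitz. *)
  have d1 : `|sigmoid pre - sigmoid (c' + g z)| <=
     (nin kappa)%:R * B * (r.+1%:R * Lam ^+ r.+1 * XX).
    rewrite (le_trans (sigmoid_lip _ _))//.
    have -> : pre - (c' + g z) = \sum_(s1 < nin kappa)
        w s1 * (net th (pt c z) r.+1 s1.+1 - ((cg s1).1 + (cg s1).2 z)).
      under eq_bigr => s1 _ do rewrite mulrBr mulrDr.
      rewrite sumrB big_split/= /pre /c' /g /w; ring.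
    rewrite (le_trans (ler_norm_sum _ _ _))//.
    rewrite (@le_trans _ _ (\sum_(s1 < nin kappa) B * (r.+1%:R * Lam ^+ r.+1 * XX)))//.
      rewrite ler_sum// => s1 _; rewrite normrM ler_pM//.
      by have [_ _] := Hcg s1; apply.
    by rewrite sumr_const card_ord -[leRHS]mulrA [leRHS]mulr_natl.
  have -> : sigmoid pre - (c0 + g' z) = (sigmoid pre - sigmoid (c' + g z)) +
     (sigmoid (c' + g z) - (c0 + g' z)) by ring.
  rewrite (le_trans (ler_normD _ _))// (le_trans (lerD d1 (h3 z z01)))//.
  have t1 : (nin kappa)%:R * B * (r.+1%:R * Lam ^+ r.+1 * XX) <=
     r.+1%:R * Lam ^+ r.+2 * XX.
    have -> : (nin kappa)%:R * B * (r.+1%:R * Lam ^+ r.+1 * XX) =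
      r.+1%:R * ((nin kappa)%:R * B * Lam ^+ r.+1) * XX by ring.
    rewrite ler_wpM2r// ler_wpM2l// [Lam ^+ r.+2]exprS ler_wpM2r ?exprn_ge0// Lam_genB//.
  have t2 : C * v ^+ q.+1 <= Lam ^+ r.+2 * XX.
    rewrite ler_pM ?exprn_ge0//; first exact: le_trans C1.
    - by case/andP: v01.
    - by rewrite (le_trans Lam_geC)// exprS ler_peMr// expr_ge1.
    - rewrite lerXn2r ?nnegrE//; first by case/andP: v01.
      by rewrite mulr_ge0 ?v1_ge0 ?exprn_ge0.
  have -> : r.+2%:R * Lam ^+ r.+2 * XX = r.+1%:R * Lam ^+ r.+2 * XX + Lam ^+ r.+2 * XX.
    by rewrite -[r.+2%:R]natr1; ring.
  exact: lerD.
Qed.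

Variables (lev : nat) (U1 : R).
Hypotheses (lev0 : (0 < lev)%N) (U10 : 0 < U1).
Definition DL : nat := (Q1 ^ L)%N.
(** A table of quantized coefficients, one for each cell and each exponent. Cells are half-open, so
    the indices run up to [mm]: the last cell of a coordinate holds the value 1. *)
Definition code : finType :=
  {ffun {ffun J -> 'I_mm.+1} * {ffun J -> 'I_DL.+1} -> 'I_lev.+1}.
Definition Amax : R := U1 * (C + 1).
Definition qv (j : 'I_lev.+1) : R := - Amax + 2 * Amax * (j%:R / lev%:R).
Definition cfun (cd : code) (y : 'M[R]_kappa) : R :=
  \sum_(c : {ffun J -> 'I_mm.+1})
    (\prod_(p : J) (((c p)%:R : R) <= mm%:R * y p.1 p.2 < (c p).+1%:R)%R%:R) *
    \sum_(e : {ffun J -> 'I_DL.+1})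
      qv (cd (c, e)) * \prod_(p : J) (mm%:R * y p.1 p.2 - (c p)%:R) ^+ e p.

Lemma card_code : #|code| = (lev.+1 ^ (mm.+1 ^ kappa ^ 2 * DL.+1 ^ kappa ^ 2))%N.
Proof. by rewrite card_ffun card_prod !card_ffun card_prod !card_ord mulnn. Qed.

Lemma Amax_gt0 : 0 < Amax.
Proof. by rewrite mulr_gt0// addr_gt0// (lt_le_trans _ C1). Qed.

Lemma quantize (x : R) : `|x| <= Amax -> exists j, `|x - qv j| <= 2 * Amax / lev%:R.
Proof.
move=> xA; have A0 := Amax_gt0; have l0 : 0 < lev%:R :> R by rewrite ltr0n.
pose t := (x + Amax) * lev%:R / (2 * Amax).
have /andP[x1 x2] : - Amax <= x <= Amax by rewrite -ler_norml.
have A20 : 0 < 2 * Amax by rewrite mulr_gt0.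
have t0 : 0 <= t by rewrite divr_ge0 ?(ltW A20)// mulr_ge0//; lra.
have tl : t <= lev%:R.
  rewrite ler_pdivrMr// mulrC ler_wpM2l//; lra.
have /andP[j1 j2] := truncn_itv t0.
have jl : (Num.truncn t < lev.+1)%N by rewrite ltnS -(ler_nat R) (le_trans j1).
exists (Ordinal jl); rewrite /qv /=.
have xE : x = - Amax + 2 * Amax * (t / lev%:R).
  by rewrite /t; field; rewrite !gt_eqF.
rewrite {1}xE.
have -> : - Amax + 2 * Amax * (t / lev%:R) -
    (- Amax + 2 * Amax * ((Num.truncn t)%:R / lev%:R)) =
   2 * Amax / lev%:R * (t - (Num.truncn t)%:R) by ring.
rewrite normrM ger0_norm ?divr_ge0 ?(ltW A20)// ler_piMr ?divr_ge0 ?(ltW A20)//.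
by rewrite ger0_norm ?subr_ge0// lerBlDr nat1r ltW.
Qed.

Lemma cell_ex (y : 'M[R]_kappa) : (forall a b, 0 <= y a b <= 1) ->
  exists c : {ffun J -> 'I_mm.+1}, forall p : J, (c p)%:R <= mm%:R * y p.1 p.2 < (c p).+1%:R.
Proof.
move=> y01; have m0 : 0 <= mm%:R :> R by [].
have yb (p : J) : 0 <= mm%:R * y p.1 p.2 <= mm%:R.
  have /andP[a b] := y01 p.1 p.2; by rewrite mulr_ge0//= ler_piMr.
have tb (p : J) : (Num.truncn (mm%:R * y p.1 p.2) < mm.+1)%N.
  have /andP[a b] := yb p; have /andP[c _] := truncn_itv a.
  by rewrite ltnS -(ler_nat R) (le_trans c).
exists [ffun p => Ordinal (tb p)] => p; rewrite ffunE/=.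
by apply: truncn_itv; have /andP[] := yb p.
Qed.

Lemma cfunE cd (y : 'M[R]_kappa) (c : {ffun J -> 'I_mm.+1}) :
  (forall p : J, (c p)%:R <= mm%:R * y p.1 p.2 < (c p).+1%:R) ->
  cfun cd y = \sum_(e : {ffun J -> 'I_DL.+1})
      qv (cd (c, e)) * \prod_(p : J) (mm%:R * y p.1 p.2 - (c p)%:R) ^+ e p.
Proof.
move=> hc; rewrite /cfun (bigD1 c)//= [X in X * _]big1 ?mul1r; last first.
  by move=> p _; rewrite hc.
rewrite [X in _ + X]big1 ?addr0// => c' c'c.
have [p pc] : exists p, c' p != c p.
  apply/existsP; apply: contraNT c'c => /existsPn h.
  by apply/eqP/ffunP => p; apply/eqP; have := h p; rewrite negbK.
rewrite (bigD1 p)//=.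
have -> : ((c' p)%:R <= mm%:R * y p.1 p.2 < (c' p).+1%:R) = false.
  apply/negP => /andP[a1 a2]; have /andP[b1 b2] := hc p.
  move/eqP: pc; apply; apply/val_inj/eqP => /=; rewrite eqn_leq.
  rewrite -ltnS -(ltr_nat R) (le_lt_trans a1 b2)/= -ltnS -(ltr_nat R).
  exact: le_lt_trans b1 a2.
by rewrite !mul0r.
Qed.

(** All networks are approximated on the same cells by polynomials of the same degree, so a weighted
    sum of them is again of this form. The number of networks therefore enters only through the
    bound [U1] on the coefficients and not through the shape of the code. *)
Lemma cover (r : seq nat) (u : nat -> R) (th : nat -> wvec R) :
  (1 <= L)%N -> \sum_(k <- r) `|u k| <= U1 ->
  (forall k, k \in r -> forall (p : J) s, (1 <= s <= nin kappa)%N ->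
     `|th k (iW 1 p.1.+1 p.2.+1 1 s)| <= W1) ->
  (forall k, k \in r -> forall e, e \in idx_w kappa L -> `|th k e| <= B) ->
  exists cd : code, forall y : 'M[R]_kappa, (forall a b, 0 <= y a b <= 1) ->
    `|\sum_(k <- r) u k * net (th k) y L 1 - cfun cd y| <=
      U1 * (L%:R * Lam ^+ L * XX) + (DL.+1 ^ kappa ^ 2)%:R * (2 * Amax / lev%:R).
Proof.
move=> L1 uU HW HB.
have nin1 : (1 <= 1 <= nin kappa)%N by rewrite /= /nin muln_gt0 expn_gt0 k1.
have Er0 : 0 <= L%:R * Lam ^+ L * XX.
  by rewrite mulr_ge0 ?XX_ge0// mulr_ge0// exprn_ge0// (le_trans _ Lam_ge1).
have Hc (c : {ffun J -> 'I_mm.+1}) : exists g, isP DL Amax g /\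
   forall z, (forall p, 0 <= z p <= 1) ->
     `|\sum_(k <- r) u k * net (th k) (pt c z) L 1 - g z| <= U1 * (L%:R * Lam ^+ L * XX).
  have Hk k : exists cg : R * ((J -> R) -> R), k \in r ->
     [/\ `|cg.1| <= C, isP DL (Lam ^+ L * v1) cg.2 &
      forall z, (forall p, 0 <= z p <= 1) ->
       `|net (th k) (pt c z) L 1 - (cg.1 + cg.2 z)| <= L%:R * Lam ^+ L * XX].
    case kr: (k \in r); last by exists (0, fun=> 0).
    have LL : (1 <= L <= L)%N by rewrite L1 leqnn.
    have [c0 [g [h1 h2 h3]]] := net_unitP c (HW k kr) (HB k kr) LL nin1.
    by exists (c0, g) => _; split.
  have [cg Hcg] := choice Hk.
  exists (fun z => \sum_(k <- r) u k * ((cg k).1 + (cg k).2 z)); split.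
    have h (r' : seq nat) : {subset r' <= r} ->
       isP DL ((\sum_(k <- r') `|u k|) * (C + 1))
        (fun z => \sum_(k <- r') u k * ((cg k).1 + (cg k).2 z)).
      elim: r' => [|k r' IH] sub.
        exists [::]; split => //; first by rewrite /l1 !big_nil mul0r.
        by move=> z; rewrite /ev !big_nil.
      have kr : k \in r by apply: sub; rewrite mem_head.
      have [h1 h2 _] := Hcg k kr.
      have a1 : isP DL (C + 1) (fun z => (cg k).1 + (cg k).2 z).
        apply: (@isP_mono _ _ DL _ (C + 1)) => //; apply: isPD.
          by apply: isP_mono (isP_cst J (cg k).1).
        by apply: isP_mono h2.
      have a2 := isPZ (u k) a1.
      have a3 := IH (fun x xr => sub x (ltac:(by rewrite in_cons xr orbT))).
      have [ts [b1 b2 b3]] := isPD a2 a3.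
      exists ts; split => //; first by rewrite big_cons mulrDl.
      by move=> z; rewrite big_cons b3.
    apply: isP_mono (h r (fun x xr => xr)) => //.
    by rewrite ler_wpM2r// addr_ge0// (le_trans _ C1).
  move=> z z01; rewrite -sumrB (le_trans (ler_norm_sum _ _ _))//.
  rewrite (@le_trans _ _ (\sum_(k <- r) `|u k| * (L%:R * Lam ^+ L * XX)))//.
    rewrite big_seq [leRHS]big_seq ler_sum// => k kr.
    by rewrite -mulrBr normrM ler_wpM2l//; have [_ _] := Hcg k kr; apply.
  by rewrite -big_distrl/= ler_wpM2r.
have [g Hg] := choice Hc.
have [cf Hcf] := choice (fun c => isP_coef (Hg c).1).
have Hq (ce : {ffun J -> 'I_mm.+1} * {ffun J -> 'I_DL.+1}) :
    exists j, `|cf ce.1 ce.2 - qv j| <= 2 * Amax / lev%:R.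
  by apply: quantize; exact: (Hcf ce.1).1.
have [qd Hqd] := choice Hq.
exists [ffun ce => qd ce] => y y01.
have [c hc] := cell_ex y01.
rewrite (cfunE _ hc).
pose z (p : J) : R := mm%:R * y p.1 p.2 - (c p)%:R.
have z01 p : 0 <= z p <= 1.
  have /andP[a b] := hc p; rewrite /z subr_ge0 a/= lerBlDr nat1r; exact: ltW.
have mmR : mm%:R != 0 :> R by rewrite pnatr_eq0 -lt0n.
have yE : y = pt c z.
  apply/matrixP => a b; rewrite mxE /z /=; field; exact: mmR.
rewrite {1}yE.
have -> : forall A Z : R, A - Z = (A - g c z) + (g c z - Z) by move=> *; ring.
rewrite (le_trans (ler_normD _ _))// lerD//; first exact: (Hg c).2.
rewrite (Hcf c).2 -sumrB (le_trans (ler_norm_sum _ _ _))//.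
rewrite (@le_trans _ _ (\sum_(e : {ffun J -> 'I_DL.+1}) 2 * Amax / lev%:R))//.
  apply: ler_sum => e _; rewrite ffunE -mulrBl normrM -[leRHS]mulr1 ler_pM//.
    exact: (Hqd (c, e)).
  have h p : 0 <= z p ^+ e p <= 1.
    by have /andP[? ?] := z01 p; rewrite exprn_ge0// exprn_ile1.
  rewrite ger0_norm; first by rewrite prodr_ile1.
  by rewrite prodr_ge0// => p _; have /andP[] := h p.
by rewrite sumr_const card_ffun card_prod !card_ord mulnn [leRHS]mulr_natl.
Qed.

End Cover.

(** * Interpolation by products of thresholds *)

Section Counting.
Variable R : realType.

Lemma near_count_aux (m N : nat) (x : R) : 0 <= x ->
  \sum_(j < N) (`|x * m%:R - (j%:R - 1)| <= 2)%R%:R <= 6 :> R.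
Proof.
move=> x0; have xm : 0 <= x * m%:R by rewrite mulr_ge0.
pose j0 := Num.truncn (x * m%:R); have /andP[j1 j2] := truncn_itv xm.
have -> : \sum_(j < N) (`|x * m%:R - (j%:R - 1)| <= 2)%R%:R =
   (#|[pred j : 'I_N | `|x * m%:R - (j%:R - 1)| <= 2]|)%:R :> R.
  rewrite -sum1_card natr_sum [RHS]big_mkcond/=.
  by apply: eq_bigr => j _; rewrite inE; case: ifP.
rewrite ler_nat -(size_iota j0.-1 6) cardE -(size_map val).
apply: uniq_leq_size.
  by rewrite map_inj_uniq ?enum_uniq//; exact: val_inj.
move=> j /mapP[i]; rewrite mem_enum inE => hi -> /=.
move: hi; rewrite ler_norml => /andP[i1 i2].
have a1 : (j0 <= i.+1)%N.
  by rewrite -(ler_nat R) -natr1; move: j1 i2; rewrite -/j0; clear; lra.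
have a2 : (i < j0 + 4)%N.
  by rewrite -(ltr_nat R) natrD; move: j2 i1; rewrite -/j0 -natr1; clear; lra.
by rewrite -[X in _ \in X]/(iota j0.-1 6) mem_iota; move: (nat_of_ord i) a1 a2; move: j0; clear; lia.
Qed.

End Counting.

(** * Networks as orthant indicators, and the bumps made from them *)

Section Bump.
Variables (R : realType) (kappa L : nat) (p0 : pix kappa).
Local Notation J := (pix kappa).
Local Notation nn := ((nin kappa)%:R : R).
Variables (m : nat) (W A dl1 dl2 t : R).
Hypotheses (m0 : (0 < m)%N) (L2 : (2 <= L)%N) (A0 : 0 < A) (W0 : 0 <= W).
Hypotheses (dl20 : 0 <= dl2) (dl2A : dl2 * (8 * nn) <= A).
Hypotheses (t0 : 0 <= t) (tn : t * (8 * nn) <= 1).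
Definition hh : R := m%:R^-1.
Hypothesis tA : expR (- (A / 8)) <= t.
Hypothesis tW : expR (- (W * hh - ((#|J|)%:R + 1) * dl1)) <= t.

(** The shift by one puts the first threshold at -1/m and the last one, of index m + 2, at 1 + 1/m,
    so that every pixel clears them by the margin [hh]. *)
Definition thr (j : nat) : R := (j%:R - 1) * hh.
(** There are twice as many first-layer units as pixels; the surplus units repeat the test at
    [p0]. *)
Definition pixs (s : nat) : J := nth p0 (enum J) s.-1.
Definition vs (r s : nat) : bool := (1 <= s <= (if r == L then 1 else nin kappa))%N.
Implicit Types (g : {ffun J -> 'I_m.+3}) (th : wvec R) (y : 'M[R]_kappa).

(** At the center of the box, first-layer unit [s] tests whether pixel [pixs s] exceeds its
    threshold, and each later unit is a conjunction: the bias -(nn - 1/2) A separates the case of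
    all nn inputs near 1 from the case where one is near 0. *)
Definition inbox g th := [/\
  forall s (p : J), (1 <= s <= nin kappa)%N ->
    `|th (iW 1 p.1.+1 p.2.+1 1 s) - (if p == pixs s then W else 0)| <= dl1,
  forall s, (1 <= s <= nin kappa)%N -> `|th (iB 1 s) + W * thr (g (pixs s))| <= dl1,
  forall r s1 s, (2 <= r <= L)%N -> (1 <= s1 <= nin kappa)%N -> vs r s ->
    `|th (iW r 1 1 s1 s) - A| <= dl2 &
  forall r s, (2 <= r <= L)%N -> vs r s -> `|th (iB r s) + (nn - 2^-1) * A| <= dl2].

Lemma card_pix : #|J| = (kappa ^ 2)%N.
Proof. by rewrite card_prod card_ord mulnn. Qed.

Lemma kappa_gt0 : (0 < kappa)%N.
Proof. by case: p0 => a _; exact: leq_ltn_trans (ltn_ord a). Qed.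

Lemma nin_gt1 : (1 < nin kappa)%N.
Proof.
have : (0 < kappa ^ 2)%N by rewrite expn_gt0 kappa_gt0.
by rewrite /nin; move: (kappa ^ 2)%N => k; lia.
Qed.

Lemma pixs_surj p : exists2 s, (1 <= s <= nin kappa)%N & pixs s = p.
Proof.
have pe : p \in enum J by rewrite mem_enum.
exists (index p (enum J)).+1; last by rewrite /pixs /= nth_index.
rewrite /= (@leq_trans #|J|)//; first by rewrite cardE index_mem.
by rewrite card_pix /nin leq_pmull.
Qed.

Lemma nn_ge1 : 1 <= nn. Proof. by rewrite ler1n ltnW// nin_gt1. Qed.

Lemma pre1 g th y s : inbox g th -> (forall a b, 0 <= y a b <= 1) ->
  (1 <= s <= nin kappa)%N ->
  `|\sum_(p : J) th (iW 1 p.1.+1 p.2.+1 1 s) * y p.1 p.2 + th (iB 1 s)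
    - W * (y (pixs s).1 (pixs s).2 - thr (g (pixs s)))| <= ((#|J|)%:R + 1) * dl1.
Proof.
move=> [h1 h2 _ _] y01 hs; set q := pixs s.
have d0 : 0 <= dl1 by exact: le_trans (h2 s hs).
have -> : \sum_(p : J) th (iW 1 p.1.+1 p.2.+1 1 s) * y p.1 p.2 + th (iB 1 s)
    - W * (y q.1 q.2 - thr (g q)) =
  \sum_(p : J) (th (iW 1 p.1.+1 p.2.+1 1 s) - (if p == q then W else 0)) * y p.1 p.2
   + (th (iB 1 s) + W * thr (g q)).
  under [in RHS]eq_bigr => p _ do rewrite mulrBl.
  rewrite sumrB.
  have -> : \sum_(p : J) (if p == q then W else 0) * y p.1 p.2 = W * y q.1 q.2.
    by rewrite (bigD1 q)//= eqxx big1 ?addr0// => p /negbTE->; rewrite mul0r.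
  ring.
rewrite (le_trans (ler_normD _ _))// mulrDl mul1r lerD ?h2//.
rewrite (le_trans (ler_norm_sum _ _ _))//.
rewrite (@le_trans _ _ (\sum_(p : J) dl1))//; last by rewrite sumr_const mulr_natl.
apply: ler_sum => p _; rewrite normrM -[leRHS]mulr1 ler_pM ?h1//.
by have /andP[? ?] := y01 p.1 p.2; rewrite ger0_norm.
Qed.

Lemma unit_on g th y s : inbox g th -> (forall a b, 0 <= y a b <= 1) ->
  (1 <= s <= nin kappa)%N -> thr (g (pixs s)) + hh <= y (pixs s).1 (pixs s).2 ->
  1 - t <= net th y 1 s.
Proof.
move=> hb y01 hs hy; have := pre1 hb y01 hs; rewrite net1E.
set z := _ + th _; rewrite ler_norml => /andP[h _].
have h' : W * hh - ((#|J|)%:R + 1) * dl1 <= z.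
  have : W * hh <= W * (y (pixs s).1 (pixs s).2 - thr (g (pixs s))).
    by rewrite ler_wpM2l// lerBrDl.
  by move: h; lra.
rewrite (le_trans _ (sigmoid_ge_exp z))// lerD2l lerN2 (le_trans _ tW)//.
by rewrite ler_expR lerN2.
Qed.

Lemma unit_off g th y s : inbox g th -> (forall a b, 0 <= y a b <= 1) ->
  (1 <= s <= nin kappa)%N -> y (pixs s).1 (pixs s).2 + hh <= thr (g (pixs s)) ->
  net th y 1 s <= t.
Proof.
move=> hb y01 hs hy; have := pre1 hb y01 hs; rewrite net1E.
set z := _ + th _; rewrite ler_norml => /andP[_ h].
have h' : z <= - (W * hh - ((#|J|)%:R + 1) * dl1).
  have : W * (y (pixs s).1 (pixs s).2 - thr (g (pixs s))) <= W * (- hh).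
    by rewrite ler_wpM2l//; lra.
  by move: h; rewrite mulrN; lra.
rewrite (le_trans (sigmoid_le_exp z))// (le_trans _ tW)//.
by rewrite ler_expR.
Qed.

Lemma layer_on (w o : 'I_(nin kappa) -> R) (b : R) :
  (forall s, `|w s - A| <= dl2) -> (forall s, 1 - t <= o s <= 1) ->
  `|b + (nn - 2^-1) * A| <= dl2 -> A / 8 <= \sum_s w s * o s + b.
Proof.
move=> hw ho; rewrite ler_norml => /andP[hb _].
have n1 := nn_ge1.
have dA : dl2 <= A / 8.
  have : dl2 * 8 <= dl2 * (8 * nn) by rewrite ler_wpM2l//; lra.
  by move: dl2A; lra.
have At0 : 0 <= A * t by rewrite mulr_ge0// ltW.
have hs : \sum_(s < nin kappa) (A - dl2 - A * t) <= \sum_s w s * o s.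
  apply: ler_sum => s _; have := hw s; rewrite ler_norml => /andP[w1 _].
  have /andP[q3 q4] := ho s.
  apply: (@le_trans _ _ ((A - dl2) * (1 - t))).
    by have := mulr_ge0 dl20 t0; lra.
  apply: (@le_trans _ _ ((A - dl2) * o s)).
    by rewrite ler_wpM2l//; move: A0 dA; lra.
  rewrite ler_wpM2r//; last lra.
  apply: le_trans q3; have : t <= t * (8 * nn) by rewrite ler_peMr//; lra.
  by move: tn; lra.
rewrite sumr_const card_ord -mulr_natl in hs.
have e1 : nn * dl2 <= A / 8 by move: dl2A; lra.
have e2 : nn * (A * t) <= A / 8.
  have : A * (t * (8 * nn)) <= A * 1 by rewrite ler_wpM2l// ltW.
  by rewrite mulr1; lra.
by move: hs hb e1 e2 dA A0; lra.
Qed.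

Lemma layer_off (w o : 'I_(nin kappa) -> R) (b : R) :
  (forall s, `|w s - A| <= dl2) -> (forall s, 0 <= o s <= 1) -> (exists s, o s <= t) ->
  `|b + (nn - 2^-1) * A| <= dl2 -> \sum_s w s * o s + b <= - (A / 8).
Proof.
move=> hw ho [s1 hs1]; rewrite ler_norml => /andP[_ hb].
have n1 := nn_ge1.
have dA : dl2 <= A / 8.
  have : dl2 * 8 <= dl2 * (8 * nn) by rewrite ler_wpM2l//; lra.
  by move: dl2A; lra.
have hs : \sum_s w s * o s <= \sum_(s < nin kappa) (A + dl2) + ((A + dl2) * t - (A + dl2)).
  rewrite (bigD1 s1)//= [X in _ <= X + _](bigD1 s1)//=.
  have q1 : w s1 * o s1 <= (A + dl2) * t.
    have := hw s1; rewrite ler_norml => /andP[w1 w2]; have /andP[q3 q4] := ho s1.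
    by rewrite ler_pM//; move: dA A0; lra.
  have q2 : \sum_(i < nin kappa | i != s1) w i * o i <= \sum_(i < nin kappa | i != s1) (A + dl2).
    apply: ler_sum => s _; have := hw s; rewrite ler_norml => /andP[w1 w2].
    have /andP[q3 q4] := ho s.
    by rewrite -[leRHS]mulr1 ler_pM//; move: dA A0; lra.
  by move: q1 q2; lra.
rewrite sumr_const card_ord -mulr_natl in hs.
have e1 : nn * dl2 <= A / 8 by move: dl2A; lra.
have e2 : (A + dl2) * t <= A / 4.
  have : (A + dl2) * t <= (2 * A) * t by rewrite ler_wpM2r//; move: dA A0; lra.
  have : A * (t * 8) <= A * 1.
    rewrite ler_wpM2l// ?(ltW A0)// (le_trans _ tn)// ler_wpM2l//; lra.
  by rewrite mulr1; lra.
by move: hs hb e1 e2 dA A0 dl20; lra.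
Qed.

Lemma vs_prev r (s : 'I_(nin kappa)) : (r < L)%N -> vs r s.+1.
Proof. by move=> rL; rewrite /vs (ltn_eqF rL) /= ltn_ord. Qed.

Lemma vs1 s : vs 1 s = (1 <= s <= nin kappa)%N.
Proof. by rewrite /vs; case: eqP => // e; move: L2; rewrite -e. Qed.

Lemma net_on g th y : inbox g th -> (forall a b, 0 <= y a b <= 1) ->
  (forall p, thr (g p) + hh <= y p.1 p.2) ->
  forall r s, (1 <= r <= L)%N -> vs r s -> 1 - t <= net th y r s.
Proof.
move=> hb y01 hy; elim=> [//|[|r] IH] s hr hs.
  by rewrite vs1 in hs; apply: (unit_on hb).
rewrite netSE; have [_ _ b3 b4] := hb.
have h : A / 8 <= \sum_(s1 < nin kappa) th (iW r.+2 1 1 s1.+1 s) * net th y r.+1 s1.+1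
    + th (iB r.+2 s).
  have rL : (r.+1 < L)%N by case/andP: hr.
  apply: layer_on => [s1|s1|]; last exact: b4.
    by apply: b3 => //; rewrite /= ltn_ord.
  rewrite IH ?vs_prev//; first by have /andP[] := net_itv th y r.+1 s1.+1.
  exact: ltnW.
rewrite (le_trans _ (sigmoid_ge_exp _))// lerD2l lerN2 (le_trans _ tA)//.
by rewrite ler_expR lerN2.
Qed.

Lemma net_off g th y p : inbox g th -> (forall a b, 0 <= y a b <= 1) ->
  y p.1 p.2 + hh <= thr (g p) ->
  forall r s, (2 <= r <= L)%N -> vs r s -> net th y r s <= t.
Proof.
move=> hb y01 hy; elim=> [//|[//|r] IH] s hr hs.
rewrite netSE; have [_ _ b3 b4] := hb.
suff h : \sum_(s1 < nin kappa) th (iW r.+2 1 1 s1.+1 s) * net th y r.+1 s1.+1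
    + th (iB r.+2 s) <= - (A / 8).
  by rewrite (le_trans (sigmoid_le_exp _))// (le_trans _ tA)// ler_expR.
apply: layer_off => [s1|s1||]; last exact: b4.
- by apply: b3 => //; rewrite /= ltn_ord.
- exact: net_itv.
case: r IH hr hs => [|r] IH hr hs.
  have [s1 hs1 ps1] := pixs_surj p.
  have s1n : (s1.-1 < nin kappa)%N by case: s1 hs1 {ps1} => // s1 /andP[].
  exists (Ordinal s1n) => /=; rewrite prednK; last by case/andP: hs1.
  by apply: (unit_off hb) => //; rewrite ps1.
have n0 : (0 < nin kappa)%N by rewrite ltnW// nin_gt1.
have rL : (r.+2 < L)%N by case/andP: hr.
by exists (Ordinal n0); apply: IH; [exact: ltnW|exact: vs_prev].
Qed.

(** Other pixels may lie close to their thresholds, where neither network is near 0 or 1. The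
    outputs are still close, because on the units watching those pixels the two networks coincide
    exactly. *)
Lemma net_pair g g' th th' y p : inbox g th -> inbox g' th' ->
  (forall a b, 0 <= y a b <= 1) ->
  (forall e, (forall s, e = iB 1 s -> pixs s != p) -> th e = th' e) ->
  thr (g p) + hh <= y p.1 p.2 -> thr (g' p) + hh <= y p.1 p.2 ->
  forall r s, (1 <= r <= L)%N -> vs r s ->
  `|net th y r s - net th' y r s| <= (2 * nn * A) ^+ r.-1 * t.
Proof.
move=> hb hb' y01 ag hy hy'; elim=> [//|[|r] IH] s hr hs.
  rewrite vs1 in hs; rewrite expr0 mul1r.
  case: (eqVneq (pixs s) p) => [sp|sp].
    have a1 : 1 - t <= net th y 1 s by apply: (unit_on hb) => //; rewrite sp.
    have a2 : 1 - t <= net th' y 1 s by apply: (unit_on hb') => //; rewrite sp.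
    have := net_itv th y 1 s; have := net_itv th' y 1 s.
    by move: a1 a2; rewrite ler_norml; lra.
  have -> : net th y 1 s = net th' y 1 s.
    have e1 : th (iB 1 s) = th' (iB 1 s) by apply: ag => s' [<-].
    have e2 : \sum_(q : J) th (iW 1 q.1.+1 q.2.+1 1 s) * y q.1 q.2 =
              \sum_(q : J) th' (iW 1 q.1.+1 q.2.+1 1 s) * y q.1 q.2.
      by apply: eq_bigr => q _; congr (_ * _); apply: ag.
    by rewrite (net1E th) (net1E th') e1 e2.
  by rewrite subrr normr0.
rewrite !netSE (le_trans (sigmoid_lip _ _))//.
have -> : th (iB r.+2 s) = th' (iB r.+2 s) by apply: ag.
have -> : forall a b c : R, a + c - (b + c) = a - b by move=> *; ring.
rewrite -sumrB (le_trans (ler_norm_sum _ _ _))//.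
have [_ _ b3 _] := hb'.
have n1 := nn_ge1.
have dA : dl2 <= A.
  have : dl2 * 8 <= dl2 * (8 * nn) by rewrite ler_wpM2l//; lra.
  by move: dl2A dl20; lra.
rewrite (@le_trans _ _ (\sum_(s1 < nin kappa) (2 * A) * ((2 * nn * A) ^+ r * t)))//; last first.
  rewrite sumr_const card_ord -mulr_natl exprS le_eqVlt; apply/orP; left; apply/eqP.
  by rewrite /=; ring.
have rL : (r.+1 < L)%N by case/andP: hr.
apply: ler_sum => s1 _; rewrite ag// -mulrBr normrM ler_pM//; last first.
  by rewrite IH ?vs_prev//= ltnW.
have : `|th' (iW r.+2 1 1 s1.+1 s) - A| <= dl2 by apply: b3 => //; rewrite /= ltn_ord.
by rewrite !ler_norml; move: dA A0; lra.
Qed.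

(** One point in the box of each corner. [THag] couples the points: changing a corner in one pixel
    changes only the biases of the units watching that pixel, as [net_pair] demands. *)
Variable TH : {ffun J -> 'I_m.+3} -> wvec R.
Hypothesis THbox : forall g, inbox g (TH g).
Hypothesis THag : forall g g' e,
  (forall s, e = iB 1 s -> g (pixs s) = g' (pixs s)) -> TH g e = TH g' e.

Definition ga (a : {ffun J -> 'I_m.+2}) (e : {ffun J -> bool}) : {ffun J -> 'I_m.+3} :=
  [ffun p => inord (a p + e p)].
Definition sg (e : {ffun J -> bool}) : R := \prod_(p : J) (-1) ^+ e p.
(** The grid starts at -1/m, outside the cube on which [f] is controlled. The same truncation later
    brings the estimate into [0,1]. *)
Definition clip (x : R) : R := Num.max 0 (Num.min 1 x).
Definition node (a : {ffun J -> 'I_m.+2}) : 'M[R]_kappa :=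
  \matrix_(i, j) clip (thr (a (i, j))).

Lemma gaE a e p : ga a e p = (a p + e p)%N :> nat.
Proof.
rewrite ffunE inordK// ltnS.
have h : (a p <= m.+1)%N by rewrite -ltnS ltn_ord.
by apply: leq_trans (leq_add h (leq_b1 (e p))) _; rewrite addn1.
Qed.

Lemma sg_norm e : `|sg e| = 1.
Proof. by rewrite normr_prod big1// => p _; rewrite normrX normrN1 expr1n. Qed.

Lemma clip_itv x : 0 <= clip x <= 1.
Proof. by rewrite /clip le_max lexx ge_max ler01 ge_min lexx. Qed.

Lemma clip_dist x (y : R) : 0 <= y <= 1 -> `|clip x - y| <= `|x - y|.
Proof.
move=> /andP[y0 y1]; rewrite /clip /Num.max /Num.min.
case: (ltP 1 x) => h1; case: ltP => h2.
- rewrite !ger0_norm; lra.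
- lra.
- by [].
- rewrite ler0_norm ?sub0r ?oppr_le0// ler0_norm; lra.
Qed.

Lemma thrS (j : nat) : thr j.+1 = thr j + hh.
Proof. by rewrite /thr -natr1; ring. Qed.

Lemma hh_gt0 : 0 < hh. Proof. by rewrite invr_gt0 ltr0n. Qed.

Lemma thr_le (i j : nat) : (i <= j)%N -> thr i <= thr j.
Proof. by move=> ij; rewrite ler_wpM2r ?(ltW hh_gt0)// lerB// ler_nat. Qed.

Section FixedPatch.
Variable y : 'M[R]_kappa.
Hypothesis y01 : forall a b, 0 <= y a b <= 1.
Definition psi g : R := net (TH g) y L 1.
Definition t2 : R := (2 * nn * A) ^+ L.-1 * t + t.

Lemma vsL : vs L 1. Proof. by rewrite /vs eqxx. Qed.

Lemma LL1 : (1 <= L <= L)%N. Proof. by rewrite leqnn andbT ltnW. Qed.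

Lemma psi_norm g : `|psi g| <= 1. Proof. exact: net_norm. Qed.

(** Inclusion-exclusion over the vertices of a grid cell: with exact orthant indicators this would
    be the indicator of the cell with lower corner [a]. *)
Definition bump (a : {ffun J -> 'I_m.+2}) : R := \sum_e sg e * psi (ga a e).

Lemma bump_le a : `|bump a| <= 2 ^+ #|J|.
Proof.
rewrite (le_trans (ler_norm_sum _ _ _))//.
rewrite (@le_trans _ _ (\sum_(e : {ffun J -> bool}) 1))//.
  by apply: ler_sum => e _; rewrite normrM sg_norm mul1r psi_norm.
by rewrite sumr_const card_ffun card_bool -natrX.
Qed.

Definition flip (p : J) (e : {ffun J -> bool}) : {ffun J -> bool} :=
  [ffun q => (q == p) (+) e q].

Lemma flipK p : involutive (flip p).
Proof. by move=> e; apply/ffunP => q; rewrite !ffunE addbA addbb. Qed.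

Lemma sg_flip p e : sg (flip p e) = - sg e.
Proof.
rewrite /sg (bigD1 p)//= [in RHS](bigD1 p)//= ffunE eqxx.
have -> : \prod_(i | i != p) (-1) ^+ flip p e i = \prod_(i | i != p) (-1 : R) ^+ e i.
  by apply: eq_bigr => q /negbTE qp; rewrite ffunE qp.
by rewrite -mulNr; congr (_ * _); case: (e p); rewrite /= ?expr0 ?expr1 ?opprK.
Qed.

Lemma t2_ge0 : 0 <= t2.
Proof.
rewrite addr_ge0// mulr_ge0// exprn_ge0// mulr_ge0 ?(ltW A0)// mulr_ge0//.
Qed.

(** Far above, the pixel clears both thresholds of the cell, and the terms [e] and [flip p e], of
    opposite sign, nearly cancel. Far below, every network is off. Of the margin 2 * hh, one [hh] is
    the cell and the other the margin of the networks. *)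
Lemma bump_far (a : {ffun J -> 'I_m.+2}) (p : J) : 2 * hh < `|y p.1 p.2 - thr (a p)| -> `|bump a| <= 2 ^+ #|J| * t2.
Proof.
move=> far; have h0 := hh_gt0.
have T2 := t2_ge0.
have tail (c : R) (F : {ffun J -> bool} -> R) : (forall e, `|F e| <= c) ->
    `|\sum_e F e| <= 2 ^+ #|J| * c.
  move=> H; rewrite (le_trans (ler_norm_sum _ _ _))//.
  rewrite (@le_trans _ _ (\sum_(e : {ffun J -> bool}) c))//; first exact: ler_sum.
  by rewrite sumr_const card_ffun card_bool -natrX mulr_natl.
case: (leP 0 (y p.1 p.2 - thr (a p))) far => s0 far.
  rewrite ger0_norm// in far.
  have on (b : bool) : thr (a p + b)%N + hh <= y p.1 p.2.
    apply: (@le_trans _ _ (thr (a p).+1 + hh)).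
      by rewrite lerD2r; apply: thr_le; case: b; rewrite ?addn1 ?addn0.
    by rewrite thrS; move: far; lra.
  have e1 : bump a = 2^-1 * \sum_e sg e * (psi (ga a e) - psi (ga a (flip p e))).
    under eq_bigr => e _ do rewrite mulrBr.
    rewrite sumrB.
    have -> : \sum_e sg e * psi (ga a (flip p e)) = - bump a.
      rewrite /bump (reindex_inj (can_inj (flipK p)))/= -sumrN.
      by apply: eq_bigr => e _; rewrite sg_flip flipK mulNr.
    rewrite -/(bump a); lra.
  rewrite e1 normrM ger0_norm ?invr_ge0//.
  apply: (@le_trans _ _ (1 * `|\sum_e sg e * (psi (ga a e) - psi (ga a (flip p e)))|)).
    by rewrite ler_wpM2r// invf_le1// ler1n.
  rewrite mul1r; apply: tail => e; rewrite normrM sg_norm mul1r.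
  apply: (@le_trans _ _ ((2 * nn * A) ^+ L.-1 * t)); last by rewrite lerDl.
  apply: (net_pair (p := p) (THbox _) (THbox _) y01) LL1 vsL => //.
  - move=> e' he'; apply: THag => s' e's'; apply: val_inj; rewrite /= !gaE ffunE.
    by rewrite (negbTE (he' s' e's')).
  - by rewrite gaE on.
  - by rewrite gaE on.
rewrite ltr0_norm// in far.
apply: tail => e; rewrite normrM sg_norm mul1r.
apply: (@le_trans _ _ t); last first.
  rewrite lerDr mulr_ge0// exprn_ge0// mulr_ge0 ?(ltW A0)// mulr_ge0//.
have /andP[n0 _] := net_itv (TH (ga a e)) y L 1.
rewrite ger0_norm//; apply: (net_off (p := p) (THbox _) y01) vsL.
  apply: (@le_trans _ _ (thr (a p))); first by move: far; lra.
  by rewrite gaE; apply: thr_le; rewrite leq_addr.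
by rewrite L2 leqnn.
Qed.

(** The alternating sums telescope in each pixel separately, so only corners with all coordinates
    extreme survive. *)
Lemma sum_bump : \sum_a bump a =
  \sum_g psi g * \prod_(p : J) (((g p : nat) == 0%N)%:R - ((g p : nat) == m.+2)%:R).
Proof.
(* Kronecker symbols make the choice of the corner a sum over all [g], after which the sums over [a]
   and [e] factor over the pixels. *)
pose F (g : {ffun J -> 'I_m.+3}) (p : J) (j : 'I_m.+2) (b : bool) : R :=
  (-1) ^+ b * ((j + b)%N == g p)%:R.
have step a e : sg e * psi (ga a e) = \sum_g psi g * \prod_p F g p (a p) (e p).
  rewrite (bigD1 (ga a e))//= [X in _ + X]big1 ?addr0.
    rewrite /F big_split/= -/(sg e) mulrC; congr (_ * _).
    by rewrite [X in _ * X]big1 ?mulr1// => p _; rewrite gaE eqxx.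
  move=> g ge; have [p pg] : exists p, g p != ga a e p.
    apply/existsP; apply: contraNT ge => /existsPn h.
    by apply/eqP/ffunP => p; apply/eqP; have := h p; rewrite negbK.
  rewrite (bigD1 p)//= {1}/F -gaE.
  have -> : ((ga a e p : nat) == g p) = false.
    by apply/negbTE; apply: contraNneq pg => h; apply/eqP/val_inj.
  by rewrite mulr0 mul0r mulr0.
rewrite /bump.
under eq_bigr => a _ do under eq_bigr => e _ do rewrite step.
under eq_bigr => a _ do rewrite exchange_big/=.
rewrite exchange_big/=; apply: eq_bigr => g _.
under eq_bigr => a _ do rewrite -big_distrr/= -(bigA_distr_bigA (fun p b => F g p (a p) b)).
rewrite -big_distrr/= -(bigA_distr_bigA (fun p j => \sum_b F g p j b)); congr (_ * _).
apply: eq_bigr => p _.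
have -> : \sum_(j < m.+2) \sum_b F g p j b =
   \sum_(j < m.+2) (((j : nat) == g p)%:R - ((j.+1 : nat) == g p)%:R).
  apply: eq_bigr => j _; rewrite big_bool /F /= expr1 expr0 mul1r mulN1r addn0 addn1.
  by rewrite addrC.
rewrite sumrB.
have e1 : \sum_(j < m.+2) ((j : nat) == g p)%:R = (g p < m.+2)%:R :> R.
  case: ltnP => gp.
    rewrite (bigD1 (Ordinal gp))//= eqxx big1 ?addr0// => j jg.
    by rewrite (_ : (_ == _) = false)//; apply/negbTE; apply: contraNneq jg => h; apply/eqP/val_inj.
  rewrite big1// => j _; rewrite (_ : (_ == _) = false)//.
  by apply/negbTE; rewrite neq_ltn (leq_trans (ltn_ord j) gp).
have e2 : \sum_(j < m.+2) ((j.+1 : nat) == g p)%:R = (0 < g p)%:R :> R.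
  case: ltnP => gp.
    have gp' : ((g p).-1 < m.+2)%N by have := ltn_ord (g p); case: (g p : nat) gp.
    rewrite (bigD1 (Ordinal gp'))//= prednK// eqxx big1 ?addr0// => j jg.
    rewrite (_ : (_ == _) = false)//; apply/negbTE; apply: contraNneq jg => h.
    by apply/eqP/val_inj => /=; rewrite -h.
  by rewrite big1// => j _; move: gp; rewrite leqn0 => /eqP->.
rewrite e1 e2; have := ltn_ord (g p); move: (nat_of_ord (g p)) => x hx.
case: (ltngtP x m.+2) hx => [h|h|->] hx; last by rewrite /= ?ltnn ?eqxx.
  by case: x {h hx} => [|x]; rewrite /= ?subr0// subrr.
by rewrite ltnS leqNgt h in hx.
Qed.

(** The corner 0 lies below every patch and contributes almost 1; each other surviving corner has a
    threshold above 1 in some pixel, so its network is off. *)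
Lemma sum_bump1 : `|\sum_a bump a - 1| <= (2 ^+ #|J| + 1) * t.
Proof.
have h0 := hh_gt0.
rewrite sum_bump (bigD1 [ffun=> ord0])//= [X in psi _ * X]big1; last first.
  by move=> p _; rewrite ffunE /= subr0.
rewrite mulr1 addrAC.
have on : `|psi [ffun=> ord0] - 1| <= t.
  have a1 : 1 - t <= psi [ffun=> ord0].
    apply: (net_on (THbox _) y01) LL1 vsL => p; rewrite ffunE /thr /=.
    by have := y01 p.1 p.2; lra.
  by have := net_itv (TH [ffun=> ord0]) y L 1; move: a1; rewrite -/(psi _) ler_norml; lra.
rewrite (le_trans (ler_normD _ _))// mulrDl mul1r [leRHS]addrC lerD//.
pose H (g : {ffun J -> 'I_m.+3}) (p : J) : R := ((g p : nat) == 0%N)%:R + ((g p : nat) == m.+2)%:R.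
apply: (@le_trans _ _ (\sum_(g : {ffun J -> 'I_m.+3}) t * \prod_p H g p)); last first.
  rewrite -big_distrr/= mulrC ler_wpM2r//.
  rewrite -(bigA_distr_bigA (fun (p : J) (j : 'I_m.+3) =>
     ((j : nat) == 0%N)%:R + ((j : nat) == m.+2)%:R : R)).
  rewrite (eq_bigr (fun=> 2)); first by rewrite prodr_const.
  move=> p _; rewrite big_split/= (bigD1 ord0)//= [X in _ + X + _]big1; last first.
    by move=> j jj; rewrite (_ : (_ == _) = false)//; apply/negbTE; apply: contraNneq jj => h; apply/eqP/val_inj.
  rewrite (bigD1 ord_max)//= eqxx [X in _ + (_ + X)]big1; last first.
    by move=> j jj; rewrite (_ : (_ == _) = false)//; apply/negbTE; apply: contraNneq jj => h; apply/eqP/val_inj.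
  by rewrite !addr0.
have Hge g p : 0 <= H g p by rewrite addr_ge0.
rewrite (le_trans (ler_norm_sum _ _ _))//.
rewrite [leRHS](bigID (fun g => g != [ffun=> ord0]))/= -[leLHS]addr0 lerD//; last first.
  by rewrite sumr_ge0// => g _; rewrite mulr_ge0// prodr_ge0.
apply: ler_sum => g g0; rewrite normrM normr_prod.
have Hle p : `|((g p : nat) == 0%N)%:R - ((g p : nat) == m.+2)%:R| <= H g p.
  by rewrite (le_trans (ler_normB _ _))// /H !ger0_norm.
have [top|ntop] := boolP [exists p, (g p : nat) == m.+2].
  have [p /eqP pt] := existsP top.
  rewrite ler_pM// ?prodr_ge0//; last by rewrite ler_prod// => q _; rewrite normr_ge0 Hle.
  have /andP[n0 _] := net_itv (TH g) y L 1.
  rewrite ger0_norm//; apply: (net_off (p := p) (THbox _) y01) vsL; last by rewrite L2 leqnn.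
  rewrite pt /thr -natr1.
  have : m%:R * hh = 1 :> R by rewrite /hh mulfV// pnatr_eq0 -lt0n.
  by have := y01 p.1 p.2; rewrite -natr1; move=> ? ?; nra.
have [p pg] : exists p, g p != ord0.
  apply/existsP; apply: contraNT g0 => /existsPn h.
  by apply/eqP/ffunP => p; apply/eqP; have := h p; rewrite negbK ffunE.
move/existsPn: ntop => /(_ p) ntop.
rewrite (bigD1 p)//= (negbTE ntop) (_ : (_ == 0%N) = false); last first.
  by apply/negbTE; apply: contraNneq pg => h; apply/eqP/val_inj.
by rewrite subr0 normr0 mul0r mulr0 mulr_ge0// prodr_ge0.
Qed.

Lemma near_count p : \sum_(j < m.+2) (`|y p.1 p.2 - thr j| <= 2 * hh)%R%:R <= 6 :> R.
Proof.
have /andP[y0 _] := y01 p.1 p.2.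
rewrite (le_trans _ (near_count_aux m m.+2 y0))//; apply: ler_sum => j _.
rewrite ler_nat; case: (boolP (_ <= 2 * hh)) => // hi; rewrite lt0b.
have mR : 0 < m%:R :> R by rewrite ltr0n.
have mm : hh * m%:R = 1 by rewrite /hh mulVf// gt_eqF.
have -> : y p.1 p.2 * m%:R - (j%:R - 1) = (y p.1 p.2 - thr j) * m%:R.
  by rewrite /thr mulrBl -[_ * hh * _]mulrA mm mulr1.
rewrite normrM (ger0_norm (ltW mR)).
by have := ler_wpM2r (ltW mR) hi; rewrite -[2 * hh * _]mulrA mm mulr1.
Qed.

Variables (f : 'M[R]_kappa -> R) (pp Cf Fm : R).
Hypotheses (pp0 : 0 <= pp) (Cf0 : 0 <= Cf) (fs : smooth_patch pp Cf f).
Hypothesis fF : forall u : 'M[R]_kappa, (forall a b, 0 <= u a b <= 1) -> `|f u| <= Fm.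
Definition HH : R := Cf * (2 * kappa%:R * hh) `^ pp.

Lemma node_itv a i j : 0 <= node a i j <= 1.
Proof. by rewrite mxE clip_itv. Qed.

Lemma node_near (a : {ffun J -> 'I_m.+2}) : (forall p : J, `|y p.1 p.2 - thr (a p)| <= 2 * hh) ->
  `|f (node a) - f y| <= HH.
Proof.
move=> near; have h0 := hh_gt0.
rewrite (le_trans (fs (node_itv a) y01))// ler_wpM2l//.
have b0 : 0 <= 2 * kappa%:R * hh by rewrite mulr_ge0 ?(ltW h0)// mulr_ge0.
apply: ge0_ler_powR => //; rewrite ?nnegrE ?sqrtr_ge0//.
rewrite -[leRHS]ger0_norm// -sqrtr_sqr ler_wsqrtr//.
rewrite pair_big/=.
rewrite (@le_trans _ _ (\sum_(p : J) (2 * hh) ^+ 2))//.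
  apply: ler_sum => p _; rewrite -[leLHS]real_normK ?num_real//.
  rewrite lerXn2r ?nnegrE ?mulr_ge0 ?(ltW h0)//.
  rewrite mxE (le_trans (clip_dist _ (y01 _ _)))// distrC.
  by have := near p; case: p.
rewrite sumr_const card_pix -[leLHS]mulr_natl natrX le_eqVlt; apply/orP; left; apply/eqP.
by ring.
Qed.

(* Away from the cell of [y] every bump cancels, and the bumps sum to 1, so
   that the sum is a convex-like combination of nearby values of [f]. *)
Theorem bump_approx :
  `|\sum_a \sum_e f (node a) * sg e * psi (ga a e) - f y| <=
    12 ^+ #|J| * HH + (2 * m.+2%:R) ^+ #|J| * (2 * Fm) * t2 + Fm * ((2 ^+ #|J| + 1) * t).
Proof.
have h0 := hh_gt0; have T2 := t2_ge0.
have F0 : 0 <= Fm by exact: le_trans (fF y01).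
have H0 : 0 <= HH by rewrite mulr_ge0// powR_ge0.
have e1 : \sum_a \sum_e f (node a) * sg e * psi (ga a e) - f y =
  \sum_a (f (node a) - f y) * bump a + f y * (\sum_a bump a - 1).
  under [in RHS]eq_bigr => a _ do rewrite mulrBl.
  rewrite sumrB -big_distrr/= mulrBr mulr1.
  have -> : \sum_a \sum_e f (node a) * sg e * psi (ga a e) = \sum_a f (node a) * bump a.
    apply: eq_bigr => a _; rewrite /bump big_distrr/=.
    by apply: eq_bigr => e _; rewrite mulrA.
  ring.
rewrite e1 (le_trans (ler_normD _ _))// lerD//; last first.
  by rewrite normrM ler_pM ?fF// sum_bump1.
pose near (a : {ffun J -> 'I_m.+2}) : R :=
  \prod_(p : J) (`|y p.1 p.2 - thr (a p)| <= 2 * hh)%R%:R.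
have near0 a : 0 <= near a by rewrite prodr_ge0.
rewrite (le_trans (ler_norm_sum _ _ _))//.
apply: (@le_trans _ _ (\sum_a (near a * (2 ^+ #|J| * HH) + 2 ^+ #|J| * (2 * Fm) * t2))).
  apply: ler_sum => a _; rewrite normrM.
  have p20 : 0 <= 2 ^+ #|J| :> R by rewrite exprn_ge0.
  have [nr|fr] := pselect (forall p : J, `|y p.1 p.2 - thr (a p)| <= 2 * hh).
    rewrite /near big1 ?mul1r; last by move=> p _; rewrite nr.
    rewrite -[leLHS]addr0 lerD//; last by rewrite mulr_ge0// mulr_ge0// mulr_ge0.
    by rewrite mulrC ler_pM ?bump_le ?node_near.
  have [p fp] : exists p : J, 2 * hh < `|y p.1 p.2 - thr (a p)|.
    by apply: contra_notP fr => nf p; rewrite leNgt; apply/negP => ?; apply: nf; exists p.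
  rewrite -[leLHS]add0r lerD//; first by rewrite mulr_ge0// mulr_ge0.
  have -> : 2 ^+ #|J| * (2 * Fm) * t2 = (2 * Fm) * (2 ^+ #|J| * t2) by ring.
  rewrite ler_pM ?(bump_far fp)// (le_trans (ler_normB _ _))//.
  by have := fF (node_itv a); have := fF y01; lra.
rewrite big_split/= lerD//.
  rewrite -big_distrl/= /near.
  rewrite -(bigA_distr_bigA (fun (p : J) (j : 'I_m.+2) =>
      (`|y p.1 p.2 - thr j| <= 2 * hh)%R%:R : R)).
  (* At most 6 near indices per pixel, times the bound 2 per pixel on a bump. *)
  have -> : 12 = 6 * 2 :> R by ring.
  have q0 : 0 <= 2 ^+ #|J| * HH by rewrite mulr_ge0// exprn_ge0.
  rewrite exprMn -[leRHS]mulrA ler_wpM2r//.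
  rewrite -prodr_const ler_prod// => p _; rewrite near_count andbT.
  by rewrite sumr_ge0.
rewrite sumr_const card_ffun card_ord -[leLHS]mulr_natl natrX exprMn.
by rewrite le_eqVlt; apply/orP; left; apply/eqP; ring.
Qed.

End FixedPatch.
End Bump.

(** * Averages over the initial weights *)

Section NonMeasurable.
Local Open Scope ereal_scope.

(* The integral of a nonnegative function is a supremum over simple functions
   below it, hence monotone even without measurability. *)
Lemma ge0_le_integral_nomeas (d : measure_display) (T : measurableType d) (R : realType)
    (mu : {measure set T -> \bar R}) (D : set T) (f g : T -> \bar R) :
  (forall x, D x -> 0 <= f x) -> (forall x, D x -> f x <= g x) ->
  \int[mu]_(x in D) f x <= \int[mu]_(x in D) g x.
Proof.
move=> f0 fg; rewrite !ge0_integralE//; last first.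
  by move=> x Dx; exact: le_trans (f0 x Dx) (fg x Dx).
apply: le_ereal_sup => _ [h hf <-]; exists h => // x.
apply: le_trans (hf x) _; rewrite /patch; case: ifPn => // xD.
by apply: fg; rewrite inE in xD.
Qed.

End NonMeasurable.

(** * Uniform initial weights against uniform digits *)

Section InitAverage.
Variable R : realType.
Implicit Types (a : R) (w : wvec R).

Lemma avg_cst (n : nat) (c : R) : (0 < n)%N -> n%:R^-1 * \sum_(j < n) c = c.
Proof.
move=> n0; rewrite sumr_const card_ord -[X in _ * X]mulr_natl mulKf//.
by rewrite pnatr_eq0 -lt0n.
Qed.

Definition gv a (m j : nat) : R := - a + 2 * a * (j%:R / m%:R).

Lemma gv_mono a m i j : 0 <= a -> (i <= j)%N -> gv a m i <= gv a m j.
Proof.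
by move=> a0 ij; rewrite lerD2l ler_wpM2l ?mulr_ge0// ler_wpM2r ?invr_ge0// ler_nat.
Qed.

Lemma gvS a m j : gv a m j.+1 = gv a m j + 2 * a / m%:R.
Proof. by rewrite /gv -natr1; ring. Qed.

Lemma gv_cell a m (v : R) : 0 < a -> (0 < m)%N -> - a <= v <= a ->
  exists2 j, (j < m)%N & gv a m j <= v <= gv a m j.+1.
Proof.
move=> a0 m0 /andP[v1 v2]; have mR : 0 < m%:R :> R by rewrite ltr0n.
pose t := (v + a) * m%:R / (2 * a).
have a20 : 0 < 2 * a by rewrite mulr_gt0.
have t0 : 0 <= t by rewrite divr_ge0 ?(ltW a20)// mulr_ge0//; lra.
have tm : t <= m%:R by rewrite ler_pdivrMr// mulrC ler_wpM2l//; lra.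
have vE : v = - a + 2 * a * (t / m%:R) by rewrite /t; field; rewrite !gt_eqF.
have /andP[j1 j2] := truncn_itv t0.
have cell j : j%:R <= t -> t <= j.+1%:R -> gv a m j <= v <= gv a m j.+1.
  move=> h1 h2; rewrite vE /gv !lerD2l !ler_wpM2l ?(ltW a20)//.
    by rewrite ler_wpM2r ?invr_ge0.
  by rewrite ler_wpM2r ?invr_ge0.
case: (ltnP (Num.truncn t) m) => jm.
  by exists (Num.truncn t) => //; apply: cell => //; exact: ltW.
have tE : t = m%:R by apply/eqP; rewrite eq_le tm (le_trans _ j1)// ler_nat.
exists m.-1; first by rewrite prednK.
by apply: cell; rewrite tE ?prednK// ler_nat leq_pred.
Qed.

Lemma unif_exp_ge0 a (h : R -> \bar R) : (forall v, (- a <= v <= a)%R -> 0 <= h v)%E ->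
  (0 <= h 0%R)%E -> (0 <= unif_exp a h)%E.
Proof.
move=> h0 h00; rewrite /unif_exp; case: ifP => // a0.
rewrite mule_ge0 ?lee_fin ?invr_ge0 ?mulr_ge0 ?(ltW a0)//.
by apply: integral_ge0 => v; rewrite /sym_itv /= in_itv/=; exact: h0.
Qed.

Lemma unif_exp_le a (m : nat) (h : R -> \bar R) (X : nat -> R) :
  0 < a -> (0 < m)%N -> (forall v, (- a <= v <= a)%R -> 0 <= h v)%E ->
  (forall j, 0 <= X j) ->
  (forall v j, (j < m)%N -> - a <= v <= a -> gv a m j <= v <= gv a m j.+1 ->
     (h v <= (X j)%:E)%E) ->
  (unif_exp a h <= (m%:R^-1 * \sum_(j < m) X j)%:E)%E.
Proof.
move=> a0 m0 h0 X0 hX; rewrite /unif_exp a0.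
have mR : 0 < m%:R :> R by rewrite ltr0n.
pose Aj (j : 'I_m) : set R := `[gv a m j, gv a m j.+1].
have mAj j : measurable (Aj j) by exact: measurable_itv.
have mD : measurable (sym_itv a) by exact: measurable_itv.
(* The closed cells share endpoints; as the terms are nonnegative, their sum still majorizes [h]. *)
have le1 : (\int[lebesgue_measure]_(v in sym_itv a) h v <=
    \int[lebesgue_measure]_(v in sym_itv a)
      (\sum_(j <- index_enum 'I_m) (X j * \1_(Aj j) v)%:E))%E.
  apply: ge0_le_integral_nomeas => v; rewrite /sym_itv/= in_itv/= => va; first exact: h0.
  have [j jm jv] := gv_cell a0 m0 va.
  apply: (le_trans (hX v j jm va jv)).
  rewrite sumEFin lee_fin (bigD1 (Ordinal jm))//= indicE mem_set ?mulr1; last first.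
    by rewrite /Aj/= in_itv.
  by rewrite lerDl sumr_ge0// => i _; rewrite mulr_ge0.
have le2 : (\int[lebesgue_measure]_(v in sym_itv a)
      (\sum_(j <- index_enum 'I_m) (X j * \1_(Aj j) v)%:E) <=
    (\sum_(j < m) X j * (2 * a / m%:R))%:E)%E.
  rewrite ge0_integral_sum//; last 2 first.
  - move=> j; apply/measurable_EFinP/measurable_funM => //.
    by apply: measurable_indic; exact: measurable_itv.
  - by move=> j v _; rewrite lee_fin mulr_ge0.
  rewrite -sumEFin; apply: lee_sum => j _.
  under eq_integral do rewrite EFinM.
  have mI : measurable_fun (sym_itv a) (fun v : R => (\1_(Aj j) v : R)%:E).
    by apply/measurable_EFinP; apply: measurable_indic; exact: measurable_itv.
  have I0 v : sym_itv a v -> (0 <= (\1_(Aj j) v : R)%:E)%E by rewrite lee_fin.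
  have X0j : (0 <= (X j)%:E)%E by rewrite lee_fin.
  apply: (@le_trans _ _ ((X j)%:E * \int[lebesgue_measure]_(v in sym_itv a) (\1_(Aj j) v : R)%:E)%E).
    rewrite le_eqVlt; apply/orP; left; apply/eqP.
    exact: (ge0_integralZl lebesgue_measure mD mI I0 X0j).
  have iE : (\int[lebesgue_measure]_(v in sym_itv a) (\1_(Aj j) v : R)%:E =
     lebesgue_measure (Aj j `&` sym_itv a))%E.
    exact: (integral_indic lebesgue_measure mD (mAj j)).
  rewrite iE [X in (_ <= X)%E](EFinM (X j)).
  apply: (lee_wpmul2l X0j).
  apply: (@le_trans _ _ (lebesgue_measure (Aj j))).
    apply: le_measure; rewrite ?inE; [|exact: mAj|exact: subIsetl].
    by apply: measurableI; [exact: mAj|exact: mD].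
  rewrite lebesgue_measure_itv/= lte_fin; case: ifP => _; last first.
    by rewrite lee_fin divr_ge0 ?mulr_ge0 ?(ltW a0).
  by rewrite -EFinD lee_fin gvS addrAC subrr add0r.
have c0 : (0 <= ((2 * a)^-1)%:E)%E by rewrite lee_fin invr_ge0 mulr_ge0// ltW.
apply: (le_trans (lee_wpmul2l c0 (le_trans le1 le2))).
rewrite -EFinM lee_fin -big_distrl/= le_eqVlt; apply/orP; left; apply/eqP.
by field; rewrite !gt_eqF.
Qed.

Lemma init_exp_ge0 l (G : wvec R -> \bar R) w : (forall w, 0 <= G w)%E ->
  (0 <= init_exp l G w)%E.
Proof.
move=> G0; elim: l w => [|[i a] l IH] w //=.
by apply: unif_exp_ge0.
Qed.

Definition updN (D : seq nat -> nat) (i : seq nat) (v : nat) : seq nat -> nat :=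
  fun j => if j == i then v else D j.

Implicit Types (H : (seq nat -> nat) -> R) (D : seq nat -> nat) (Q : seq nat -> nat).

(* Expectation over independent digits, the digit [D i] being uniform on
   [0, Q i) for [i] in [ks]. *)
Fixpoint favq (ks : seq (seq nat)) Q H D : R :=
  match ks with
  | [::] => H D
  | i :: ks' => (Q i)%:R^-1 * \sum_(j < Q i) favq ks' Q H (updN D i j)
  end.

(** It suffices to compare [G] and [H] when each weight lies within one grid step of the point of
    its digit; keys outside the list keep their starting values on both sides. *)
Lemma init_exp_le (m : nat) l (G : wvec R -> \bar R) H w D : (0 < m)%N ->
  (forall ia, ia \in l -> 0 < ia.2) -> (forall w, 0 <= G w)%E -> (forall D, 0 <= H D) ->
  (forall w' D', (forall i,
      (exists a, [/\ (i, a) \in l, `|w' i| <= a, (D' i < m)%N &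
          `|w' i - gv a m (D' i)| <= 2 * a / m%:R]) \/
      [/\ i \notin map fst l, w' i = w i & D' i = D i]) -> (G w' <= (H D')%:E)%E) ->
  (init_exp l G w <= (favq (map fst l) (fun=> m) H D)%:E)%E.
Proof.
move=> m0 la G0 H0; elim: l w D la => [|[i a] l IH] w D la HG /=.
  by apply: HG => i; right.
have a0 : 0 < a by have := la (i, a); rewrite mem_head; exact.
have fge0 ks D' : 0 <= favq ks (fun=> m) H D'.
  elim: ks D' => [|k ks IHk] D' //=.
  by rewrite mulr_ge0 ?invr_ge0// sumr_ge0.
apply: (@unif_exp_le a m _ (fun j => favq (map fst l) (fun=> m) H (updN D i j))) => //.
  by move=> v _; exact: init_exp_ge0.
move=> v j jm va /andP[jv1 jv2]; apply: IH => [ia ial|w' D' HD].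
  by apply: la; rewrite in_cons ial orbT.
apply: HG => k; case: (HD k) => [[b [bl b1 b2 b3]]|[nk e1 e2]].
  by left; exists b; split => //; rewrite in_cons bl orbT.
move: e1 e2; rewrite /upd /updN; case: eqP => [-> e1 e2|/eqP ki -> ->]; last first.
  by right; rewrite in_cons negb_or ki.
left; exists a; rewrite mem_head e1 e2; split => //; first by rewrite ler_norml.
by rewrite ger0_norm ?subr_ge0// lerBlDl -gvS.
Qed.

Lemma favq_le ks Q H H' D :
  (forall D', (forall i, (i \in ks) && (D' i < Q i)%N \/ D' i = D i) -> H D' <= H' D') ->
  favq ks Q H D <= favq ks Q H' D.
Proof.
elim: ks D => [|i ks IH] D HH /=; first by apply: HH => i; right.
rewrite ler_wpM2l ?invr_ge0// ler_sum// => j _; apply: IH => D' HD; apply: HH => k.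
case: (HD k) => [/andP[k1 k2]|]; first by left; rewrite in_cons k1 orbT.
rewrite /updN; case: eqP => [-> ->|_ ->]; last by right.
by left; rewrite mem_head ltn_ord.
Qed.

Lemma favq_eq ks Q H H' D :
  (forall D', (forall i, (i \in ks) && (D' i < Q i)%N \/ D' i = D i) -> H D' = H' D') ->
  favq ks Q H D = favq ks Q H' D.
Proof.
by move=> HH; apply/eqP; rewrite eq_le !favq_le// => D' HD; rewrite HH.
Qed.

Lemma favq_cst ks Q (c : R) D : (forall i, i \in ks -> (0 < Q i)%N) ->
  favq ks Q (fun=> c) D = c.
Proof.
elim: ks D => [//|i ks IH] D HQ /=.
rewrite (eq_bigr (fun=> c)); last first.
  by move=> j _; apply: IH => k kk; apply: HQ; rewrite in_cons kk orbT.
by apply: avg_cst; apply: HQ; rewrite mem_head.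
Qed.

Lemma favqD ks Q H H' D : favq ks Q (fun D => H D + H' D) D = favq ks Q H D + favq ks Q H' D.
Proof.
elim: ks D => [//|i ks IH] D /=; rewrite -mulrDr -big_split/=.
by congr (_ * _); apply: eq_bigr => j _; rewrite IH.
Qed.

Lemma favqZ ks Q (c : R) H D : favq ks Q (fun D => c * H D) D = c * favq ks Q H D.
Proof.
elim: ks D => [//|i ks IH] D /=; rewrite mulrCA; congr (_ * _).
by rewrite big_distrr/=; apply: eq_bigr => j _; rewrite IH.
Qed.

Lemma favq0 ks Q D : favq ks Q (fun=> 0) D = 0.
Proof.
elim: ks D => [//|i ks IH] D /=.
by rewrite big1 ?mulr0.
Qed.

Lemma favq_sum (T : Type) (r : seq T) ks Q (H : T -> (seq nat -> nat) -> R) D :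
  favq ks Q (fun D => \sum_(t <- r) H t D) D = \sum_(t <- r) favq ks Q (H t) D.
Proof.
elim: r => [|t r IH].
  by rewrite big_nil -[RHS](favq0 ks Q D); apply: favq_eq => D' _; rewrite big_nil.
rewrite big_cons -IH -favqD; apply: favq_eq => D' _; by rewrite big_cons.
Qed.

Definition dep (S : pred (seq nat)) H :=
  forall D D', (forall i, S i -> D i = D' i) -> H D = H D'.

Lemma favq_dep S ks Q H D D' : dep S H -> (forall i, S i -> D i = D' i) ->
  favq ks Q H D = favq ks Q H D'.
Proof.
move=> HS; elim: ks D D' => [|i ks IH] D D' e /=; first exact: HS.
congr (_ * _); apply: eq_bigr => j _; apply: IH => k kS.
by rewrite /updN; case: eqP => // _; exact: e.
Qed.

(** Each digit is seen by at most one of the factors; the other one is constant in it and leaves the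
    average. *)
Lemma favq_indep (S S' : pred (seq nat)) ks Q A B D :
  (forall i, i \in ks -> (0 < Q i)%N) ->
  dep S A -> dep S' B -> (forall i, S i -> ~~ S' i) ->
  favq ks Q (fun D => A D * B D) D = favq ks Q A D * favq ks Q B D.
Proof.
move=> HQ dA dB dis; elim: ks D HQ => [//|i ks IH] D HQ /=.
have HQ' k : k \in ks -> (0 < Q k)%N by move=> kk; apply: HQ; rewrite in_cons kk orbT.
have Qi : (Q i)%:R != 0 :> R.
  by rewrite pnatr_eq0 -lt0n; apply: HQ; rewrite mem_head.
under eq_bigr => j _ do rewrite (IH _ HQ').
have cst (S0 : pred (seq nat)) H0 : dep S0 H0 -> ~~ S0 i -> forall j,
    favq ks Q H0 (updN D i j) = favq ks Q H0 D.
  move=> d0 ni j; apply: (favq_dep _ _ d0) => k kS; rewrite /updN.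
  by case: eqP => // ki; rewrite ki (negbTE ni) in kS.
case Si: (S i).
  have cB := cst S' B dB (dis i Si).
  rewrite (eq_bigr (fun j : 'I_(Q i) => favq ks Q A (updN D i j) * favq ks Q B D)); last first.
    by move=> j _; rewrite cB.
  rewrite [X in _ = _ * (_ * X)](eq_bigr (fun=> favq ks Q B D)); last by move=> j _; rewrite cB.
  rewrite [X in _ = _ * X]avg_cst; last by apply: HQ; rewrite mem_head.
  by rewrite -big_distrl/= mulrA.
have cA := cst S A dA (negbT Si).
rewrite (eq_bigr (fun j : 'I_(Q i) => favq ks Q A D * favq ks Q B (updN D i j))); last first.
  by move=> j _; rewrite cA.
rewrite [X in _ = _ * X * _](eq_bigr (fun=> favq ks Q A D)); last by move=> j _; rewrite cA.
rewrite [X in _ = X * _]avg_cst; last by apply: HQ; rewrite mem_head.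
by rewrite -big_distrr/= mulrCA.
Qed.

(* Restricting each digit to a window and renormalizing is the same as drawing
   the offset inside the window. *)
Lemma favq_shift (m : nat) ks (b q : seq nat -> nat) H D Om : uniq ks -> (0 < m)%N ->
  (forall i, i \in ks -> (0 < q i)%N && (b i + q i <= m)%N) ->
  (forall i, i \notin ks -> D i = (b i + Om i)%N) ->
  favq ks (fun=> m) (fun D => (\prod_(i <- ks)
     (m%:R / (q i)%:R * (b i <= D i < b i + q i)%N%:R)) * H D) D =
  favq ks q (fun Om => H (fun i => b i + Om i)%N) Om.
Proof.
move=> uk m0; elim: ks uk H D Om => [|i ks IH] uk H D Om hq hD.
  by rewrite /= big_nil mul1r; congr H; apply/funext => i; exact: hD.
have /andP[ik uk'] : (i \notin ks) && uniq ks by [].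
have /andP[qi bi] := hq i (mem_head _ _).
have mR : m%:R != 0 :> R by rewrite pnatr_eq0 -lt0n.
rewrite [LHS]/= [RHS]/=.
pose c : R := m%:R / (q i)%:R.
have st (d : nat) : favq ks (fun=> m) (fun D => (\prod_(k <- i :: ks)
     (m%:R / (q k)%:R * (b k <= D k < b k + q k)%N%:R)) * H D) (updN D i d) =
   c * (b i <= d < b i + q i)%N%:R *
   favq ks (fun=> m) (fun D => (\prod_(k <- ks)
     (m%:R / (q k)%:R * (b k <= D k < b k + q k)%N%:R)) * H D) (updN D i d).
  rewrite -favqZ; apply: favq_eq => D' HD; rewrite big_cons.
  have -> : D' i = d.
    by case: (HD i) => [/andP[ki _]|->]; [rewrite ki in ik|rewrite /updN eqxx].
  by rewrite -!mulrA.
under eq_bigr => d _ do rewrite st.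
have reidx (F : nat -> R) : \sum_(d < m) (b i <= d < b i + q i)%N%:R * F d =
    \sum_(o < q i) F (b i + o)%N.
  transitivity (\sum_(d < m | (b i <= d < b i + q i)%N) F d).
    by rewrite [RHS]big_mkcond/=; apply: eq_bigr => d _; case: ifP => _; rewrite ?mul1r ?mul0r.
  rewrite -(big_mkord (fun d => (b i <= d < b i + q i)%N) F).
  rewrite (big_cat_nat (leq0n (b i))) /=; last exact: leq_trans (leq_addr _ _) bi.
  rewrite big_nat_cond big1 ?add0r; last first.
    by move=> d /andP[/andP[_ d1] /andP[d2 _]]; move: d1; rewrite ltnNge d2.
  rewrite (big_cat_nat (leq_addr (q i) (b i)) bi)/=.
  rewrite [X in _ + X]big_nat_cond [X in _ + X]big1 ?addr0; last first.
    by move=> d /andP[/andP[d1 _] /andP[_ d2]]; move: d2; rewrite ltnNge d1.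
  rewrite big_nat_cond (eq_bigl (fun d => (b i <= d < b i + q i)%N)); last first.
    by move=> d; rewrite andbb.
  rewrite -big_nat -{1}(add0n (b i)) big_addn [(b i + q i)%N]addnC addnK big_mkord.
  by apply: eq_bigr => o _; rewrite addnC.
have -> : \sum_(d < m) (c * (b i <= d < b i + q i)%N%:R *
     favq ks (fun=> m) (fun D => (\prod_(k <- ks)
     (m%:R / (q k)%:R * (b k <= D k < b k + q k)%N%:R)) * H D) (updN D i d)) =
   c * \sum_(o < q i) favq ks q (fun Om => H (fun i => b i + Om i)%N) (updN Om i o).
  under eq_bigr => d _ do rewrite -mulrA.
  rewrite -big_distrr/=.
  rewrite (reidx (fun d => favq ks (fun=> m) (fun D => (\prod_(k <- ks)
     (m%:R / (q k)%:R * (b k <= D k < b k + q k)%N%:R)) * H D) (updN D i d))).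
  congr (_ * _); apply: eq_bigr => o _.
  apply: IH => // [k kk|k kk]; first by apply: hq; rewrite in_cons kk orbT.
  rewrite /updN; case: eqP => [->//|/eqP ki]; apply: hD.
  by rewrite in_cons negb_or ki kk.
by rewrite mulrA /c mulrA mulVf// mul1r.
Qed.

(** The last entry of a key is the number of its network, so [xi k] depends on the digits of network
    [k] only. The summands are then independent, and the variance of the sum is at most the sum of
    the second moments. *)
Lemma favq_var (r : seq nat) ks Q (xi : nat -> (seq nat -> nat) -> R) (mu : nat -> R) D :
  uniq r -> (forall i, i \in ks -> (0 < Q i)%N) ->
  (forall k, k \in r -> dep (fun i => last 0%N i == k) (xi k)) ->
  (forall k, k \in r -> favq ks Q (xi k) D = mu k) ->
  favq ks Q (fun D => (\sum_(k <- r) xi k D - \sum_(k <- r) mu k) ^+ 2) D <=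
    \sum_(k <- r) favq ks Q (fun D => xi k D ^+ 2) D.
Proof.
move=> ur HQ.
elim: r ur => [|k r IH] /= ur dx ex.
  rewrite [leRHS]big_nil -[leRHS](favq0 ks Q D); apply: favq_le => D' _.
  by rewrite !big_nil subrr expr0n.
have /andP[kr ur'] := ur.
pose ze D := xi k D - mu k; pose Z D := \sum_(k <- r) xi k D - \sum_(k <- r) mu k.
have kk : k \in k :: r by rewrite mem_head.
have sub j : j \in r -> j \in k :: r by move=> jr; rewrite in_cons jr orbT.
have dz : dep (fun i => last 0%N i == k) ze.
  by move=> D1 D2 e; rewrite /ze (dx k kk D1 D2 e).
have dZ : dep (fun i => last 0%N i \in r) Z.
  move=> D1 D2 e; rewrite /Z; congr (_ - _); rewrite big_seq [RHS]big_seq.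
  by apply: eq_bigr => j jr; apply: (dx j (sub j jr)) => i /eqP li; apply: e; rewrite li.
have Eze : favq ks Q ze D = 0.
  rewrite (favqD ks Q (xi k) (fun=> - mu k)) favq_cst// ex// subrr//.
have cross : favq ks Q (fun D => ze D * Z D) D = 0.
  rewrite (favq_indep D HQ dz dZ); first by rewrite Eze mul0r.
  by move=> i /eqP->.
have Eze2 : favq ks Q (fun D => ze D ^+ 2) D <= favq ks Q (fun D => xi k D ^+ 2) D.
  have -> : favq ks Q (fun D => ze D ^+ 2) D =
     favq ks Q (fun D => xi k D ^+ 2) D + ((- 2 * mu k) * favq ks Q (xi k) D + mu k ^+ 2).
    rewrite -favqZ -[X in _ + (_ + X)](favq_cst (mu k ^+ 2) D HQ) -!favqD.
    by apply: favq_eq => D' _; rewrite /ze; ring.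
  rewrite ex//; have := sqr_ge0 (mu k); move: (mu k) => y; move: (favq _ _ _ _) => x; clear; nra.
have -> : favq ks Q (fun D => (\sum_(j <- k :: r) xi j D - \sum_(j <- k :: r) mu j) ^+ 2) D =
   favq ks Q (fun D => ze D ^+ 2) D + (2 * favq ks Q (fun D => ze D * Z D) D +
   favq ks Q (fun D => Z D ^+ 2) D).
  rewrite -favqZ -!favqD; apply: favq_eq => D' _; rewrite !big_cons /ze /Z; ring.
rewrite cross mulr0 add0r [leRHS]big_cons lerD//.
by apply: IH => // j jr; [apply: dx|apply: ex]; exact: sub.
Qed.

End InitAverage.

(** * Averages over the sample *)

Section FastRateAlgebra.
Variable R : realType.

Lemma exp_quad (t : R) : `|t| <= 16^-1 -> expR t <= 1 + t + 2 * t ^+ 2.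
Proof.
move=> ht; have := exp_taylor 1 t.
have -> : (exp_poly R 1).[t] = 1 + t.
  rewrite horner_poly !big_ord_recl big_ord0 /= fact0 invr1 expr0 expr1 mulr1 mul1r.
  by rewrite addr0.
rewrite ler_norml => /andP[_ h].
have e2 : expR `|t| <= 2.
  have h1 : 1 + (- `|t|) <= expR (- `|t|) by exact: expR_ge1Dx.
  have h2 : expR (- `|t|) * expR `|t| = 1 by rewrite -expRD addNr expR0.
  have h3 := expR_gt0 `|t|.
  by move: h1 h2 h3 ht; clear; nra.
have h4 : expR `|t| * `|t| ^+ 2 <= 2 * t ^+ 2.
  by rewrite real_normK ?num_real// ler_wpM2r// sqr_ge0.
by move: h h4; clear; lra.
Qed.

Lemma loss_diff_le (g e : R) (b : bool) : 0 <= g <= 1 -> 0 <= e <= 1 ->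
  `|(((b : nat)%:R - g) ^+ 2 - ((b : nat)%:R - e) ^+ 2) / 16| <= 16^-1.
Proof.
move=> /andP[g0 g1] /andP[e0 e1].
rewrite normrM [`|16^-1|]ger0_norm ?invr_ge0// ler_piMl ?invr_ge0//.
by rewrite ler_norml; case: b => /=; nra.
Qed.

(** With the scale 16 the quadratic term, 2 * 4 / 256, is half of the linear one, 1 / 16, which
    leaves 1 / 32. *)
Lemma quad_fast (g e : R) : 0 <= g <= 1 -> 0 <= e <= 1 ->
  e * (1 + - (((1 - g) ^+ 2 - (1 - e) ^+ 2) / 16) +
       2 * (- (((1 - g) ^+ 2 - (1 - e) ^+ 2) / 16)) ^+ 2) +
  (1 - e) * (1 + - (((0 - g) ^+ 2 - (0 - e) ^+ 2) / 16) +
       2 * (- (((0 - g) ^+ 2 - (0 - e) ^+ 2) / 16)) ^+ 2) <= 1 - (g - e) ^+ 2 / 32.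
Proof.
move=> /andP[g0 g1] /andP[e0 e1].
have -> : (1 - g) ^+ 2 - (1 - e) ^+ 2 = (g - e) * (g + e - 2) by ring.
have -> : (0 - g) ^+ 2 - (0 - e) ^+ 2 = (g - e) * (g + e) by ring.
have s1 : (g + e - 2) ^+ 2 <= 4 by move: e0 e1 g0 g1; clear; nra.
have s2 : (g + e) ^+ 2 <= 4 by move: e0 e1 g0 g1; clear; nra.
have d0 := sqr_ge0 (g - e).
have w1 : e * ((g - e) ^+ 2 * (g + e - 2) ^+ 2) <= e * ((g - e) ^+ 2 * 4).
  by rewrite ler_wpM2l// ler_wpM2l.
have w2 : (1 - e) * ((g - e) ^+ 2 * (g + e) ^+ 2) <= (1 - e) * ((g - e) ^+ 2 * 4).
  by rewrite ler_wpM2l ?subr_ge0// ler_wpM2l.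
by move: w1 w2; clear; lra.
Qed.

End FastRateAlgebra.

(** * Measurability and integration over the sample *)

Section Measurability.
Variables (R : realType) (d1 d2 : nat).
Local Notation X := (xsp R d1 d2).

Lemma measurable_xat i j : measurable_fun setT (fun x : X => xat x i j).
Proof.
case: (ltnP i.-1 d1) => hi; last first.
  rewrite (_ : (fun x : X => _) = cst 0)//; apply/funext => x; rewrite /xat.
  by rewrite (@nth_default _ _ (map val x)) ?size_map ?size_tuple// nth_nseq if_same.
case: (ltnP j.-1 d2) => hj; last first.
  rewrite (_ : (fun x : X => _) = cst 0)//; apply/funext => x; rewrite /xat.
  by rewrite nth_default// (nth_map (tnth x (Ordinal hi))) ?size_tuple.
rewrite (_ : (fun x : X => _) =
   (fun t : d2.-tuple R => tnth t (Ordinal hj)) \o (fun x : X => tnth x (Ordinal hi))).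
  apply: measurableT_comp; exact: measurable_tnth.
apply/funext => x /=; rewrite /xat (nth_map (tnth x (Ordinal hi))) ?size_tuple//.
have -> : nth (tnth x (Ordinal hi)) x i.-1 = tnth x (Ordinal hi).
  by rewrite [RHS](tnth_nth (tnth x (Ordinal hi))).
by rewrite (tnth_nth 0).
Qed.

Lemma measurable_cube : measurable (@cube R d1 d2).
Proof.
have -> : @cube R d1 d2 = \bigcap_i \bigcap_j
   [set x : X | inD d1 d2 i j -> 0 <= xat x i j <= 1].
  by apply/seteqP; split => x /= h; [move=> i _ j _; exact: h|move=> i j; exact: h].
apply: bigcapT_measurable => i; apply: bigcapT_measurable => j.
case: (inD d1 d2 i j); last first.
  by rewrite (_ : [set x | _] = setT)//; apply/seteqP; split.
rewrite (_ : [set x | _] = setT `&` (fun x : X => xat x i j) @^-1` `[0, 1]).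
  by apply: measurable_xat.
by rewrite setTI; apply/seteqP; split => x /=; rewrite in_itv/= => h; [exact: h|move=> _].
Qed.

Lemma measurable_sigmoid : measurable_fun setT (@sigmoid R).
Proof.
apply: continuous_measurable_fun => x; apply/cvgrPdist_le => e e0.
near=> z; apply: (le_trans (sigmoid_lip x z)).
near: z; exact: (nbhs_ball_norm e0 x) || (apply/nbhs_normP; exists e => //= z /= /ltW).
Unshelve. all: by end_near. Qed.

End Measurability.

Section Integral.
Variables (R : realType) (d1 d2 : nat) (mu : probability (xsp R d1 d2) R).
Local Notation X := (xsp R d1 d2).
Local Notation C := (@cube R d1 d2).
Hypothesis muC : mu C = 1%E.
Implicit Types (g h : X -> R).

Definition bm g := measurable_fun C g /\ exists M : R, forall x, C x -> `|g x| <= M.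
Definition I g : R := \int[mu]_(x in C) g x.

Lemma bm_cst (c : R) : bm (fun=> c).
Proof. by split; [exact: measurable_cst|exists `|c|]. Qed.

Lemma bmD g h : bm g -> bm h -> bm (fun x => g x + h x).
Proof.
move=> [mg [M gM]] [mh [N hN]]; split; first exact: measurable_funD.
by exists (M + N) => x Cx; rewrite (le_trans (ler_normD _ _))// lerD ?gM ?hN.
Qed.

Lemma bmM g h : bm g -> bm h -> bm (fun x => g x * h x).
Proof.
move=> [mg [M gM]] [mh [N hN]]; split; first exact: measurable_funM.
by exists (M * N) => x Cx; rewrite normrM ler_pM ?gM ?hN.
Qed.

Lemma bmN g : bm g -> bm (fun x => - g x).
Proof.
move=> hg; have := bmM (bm_cst (-1)) hg.
by rewrite (_ : (fun x => -1 * g x) = (fun x => - g x))//; apply/funext => x; rewrite mulN1r.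
Qed.

Lemma bmB g h : bm g -> bm h -> bm (fun x => g x - h x).
Proof. by move=> hg hh; apply: bmD => //; exact: bmN. Qed.

Lemma bm_sqr g : bm g -> bm (fun x => g x ^+ 2).
Proof.
move=> hg; have := bmM hg hg.
by rewrite (_ : (fun x => g x * g x) = (fun x => g x ^+ 2))//; apply/funext => x; rewrite expr2.
Qed.

Lemma bm_sum (T : Type) (r : seq T) (g : T -> X -> R) : (forall t, bm (g t)) ->
  bm (fun x => \sum_(t <- r) g t x).
Proof.
move=> hg; elim: r => [|t r IH].
  by rewrite (_ : (fun x => _) = (fun=> 0)); [exact: bm_cst|apply/funext => x; rewrite big_nil].
rewrite (_ : (fun x => _) = (fun x => g t x + \sum_(t <- r) g t x)); first exact: bmD.
by apply/funext => x; rewrite big_cons.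
Qed.

Lemma bm_ext g h : (forall x, C x -> g x = h x) -> bm g -> bm h.
Proof.
move=> e [mg [M gM]]; split; last by exists M => x Cx; rewrite -e// gM.
by apply: eq_measurable_fun mg => x; rewrite inE => /e.
Qed.

Lemma bm_exp g : bm g -> bm (fun x => expR (g x)).
Proof.
move=> [mg [M gM]]; split; first exact: measurableT_comp.
exists (expR M) => x Cx; rewrite ger0_norm ?expR_ge0// ler_expR.
by rewrite (le_trans (ler_norm _))// gM.
Qed.

Lemma bm_int g : bm g -> mu.-integrable C (EFin \o g).
Proof.
move=> [mg [M gM]]; apply: measurable_bounded_integrable => //.
- exact: measurable_cube.
- have h : (mu C < +oo)%E by rewrite muC ltry.
  exact: h.
- exists M; split; first exact: num_real.
  by move=> y My x Cx /=; exact: le_trans (gM x Cx) (ltW My).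
Qed.

Lemma I_EFin g : bm g -> ((\int[mu]_(x in C) (g x)%:E) = (I g)%:E)%E.
Proof.
move=> hg; rewrite /I /Rintegral fineK//.
by apply: integrable_fin_num (bm_int hg); exact: measurable_cube.
Qed.

Lemma I_cst (c : R) : I (fun=> c) = c.
Proof.
transitivity (c * fine (mu C)); last by rewrite muC mulr1.
by apply: Rintegral_cst; exact: measurable_cube.
Qed.

Lemma ID g h : bm g -> bm h -> I (fun x => g x + h x) = I g + I h.
Proof. by move=> hg hh; apply: RintegralD; [exact: measurable_cube|exact: bm_int..]. Qed.

Lemma IZ (c : R) g : bm g -> I (fun x => c * g x) = c * I g.
Proof. by move=> hg; apply: RintegralZl; [exact: measurable_cube|exact: bm_int]. Qed.

Lemma I_le g h : bm g -> bm h -> (forall x, C x -> g x <= h x) -> I g <= I h.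
Proof. by move=> hg hh gh; apply: le_Rintegral => //; [exact: measurable_cube|exact: bm_int..]. Qed.

Lemma I_ext g h : (forall x, C x -> g x = h x) -> I g = I h.
Proof. by move=> e; apply: eq_Rintegral => x; rewrite inE => /e. Qed.

Lemma I_ge0 g : (forall x, C x -> 0 <= g x) -> 0 <= I g.
Proof. exact: Rintegral_ge0. Qed.

Lemma I_sum (T : Type) (r : seq T) (g : T -> X -> R) : (forall t, bm (g t)) ->
  I (fun x => \sum_(t <- r) g t x) = \sum_(t <- r) I (g t).
Proof.
move=> hg; elim: r => [|t r IH].
  by rewrite big_nil -[RHS](I_cst 0); apply: I_ext => x _; rewrite big_nil.
rewrite big_cons -IH -ID//; last exact: bm_sum.
by apply: I_ext => x _; rewrite big_cons.
Qed.

Variable eta : X -> R.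
Hypotheses (meta : measurable_fun C eta) (eta01 : forall x, C x -> 0 <= eta x <= 1).

Lemma bm_eta : bm eta.
Proof.
by split => //; exists 1 => x /eta01/andP[? ?]; rewrite ger0_norm.
Qed.

Definition Ey (q : X * bool -> R) : R :=
  I (fun x => eta x * q (x, true) + (1 - eta x) * q (x, false)).

Definition bmb (q : X * bool -> R) := forall b, bm (fun x => q (x, b)).

Lemma bm_Ey q : bmb q -> bm (fun x => eta x * q (x, true) + (1 - eta x) * q (x, false)).
Proof.
move=> hq; apply: bmD; apply: bmM; try exact: hq; first exact: bm_eta.
by apply: bmB; [exact: bm_cst|exact: bm_eta].
Qed.

Lemma sample_exp_ge0 m (G : seq (X * bool) -> \bar R) : (forall s, 0 <= G s)%E ->
  (0 <= sample_exp mu eta m G)%E.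
Proof.
elim: m G => [|m IH] G G0 /=; first exact: G0.
apply: integral_ge0 => x Cx; have /andP[e0 e1] := eta01 Cx.
by rewrite adde_ge0// mule_ge0 ?lee_fin ?subr_ge0// IH.
Qed.

(** The majorant keeps its shape when one observation is integrated out: the sum turns into
    multiples of the mean of [q], each product into a power of the expectation of [e t]. The
    constants [c] and [cg] vary in the induction to store the observations already fixed. *)
Lemma sample_exp_le (T : Type) (r : seq T) m (G : seq (X * bool) -> \bar R) (c : R)
    (q : X * bool -> R) (cg : T -> R) (e : T -> X * bool -> R) :
  bmb q -> (forall t, bmb (e t)) -> (forall s, 0 <= G s)%E ->
  (forall s, size s = m -> (forall z, z \in s -> C z.1) ->
    (G s <= (c + \sum_(z <- s) q z + \sum_(t <- r) cg t * \prod_(z <- s) e t z)%:E)%E) ->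
  (sample_exp mu eta m G <=
     (c + m%:R * Ey q + \sum_(t <- r) cg t * Ey (e t) ^+ m)%:E)%E.
Proof.
move=> hq he; elim: m G c cg => [|m IH] G c cg G0 HG.
  have := HG [::] erefl (fun z (h : z \in [::]) => False_ind _ (notF h)).
  by rewrite big_nil mul0r /=; under eq_bigr do rewrite big_nil.
rewrite [sample_exp _ _ _ _]/=.
pose K x b := c + q (x, b) + m%:R * Ey q + \sum_(t <- r) cg t * e t (x, b) * Ey (e t) ^+ m.
have step x b : C x -> (sample_exp mu eta m (fun s => G ((x, b) :: s)) <= (K x b)%:E)%E.
  move=> Cx; apply: (IH _ (c + q (x, b)) (fun t => cg t * e t (x, b))) => // s sm sC.
  apply: (le_trans (HG ((x, b) :: s) _ _)); first by rewrite /= sm.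
    by move=> z; rewrite in_cons => /orP[/eqP->//|/sC].
  rewrite lee_fin big_cons addrA le_eqVlt; apply/orP; left; apply/eqP; congr (_ + _).
  by apply: eq_bigr => t _; rewrite big_cons mulrA.
pose F x := eta x * K x true + (1 - eta x) * K x false.
apply: (@le_trans _ _ (\int[mu]_(x in C) (F x)%:E)%E).
  apply: ge0_le_integral_nomeas => x Cx; have /andP[e0 e1] := eta01 Cx.
    by rewrite adde_ge0// mule_ge0 ?lee_fin ?subr_ge0// sample_exp_ge0.
  have -> : ((F x)%:E = (eta x)%:E * (K x true)%:E + (1 - eta x)%:E * (K x false)%:E)%E.
    by rewrite -!EFinM -EFinD.
  rewrite leeD// lee_wpmul2l ?lee_fin ?subr_ge0//; exact: step.
have FE x : F x = (c + m%:R * Ey q) + ((eta x * q (x, true) + (1 - eta x) * q (x, false)) +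
   \sum_(t <- r) (cg t * Ey (e t) ^+ m) *
     (eta x * e t (x, true) + (1 - eta x) * e t (x, false))).
  have -> : \sum_(t <- r) (cg t * Ey (e t) ^+ m) *
     (eta x * e t (x, true) + (1 - eta x) * e t (x, false)) =
     eta x * (\sum_(t <- r) cg t * e t (x, true) * Ey (e t) ^+ m) +
     (1 - eta x) * (\sum_(t <- r) cg t * e t (x, false) * Ey (e t) ^+ m).
    rewrite !big_distrr -big_split; apply: eq_bigr => t _ /=; ring.
  by rewrite /F /K; ring.
have bs : bm (fun x => \sum_(t <- r) (cg t * Ey (e t) ^+ m) *
     (eta x * e t (x, true) + (1 - eta x) * e t (x, false))).
  by apply: bm_sum => t; apply: bmM; [exact: bm_cst|exact: bm_Ey].
have bF : bm (fun x => (c + m%:R * Ey q) + ((eta x * q (x, true) + (1 - eta x) * q (x, false)) +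
   \sum_(t <- r) (cg t * Ey (e t) ^+ m) *
     (eta x * e t (x, true) + (1 - eta x) * e t (x, false)))).
  by apply: bmD; [exact: bm_cst|apply: bmD => //; exact: bm_Ey].
have bF' : bm F by apply: bm_ext bF => x _; rewrite FE.
rewrite I_EFin// lee_fin (I_ext (fun x _ => FE x)) ID ?I_cst; [|exact: bm_cst|by apply: bmD => //; exact: bm_Ey].
rewrite ID//; last exact: bm_Ey.
rewrite I_sum; last by move=> t; apply: bmM; [exact: bm_cst|exact: bm_Ey].
have -> : \sum_(t <- r) I (fun x => cg t * Ey (e t) ^+ m *
     (eta x * e t (x, true) + (1 - eta x) * e t (x, false))) =
  \sum_(t <- r) cg t * Ey (e t) ^+ m.+1.
  by apply: eq_bigr => t _; rewrite IZ; [rewrite -mulrA -exprSr|exact: bm_Ey].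
by rewrite -/(Ey q) -natr1 le_eqVlt; apply/orP; left; apply/eqP; ring.
Qed.

Definition Zg (g : X -> R) (z : X * bool) : R :=
  ((z.2 : nat)%:R - g z.1) ^+ 2 - ((z.2 : nat)%:R - eta z.1) ^+ 2.

Lemma bmb_Z g : bm g -> bmb (Zg g).
Proof.
move=> hg b; apply: bmB; apply: bm_sqr; apply: bmB; try exact: bm_cst.
  exact: hg.
exact: bm_eta.
Qed.

(* Conditionally on x the loss difference has mean (g - eta)^2 and second
   moment at most 4 (g - eta)^2: the variance condition behind the fast rate. *)
Lemma Ey_exp_le1 g (v : R) : bm g -> (forall x, C x -> 0 <= g x <= 1) ->
  v = I (fun x => (g x - eta x) ^+ 2) ->
  0 <= Ey (fun z => expR (16^-1 * (v / 2 - Zg g z))) <= 1.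
Proof.
move=> hg g01 vE.
have hge := bm_sqr (bmB hg bm_eta).
have he : bmb (fun z => expR (16^-1 * (v / 2 - Zg g z))).
  move=> b; apply: bm_exp; apply: bmM; first exact: bm_cst.
  by apply: bmB; [exact: bm_cst|exact: bmb_Z].
apply/andP; split.
  apply: I_ge0 => x Cx; have /andP[e0 e1] := eta01 Cx.
  by rewrite addr_ge0// mulr_ge0 ?expR_ge0// subr_ge0.
have pt x : C x -> eta x * expR (16^-1 * (v / 2 - Zg g (x, true))) +
   (1 - eta x) * expR (16^-1 * (v / 2 - Zg g (x, false))) <=
   expR (v / 32) * (1 - (g x - eta x) ^+ 2 / 32).
  move=> Cx; have e01 := eta01 Cx; have /andP[e0 e1] := e01; have gx := g01 x Cx.
  have sp b : expR (16^-1 * (v / 2 - Zg g (x, b))) = expR (v / 32) * expR (- (Zg g (x, b) / 16)).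
    by rewrite -expRD; congr expR; field.
  rewrite !sp mulrCA [X in _ + X]mulrCA -mulrDr ler_wpM2l ?expR_ge0//.
  have zb b : `|- (Zg g (x, b) / 16)| <= 16^-1.
    by rewrite normrN; apply: loss_diff_le.
  have := exp_quad (zb true); have := exp_quad (zb false).
  set A := expR _; set B := expR _ => hB hA.
  have q1 : eta x * B <= eta x * (1 + - (Zg g (x, true) / 16) + 2 * (- (Zg g (x, true) / 16)) ^+ 2).
    by rewrite ler_wpM2l.
  have q2 : (1 - eta x) * A <= (1 - eta x) * (1 + - (Zg g (x, false) / 16) + 2 * (- (Zg g (x, false) / 16)) ^+ 2).
    by rewrite ler_wpM2l// subr_ge0.
  apply: (le_trans (lerD q1 q2)).
  exact: (quad_fast gx e01).
apply: (@le_trans _ _ (I (fun x => expR (v / 32) * (1 - (g x - eta x) ^+ 2 / 32)))).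
  apply: I_le => //; first exact: (bm_Ey he).
  apply: bmM; first exact: bm_cst.
  by apply: bmB; [exact: bm_cst|apply: bmM => //; exact: bm_cst].
rewrite IZ; last by apply: bmB; [exact: bm_cst|apply: bmM => //; exact: bm_cst].
have -> : I (fun x => 1 - (g x - eta x) ^+ 2 / 32) = 1 - v / 32.
  transitivity (I (fun x => 1 + (- 32^-1) * (g x - eta x) ^+ 2)).
    by apply: I_ext => x _; ring.
  rewrite ID; [|exact: bm_cst|by apply: bmM => //; exact: bm_cst].
  by rewrite I_cst IZ// -vE; ring.
(* It remains to use exp u (1 - u) <= 1 at u = v / 32. *)
have h1 : 1 + (- (v / 32)) <= expR (- (v / 32)) by exact: expR_ge1Dx.
have h2 : expR (v / 32) * expR (- (v / 32)) = 1 by rewrite -expRD subrr expR0.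
by have := ler_wpM2l (expR_ge0 (v / 32)) h1; rewrite h2.
Qed.

End Integral.

(** * Convolutional networks as patch averages *)

Section Glue.
Variables (R : realType) (kappa L d1 d2 : nat).
Hypotheses (k1 : (1 <= kappa)%N) (L2 : (2 <= L)%N) (kd1 : (kappa <= d1)%N) (kd2 : (kappa <= d2)%N).
Local Notation X := (xsp R d1 d2).
Local Notation C := (@cube R d1 d2).
Local Notation M := (archM kappa L).
Local Notation kk := (archk kappa L).

Definition pos : seq (nat * nat) :=
  [seq (i, j) | i <- index_iota 1 (d1 - kappa + 1).+1, j <- index_iota 1 (d2 - kappa + 1).+1].

Lemma size_pos : size pos = ((d1 - kappa + 1) * (d2 - kappa + 1))%N.
Proof. by rewrite size_allpairs !size_iota !subn1. Qed.

Lemma pos_gt0 : (0 < size pos)%N.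
Proof. by rewrite size_pos !addn1. Qed.

Lemma posP ij : ij \in pos ->
  (1 <= ij.1 <= d1 - kappa + 1)%N /\ (1 <= ij.2 <= d2 - kappa + 1)%N.
Proof.
case/allpairsP => [[i j] /= [hi hj ->]] /=.
by move: hi hj; rewrite !mem_index_iota !ltnS.
Qed.

Definition Gp (th : wvec R) (x : X) : R :=
  (size pos)%:R^-1 * \sum_(ij <- pos) net th (Defs.patch kappa x ij.1 ij.2) L 1.

Lemma inD_pos ij (a b : 'I_kappa) : ij \in pos -> inD d1 d2 (ij.1 + a) (ij.2 + b).
Proof.
move=> /posP[h1 h2]; rewrite /inD; have := ltn_ord a; have := ltn_ord b.
by move: (nat_of_ord a) (nat_of_ord b) h1 h2 kd1 kd2; clear; lia.
Qed.

Lemma patch01 x ij : C x -> ij \in pos -> forall a b, 0 <= Defs.patch kappa x ij.1 ij.2 a b <= 1.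
Proof. by move=> Cx hp a b; rewrite mxE; apply: Cx; exact: inD_pos. Qed.

Lemma avg_poolE (f : 'M[R]_kappa -> R) (x : X) : avg_pool f x =
  (size pos)%:R^-1 * \sum_(ij <- pos) f (Defs.patch kappa x ij.1 ij.2).
Proof. by rewrite /avg_pool size_pos big_allpairs. Qed.

Lemma cnn_oS w (x : X) k r i j s : cnn_o M kk w x k r.+1 i j s =
  sigmoid (\sum_(1 <= s1 < (kk r).+1) \sum_(1 <= t1 < (M r.+1).+1)
     \sum_(1 <= t2 < (M r.+1).+1)
       (if inD d1 d2 (i + t1 - 1) (j + t2 - 1)
        then blk w k (iW r.+1 t1 t2 s1 s) *
             cnn_o M kk w x k r (i + t1 - 1) (j + t2 - 1) s1
        else 0)
     + blk w k (iB r.+1 s)).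
Proof. exact: erefl. Qed.

(** At a pooled position the whole window of the first filter lies inside the image, so the boundary
    test [inD] always succeeds, and the later filters have size one. *)
Lemma cnn_o_net w (x : X) k r ij s : ij \in pos -> (1 <= r <= L)%N ->
  cnn_o M kk w x k r ij.1 ij.2 s = net (blk w k) (Defs.patch kappa x ij.1 ij.2) r s.
Proof.
move=> hp; elim: r s => [//|[|r] IH] s hr.
  rewrite cnn_oS net1E.
  have -> : kk 0 = 1%N by [].
  have -> : M 1 = kappa by [].
  suff -> : \sum_(1 <= s1 < 2) \sum_(1 <= t1 < kappa.+1) \sum_(1 <= t2 < kappa.+1)
       (if inD d1 d2 (ij.1 + t1 - 1) (ij.2 + t2 - 1)
        then blk w k (iW 1 t1 t2 s1 s) *
             cnn_o M kk w x k 0 (ij.1 + t1 - 1) (ij.2 + t2 - 1) s1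
        else 0) = \sum_(p : pix kappa) blk w k (iW 1 p.1.+1 p.2.+1 1 s) *
            (Defs.patch kappa x ij.1 ij.2) p.1 p.2 by [].
  rewrite big_nat1 big_add1 big_mkord.
  rewrite -(pair_bigA _ (fun (a b : 'I_kappa) => blk w k (iW 1 a.+1 b.+1 1 s) *
      Defs.patch kappa x ij.1 ij.2 a b)).
  apply: eq_bigr => a _; rewrite big_add1 big_mkord; apply: eq_bigr => b _.
  by rewrite mxE !addnS !subn1 [in X in if X then _ else _]/= inD_pos.
have rL : (r.+1 < L)%N by case/andP: hr.
have [] := posP hp => h1 h2.
rewrite netSE cnn_oS.
have -> : kk r.+1 = nin kappa by rewrite /archk (ltn_eqF rL).
have -> : M r.+2 = 1%N.
  by rewrite /archM (_ : (r.+2 == L.+1) = false)// eqSS (ltn_eqF rL).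
suff -> : \sum_(1 <= s1 < (nin kappa).+1) \sum_(1 <= t1 < 2) \sum_(1 <= t2 < 2)
       (if inD d1 d2 (ij.1 + t1 - 1) (ij.2 + t2 - 1)
        then blk w k (iW r.+2 t1 t2 s1 s) *
             cnn_o M kk w x k r.+1 (ij.1 + t1 - 1) (ij.2 + t2 - 1) s1
        else 0) = \sum_(s1 < nin kappa) blk w k (iW r.+2 1 1 s1.+1 s) *
          net (blk w k) (Defs.patch kappa x ij.1 ij.2) r.+1 s1.+1 by [].
have iD : inD d1 d2 ij.1 ij.2.
  rewrite /inD; move: h1 h2 k1 kd1 kd2; clear; lia.
rewrite big_add1 big_mkord; apply: eq_bigr => s1 _.
rewrite !big_nat1 !addnK iD IH//.
exact: ltnW.
Qed.

Lemma cnn_kE w (x : X) k : cnn_k L M kk w x k = Gp (blk w k) x.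
Proof.
rewrite /cnn_k /Gp size_pos.
have -> : M L.+1 = kappa by rewrite /archM eqxx orbT.
congr (_ * _); rewrite [RHS]big_seq -big_seq /pos big_allpairs.
rewrite [LHS]big_seq [RHS]big_seq; apply: eq_bigr => i hi.
rewrite [LHS]big_seq [RHS]big_seq; apply: eq_bigr => j hj.
apply: (@cnn_o_net w x k L (i, j) 1); last by rewrite leqnn ltnW.
by apply/allpairsP; exists (i, j).
Qed.

Lemma cnnE K w (x : X) : cnn L K M kk w x = fO Gp K (uo w) w x.
Proof. by rewrite /cnn /fO; apply: eq_bigr => k _; rewrite cnn_kE. Qed.

Lemma FnE K c4 (s : seq (X * bool)) : Fn L K M kk c4 s = FF Gp K c4 s.
Proof.
apply/funext => w; rewrite /Fn /FF /FO; congr (_ * _ + _ * _).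
by apply: eq_bigr => z _; rewrite cnnE.
Qed.

Lemma Gp_itv th x : 0 <= Gp th x <= 1.
Proof.
rewrite /Gp mulr_ge0 ?invr_ge0// ?sumr_ge0//; last first.
  by move=> ij _; have /andP[] := net_itv th (Defs.patch kappa x ij.1 ij.2) L 1.
rewrite mean_le ?pos_gt0// => ij _.
by have /andP[] := net_itv th (Defs.patch kappa x ij.1 ij.2) L 1.
Qed.

Lemma nin_1 : (1 <= 1 <= nin kappa)%N.
Proof. by rewrite /= /nin muln_gt0 expn_gt0 k1. Qed.

Lemma Gp_expd (Cs B : R) th x : 1 <= Cs ->
  (forall z, exists c, `|c| <= Cs /\
    forall h, `|sigmoid (z + h) - sigmoid z - c * h| <= Cs * h ^+ 2) ->
  0 <= B -> C x -> (forall e, e \in idx_w kappa L -> `|th e| <= B) ->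
  exists a, expd (idx kappa L) th (netP kappa Cs B L) (Gp^~ x) a.
Proof.
move=> C1 HC B0 Cx HB.
have Hp (ij : nat * nat) : exists a, ij \in pos -> expd (idx kappa L) th (netP kappa Cs B L)
     (fun th => net th (Defs.patch kappa x ij.1 ij.2) L 1) a.
  case hp: (ij \in pos); last by exists (fun=> 0).
  have LL : (1 <= L <= L)%N by rewrite leqnn ltnW.
  by have [a ha] := net_expd C1 HC B0 HB (patch01 Cx hp) LL nin_1; exists a.
have [a Ha] := choice Hp.
have P0 := le_trans ler01 (netP_ge1 kappa L C1 B0).
have es := expd_sum Ha.
have := expdZ ((size pos)%:R^-1) (mulr_ge0 (ler0n R (size pos)) P0) es.
rewrite ger0_norm ?invr_ge0// mulrA mulVf ?mul1r; last by rewrite pnatr_eq0 -lt0n pos_gt0.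
by move=> h; eexists; exact: h.
Qed.

Variable mu : probability X R.
Hypothesis muC : mu C = 1%E.

Lemma measurable_patch ij a b : measurable_fun C (fun x : X => Defs.patch kappa x ij.1 ij.2 a b).
Proof.
rewrite (_ : (fun x : X => _) = (fun x => xat x (ij.1 + a) (ij.2 + b))).
  by apply: measurable_funTS; exact: measurable_xat.
by apply/funext => x; rewrite mxE.
Qed.

Lemma measurable_net th ij r s : measurable_fun C (fun x : X => net th (Defs.patch kappa x ij.1 ij.2) r s).
Proof.
elim: r s => [|[|r] IH] s; first exact: measurable_cst.
  rewrite (_ : (fun x : X => _) = @sigmoid R \o (fun x : X =>
     \sum_(p : pix kappa) th (iW 1 p.1.+1 p.2.+1 1 s) * Defs.patch kappa x ij.1 ij.2 p.1 p.2
       + th (iB 1 s)))//.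
  apply: measurableT_comp; first exact: measurable_sigmoid.
  apply: measurable_funD; last exact: measurable_cst.
  apply: measurable_sum => p; apply: measurable_funM; first exact: measurable_cst.
  exact: measurable_patch.
rewrite (_ : (fun x : X => _) = @sigmoid R \o (fun x : X =>
   \sum_(s1 < nin kappa) th (iW r.+2 1 1 s1.+1 s) *
     net th (Defs.patch kappa x ij.1 ij.2) r.+1 s1.+1 + th (iB r.+2 s)))//.
apply: measurableT_comp; first exact: measurable_sigmoid.
apply: measurable_funD; last exact: measurable_cst.
apply: measurable_sum => s1; apply: measurable_funM; first exact: measurable_cst.
exact: IH.
Qed.

Lemma bm_Gp th : bm (Gp th).
Proof.
split; last by exists 1 => x _; have /andP[? ?] := Gp_itv th x; rewrite ger0_norm.
apply: measurable_funM; first exact: measurable_cst.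
by apply: measurable_sum => ij; exact: measurable_net.
Qed.

Lemma measurable_cell ij (mm : nat) (c : {ffun pix kappa -> 'I_mm.+1}) :
  measurable_fun C (fun x : X => \prod_(p : pix kappa)
    (((c p)%:R : R) <= mm%:R * Defs.patch kappa x ij.1 ij.2 p.1 p.2 < (c p).+1%:R)%R%:R : R).
Proof.
apply: measurable_prod => p _.
have mp : measurable_fun C (fun x : X => mm%:R * Defs.patch kappa x ij.1 ij.2 p.1 p.2).
  by apply: measurable_funM; [exact: measurable_cst|exact: measurable_patch].
have mb : measurable_fun C (fun x : X =>
    ((c p)%:R : R) <= mm%:R * Defs.patch kappa x ij.1 ij.2 p.1 p.2 < (c p).+1%:R).
  apply: measurable_and; first by apply: measurable_fun_ler => //; exact: measurable_cst.
  by apply: measurable_fun_ltr => //; exact: measurable_cst.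
rewrite (_ : (fun x : X => _) = (fun x : X => if (((c p)%:R : R) <=
    mm%:R * Defs.patch kappa x ij.1 ij.2 p.1 p.2 < (c p).+1%:R) then 1 else 0)).
  apply: measurable_fun_if => //; first exact: measurable_cube.
by apply/funext => x /=; case: ifP.
Qed.

Definition avg_code q mm (Cs : R) lev U1 (cd : code kappa L q mm lev) (x : X) : R :=
  (size pos)%:R^-1 * \sum_(ij <- pos) cfun Cs U1 cd (Defs.patch kappa x ij.1 ij.2).

Lemma measurable_avg_code q mm Cs lev U1 (cd : code kappa L q mm lev) :
  measurable_fun C (avg_code Cs U1 cd).
Proof.
apply: measurable_funM; first exact: measurable_cst.
apply: measurable_sum => ij; apply: measurable_sum => c.
apply: measurable_funM; first exact: measurable_cell.
apply: measurable_sum => e; apply: measurable_funM; first exact: measurable_cst.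
apply: measurable_prod => p _; apply: measurable_funX.
apply: measurable_funB; last exact: measurable_cst.
by apply: measurable_funM; [exact: measurable_cst|exact: measurable_patch].
Qed.

(** [f] is continuous on the cube of patches and arbitrary elsewhere, so it is reached as a limit of
    functions constant on half-open grid cells, whose indicators are measurable. *)
Lemma measurable_avg_pool (p Cf : R) (f : 'M[R]_kappa -> R) : 0 < p -> 0 < Cf -> smooth_patch p Cf f ->
  measurable_fun C (avg_pool f : X -> R).
Proof.
move=> p0 Cf0 fs.
pose nd mm (c : {ffun pix kappa -> 'I_mm.+1}) : 'M[R]_kappa :=
  \matrix_(a, b) ((c (a, b))%:R / mm%:R).
pose hN mm (x : X) : R := (size pos)%:R^-1 * \sum_(ij <- pos)
  \sum_(c : {ffun pix kappa -> 'I_mm.+1})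
    (\prod_(p : pix kappa)
      (((c p)%:R : R) <= mm%:R * Defs.patch kappa x ij.1 ij.2 p.1 p.2 < (c p).+1%:R)%R%:R) *
    f (nd mm c).
apply: (@measurable_fun_cvg _ _ _ _ (fun N => hN N.+1)).
  move=> N; apply: measurable_funM; first exact: measurable_cst.
  apply: measurable_sum => ij; apply: measurable_sum => c.
  by apply: measurable_funM; [exact: measurable_cell|exact: measurable_cst].
move=> x Cx.
(* Distance within which the smoothness condition keeps the values of [f] within [e]. *)
pose dl (e : R) := (e / Cf) `^ p^-1.
have dl0 e : 0 < e -> 0 < dl e by move=> e0; rewrite powR_gt0// divr_gt0.
have key N e : 0 < e -> kappa%:R <= dl e * N.+1%:R -> `|avg_pool f x - hN N.+1 x| <= e.
  move=> e0 hN'; rewrite avg_poolE -mulrBr -sumrB.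
  apply: mean_norm_le; first exact: pos_gt0.
  move=> ij hp; have y01 := patch01 Cx hp.
  have [c hc] : exists c : {ffun pix kappa -> 'I_N.+2}, forall q : pix kappa,
     (c q)%:R <= N.+1%:R * (Defs.patch kappa x ij.1 ij.2) q.1 q.2 < (c q).+1%:R.
    exact: cell_ex.
  set y := Defs.patch kappa x ij.1 ij.2 in y01 hc *.
  rewrite (bigD1 c)//= [X in X * _]big1 ?mul1r; last by move=> q _; rewrite hc.
  rewrite [X in f (nd N.+1 c) + X]big1 ?addr0; last first.
    move=> c' c'c; have [q qc] : exists q, c' q != c q.
      apply/existsP; apply: contraNT c'c => /existsPn h.
      by apply/eqP/ffunP => q; apply/eqP; have := h q; rewrite negbK.
    rewrite (bigD1 q)//= (_ : (_ <= _ < _) = false) ?mul0r//.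
    apply/negP => /andP[b1 b2]; have /andP[b3 b4] := hc q.
    move/eqP: qc; apply; apply/val_inj/eqP => /=; rewrite eqn_leq.
    rewrite -ltnS -(ltr_nat R) (le_lt_trans b1 b4)/= -ltnS -(ltr_nat R).
    exact: le_lt_trans b3 b2.
  have NR : 0 < N.+1%:R :> R by rewrite ltr0n.
  have nd01 a b : 0 <= nd N.+1 c a b <= 1.
    rewrite mxE divr_ge0//= ler_pdivrMr// mul1r ler_nat -ltnS; exact: ltn_ord.
  have dist a b : `|y a b - nd N.+1 c a b| <= N.+1%:R^-1.
    have /andP[b1 b2] := hc (a, b); rewrite /= in b1 b2.
    have -> : nd N.+1 c a b = (c (a, b))%:R / N.+1%:R by rewrite /nd mxE.
    have -> : y a b - (c (a, b))%:R / N.+1%:R =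
       (N.+1%:R * y a b - (c (a, b))%:R) / N.+1%:R by field; rewrite gt_eqF.
    rewrite normrM [`|N.+1%:R^-1|]ger0_norm ?invr_ge0// ler_piMl ?invr_ge0//.
    by rewrite ger0_norm ?subr_ge0// lerBlDr nat1r ltW.
  apply: (le_trans (fs _ _ y01 nd01)).
  have s1 : Num.sqrt (\sum_a \sum_b (y a b - nd N.+1 c a b) ^+ 2) <= dl e.
    apply: (@le_trans _ _ (kappa%:R / N.+1%:R)); last by rewrite ler_pdivrMr.
    have k0 : 0 <= kappa%:R / N.+1%:R :> R by rewrite divr_ge0.
    rewrite -[leRHS]ger0_norm// -sqrtr_sqr ler_wsqrtr// pair_big/=.
    rewrite (@le_trans _ _ (\sum_(q : pix kappa) (N.+1%:R^-1) ^+ 2))//.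
      apply: ler_sum => q _; rewrite -[leLHS]real_normK ?num_real//.
      by rewrite lerXn2r ?nnegrE ?invr_ge0.
    rewrite sumr_const card_prod card_ord mulnn -[leLHS]mulr_natl natrX.
    by rewrite exprMn.
  have s2 : (Num.sqrt (\sum_a \sum_b (y a b - nd N.+1 c a b) ^+ 2)) `^ p <= e / Cf.
    have -> : e / Cf = dl e `^ p.
      by rewrite /dl -powRrM mulVf ?gt_eqF// powRr1// divr_ge0// ltW.
    by apply: ge0_ler_powR; rewrite ?nnegrE ?sqrtr_ge0// ltW// dl0.
  rewrite (le_trans (ler_wpM2l (ltW Cf0) s2))// mulrC divfK// gt_eqF//.
apply/cvgrPdist_le => e e0; near=> N; apply: key => //.
rewrite mulrC -ler_pdivrMr ?dl0//.
apply: (@le_trans _ _ N%:R); last by rewrite ler_nat.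
near: N; exact: nbhs_infty_ger.
Unshelve. all: by end_near. Qed.

Lemma bm_avg_pool (p Cf : R) (f : 'M[R]_kappa -> R) : 0 < p -> 0 < Cf -> smooth_patch p Cf f ->
  (forall x, C x -> 0 <= avg_pool f x <= 1) -> bm (avg_pool f : X -> R).
Proof.
move=> p0 C0 fs h; split; first exact: measurable_avg_pool fs.
by exists 1 => x /h/andP[? ?]; rewrite ger0_norm.
Qed.

End Glue.

(** * The list of initial weights *)

Section InitList.
Variables (R : realType) (kappa L K : nat) (a1 a2 : R).
Hypotheses (k1 : (1 <= kappa)%N) (L2 : (2 <= L)%N).
Local Notation M := (archM kappa L).
Local Notation kk := (archk kappa L).
Local Notation l := (init_list L K M kk a1 a2).
Definition keys : seq (seq nat) := map fst l.
(** In every key of the list, the entry at index 1 is the layer. *)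
Definition aof (i : seq nat) : R := if nth 0%N i 1 == 1%N then a1 else a2.

Lemma mem_bindl (A B : eqType) (s : seq A) (f : A -> seq B) z :
  reflect (exists2 x, x \in s & z \in f x) (z \in bindl s f).
Proof. exact: flatten_mapP. Qed.

Lemma map_bindl (A B D : Type) (s : seq A) (f : A -> seq B) (g : B -> D) :
  map g (bindl s f) = bindl s (fun x => map g (f x)).
Proof. by rewrite /bindl map_flatten -map_comp. Qed.

(** [g] reads the outer index off an element, so that pieces with different indices are disjoint. *)
Lemma uniq_bindl (A B : eqType) (s : seq A) (f : A -> seq B) (g : B -> A) :
  uniq s -> (forall x, x \in s -> uniq (f x)) ->
  (forall x z, x \in s -> z \in f x -> g z = x) -> uniq (bindl s f).
Proof.
elim: s => [//|x s IH] /= /andP[xs us] uf gf; rewrite cat_uniq uf ?mem_head//=.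
rewrite IH//; last 2 first.
- by move=> y ys; apply: uf; rewrite in_cons ys orbT.
- by move=> y z ys; apply: gf; rewrite in_cons ys orbT.
rewrite andbT; apply/hasPn => z /mem_bindl[y ys zy]; apply/negP => zx.
have e1 : g z = x by apply: gf zx; rewrite mem_head.
have e2 : g z = y by apply: gf zy; rewrite in_cons ys orbT.
by move: xs; rewrite -e1 e2 ys.
Qed.

Lemma kk1 : kk 1 = nin kappa.
Proof. by rewrite /archk /= (ltn_eqF L2). Qed.

Lemma MS r : (2 <= r <= L)%N -> M r = 1%N.
Proof.
move=> /andP[r2 rL]; rewrite /archM (gtn_eqF r2) /= (_ : (r == L.+1) = false)//.
by apply: ltn_eqF.
Qed.

Lemma kk_pred r : (2 <= r <= L)%N -> kk r.-1 = nin kappa.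
Proof.
case: r => [//|[//|r]] /andP[_ rL] /=.
by rewrite /archk /= (ltn_eqF rL).
Qed.

Lemma kk_vs r s : (1 <= r)%N -> ((1 <= s <= kk r)%N) = vs kappa L r s.
Proof. by case: r => [//|r] _; rewrite /archk /vs /=; case: ifP. Qed.

Lemma kk_le r : (1 <= r)%N -> (kk r <= nin kappa)%N.
Proof.
case: r => [//|r] _; rewrite /archk /=; case: ifP => // _.
by rewrite /nin muln_gt0 expn_gt0 k1.
Qed.

Lemma init_memP i a : (i, a) \in l -> exists e k,
  [/\ i = rcons e k, (1 <= k <= K)%N, a = aof i &
   (exists p s, [/\ e = iW 1 (val p.1).+1 (val p.2).+1 1 s, p \in pix kappa & (1 <= s <= nin kappa)%N]) \/
   (exists s, e = iB 1 s /\ (1 <= s <= nin kappa)%N) \/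
   (exists r s1 s, [/\ e = iW r 1 1 s1 s, (2 <= r <= L)%N, (1 <= s1 <= nin kappa)%N &
      (1 <= s <= nin kappa)%N]) \/
   (exists r s, [/\ e = iB r s, (2 <= r <= L)%N & (1 <= s <= nin kappa)%N])].
Proof.
rewrite mem_cat => /orP[|].
  case/mem_bindl => r; rewrite mem_iota add1n ltnS => /andP[r1 rL].
  case/mem_bindl => x; rewrite mem_iota add1n ltnS => /andP[x1 xM].
  case/mem_bindl => y; rewrite mem_iota add1n ltnS => /andP[y1 yM].
  case/mem_bindl => s1; rewrite mem_iota add1n ltnS => /andP[s11 s1k].
  case/mem_bindl => s; rewrite mem_iota add1n ltnS => /andP[s2 sk].
  case/mapP => k; rewrite mem_iota add1n ltnS => kK [-> ->].
  exists (iW r x y s1 s), k; split => //.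
  have sn := leq_trans sk (kk_le r1).
  case: (ltngtP r 1%N) r1 => // [r2|r1'] _; last first.
    subst r; left; move: s1k; rewrite /archk /= => s1k.
    have xk : (x.-1 < kappa)%N by case: x x1 xM.
    have yk : (y.-1 < kappa)%N by case: y y1 yM.
    exists (Ordinal xk, Ordinal yk), s; rewrite s2 sn /= !prednK//.
    have -> : s1 = 1%N by apply/eqP; rewrite eqn_leq s1k.
    by split.
  right; right; left; exists r, s1, s.
  have rr : (2 <= r <= L)%N by rewrite r2.
  rewrite r2 rL s11 s2 sn -(kk_pred rr) s1k; split => //.
  move: xM yM; rewrite MS// => xM yM.
  have -> : x = 1%N by apply/eqP; rewrite eqn_leq xM.
  by have -> : y = 1%N by apply/eqP; rewrite eqn_leq yM.
case/mem_bindl => r; rewrite mem_iota add1n ltnS => /andP[r1 rL].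
case/mem_bindl => s; rewrite mem_iota add1n ltnS => /andP[s2 sk].
case/mapP => k; rewrite mem_iota add1n ltnS => kK [-> ->].
exists (iB r s), k; split => //.
have sn := leq_trans sk (kk_le r1).
case: (ltngtP r 1%N) r1 => // [r2|r1'] _; last first.
  by subst r; right; left; exists s; rewrite s2 sn.
by right; right; right; exists r, s; rewrite r2 rL s2 sn.
Qed.

Lemma init_a i a : (i, a) \in l -> a = aof i.
Proof. by move=> /init_memP[e [k []]]. Qed.

Lemma key_pair i : i \in keys -> (i, aof i) \in l.
Proof. by case/mapP => -[j a] ja /= ->; rewrite -(init_a ja). Qed.

Lemma uniq_keys : uniq keys.
Proof.
rewrite /keys map_cat cat_uniq !map_bindl; apply/and3P; split.
- apply: (uniq_bindl (g := fun z => nth 0%N z 1)); rewrite ?iota_uniq//; last first.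
    move=> r z _ /mapP[[i a] + ->] /=.
    case/mem_bindl => x _ /mem_bindl[y _ /mem_bindl[s1 _ /mem_bindl[s _ /mapP[k _ [-> _]]]]] //.
  move=> r _; rewrite map_bindl.
  apply: (uniq_bindl (g := fun z => nth 0%N z 2)); rewrite ?iota_uniq//; last first.
    move=> x z _ /mapP[[i a] + ->] /=.
    case/mem_bindl => y _ /mem_bindl[s1 _ /mem_bindl[s _ /mapP[k _ [-> _]]]] //.
  move=> x _; rewrite map_bindl.
  apply: (uniq_bindl (g := fun z => nth 0%N z 3)); rewrite ?iota_uniq//; last first.
    move=> y z _ /mapP[[i a] + ->] /=.
    case/mem_bindl => s1 _ /mem_bindl[s _ /mapP[k _ [-> _]]] //.
  move=> y _; rewrite map_bindl.
  apply: (uniq_bindl (g := fun z => nth 0%N z 4)); rewrite ?iota_uniq//; last first.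
    move=> s1 z _ /mapP[[i a] + ->] /=.
    case/mem_bindl => s _ /mapP[k _ [-> _]] //.
  move=> s1 _; rewrite map_bindl.
  apply: (uniq_bindl (g := fun z => nth 0%N z 5)); rewrite ?iota_uniq//; last first.
    by move=> s z _ /mapP[[i a] + ->] /= => /mapP[k _ [-> _]].
  move=> s _; rewrite -map_comp map_inj_uniq ?iota_uniq//.
  by move=> k k' /= [].
- apply/hasPn => z /mem_bindl[r _ /mapP[[i a] + ->]] /=.
  case/mem_bindl => s _ /mapP[k _ [-> _]].
  apply/negP => /mem_bindl[r' _ /mapP[[i' a'] + /= e']].
  case/mem_bindl => x _ /mem_bindl[y _ /mem_bindl[s1 _ /mem_bindl[s' _ /mapP[k' _ [ei _]]]]].
  by move: e'; rewrite ei.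
- apply: (uniq_bindl (g := fun z => nth 0%N z 1)); rewrite ?iota_uniq//; last first.
    move=> r z _ /mapP[[i a] + ->] /=.
    case/mem_bindl => s _ /mapP[k _ [-> _]] //.
  move=> r _; rewrite map_bindl.
  apply: (uniq_bindl (g := fun z => nth 0%N z 2)); rewrite ?iota_uniq//; last first.
    by move=> s z _ /mapP[[i a] + ->] /= => /mapP[k _ [-> _]].
  move=> s _; rewrite -map_comp map_inj_uniq ?iota_uniq//.
  by move=> k k' /= [].
Qed.

Lemma mem_keys_W r t1 t2 s1 s k : (1 <= r <= L)%N -> (1 <= t1 <= M r)%N -> (1 <= t2 <= M r)%N ->
  (1 <= s1 <= kk r.-1)%N -> (1 <= s <= kk r)%N -> (1 <= k <= K)%N ->
  rcons (iW r t1 t2 s1 s) k \in keys.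
Proof.
move=> hr h1 h2 hs1 hs hk; apply/mapP.
exists (rcons (iW r t1 t2 s1 s) k, if r == 1%N then a1 else a2) => //.
rewrite mem_cat; apply/orP; left.
have mi (x n : nat) : (1 <= x <= n)%N -> x \in iota 1 n by rewrite mem_iota add1n ltnS.
apply/mem_bindl; exists r; first exact: mi.
apply/mem_bindl; exists t1; first exact: mi.
apply/mem_bindl; exists t2; first exact: mi.
apply/mem_bindl; exists s1; first exact: mi.
apply/mem_bindl; exists s; first exact: mi.
by apply/mapP; exists k; first exact: mi.
Qed.

Lemma mem_keys_B r s k : (1 <= r <= L)%N -> (1 <= s <= kk r)%N -> (1 <= k <= K)%N ->
  rcons (iB r s) k \in keys.
Proof.
move=> hr hs hk; apply/mapP.
exists (rcons (iB r s) k, if r == 1%N then a1 else a2) => //.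
rewrite mem_cat; apply/orP; right.
have mi (x n : nat) : (1 <= x <= n)%N -> x \in iota 1 n by rewrite mem_iota add1n ltnS.
apply/mem_bindl; exists r; first exact: mi.
apply/mem_bindl; exists s; first exact: mi.
by apply/mapP; exists k; first exact: mi.
Qed.

(** The number of first-layer weights of one network. Each contributes a factor of order n^tau to
    the inverse probability of a box, and tau * N1 = 2 kappa^2; the weights counted by [N2]
    contribute constant factors. *)
Definition N1 : nat := (nin kappa * (kappa ^ 2).+1)%N.
Definition N2 : nat := size (idx kappa L).

Lemma count_layer1 k : (count (fun i => (last 0%N i == k) && (nth 0%N i 1 == 1%N)) keys <= N1)%N.
Proof.
have -> : N1 = size (map (rcons^~ k) (idx_1 kappa ++ [seq iB 1 s | s <- iota 1 (nin kappa)])).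
  rewrite size_map size_cat !size_map size_allpairs -cardE card_prod card_ord.
  by rewrite mulnn !size_iota /N1 mulnS mulnC addnC.
rewrite -size_filter; apply: uniq_leq_size; first by rewrite filter_uniq// uniq_keys.
move=> i; rewrite mem_filter => /andP[/andP[/eqP lk /eqP n1] /key_pair/init_memP].
case=> e [k' [ie kK _ H]]; move: lk; rewrite ie last_rcons => ek; subst k'.
apply: map_f; rewrite mem_cat; rewrite ie in n1.
case: H => [[p [s [-> _ hs]]]|[[s [-> hs]]|[[r [s1 [s [ee hr _ _]]]]|[r [s [ee hr _]]]]]].
- apply/orP; left; apply/mapP; exists (p, s) => //; apply/allpairsP; exists (p, s); split => //=.
    by rewrite mem_enum.
  by rewrite mem_iota add1n ltnS.
- by apply/orP; right; apply/mapP; exists s => //; rewrite mem_iota add1n ltnS.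
- by move: n1; rewrite ee /= => r1; rewrite r1 in hr.
- by move: n1; rewrite ee /= => r1; rewrite r1 in hr.
Qed.

Lemma count_layer2 k : (count (fun i => (last 0%N i == k) && (nth 0%N i 1 != 1%N)) keys <= N2)%N.
Proof.
have -> : N2 = size (map (rcons^~ k) (idx kappa L)) by rewrite size_map.
rewrite -size_filter; apply: uniq_leq_size; first by rewrite filter_uniq// uniq_keys.
move=> i; rewrite mem_filter => /andP[/andP[/eqP lk /eqP n1] /key_pair/init_memP].
case=> e [k' [ie kK _ H]]; move: lk; rewrite ie last_rcons => ek; subst k'.
apply: map_f; rewrite ie in n1.
case: H => [[p [s [ee _ hs]]]|[[s [ee hs]]|[[r [s1 [s [-> hr h1 hs]]]]|[r [s [-> hr hs]]]]]].
- by move: n1; rewrite ee.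
- by move: n1; rewrite ee.
- exact: mem_idx_w.
- by apply: mem_idx_b => //; case/andP: hr => /ltnW-> ->.
Qed.

End InitList.

(** * Outer weights by importance sampling *)

Section DigitWindow.
Variable R : realType.

(** First digit and length of a window at [c]. A digit has width 2 a / m, so the window covers at
    most tol / 2; the other half of the tolerance pays for rounding [c] down to the grid. *)
Definition bw (a c : R) (m : nat) : nat := Num.truncn ((c + a) * m%:R / (2 * a)).
Definition qw (a tol : R) (m : nat) : nat := Num.truncn (tol * m%:R / (4 * a)).

Lemma digit_window (a c tol : R) (m : nat) : 0 < a -> 0 < tol -> (0 < m)%N ->
  `|c| + tol <= a -> 4 * a <= tol * m%:R ->
  [/\ (0 < qw a tol m)%N, (bw a c m + qw a tol m <= m)%N,
   forall om, (om < qw a tol m)%N -> `|gv a m (bw a c m + om) - c| <= tol &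
   m%:R / (qw a tol m)%:R <= 8 * a / tol].
Proof.
move=> a0 tol0 m0 ca am; have mR : 0 < m%:R :> R by rewrite ltr0n.
have [c1 c2] : - a + tol <= c /\ c <= a - tol.
  have : `|c| <= a - tol by lra.
  by rewrite ler_norml => /andP[? ?]; split; lra.
set x := (c + a) * m%:R / (2 * a); set y := tol * m%:R / (4 * a).
have x0 : 0 <= x by rewrite divr_ge0 ?mulr_ge0//; lra.
have y1 : 1 <= y by rewrite ler_pdivlMr ?mulr_gt0// mul1r.
have /andP[b1 b2] := truncn_itv x0.
have /andP[q1 q2] := truncn_itv (le_trans ler01 y1).
rewrite -/(bw a c m) in b1 b2; rewrite -/(qw a tol m) in q1 q2.
set b := bw a c m in b1 b2 *; set q := qw a tol m in q1 q2 *.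
have q0 : (0 < q)%N.
  by rewrite lt0n; apply/eqP => q0; move: q2; rewrite q0 => /(le_lt_trans y1); rewrite ltxx.
have qR : 1 <= q%:R :> R by rewrite ler1n.
have yE : 2 * a * (y / m%:R) = tol / 2 by rewrite /y; field; rewrite !gt_eqF.
have xE : c = - a + 2 * a * (x / m%:R) by rewrite /x; field; rewrite !gt_eqF.
have am' : 2 * a / m%:R <= tol / 2 by rewrite ler_pdivrMr//; lra.
split => //.
- rewrite -(ler_nat R) natrD (le_trans (lerD b1 q1))//.
  have -> : x + y = (c + a + tol / 2) * m%:R / (2 * a).
    by rewrite /x /y; field; rewrite !gt_eqF.
  rewrite ler_pdivrMr ?mulr_gt0// [leRHS]mulrC ler_wpM2r//; lra.
- move=> om omq; rewrite /gv natrD [X in `|_ - X|]xE.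
  have -> : - a + 2 * a * ((b%:R + om%:R) / m%:R) - (- a + 2 * a * (x / m%:R)) =
    2 * a * (om%:R / m%:R) - 2 * a * ((x - b%:R) / m%:R) by ring.
  have e1 : 2 * a * (om%:R / m%:R) <= tol / 2.
    rewrite -yE ler_wpM2l ?mulr_ge0 ?(ltW a0)// ler_wpM2r ?invr_ge0//.
    by rewrite (le_trans _ q1)// ler_nat ltnW.
  have e2 : 2 * a * ((x - b%:R) / m%:R) <= tol / 2.
    rewrite (le_trans _ am')// ler_wpM2l ?mulr_ge0 ?(ltW a0)// -[leRHS]mul1r.
    by rewrite ler_wpM2r ?invr_ge0//; move: b2; rewrite -natr1; lra.
  have e3 : 0 <= 2 * a * (om%:R / m%:R) by rewrite !mulr_ge0 ?invr_ge0// ltW.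
  have e4 : 0 <= 2 * a * ((x - b%:R) / m%:R).
    by rewrite mulr_ge0 ?mulr_ge0 ?(ltW a0) ?invr_ge0// subr_ge0.
  by rewrite ler_norml; move: e1 e2 e3 e4; set u := _ * (om%:R / _); set v := _ * (_ / _); lra.
- rewrite ler_pdivrMr ?(lt_le_trans ltr01)// mulrAC ler_pdivlMr//.
  have q2' : y <= 2 * q%:R by move: q2 qR; rewrite -natr1; lra.
  have := ler_wpM2l (ltW (mulr_gt0 (ltr0n R 4) a0)) q2'.
  have -> : 4 * a * y = tol * m%:R by rewrite /y; field; rewrite gt_eqF.
  by lra.
Qed.

Lemma sqr_triangle (q z v e : R) : (z - v) ^+ 2 <= e ^+ 2 ->
  (q - v) ^+ 2 <= 2 * (q - z) ^+ 2 + 2 * e ^+ 2.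
Proof. by move=> h; have := sqr_ge0 ((q - z) - (z - v)); nra. Qed.

Lemma prod_le_count (T : Type) (s : seq T) (P Q : pred T) (F : T -> R) (x1 x2 : R) :
  1 <= x1 -> 1 <= x2 ->
  (forall i, P i -> Q i -> 0 <= F i <= x1) -> (forall i, P i -> ~~ Q i -> 0 <= F i <= x2) ->
  0 <= \prod_(i <- s) (if P i then F i else 1) <=
    x1 ^+ count (fun i => P i && Q i) s * x2 ^+ count (fun i => P i && ~~ Q i) s.
Proof.
move=> h1 h2 F1 F2; elim: s => [|i s /andP[IH0 IH]]; first by rewrite big_nil/= mulr1 ler01 lexx.
have x10 : 0 <= x1 by lra.
have x20 : 0 <= x2 by lra.
rewrite big_cons /=; case: (boolP (P i)) => Pi /=; last by rewrite mul1r IH0 !add0n IH.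
case: (boolP (Q i)) => Qi /=; rewrite !(add0n, add1n).
  have /andP[f0 f1] := F1 i Pi Qi; rewrite mulr_ge0//= exprS -mulrA ler_pM//.
have /andP[f0 f1] := F2 i Pi Qi; rewrite mulr_ge0//= exprS mulrCA ler_pM//.
Qed.

End DigitWindow.

(** * Mean and variance of the importance-sampled outer weights *)

Section Outer.
Variables (R : realType) (kappa L K d1 d2 : nat) (p0 : pix kappa).
Hypotheses (k1 : (1 <= kappa)%N) (L2 : (2 <= L)%N) (kd1 : (kappa <= d1)%N) (kd2 : (kappa <= d2)%N).
Hypothesis K1 : (1 <= K)%N.
Local Notation X := (xsp R d1 d2).
Local Notation C := (@cube R d1 d2).
Local Notation J := (pix kappa).
Local Notation nn := ((nin kappa)%:R).
Variables (a1 a2 : R) (m mg : nat) (W A dl1 dl2 t : R).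
Hypotheses (a10 : 0 < a1) (a20 : 0 < a2) (m0 : (0 < m)%N) (mg0 : (0 < mg)%N) (W0 : 0 <= W) (A0 : 0 < A).
Hypotheses (dl10 : 0 < dl1) (dl20 : 0 < dl2).
Hypotheses (Wa : 2 * W + dl1 <= a1) (Aa : nn * A + dl2 <= a2).
Hypotheses (m1 : 4 * a1 <= dl1 * m%:R) (m2 : 4 * a2 <= dl2 * m%:R).
Hypotheses (dl2A : dl2 * (8 * nn) <= A) (t0 : 0 <= t) (tn : t * (8 * nn) <= 1).
Hypothesis tA : expR (- (A / 8)) <= t.
Hypothesis tW : expR (- (W * hh R mg - ((#|J|)%:R + 1) * dl1)) <= t.
Variables (f : 'M[R]_kappa -> R) (pp Cf Fm : R).
Hypotheses (pp0 : 0 <= pp) (Cf0 : 0 <= Cf) (fs : smooth_patch pp Cf f).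
Hypothesis fF : forall u : 'M[R]_kappa, (forall a b, 0 <= u a b <= 1) -> `|f u| <= Fm.

Local Notation ks := (keys kappa L K a1 a2).
Local Notation ao := (aof a1 a2).
Implicit Types (g : {ffun J -> 'I_mg.+3}) (D Om : seq nat -> nat).

Definition tol (i : seq nat) : R := if nth 0%N i 1 == 1%N then dl1 else dl2.

(* Center of the box of initial weights for which a network computes (up to an
   exponentially small error) the indicator of the orthant with corner [g]. *)
Definition ctr g (i : seq nat) : R :=
  if nth 0%N i 1 == 1%N then
    (if i == rcons (iB 1 (nth 0%N i 2)) (last 0%N i) then - (W * thr R mg (g (pixs p0 (nth 0%N i 2))))
     else if (nth 0%N i 2 == (pixs p0 (nth 0%N i 5)).1.+1) &&
             (nth 0%N i 3 == (pixs p0 (nth 0%N i 5)).2.+1) then W else 0)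
  else if nth 0%N i 0 == 2%N then - ((nn - 2^-1) * A) else A.

Lemma ao_gt0 i : 0 < ao i. Proof. by rewrite /aof; case: ifP. Qed.
Lemma tol_gt0 i : 0 < tol i. Proof. by rewrite /tol; case: ifP. Qed.

Lemma ctr_le g i : `|ctr g i| + tol i <= ao i.
Proof.
rewrite /ctr /tol /aof; case: ifP => _; last first.
  have n1 : 1 <= nn :> R by rewrite ler1n /nin muln_gt0 expn_gt0 k1.
  have nA : A <= nn * A by rewrite ler_peMl// ltW.
  have nA' (x : R) : x <= nn * A -> x + dl2 <= a2 by move=> h; rewrite (le_trans _ Aa)// lerD2r.
  case: ifP => _; last by apply: nA'; rewrite ger0_norm// ltW.
  rewrite normrN ger0_norm.
    by apply: nA'; rewrite ler_wpM2r ?(ltW A0)// gerBl invr_ge0.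
  by rewrite mulr_ge0 ?(ltW A0)//; lra.
have w2 (x : R) : `|x| <= 2 * W -> `|x| + dl1 <= a1 by move: Wa; lra.
case: ifP => _; last by case: ifP => _; apply: w2; rewrite ?normr0 ?ger0_norm//; move: W0; lra.
(* Thresholds lie between -1/mg and 1 + 1/mg, hence a bias is at most 2 * W in absolute value. *)
apply: w2; rewrite normrN normrM (ger0_norm W0) mulrC ler_wpM2r//.
set j := g _; have jm : (j <= mg.+2)%N by rewrite -ltnS ltn_ord.
have mR : 1 <= mg%:R :> R by rewrite ler1n.
rewrite /thr normrM [`|hh R mg|]ger0_norm ?invr_ge0// ler_pdivrMr; last lra.
have : j%:R <= mg%:R + 2 :> R by rewrite -natrD addn2 ler_nat.
have : 0 <= j%:R :> R by [].
by rewrite ler_norml; move: mR; lra.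
Qed.

Definition bk (k : nat) g (i : seq nat) : nat :=
  if (i \in ks) && (last 0%N i == k) then bw (ao i) (ctr g i) m else 0%N.
Definition qk (k : nat) (i : seq nat) : nat :=
  if last 0%N i == k then qw (ao i) (tol i) m else m.

Lemma winP g i : [/\ (0 < qw (ao i) (tol i) m)%N, (bw (ao i) (ctr g i) m + qw (ao i) (tol i) m <= m)%N,
   forall om, (om < qw (ao i) (tol i) m)%N ->
     `|gv (ao i) m (bw (ao i) (ctr g i) m + om) - ctr g i| <= tol i &
   m%:R / (qw (ao i) (tol i) m)%:R <= 8 * ao i / tol i].
Proof.
apply: digit_window; [exact: ao_gt0|exact: tol_gt0|exact: m0|exact: ctr_le|].
by rewrite /aof /tol; case: ifP.
Qed.

Definition wh D : wvec R := fun i => if i \in ks then gv (ao i) m (D i) else 0.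

(** Density, with respect to the uniform digits, of the law under which network [k] is uniform on
    the box of corner [g]; keys of other networks contribute 1. *)
Definition ind k g D : R := \prod_(i <- ks)
  (if last 0%N i == k then
     m%:R / (qk k i)%:R * (bk k g i <= D i < bk k g i + qk k i)%N%:R else 1).

Definition rho : R := (8 * a1 / dl1) ^+ N1 kappa * (8 * a2 / dl2) ^+ N2 kappa L.

Lemma ind_itv k g D : 0 <= ind k g D <= rho.
Proof.
have x1 : 1 <= 8 * a1 / dl1 by rewrite ler_pdivlMr// mul1r; move: Wa W0 a10; lra.
have x2 : 1 <= 8 * a2 / dl2.
  have := mulr_ge0 (ler0n R (nin kappa)) (ltW A0).
  by rewrite ler_pdivlMr// mul1r; move: Aa a20; lra.
have := @prod_le_count R _ ks (fun i => last 0%N i == k) (fun i => nth 0%N i 1 == 1%N)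
  (fun i => m%:R / (qk k i)%:R * (bk k g i <= D i < bk k g i + qk k i)%N%:R) _ _ x1 x2.
have F i : last 0%N i == k ->
    0 <= (m%:R : R) / (qk k i)%:R * (bk k g i <= D i < bk k g i + qk k i)%N%:R <= 8 * ao i / tol i.
  move=> ik; have [_ _ _ h] := winP g i.
  rewrite /qk ik mulr_ge0 ?divr_ge0//= (le_trans _ h)//.
  by rewrite ler_piMr ?divr_ge0//; case: (_ <= _ < _)%N.
have F1 i : last 0%N i == k -> nth 0%N i 1 == 1%N ->
    0 <= (m%:R : R) / (qk k i)%:R * (bk k g i <= D i < bk k g i + qk k i)%N%:R <= 8 * a1 / dl1.
  by move=> ik i1; have := F i ik; rewrite /aof /tol i1.
have F2 i : last 0%N i == k -> nth 0%N i 1 != 1%N ->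
    0 <= (m%:R : R) / (qk k i)%:R * (bk k g i <= D i < bk k g i + qk k i)%N%:R <= 8 * a2 / dl2.
  by move=> ik /negbTE i1; have := F i ik; rewrite /aof /tol i1.
move=> /(_ F1 F2)/andP[-> h] /=; apply: (le_trans h).
have y1 : 0 <= 8 * a1 / dl1 by lra.
have y2 : 0 <= 8 * a2 / dl2 by lra.
rewrite /rho ler_pM ?exprn_ge0//; apply: ler_weXn2l => //.
  exact: count_layer1.
exact: count_layer2.
Qed.

Lemma rho_ge0 : 0 <= rho.
Proof. by have /andP[h1 h2] := ind_itv 0%N [ffun=> ord0] (fun=> 0%N); exact: le_trans h1 h2. Qed.

Local Notation Z0 := (fun _ : seq nat => 0%N).
Local Notation Ex H := (favq ks (fun=> m) H Z0).

(** Weighting by the density is the same as drawing an offset inside the box. All boxes have the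
    same side lengths [qk k], so the average on the right runs over the same offsets for every
    corner. *)
Lemma favq_ind k g (H : (seq nat -> nat) -> R) :
  Ex (fun D => ind k g D * H D) = favq ks (qk k) (fun Om => H (fun i => bk k g i + Om i)%N) Z0.
Proof.
have bq i : i \in ks -> (0 < qk k i)%N && (bk k g i + qk k i <= m)%N.
  move=> ik; rewrite /qk /bk ik /=; case: ifP => _; last by rewrite m0 add0n /=.
  by have [-> -> _ _] := winP g i.
rewrite -(@favq_shift R m ks (bk k g) (qk k) H Z0 Z0) ?uniq_keys//; last first.
  by move=> i ik; rewrite /bk (negbTE ik) addn0.
apply: favq_eq => D hD; congr (_ * _); rewrite /ind.
rewrite !big_seq; apply: eq_bigr => i ik; case: ifP => // ilk.
rewrite /qk /bk ilk andbF add0n leq0n /=.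
have -> : (D i < m)%N by case: (hD i) => [/andP[]//|->].
by rewrite mulr1 divff// pnatr_eq0 -lt0n.
Qed.

Lemma ind_mean k g : Ex (ind k g) = 1.
Proof.
have -> : Ex (ind k g) = Ex (fun D => ind k g D * 1) by apply: favq_eq => D _; rewrite mulr1.
rewrite (favq_ind k g (fun=> 1)) favq_cst// => i ik.
by rewrite /qk; case: ifP => // _; have [] := winP [ffun=> ord0] i.
Qed.

Lemma dep_ind k g : dep (fun i => last 0%N i == k) (ind k g).
Proof. by move=> D D' h; apply: eq_bigr => i _; case: ifP => // ik; rewrite (h i ik). Qed.

Definition uD k D : R := K%:R^-1 * \sum_(a : {ffun J -> 'I_mg.+2}) \sum_(e : {ffun J -> bool})
   f (node R a) * sg R e * ind k (ga a e) D.

(** The offset [Om] is common to all corners. This is what allows the alternating sums to cancel for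
    each fixed offset, before averaging. *)
Definition TH k Om g : wvec R := blk (wh (fun i => bk k g i + Om i)%N) k.

Lemma TH_near k Om g e : (forall i, i \in ks -> (Om i < qk k i)%N) -> rcons e k \in ks ->
  `|TH k Om g e - ctr g (rcons e k)| <= tol (rcons e k).
Proof.
move=> hO ke; rewrite /TH /blk /wh ke /bk ke last_rcons eqxx /=.
have [_ _ h _] := winP g (rcons e k); apply: h.
by have := hO _ ke; rewrite /qk last_rcons eqxx.
Qed.

Lemma TH_box k Om g : (1 <= k <= K)%N -> (forall i, i \in ks -> (Om i < qk k i)%N) ->
  inbox L p0 W A dl1 dl2 g (TH k Om g).
Proof.
move=> hk hO; have nr := TH_near g hO.
have L1 : (1 <= 1 <= L)%N by apply/andP; split => //; exact: ltnW.
split.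
- move=> s p hs.
  have /nr : rcons (iW 1 p.1.+1 p.2.+1 1 s) k \in ks.
    by apply: mem_keys_W => //; rewrite ?ltn_ord// kk1.
  rewrite /ctr /tol /=.
  have -> : (p == pixs p0 s) = ((val p.1).+1 == (pixs p0 s).1.+1) && ((val p.2).+1 == (pixs p0 s).2.+1).
    by rewrite !eqSS; case: p => p1 p2; case: (pixs p0 s) => q1 q2.
  by [].
- move=> s hs; have /nr : rcons (iB 1 s) k \in ks by apply: mem_keys_B => //; rewrite kk1.
  by rewrite /ctr /tol /= eqxx opprK.
- move=> r s1 s hr hs1 hs; have r1 : (1 <= r)%N by case/andP: hr => /ltnW.
  have /nr : rcons (iW r 1 1 s1 s) k \in ks.
    apply: mem_keys_W => //; rewrite ?MS ?kk_pred ?kk_vs//.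
    by case/andP: hr => _ ->; rewrite r1.
  have r0 : (r == 1%N) = false by case/andP: hr => r2 _; rewrite gtn_eqF.
  by rewrite /ctr /tol /= r0.
- move=> r s hr hs; have r1 : (1 <= r)%N by case/andP: hr => /ltnW.
  have /nr : rcons (iB r s) k \in ks.
    by apply: mem_keys_B => //; rewrite ?kk_vs//; case/andP: hr => _ ->; rewrite r1.
  have r0 : (r == 1%N) = false by case/andP: hr => r2 _; rewrite gtn_eqF.
  by rewrite /ctr /tol /= r0 opprK.
Qed.

Lemma TH_agree k Om g g' e : (forall s, e = iB 1 s -> g (pixs p0 s) = g' (pixs p0 s)) ->
  TH k Om g e = TH k Om g' e.
Proof.
move=> h; rewrite /TH /blk /wh; case: ifP => // ke; congr gv; congr (_ + _)%N.
rewrite /bk ke last_rcons eqxx /=; congr bw; rewrite /ctr; case: ifP => // _.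
case: ifP => // /eqP; rewrite last_rcons => ee.
by move/eqP: ee; rewrite eqseq_rcons eqxx andbT => /eqP ee; rewrite (h _ ee).
Qed.

Definition eps0 : R := 12 ^+ #|J| * HH kappa mg pp Cf + (2 * mg.+2%:R) ^+ #|J| * (2 * Fm) * t2 kappa L A t
    + Fm * ((2 ^+ #|J| + 1) * t).

Lemma uD_mean k x : (1 <= k <= K)%N -> C x ->
  `|K%:R * Ex (fun D => uD k D * Gp kappa L (blk (wh D) k) x) - avg_pool f x| <= eps0.
Proof.
move=> hk Cx; have KR : K%:R != 0 :> R by rewrite pnatr_eq0 -lt0n.
pose h D := Gp kappa L (blk (wh D) k) x.
pose Q Om := \sum_(a : {ffun J -> 'I_mg.+2}) \sum_(e : {ffun J -> bool})
   f (node R a) * sg R e * Gp kappa L (TH k Om (ga a e)) x.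
have e1 : K%:R * Ex (fun D => uD k D * h D) = favq ks (qk k) Q Z0.
  rewrite -favqZ.
  transitivity (Ex (fun D => \sum_(a : {ffun J -> 'I_mg.+2}) \sum_(e : {ffun J -> bool})
     (f (node R a) * sg R e) * (ind k (ga a e) D * h D))).
    apply: favq_eq => D _; rewrite /uD -[_ * _ * h D]mulrA mulVKf// big_distrl/=.
    apply: eq_bigr => a _; rewrite big_distrl/=; apply: eq_bigr => e _; by rewrite !mulrA.
  rewrite (@favq_sum R _ (index_enum _)); rewrite [RHS](@favq_sum R _ (index_enum _)).
  apply: eq_bigr => a _.
  rewrite (@favq_sum R _ (index_enum _)); rewrite [RHS](@favq_sum R _ (index_enum _)).
  by apply: eq_bigr => e _; rewrite favqZ (favq_ind k (ga a e) h) -favqZ.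
have q0 i : i \in ks -> (0 < qk k i)%N.
  by move=> ik; rewrite /qk; case: ifP => // _; have [] := winP [ffun=> ord0] i.
have QB Om : (forall i, (i \in ks) && (Om i < qk k i)%N \/ Om i = 0%N) -> `|Q Om - avg_pool f x| <= eps0.
  move=> hO'; have hO i : i \in ks -> (Om i < qk k i)%N.
    by move=> ik; case: (hO' i) => [/andP[]//|->]; exact: q0.
  have QE : Q Om = (size (pos kappa d1 d2))%:R^-1 * \sum_(ij <- pos kappa d1 d2)
      \sum_(a : {ffun J -> 'I_mg.+2}) \sum_(e : {ffun J -> bool})
       f (node R a) * sg R e * psi L (TH k Om) (Defs.patch kappa x ij.1 ij.2) (ga a e).
    rewrite exchange_big/= big_distrr/=; apply: eq_bigr => a _.
    rewrite exchange_big/= big_distrr/=; apply: eq_bigr => e _.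
    by rewrite /Gp -big_distrr/= mulrCA.
  rewrite QE avg_poolE -mulrBr -sumrB; apply: mean_norm_le; first exact: pos_gt0.
  move=> ij hij; have y01 := patch01 kd1 kd2 Cx hij.
  have box g : inbox L p0 W A dl1 dl2 g (TH k Om g) by exact: TH_box.
  apply: (bump_approx mg0 L2 A0 W0 (ltW dl20) dl2A t0 tn tA tW box _ y01 pp0 Cf0 fs fF).
  by move=> g g' e; exact: TH_agree.
have -> : K%:R * Ex (fun D => uD k D * h D) - avg_pool f x =
    favq ks (qk k) (fun D => Q D + - avg_pool f x) Z0.
  by rewrite e1 favqD (favq_cst (- avg_pool f x) Z0 q0).
have H1 : favq ks (qk k) (fun D => Q D + - avg_pool f x) Z0 <= eps0.
  rewrite -(favq_cst eps0 Z0 q0); apply: favq_le => D hD.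
  by have := QB D hD; rewrite ler_norml => /andP[].
have H2 : - eps0 <= favq ks (qk k) (fun D => Q D + - avg_pool f x) Z0.
  rewrite -(favq_cst (- eps0) Z0 q0); apply: favq_le => D hD.
  by have := QB D hD; rewrite ler_norml => /andP[].
by rewrite ler_norml H1 H2.
Qed.

Definition NJ : R := (2 * mg.+2%:R) ^+ #|J|.
Definition u2 : R := (Fm * NJ / K%:R) ^+ 2 * rho.

Lemma Fm_ge0 : 0 <= Fm.
Proof. by apply: le_trans (fF (u := 0) _) => // a b; rewrite mxE lexx ler01. Qed.

(** The sum [S] of the densities has mean [NJ], the number of its terms, and is at most NJ * rho; so
    its second moment contains [rho] once and not squared. *)
Lemma uD_sq k : Ex (fun D => uD k D ^+ 2) <= u2.
Proof.
have F0 := Fm_ge0; have KR : 0 < K%:R :> R by rewrite ltr0n.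
have mp i : i \in ks -> (0 < (fun _ : seq nat => m) i)%N by [].
pose S D := \sum_(a : {ffun J -> 'I_mg.+2}) \sum_(e : {ffun J -> bool}) ind k (ga a e) D.
have cst (c : R) : \sum_(a : {ffun J -> 'I_mg.+2}) \sum_(e : {ffun J -> bool}) c = NJ * c.
  rewrite (eq_bigr (fun=> 2 ^+ #|J| * c)); last first.
    by move=> a _; rewrite sumr_const card_ffun card_bool -[LHS]mulr_natl natrX.
  rewrite sumr_const card_ffun card_ord -[LHS]mulr_natl natrX /NJ exprMn; ring.
have S0 D : 0 <= S D.
  by rewrite sumr_ge0// => a _; rewrite sumr_ge0// => e _; have /andP[] := ind_itv k (ga a e) D.
have SN D : S D <= NJ * rho.
  rewrite -cst; apply: ler_sum => a _; apply: ler_sum => e _.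
  by have /andP[] := ind_itv k (ga a e) D.
have uS D : `|uD k D| <= Fm / K%:R * S D.
  rewrite /uD normrM ger0_norm ?invr_ge0// mulrAC mulrC ler_wpM2r ?invr_ge0//.
  rewrite (le_trans (ler_norm_sum _ _ _))// big_distrr/=; apply: ler_sum => a _.
  rewrite (le_trans (ler_norm_sum _ _ _))// big_distrr/=; apply: ler_sum => e _.
  have /andP[i0 _] := ind_itv k (ga a e) D.
  rewrite !normrM sg_norm mulr1 [`|ind _ _ _|]ger0_norm// ler_wpM2r//; apply: fF => i j.
  exact: node_itv.
have ES : Ex S = NJ.
  rewrite /S (@favq_sum R _ (index_enum _)).
  transitivity (\sum_(a : {ffun J -> 'I_mg.+2}) \sum_(e : {ffun J -> bool}) (1 : R)).
    apply: eq_bigr => a _; rewrite (@favq_sum R _ (index_enum _)).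
    by apply: eq_bigr => e _; exact: ind_mean.
  by rewrite cst mulr1.
have -> : u2 = (Fm / K%:R) ^+ 2 * (NJ * rho) * Ex S by rewrite ES /u2; field; rewrite gt_eqF.
rewrite -favqZ; apply: favq_le => D _.
apply: (@le_trans _ _ ((Fm / K%:R * S D) ^+ 2)).
  by rewrite -[leLHS]real_normK ?num_real// lerXn2r ?nnegrE ?mulr_ge0 ?divr_ge0.
by rewrite exprMn -[leRHS]mulrA ler_wpM2l ?sqr_ge0// expr2 ler_wpM2r.
Qed.

Lemma u2_ge0 : 0 <= u2.
Proof. by rewrite mulr_ge0 ?sqr_ge0// rho_ge0. Qed.

Lemma sum_cstK (c : R) : \sum_(1 <= k < K.+1) c = K%:R * c.
Proof. by rewrite sumr_const_nat subSS subn0 mulr_natl. Qed.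

Theorem outer_norm : Ex (fun D => \sum_(1 <= k < K.+1) uD k D ^+ 2) <= K%:R * u2.
Proof.
rewrite favq_sum (@le_trans _ _ (\sum_(1 <= k < K.+1) u2))//; first by apply: ler_sum => k _; exact: uD_sq.
by rewrite sum_cstK.
Qed.

Theorem outer_approx x : C x ->
  Ex (fun D => (fO (@Gp R kappa L d1 d2) K (fun k => uD k D) (wh D) x - avg_pool f x) ^+ 2) <=
    2 * (K%:R * u2) + 2 * eps0 ^+ 2.
Proof.
move=> Cx; have KR : 0 < K%:R :> R by rewrite ltr0n.
have mp i : i \in ks -> (0 < (fun _ : seq nat => m) i)%N by [].
pose xi k D := uD k D * Gp kappa L (blk (wh D) k) x.
pose mu k := Ex (xi k).
have dx k : dep (fun i => last 0%N i == k) (xi k).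
  move=> D D' h; congr (_ * _).
    by congr (_ * _); apply: eq_bigr => a _; apply: eq_bigr => e _; rewrite (dep_ind _ h).
  congr (Gp _ _ _ _); apply/funext => e; rewrite /blk /wh; case: ifP => // _.
  by rewrite (h (rcons e k))// last_rcons.
have V := @favq_var R (index_iota 1 K.+1) ks (fun=> m) xi mu Z0 (iota_uniq _ _) mp
   (fun k _ => dx k) (fun k _ => erefl).
have V2 : \sum_(k <- index_iota 1 K.+1) Ex (fun D => xi k D ^+ 2) <= K%:R * u2.
  rewrite (@le_trans _ _ (\sum_(1 <= k < K.+1) u2))//; last first.
    by rewrite sum_cstK.
  apply: ler_sum => k _; apply: le_trans (uD_sq k); apply: favq_le => D _.
  have /andP[g0 g1] : 0 <= Gp kappa L (blk (wh D) k) x <= 1 by exact: Gp_itv.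
  by rewrite /xi exprMn ler_piMr ?sqr_ge0// exprn_ile1.
have M : `|\sum_(k <- index_iota 1 K.+1) mu k - avg_pool f x| <= eps0.
  have -> : \sum_(k <- index_iota 1 K.+1) mu k - avg_pool f x =
     K%:R^-1 * \sum_(k <- index_iota 1 K.+1) (K%:R * mu k - avg_pool f x).
    by rewrite sumrB -big_distrr/= sum_cstK mulrBr !mulKf ?gt_eqF.
  rewrite -[X in X%:R^-1](_ : size (index_iota 1 K.+1) = K); last by rewrite size_iota subn1.
  apply: mean_norm_le; first by rewrite size_iota subn1.
  by move=> k; rewrite mem_index_iota ltnS => hk; exact: uD_mean.
apply: (@le_trans _ _ (Ex (fun D => 2 * (\sum_(k <- index_iota 1 K.+1) xi k D -
     \sum_(k <- index_iota 1 K.+1) mu k) ^+ 2 + 2 * eps0 ^+ 2))).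
  apply: favq_le => D _; rewrite /fO.
  have -> : \sum_(1 <= k < K.+1) uD k D * Gp kappa L (blk (wh D) k) x =
     \sum_(1 <= k < K.+1) xi k D by [].
  set q := \sum_(1 <= k < K.+1) xi k D.
  set z := \sum_(k <- _) mu k in M *.
  apply: sqr_triangle.
  by rewrite -[leLHS]real_normK ?num_real// lerXn2r ?nnegrE// (le_trans _ M).
rewrite favqD favqZ (favq_cst _ Z0 mp) lerD2r ler_wpM2l//.
exact: le_trans V V2.
Qed.

End Outer.

(** * Risk of the trained classifier *)

Section RiskAlgebra.
Variable R : realType.

(** The factor 1 + 1/n on the loss costs only O(1/n), see [excess_algebra]; the large factor 1 + n
    falls on the drift, which is multiplied by the tiny squared norm of [u]. *)
Lemma sq_young (n y a b : R) : 0 < n ->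
  (y - a) ^+ 2 <= (1 + n^-1) * (y - b) ^+ 2 + (1 + n) * (b - a) ^+ 2.
Proof.
move=> n0; have -> : (1 + n^-1) * (y - b) ^+ 2 + (1 + n) * (b - a) ^+ 2 =
   (y - a) ^+ 2 + n^-1 * (y - b - n * (b - a)) ^+ 2 by field; rewrite gt_eqF.
by rewrite lerDl mulr_ge0 ?sqr_ge0// invr_ge0 ltW.
Qed.

Lemma clip_sq (y a : R) : 0 <= y <= 1 -> (y - clip a) ^+ 2 <= (y - a) ^+ 2.
Proof.
move=> y01; have := clip_dist a y01; rewrite ![`|_ - y|]distrC => h.
rewrite -[leLHS]real_normK ?num_real// -[leRHS]real_normK ?num_real//.
by rewrite lerXn2r ?nnegrE.
Qed.

Lemma clip_lip (a b : R) : `|clip a - clip b| <= `|a - b|.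
Proof.
rewrite /clip /Num.max /Num.min.
case: (ltP 1 a) => a1; case: (ltP 1 b) => b1.
- by rewrite ltr01 subrr normr0.
- rewrite ltr01; case: ltP => b0.
    by rewrite !ger0_norm; lra.
  by rewrite !ger0_norm; lra.
- rewrite ltr01; case: ltP => a0.
    by rewrite !ler0_norm; lra.
  by rewrite !ler0_norm; lra.
- case: (ltP 0 a) => a0; case: (ltP 0 b) => b0 //.
  + by rewrite !ger0_norm; lra.
  + by rewrite !ler0_norm; lra.
  + by rewrite subrr normr0.
Qed.

Lemma sq_close (y a b d : R) : 0 <= y <= 1 -> 0 <= a <= 1 -> 0 <= b <= 1 -> `|a - b| <= d ->
  (y - b) ^+ 2 <= (y - a) ^+ 2 + 2 * d.
Proof.
move=> /andP[y0 y1] /andP[a0 a1] /andP[b0 b1] h.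
have -> : (y - b) ^+ 2 = (y - a) ^+ 2 + (a - b) * ((y - a) + (y - b)) by ring.
rewrite lerD2l (le_trans (ler_norm _))// normrM mulrC ler_pM//.
by rewrite ler_norml; lra.
Qed.

(** Where the rule differs from the Bayes rule, |2 eta - 1| <= 2 |clip h - eta|, and 2 z <= al + z^2
    / al turns this into a squared error. *)
Lemma class_risk (h eta al : R) : 0 <= eta <= 1 -> 0 < al ->
  (if 2^-1 <= h then 1 - eta else eta) <=
    Num.min eta (1 - eta) + al + al^-1 * (clip h - eta) ^+ 2.
Proof.
move=> /andP[e0 e1] al0.
have yg (z : R) : 2 * z <= al + al^-1 * z ^+ 2.
  have -> : al + al^-1 * z ^+ 2 = 2 * z + al^-1 * (al - z) ^+ 2 by field; rewrite gt_eqF.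
  by rewrite lerDl mulr_ge0 ?sqr_ge0// invr_ge0 ltW.
rewrite -addrA; case: ifPn => hh.
  case: (leP 2^-1 eta) => he.
    rewrite min_r; last lra.
    by rewrite lerDl addr_ge0 ?(ltW al0)// mulr_ge0 ?sqr_ge0// invr_ge0 ltW.
  rewrite min_l; last lra.
  have hc : 2^-1 <= clip h.
    by rewrite /clip le_max; apply/orP; right; rewrite le_min hh andbT; lra.
  by have := yg (clip h - eta); set q := al^-1 * _; lra.
rewrite -ltNge in hh.
case: (leP eta 2^-1) => he.
  rewrite min_l; last lra.
  by rewrite lerDl addr_ge0 ?(ltW al0)// mulr_ge0 ?sqr_ge0// invr_ge0 ltW.
rewrite min_r; last lra.
have hc : clip h <= 2^-1 by rewrite /clip ge_max invr_ge0 ler0n /= ge_min (ltW hh) orbT.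
by have := yg (eta - clip h); rewrite -[(eta - _) ^+ 2]sqrrN opprB; set q := al^-1 * _; lra.
Qed.

(** Bounds the expected maximum of N variables with exponential moments at most 1 by ln N + 1,
    without tail integrals. *)
Lemma exp_log_bound (x N : R) : 1 <= N -> x <= ln N + N^-1 * expR x.
Proof.
move=> N1; have N0 : 0 < N by lra.
have -> : N^-1 * expR x = expR (x - ln N) by rewrite expRD expRN lnK ?posrE// mulrC.
by have := expR_ge1Dx (x - ln N); lra.
Qed.

Lemma expR_sum (T : Type) (s : seq T) (g : T -> R) :
  expR (\sum_(z <- s) g z) = \prod_(z <- s) expR (g z).
Proof. by apply: (big_morph _ (@expRD R) (@expR0 R)). Qed.

End RiskAlgebra.

(** * From descent and covering to the expected error *)

Section Risk.
Variables (R : realType) (kappa L K d1 d2 n : nat).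
Hypotheses (k1 : (1 <= kappa)%N) (L2 : (2 <= L)%N) (kd1 : (kappa <= d1)%N) (kd2 : (kappa <= d2)%N).
Hypotheses (K1 : (1 <= K)%N) (n1 : (1 <= n)%N).
Local Notation X := (xsp R d1 d2).
Local Notation C := (@cube R d1 d2).
Local Notation E := (idx kappa L).
Local Notation E2 := (idx_w kappa L).
Local Notation G := (@Gp R kappa L d1 d2).
Local Notation KK := (index_iota 1 K.+1).
Variable mu : probability X R.
Hypothesis muC : mu C = 1%E.
Variable eta : X -> R.
Hypotheses (meta : measurable_fun C eta) (eta01 : forall x, C x -> 0 <= eta x <= 1).
Variables (c4 Cs lam a1 a2 B U : R) (T : nat).
Local Notation P := (netP kappa Cs B L).
Hypotheses (c4_gt0 : 0 < c4) (Cs1 : 1 <= Cs).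
Hypothesis HCs : forall z : R, exists c, `|c| <= Cs /\
    forall h, `|sigmoid (z + h) - sigmoid z - c * h| <= Cs * h ^+ 2.
Hypotheses (B1 : 1 <= B) (U0 : 0 <= U) (lam0 : 0 < lam).
Hypotheses (Qlam : Qc K c4 P U * lam <= 2^-1) (c4lam : 2 * c4 * lam <= 1).
Hypotheses (c4U : c4 * U ^+ 2 = 1) (TB : a2 + Num.sqrt (2 * T%:R * lam) <= B).
Hypothesis Tn : (1 - 2 * c4 * lam) ^+ T <= n%:R^-1.
Variables (q mm lev : nat) (Ct W1 : R).
Hypotheses (mm0 : (0 < mm)%N) (lev0 : (0 < lev)%N) (Ct1 : 1 <= Ct) (W10 : 0 <= W1).
Hypothesis Htaylor : forall z : R, exists p : {poly R}, [/\ (size p <= (q * q).+1)%N,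
    forall i, `|p`_i| <= Ct &
    forall h, `|h| <= 1 -> `|sigmoid (z + h) - p.[h]| <= Ct * `|h| ^+ q.+1].
Hypothesis W1b : a1 + Num.sqrt (2 * T%:R * lam) <= W1.
Hypothesis LV : Lam kappa q Ct B ^+ L * v1 kappa mm W1 <= 1.
Local Notation U1 := (Num.sqrt K%:R * U).
Hypothesis U10 : 0 < U1.
Hypothesis covB : U1 * (L%:R * Lam kappa q Ct B ^+ L * XX kappa L q mm Ct B W1)
   + ((DL L q).+1 ^ kappa ^ 2)%N%:R * (2 * Amax Ct U1 / lev%:R) <= n%:R^-1.

Local Notation nR := (n%:R : R).
Lemma nR_gt0 : 0 < nR. Proof. by rewrite ltr0n. Qed.
Lemma P_ge1 : 1 <= P. Proof. exact: netP_ge1 (le_trans ler01 B1). Qed.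

Lemma drift (u : nat -> R) (w w' : wvec R) (Mx : R) x : C x ->
  (forall k e, k \in KK -> e \in E2 -> `|w (rcons e k)| <= B) ->
  \sum_(k <- KK) nr2 E (sub_w w' w k) <= Mx ->
  (fO G K u w' x - fO G K u w x) ^+ 2 <= 4 * P ^+ 2 * Mx * \sum_(k <- KK) u k ^+ 2.
Proof.
move=> Cx wB hM; have P1 := P_ge1; have P0 := le_trans ler01 P1.
rewrite /fO -sumrB; under eq_bigr => k _ do rewrite -mulrBr.
apply: (le_trans (csq _ _ _)); rewrite mulrC ler_wpM2r//.
  by rewrite sumr_ge0// => k _; exact: sqr_ge0.
apply: (@le_trans _ _ (4 * P ^+ 2 * \sum_(k <- KK) nr2 E (sub_w w' w k))); last first.
  by rewrite ler_wpM2l// mulr_ge0// sqr_ge0.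
rewrite big_distrr/= !big_seq; apply: ler_sum => k kK.
have n0 : 0 <= nr2 E (sub_w w' w k) by rewrite /nr2 sumr_ge0// => e _; exact: sqr_ge0.
have -> : 4 * P ^+ 2 * nr2 E (sub_w w' w k) = (2 * P * nr E (sub_w w' w k)) ^+ 2.
  by rewrite !exprMn /nr sqr_sqrtr//; ring.
rewrite -[leLHS]real_normK ?num_real// lerXn2r ?nnegrE ?mulr_ge0 ?sqrtr_ge0//.
have [a ha] := Gp_expd k1 L2 kd1 kd2 Cs1 HCs (le_trans ler01 B1) Cx (fun e => wB k e kK).
have bE : blk w' k = (fun e => blk w k e + sub_w w' w k e).
  by apply/funext => e; rewrite /blk /sub_w addrC subrK.
case: (leP (nr E (sub_w w' w k)) 1) => hd.
  by rewrite bE; exact: expd_diff ha hd.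
have /andP[g0 g1] : 0 <= G (blk w' k) x <= 1 by exact: Gp_itv.
have /andP[g2 g3] : 0 <= G (blk w k) x <= 1 by exact: Gp_itv.
(* Increments longer than 1 are outside the expansion, but then boundedness of the networks
   suffices. *)
apply: (@le_trans _ _ 1); first by rewrite ler_norml; move: g0 g1 g2 g3; lra.
rewrite -[leLHS]mulr1 ler_pM ?(ltW hd)//; move: P1; lra.
Qed.

Section Sample.
Variables (s : seq (X * bool)) (w0 w1 : wvec R) (u : nat -> R).
Hypotheses (sn : size s = n) (sX : forall z, z \in s -> C z.1).
Hypothesis w0u : forall k, uo w0 k = 0.
Hypothesis w0B : forall k e, k \in KK -> e \in E2 -> `|w0 (rcons e k)| <= a2.
Hypothesis w0W : forall k, k \in KK -> forall (p : pix kappa) r, (1 <= r <= nin kappa)%N ->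
     `|w0 (rcons (iW 1 p.1.+1 p.2.+1 1 r) k)| <= a1.
Hypothesis w01 : \sum_(k <- KK) nr2 E (sub_w w1 w0 k) <= 1.
Local Notation wt t := (iter t (gd_step (FF G K c4 s) lam) w0).
Local Notation wT := (wt T).
(** Price of one unit of the squared norm of [u]: the passage from the current inner weights to
    [w1], with the factor 1 + n of [sq_young], and the regularizer. The number 4 T lam + 2 is twice
    the squared distance travelled plus twice the squared rounding error. *)
Definition cu : R := (1 + nR) * (4 * P ^+ 2 * (4 * T%:R * lam + 2)) + c4.
Local Notation mean F := (nR^-1 * \sum_(z <- s) F z).
Definition sqe (g : X -> R) (z : X * bool) : R := ((z.2 : nat)%:R - g z.1) ^+ 2.

Lemma meanC (c : R) : nR^-1 * \sum_(z <- s) c = c.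
Proof.
rewrite big_const_seq count_predT iter_addr_0 sn -[X in _ * X]mulr_natl mulKf//.
by rewrite gt_eqF// nR_gt0.
Qed.

Lemma FOE u' w : FO G K c4 s u' w = mean (sqe (fO G K u' w)) + c4 * \sum_(k <- KK) u' k ^+ 2.
Proof. by rewrite /FO sn. Qed.

Lemma Gp_itv_fun th x : 0 <= G th x <= 1. Proof. exact: Gp_itv. Qed.

Lemma s_gt0 : (0 < size s)%N. Proof. by rewrite sn. Qed.

Lemma Gp_expd_fun th x : C x -> (forall e, e \in E2 -> `|th e| <= B) ->
  exists a, expd E th P (G^~ x) a.
Proof. by move=> Cx hB; exact: Gp_expd (le_trans ler01 B1) Cx hB. Qed.

Lemma gdst t : (t <= T)%N ->
  [/\ nn E K (sub_w (wt t) w0) <= 2 * T%:R * lam, FF G K c4 s (wt t) <= 1,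
     \sum_(k <- KK) uo (wt t) k ^+ 2 <= U ^+ 2 &
     forall k e, k \in KK -> e \in E2 -> `|wt t (rcons e k)| <= B].
Proof.
move=> tT; exact (gd_state (uniq_idx _ _) (iO_idx _ _) (@idx_w_sub kappa L) Gp_itv_fun K1 c4_gt0 s_gt0 sX
  P_ge1 U0 Gp_expd_fun lam0 Qlam c4U TB w0u w0B tT).
Qed.

Lemma moved t : (t <= T)%N -> \sum_(k <- KK) nr2 E (sub_w w1 (wt t) k) <= 4 * T%:R * lam + 2.
Proof.
move=> tT; have [h _ _ _] := gdst tT.
apply: (@le_trans _ _ (2 * \sum_(k <- KK) nr2 E (sub_w w1 w0 k) + 2 * nn E K (sub_w (wt t) w0))).
  rewrite /nn !big_distrr/= -big_split/=; apply: ler_sum => k _.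
  apply: (@le_trans _ _ (2 * nr2 E (sub_w w1 w0 k) + 2 * nr2 E (sub_w (wt t) w0 k))).
    rewrite /nr2 !big_distrr/= -big_split/=; apply: ler_sum => e _; rewrite /sub_w.
    have := sqr_ge0 ((w1 (rcons e k) - w0 (rcons e k)) + (wt t (rcons e k) - w0 (rcons e k))).
    by move: (w1 _) (w0 _) (wt t _) => x y z; nra.
  by rewrite lerD2l ler_wpM2l// lerDr sqr_ge0.
have h2 : 2 * (2 * T%:R * lam) = 4 * T%:R * lam by ring.
rewrite -h2 addrC lerD ?ler_wpM2l//.
by rewrite -[leRHS]mulr1 ler_wpM2l.
Qed.

Lemma descent : FF G K c4 s wT <=
  (1 + nR^-1) * mean (sqe (fO G K u w1)) + cu * \sum_(k <- KK) u k ^+ 2 + nR^-1.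
Proof.
have n0 := nR_gt0; have P0 := le_trans ler01 P_ge1.
have su0 : 0 <= \sum_(k <- KK) u k ^+ 2 by rewrite sumr_ge0// => k _; exact: sqr_ge0.
have M0 : 0 <= 4 * T%:R * lam + 2 by rewrite addr_ge0// mulr_ge0 ?(ltW lam0)// mulr_ge0.
have c0 : 0 <= cu.
  by rewrite addr_ge0 ?(ltW c4_gt0)// mulr_ge0 ?addr_ge0// mulr_ge0// mulr_ge0// sqr_ge0.
have m0 : 0 <= mean (sqe (fO G K u w1)).
  by rewrite mulr_ge0 ?invr_ge0// sumr_ge0// => z _; exact: sqr_ge0.
set Bd := _ + cu * _.
have Bd0 : 0 <= Bd by rewrite addr_ge0// mulr_ge0// addr_ge0// invr_ge0.
apply: (@le_trans _ _ (Bd + (1 - 2 * c4 * lam) ^+ T)); last by rewrite lerD2l.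
apply: (@gd_final _ _ _ _ _ _ _ _ _ (uniq_idx _ _) (iO_idx _ _) (@idx_w_sub kappa L) Gp_itv_fun K1
  c4_gt0 s_gt0 sX _ _ _ P_ge1 U0 Gp_expd_fun _ _ _ _ lam0 Qlam c4lam c4U TB w0u w0B u _ Bd0).
move=> t tT; have [_ _ _ wB] := gdst tT.
rewrite FOE /Bd /cu [X in _ <= _ + X]mulrDl addrA lerD2r.
set Q := (1 + nR) * _ * _.
have -> : (1 + nR^-1) * mean (sqe (fO G K u w1)) + Q =
   nR^-1 * \sum_(z <- s) ((1 + nR^-1) * sqe (fO G K u w1) z + Q).
  rewrite big_split/= mulrDr meanC; congr (_ + _).
  by rewrite -big_distrr/= mulrCA.
rewrite ler_wpM2l ?invr_ge0// !big_seq; apply: ler_sum => z zs.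
rewrite /sqe; apply: (le_trans (sq_young _ _ (fO G K u w1 z.1) n0)); rewrite lerD2l /Q.
rewrite -[leRHS]mulrA ler_wpM2l ?addr_ge0//.
exact: drift (sX zs) wB (moved tT).
Qed.

Local Notation code := (code kappa L q mm lev).
Definition gg (cd : code) (x : X) : R := clip (avg_code Ct U1 cd x).
Definition vv (cd : code) : R := I mu (fun x => (gg cd x - eta x) ^+ 2).
(** The Bayes risk in closed form; by [rst_le_risk] it is a lower bound for every classifier. *)
Definition rst : R := I mu (fun x => Num.min (eta x) (1 - eta x)).
Definition NN : R := #|code|%:R.

Lemma NN_ge1 : 1 <= NN.
Proof. by rewrite /NN card_code ler1n expn_gt0. Qed.

Lemma bm_clip (g : X -> R) : measurable_fun C g -> bm (fun x => clip (g x)).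
Proof.
move=> mg; split; last by exists 1 => x _; have /andP[? ?] := clip_itv (g x); rewrite ger0_norm.
apply: measurable_maxr; first exact: measurable_cst.
by apply: measurable_minr => //; exact: measurable_cst.
Qed.

Lemma bm_gg cd : bm (gg cd).
Proof. by apply: bm_clip; exact: measurable_avg_code. Qed.

Lemma bm_fO u' w : bm (fO G K u' w).
Proof.
apply: bm_sum => k; apply: bmM; [exact: bm_cst|exact: bm_Gp].
Qed.

Lemma bmin : bm (fun x => Num.min (eta x) (1 - eta x)).
Proof.
split; last first.
  exists 1 => x /eta01 /andP[e0 e1]; rewrite ler_norml le_min ge_min e1 /= andbT.
  by apply/andP; split; lra.
by apply: measurable_minr => //; apply: measurable_funB => //; exact: measurable_cst.
Qed.

Lemma cover_final : exists cd : code, forall x, C x -> `|fO G K (uo wT) wT x - avg_code Ct U1 cd x| <= nR^-1.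
Proof.
have [hn _ hu wB] := gdst (leqnn T).
have L1 : (1 <= L)%N by exact: ltnW.
have h1 : \sum_(k <- KK) `|uo wT k| <= U1.
  apply: (le_trans (sum_le_sqrt _ _)).
  rewrite size_iota subn1 ler_wpM2l ?sqrtr_ge0//.
  rewrite -[leRHS]ger0_norm// -sqrtr_sqr ler_wsqrtr// (le_trans _ hu)//.
  by apply: ler_sum => k _; rewrite real_normK ?num_real.
have h2 k : k \in KK -> forall (p : pix kappa) r, (1 <= r <= nin kappa)%N ->
     `|blk wT k (iW 1 p.1.+1 p.2.+1 1 r)| <= W1.
  move=> kK p r hr; apply: le_trans W1b.
  set e := iW _ _ _ _ _; have eE : e \in E by exact: mem_idx_1.
  have -> : blk wT k e = w0 (rcons e k) + sub_w wT w0 k e by rewrite /blk /sub_w addrC subrK.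
  rewrite (le_trans (ler_normD _ _))// lerD ?w0W//.
  rewrite -sqrtr_sqr ler_wsqrtr// (le_trans _ hn)//.
  apply: le_trans (nn_term_le _ _ kK).
  rewrite (@le_trans _ _ (nr2 E (sub_w wT w0 k)))//; last by rewrite lerDr sqr_ge0.
  rewrite /nr2 (bigD1_seq e) ?uniq_idx//= lerDl sumr_ge0// => *; exact: sqr_ge0.
have h3 k : k \in KK -> forall e, e \in E2 -> `|blk wT k e| <= B by move=> kK e; exact: wB.
have [cd hcd] := @cover R kappa L q mm Ct B W1 mm0 Ct1 B1 W10 k1 Htaylor LV lev U1 lev0 U10 KK (uo wT) (blk wT)
   L1 h1 h2 h3.
exists cd => x Cx.
have -> : fO G K (uo wT) wT x = (size (pos kappa d1 d2))%:R^-1 * \sum_(ij <- pos kappa d1 d2)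
   \sum_(k <- KK) uo wT k * net (blk wT k) (Defs.patch kappa x ij.1 ij.2) L 1.
  rewrite exchange_big/= big_distrr/=; apply: eq_bigr => k _.
  by rewrite /Gp -big_distrr/= mulrCA.
rewrite /avg_code -mulrBr -sumrB; apply: mean_norm_le; first exact: pos_gt0.
move=> ij hij; apply: le_trans covB; apply: hcd; exact: patch01 hij.
Qed.

(** A constant, sums over [s] and products over [s]: the shape that [sample_exp_le] integrates. The
    code approximating the trained network depends on the sample, so [exp_log_bound] replaces the
    worst code by an average over all of them. *)
Definition Vb : R := 8 / nR + 2 * ((1 + nR^-1) * mean (sqe (fO G K u w1))
    - mean (sqe eta) + cu * \sum_(k <- KK) u k ^+ 2) +
  32 / nR * (ln NN + NN^-1 * \sum_(cd : code)
     \prod_(z <- s) expR (16^-1 * (vv cd / 2 - Zg eta (gg cd) z))).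

Lemma Y01 (z : X * bool) : 0 <= ((z.2 : nat)%:R : R) <= 1.
Proof. by case: z.2; rewrite ?lexx ?ler01. Qed.

Lemma mean_mono (F F' : X * bool -> R) : (forall z, z \in s -> F z <= F' z) -> mean F <= mean F'.
Proof.
move=> h; rewrite ler_wpM2l ?invr_ge0// !big_seq; apply: ler_sum => z zs; exact: h.
Qed.

Lemma sq_dev_final : I mu (fun x => (clip (fO G K (uo wT) wT x) - eta x) ^+ 2) <= Vb.
Proof.
have n0 := nR_gt0; have N1 := NN_ge1.
have [cd hcd] := cover_final; set h := fO G K (uo wT) wT in hcd *.
have hg x : C x -> `|clip (h x) - gg cd x| <= nR^-1.
  by move=> Cx; exact: le_trans (clip_lip _ _) (hcd x Cx).
have hge := bm_sqr (bmB (bm_gg cd) (bm_eta meta eta01)).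
have i1 : I mu (fun x => (clip (h x) - eta x) ^+ 2) <= vv cd + 2 * nR^-1.
  have -> : vv cd + 2 * nR^-1 = I mu (fun x => (gg cd x - eta x) ^+ 2 + 2 * nR^-1).
    by rewrite (ID muC hge (bm_cst _ _ _)) (I_cst muC).
  apply: I_le => //.
  - apply: bm_sqr; apply: bmB; last exact: bm_eta.
    by apply: bm_clip; have [] := bm_fO (uo wT) wT.
  - by apply: bmD => //; exact: bm_cst.
  move=> x Cx; rewrite -[(clip _ - _) ^+ 2]sqrrN -[(gg _ _ - _) ^+ 2]sqrrN !opprB.
  apply: sq_close; [exact: eta01|exact: clip_itv|exact: clip_itv|].
  by rewrite distrC hg.
pose Xg := \sum_(z <- s) 16^-1 * (vv cd / 2 - Zg eta (gg cd) z).
(* Solving for [vv cd]: the true squared error becomes twice the empirical excess loss plus a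
   multiple of [Xg], whose exponential has mean at most 1 for a fixed code. *)
have XgE : vv cd = 32 / nR * Xg + 2 * (mean (sqe (gg cd)) - mean (sqe eta)).
  rewrite /Xg -big_distrr/= sumrB.
  have -> : \sum_(z <- s) vv cd / 2 = nR * (vv cd / 2).
    by rewrite -[in RHS](meanC (vv cd / 2)) mulVKf// gt_eqF.
  rewrite -mulrBr -sumrB.
  set S := \sum_(z <- s) _; rewrite -/S; move: S (vv cd) n0; move: nR => nn S v n0.
  by field; rewrite gt_eqF.
have Xle : Xg <= ln NN + NN^-1 * \sum_(cd : code)
     \prod_(z <- s) expR (16^-1 * (vv cd / 2 - Zg eta (gg cd) z)).
  apply: (le_trans (exp_log_bound _ N1)); rewrite lerD2l ler_wpM2l//.
    by rewrite invr_ge0 (le_trans ler01).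
  rewrite /Xg expR_sum [leRHS](bigD1 cd)//= lerDl sumr_ge0// => c _.
  by rewrite prodr_ge0// => z _; exact: expR_ge0.
have mg : mean (sqe (gg cd)) <= mean (sqe h) + 2 * nR^-1.
  rewrite -[2 * nR^-1]meanC -mulrDr -big_split/=; apply: mean_mono => z zs.
  apply: (@le_trans _ _ (((z.2 : nat)%:R - clip (h z.1)) ^+ 2 + 2 * nR^-1)).
    apply: sq_close; [exact: Y01|exact: clip_itv|exact: clip_itv|].
    by apply: hg; exact: sX.
  by rewrite lerD2r clip_sq// Y01.
have mh : mean (sqe h) <= FF G K c4 s wT.
  rewrite /FF FOE -/h lerDl mulr_ge0 ?(ltW c4_gt0)// sumr_ge0// => k _; exact: sqr_ge0.
have dsc := descent.
have X2 : 32 / nR * Xg <= 32 / nR * (ln NN + NN^-1 * \sum_(cd : code)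
     \prod_(z <- s) expR (16^-1 * (vv cd / 2 - Zg eta (gg cd) z))).
  by rewrite ler_wpM2l// divr_ge0.
apply: (le_trans i1); rewrite XgE /Vb.
move: X2 mg mh dsc; set x1 := 32 / nR * Xg; set x2 := 32 / nR * _.
set y1 := mean (sqe (gg cd)); set y2 := mean (sqe h).
set y3 := FF _ _ _ _ _; set y4 := (1 + nR^-1) * _; set y5 := cu * _; set y6 := mean _.
by move: x1 x2 y1 y2 y3 y4 y5 y6 (nR^-1) => *; lra.
Qed.

Lemma risk_le (al : R) : 0 < al ->
  (risk mu eta (fun x : X => (2^-1 <= fO G K (uo wT) wT x)%R) <= (rst + al + al^-1 * Vb)%:E)%E.
Proof.
move=> al0; set h := fO G K (uo wT) wT.
pose F x := Num.min (eta x) (1 - eta x) + al + al^-1 * (clip (h x) - eta x) ^+ 2.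
have bV : bm (fun x => (clip (h x) - eta x) ^+ 2).
  apply: bm_sqr; apply: bmB; last exact: bm_eta.
  by apply: bm_clip; have [] := bm_fO (uo wT) wT.
have bV' : bm (fun x => al^-1 * (clip (h x) - eta x) ^+ 2) by apply: bmM => //; exact: bm_cst.
have bF1 : bm (fun x => Num.min (eta x) (1 - eta x) + al).
  by apply: bmD; [exact: bmin|exact: bm_cst].
have bF : bm F by apply: bmD.
apply: (@le_trans _ _ (\int[mu]_(x in C) (F x)%:E)%E).
  apply: ge0_le_integral_nomeas => x Cx; have /andP[e0 e1] := eta01 Cx.
    by rewrite lee_fin; case: ifP => _ //; rewrite subr_ge0.
  by rewrite lee_fin; apply: class_risk => //; exact: eta01.
rewrite (I_EFin muC bF) lee_fin /F.
rewrite (ID muC bF1 bV') (ID muC bmin (bm_cst _ _ _)) (I_cst muC) (IZ muC _ bV) -/rst.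
by rewrite lerD2l ler_wpM2l ?invr_ge0 ?(ltW al0)// sq_dev_final.
Qed.

End Sample.

Lemma excess_algebra (c m e a : R) : 0 <= c -> 1 <= m -> 0 <= e <= 1 ->
  e * (c * ((1 + m^-1) * (1 - a) ^+ 2 - (1 - e) ^+ 2)) +
  (1 - e) * (c * ((1 + m^-1) * (0 - a) ^+ 2 - (0 - e) ^+ 2)) <= c * (2 * (a - e) ^+ 2 + m^-1).
Proof.
move=> c0 m1 /andP[e0 e1].
have -> : e * (c * ((1 + m^-1) * (1 - a) ^+ 2 - (1 - e) ^+ 2)) +
  (1 - e) * (c * ((1 + m^-1) * (0 - a) ^+ 2 - (0 - e) ^+ 2)) =
  c * ((1 + m^-1) * (a - e) ^+ 2 + m^-1 * (e * (1 - e))) by ring.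
have mi0 : 0 <= m^-1 by rewrite invr_ge0 (le_trans ler01 m1).
have mi1 : m^-1 <= 1 by rewrite invf_le1// (lt_le_trans ltr01 m1).
rewrite ler_wpM2l// lerD//.
  by rewrite ler_wpM2r ?sqr_ge0//; move: mi1; lra.
by rewrite ler_piMr//; move: e0 e1; nra.
Qed.

Lemma bm_sqe g b : bm g -> bm (fun x => sqe g (x, b)).
Proof. by move=> hg; apply: bm_sqr; apply: bmB => //; exact: bm_cst. Qed.

Lemma risk_ge0 g : (0 <= risk mu eta g)%E.
Proof.
apply: integral_ge0 => x Cx; have /andP[e0 e1] := eta01 Cx.
by rewrite lee_fin; case: ifP => _ //; rewrite subr_ge0.
Qed.

Local Notation wTs s w0 := (iter T (gd_step (FF G K c4 s) lam) w0).
Local Notation code := (code kappa L q mm lev).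

(** In the mean, the products in [Vb] become n-th powers of numbers in [0,1] by [Ey_exp_le1], so the
    average over the codes contributes at most 1, whatever their number. *)
Lemma sample_bound (w0 w1 : wvec R) (u : nat -> R) (al : R) : 0 < al ->
  (forall k, uo w0 k = 0) ->
  (forall k e, k \in KK -> e \in E2 -> `|w0 (rcons e k)| <= a2) ->
  (forall k, k \in KK -> forall (p : pix kappa) r, (1 <= r <= nin kappa)%N ->
     `|w0 (rcons (iW 1 p.1.+1 p.2.+1 1 r) k)| <= a1) ->
  \sum_(k <- KK) nr2 E (sub_w w1 w0 k) <= 1 ->
  (sample_exp mu eta n (fun s => risk mu eta
     (fun x : X => (2^-1 <= fO G K (uo (wTs s w0)) (wTs s w0) x)%R)) <=
   (rst + al + al^-1 * ((42 + 32 * ln NN) / nR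
      + 4 * I mu (fun x => (fO G K u w1 x - eta x) ^+ 2)
      + 2 * (cu * \sum_(k <- KK) u k ^+ 2)))%:E)%E.
Proof.
move=> al0 w0u w0B w0W w01; have n0 := nR_gt0; have N1 := NN_ge1.
have n1R : 1 <= nR by rewrite ler1n.
have ai0 : 0 <= al^-1 by rewrite invr_ge0 ltW.
have bf : bm (fO G K u w1) by exact: bm_fO.
have be := bm_eta meta eta01.
set Su := \sum_(k <- KK) u k ^+ 2.
pose c : R := rst + al + al^-1 * (8 / nR + 2 * (cu * Su) + 32 / nR * ln NN).
pose qq (z : X * bool) : R := al^-1 * (2 / nR) * ((1 + nR^-1) * sqe (fO G K u w1) z - sqe eta z).
pose cg (t : code) : R := al^-1 * (32 / nR) * NN^-1.
pose e (t : code) (z : X * bool) : R := expR (16^-1 * (vv t / 2 - Zg eta (gg t) z)).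
have bq : bmb qq.
  move=> b; apply: bmM; first exact: bm_cst.
  apply: bmB; last exact: bm_sqe.
  by apply: bmM; [exact: bm_cst|exact: bm_sqe].
have bge t : bmb (e t).
  move=> b; apply: bm_exp; apply: bmM; first exact: bm_cst.
  by apply: bmB; [exact: bm_cst|apply: bmb_Z => //; exact: bm_gg].
have := @sample_exp_le R d1 d2 mu muC eta meta eta01 code (index_enum code) n
  (fun s => risk mu eta (fun x : X => (2^-1 <= fO G K (uo (wTs s w0)) (wTs s w0) x)%R)) c qq cg e
  bq bge (fun s => risk_ge0 _).
move=> H; apply: (le_trans (H _)).
  move=> s sn sX; apply: (@le_trans _ _ (rst + al + al^-1 * Vb s w1 u)%:E%E); first by apply: risk_le.
  rewrite lee_fin /Vb -/Su.
  rewrite /cg -big_distrr/= /qq -big_distrr/= sumrB -big_distrr/=.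
  set S1 := \sum_(z <- s) sqe (fO _ _ _ _) z; set S2 := \sum_(z <- s) sqe eta z.
  set S3 := \sum_(cd : code) _.
  rewrite /c le_eqVlt; apply/orP; left; apply/eqP; ring.
rewrite lee_fin.
have Eq : nR * Ey mu eta qq <= al^-1 * (4 * I mu (fun x => (fO G K u w1 x - eta x) ^+ 2) + 2 / nR).
  have bd : bm (fun x => (fO G K u w1 x - eta x) ^+ 2) by apply: bm_sqr; exact: bmB.
  have b2 : bm (fun x => 2 * (fO G K u w1 x - eta x) ^+ 2) by apply: bmM => //; exact: bm_cst.
  have b3 : bm (fun x => 2 * (fO G K u w1 x - eta x) ^+ 2 + nR^-1) by apply: bmD => //; exact: bm_cst.
  have : Ey mu eta qq <= I mu (fun x => al^-1 * (2 / nR) * (2 * (fO G K u w1 x - eta x) ^+ 2 + nR^-1)).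
    apply: I_le => //; first exact: bm_Ey.
      by apply: bmM => //; exact: bm_cst.
    move=> x Cx; apply: excess_algebra => //; last exact: eta01.
    by rewrite mulr_ge0// divr_ge0.
  rewrite (IZ muC _ b3) (ID muC b2 (bm_cst _ _ _)) (I_cst muC) (IZ muC _ bd).
  move=> h; apply: (le_trans (ler_wpM2l (ltW n0) h)).
  rewrite le_eqVlt; apply/orP; left; apply/eqP.
  by field; rewrite !gt_eqF.
have Es : \sum_(t : code) cg t * Ey mu eta (e t) ^+ n <= al^-1 * (32 / nR).
  apply: (@le_trans _ _ (\sum_(t : code) cg t)).
    apply: ler_sum => t _.
    have /andP[h0 h1] := Ey_exp_le1 muC meta eta01 (bm_gg t) (fun x _ => clip_itv _) (erefl (vv t)).
    rewrite ler_piMr ?exprn_ile1// mulr_ge0 ?invr_ge0 ?(le_trans ler01 N1)//.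
    by rewrite mulr_ge0// divr_ge0.
  have -> : \sum_(t : code) cg t = al^-1 * (32 / nR) * (NN^-1 * NN).
    by rewrite /cg sumr_const -[LHS]mulr_natr [RHS]mulrA.
  by rewrite mulVf ?mulr1// gt_eqF// (lt_le_trans ltr01 N1).
(* 42 = 8 + 2 + 32: the covering errors in [Vb], the factor 1 + 1/n on the loss, and the average
   over the codes. *)
apply: (le_trans (lerD (lerD (lexx c) Eq) Es)).
rewrite /c le_eqVlt; apply/orP; left; apply/eqP; ring.
Qed.

Lemma favq_I ks Q (F : (seq nat -> nat) -> X -> R) D : (forall D, bm (F D)) ->
  bm (fun x => favq ks Q (fun D => F D x) D) /\
  favq ks Q (fun D => I mu (F D)) D = I mu (fun x => favq ks Q (fun D => F D x) D).
Proof.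
move=> bF; elim: ks D => [|i ks IH] D /=; first by [].
have bs : bm (fun x => \sum_(j < Q i) favq ks Q (fun D => F D x) (updN D i j)).
  by apply: bm_sum => j; have [] := IH (updN D i j).
split; first by apply: bmM => //; exact: bm_cst.
rewrite (IZ muC _ bs) (I_sum muC); last by move=> j; have [] := IH (updN D i j).
by congr (_ * _); apply: eq_bigr => j _; have [] := IH (updN D i j).
Qed.

Variables (m mg : nat) (W A dl1 dl2 t am : R) (p0 : pix kappa).
Hypotheses (a10 : 0 < a1) (a20 : 0 < a2) (m0 : (0 < m)%N) (mg0 : (0 < mg)%N) (W0 : 0 <= W) (A0 : 0 < A).
Hypotheses (dl10 : 0 < dl1) (dl20 : 0 < dl2).
Hypotheses (Wa : 2 * W + dl1 <= a1) (Aa : (nin kappa)%:R * A + dl2 <= a2).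
Hypotheses (m1 : 4 * a1 <= dl1 * m%:R) (m2 : 4 * a2 <= dl2 * m%:R).
Hypotheses (dl2A : dl2 * (8 * (nin kappa)%:R) <= A) (t0 : 0 <= t) (tn : t * (8 * (nin kappa)%:R) <= 1).
Hypothesis tA : expR (- (A / 8)) <= t.
Hypothesis tW : expR (- (W * hh R mg - ((#|pix kappa|)%:R + 1) * dl1)) <= t.
Variables (f : 'M[R]_kappa -> R) (pp Cf Fm : R).
Hypotheses (pp0 : 0 <= pp) (Cf0 : 0 <= Cf) (fs : smooth_patch pp Cf f).
Hypothesis fF : forall u : 'M[R]_kappa, (forall a b, 0 <= u a b <= 1) -> `|f u| <= Fm.
Hypothesis etaE : eta = avg_pool f.
Hypotheses (a1m : a1 <= am) (a2m : a2 <= am).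
Hypothesis round : (K * size E)%:R * (2 * am / m%:R) ^+ 2 <= 1.
Local Notation M := (archM kappa L).
Local Notation kk := (archk kappa L).
Local Notation l := (init_list L K M kk a1 a2).
Local Notation ks := (keys kappa L K a1 a2).
Local Notation u2 := (u2 kappa L K a1 a2 mg dl1 dl2 Fm).
Local Notation eps0 := (eps0 kappa L mg A t pp Cf Fm).
Local Notation Z0 := (fun _ : seq nat => 0%N).

Lemma idx_w_layer e k : e \in E2 -> nth 0%N (rcons e k) 1 == 1%N = false.
Proof.
move=> /allpairsP[[r s] /= [+ _ ->]] /=; rewrite mem_iota.
by case: r => [|[|r]].
Qed.

Definition near_init (w' : wvec R) (D' : seq nat -> nat) := forall i,
  (exists a, [/\ (i, a) \in l, `|w' i| <= a, (D' i < m)%N & `|w' i - gv a m (D' i)| <= 2 * a / m%:R]) \/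
  [/\ i \notin map fst l, w' i = 0 & D' i = 0%N].

Section Near.
Variables (w' : wvec R) (D' : seq nat -> nat).
Hypothesis near : near_init w' D'.

Lemma near_u k : uo w' k = 0.
Proof.
case: (near (rcons iO k)) => [[a [/(init_memP k1)[e [k' [ee _ _ H]]] _ _ _]]|[]//].
have {ee} /rcons_inj[ei _] := ee.
by case: H => [[p [s [H _ _]]]|[[s [H _]]|[[r [s1 [s [H _ _ _]]]]|[r [s [H _ _]]]]]]; rewrite H in ei.
Qed.

Lemma near_B k e : k \in KK -> e \in E2 -> `|w' (rcons e k)| <= a2.
Proof.
move=> _ eE; case: (near (rcons e k)) => [[a [/(init_a k1) -> h _ _]]|[_ -> _]].
  by move: h; rewrite /aof idx_w_layer.
by rewrite normr0 ltW.
Qed.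

Lemma near_W k : k \in KK -> forall (p : pix kappa) r, (1 <= r <= nin kappa)%N ->
     `|w' (rcons (iW 1 p.1.+1 p.2.+1 1 r) k)| <= a1.
Proof.
move=> _ p r _; case: (near (rcons (iW 1 p.1.+1 p.2.+1 1 r) k)) => [[a [/(init_a k1) -> h _ _]]|[_ -> _]] //.
by rewrite normr0 ltW.
Qed.

Lemma near_round : \sum_(k <- KK) nr2 E (sub_w (wh kappa L K a1 a2 m D') w' k) <= 1.
Proof.
apply: le_trans round.
have mR : 0 < m%:R :> R by rewrite ltr0n.
have am0 : 0 <= am by exact: le_trans (ltW a10) a1m.
have i1 i : (wh kappa L K a1 a2 m D' i - w' i) ^+ 2 <= (2 * am / m%:R) ^+ 2.
  case: (near i) => [[a [ia _ _ h]]|[ni -> _]].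
    have ik : i \in ks by apply/mapP; exists (i, a).
    have aE := init_a k1 ia; rewrite /wh ik -aE -sqrrN opprB.
    rewrite -[leLHS]real_normK ?num_real// lerXn2r ?nnegrE ?divr_ge0 ?mulr_ge0//.
    apply: (le_trans h); rewrite ler_wpM2r ?invr_ge0// ler_wpM2l//.
    by rewrite aE /aof; case: ifP.
  by rewrite /wh (negbTE ni) subr0 expr0n /= sqr_ge0.
apply: (@le_trans _ _ (\sum_(k <- KK) \sum_(e <- E) (2 * am / m%:R) ^+ 2)).
  by apply: ler_sum => k _; apply: ler_sum => e _; exact: i1.
rewrite [leLHS](eq_bigr (fun=> (size E)%:R * (2 * am / m%:R) ^+ 2)); last first.
  by move=> k _; rewrite big_const_seq count_predT iter_addr_0 [RHS]mulr_natl.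
by rewrite sum_cstK natrM mulrA.
Qed.

End Near.

Theorem error_bound (al : R) : 0 < al ->
  (cnn_error mu eta n L K M kk c4 a1 a2 lam T <=
   (rst + al + al^-1 * ((42 + 32 * ln NN) / nR + 8 * (K%:R * u2) + 8 * eps0 ^+ 2
      + 2 * (cu * (K%:R * u2))))%:E)%E.
Proof.
move=> al0; have n0 := nR_gt0; have N1 := NN_ge1.
have ai0 : 0 <= al^-1 by rewrite invr_ge0 ltW.
have P0 := le_trans ler01 P_ge1.
have cu0 : 0 <= cu.
  rewrite addr_ge0 ?(ltW c4_gt0)// mulr_ge0 ?addr_ge0// mulr_ge0//.
    by rewrite mulr_ge0// sqr_ge0.
  by rewrite addr_ge0// mulr_ge0 ?(ltW lam0)// mulr_ge0.
have rst0 : 0 <= rst.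
  by apply: I_ge0 => x /eta01 /andP[e0 e1]; rewrite le_min e0 subr_ge0.
have lN : 0 <= ln NN by exact: ln_ge0.
pose uu D k := uD L K p0 a1 a2 m mg W A dl1 dl2 f k D.
pose ww D := wh kappa L K a1 a2 m D.
pose Ih D := I mu (fun x => (fO G K (uu D) (ww D) x - eta x) ^+ 2).
pose Sh D := \sum_(k <- KK) uu D k ^+ 2.
pose c0 := rst + al + al^-1 * ((42 + 32 * ln NN) / nR).
pose H D := (c0 + (al^-1 * 4) * Ih D) + (al^-1 * 2 * cu) * Sh D.
have c00 : 0 <= c0.
  rewrite addr_ge0// ?addr_ge0 ?(ltW al0)// mulr_ge0// divr_ge0// addr_ge0// mulr_ge0//.
have Ih0 D : 0 <= Ih D by apply: I_ge0 => x _; exact: sqr_ge0.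
have Sh0 D : 0 <= Sh D by rewrite sumr_ge0// => k _; exact: sqr_ge0.
have H0 D : 0 <= H D.
  apply: addr_ge0; last by apply: mulr_ge0 => //; apply: mulr_ge0 => //; exact: mulr_ge0.
  by apply: addr_ge0 => //; apply: mulr_ge0 => //; exact: mulr_ge0.
have step : (cnn_error mu eta n L K M kk c4 a1 a2 lam T <= (favq ks (fun=> m) H Z0)%:E)%E.
  rewrite /cnn_error.
  have -> : (fun w0 : wvec R => sample_exp mu eta n (fun s =>
       let wt := iter T (gd_step (Fn L K M kk c4 s) lam) w0 in
       risk mu eta (fun x => (2^-1 <= cnn L K M kk wt x)%R))) =
     (fun w0 => sample_exp mu eta n (fun s => risk mu eta
     (fun x : X => (2^-1 <= fO G K (uo (wTs s w0)) (wTs s w0) x)%R))).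
    apply/funext => w0; congr (sample_exp _ _ _ _); apply/funext => s /=.
    rewrite (FnE k1 L2 kd1 kd2); congr (risk _ _ _); apply/funext => x.
    by rewrite (cnnE k1 L2 kd1 kd2).
  apply: init_exp_le => //.
  - by move=> [i a] /= /(init_a k1) ->; rewrite /aof; case: ifP.
  - by move=> w; apply: sample_exp_ge0 => // s; exact: risk_ge0.
  move=> w' D' hD.
  have := sample_bound (uu D') al0 (near_u hD) (near_B hD) (near_W hD) (near_round hD).
  move=> h; apply: (le_trans h); rewrite lee_fin /H /c0 /Ih /Sh /ww.
  by rewrite le_eqVlt; apply/orP; left; apply/eqP; ring.
apply: (le_trans step); rewrite lee_fin /H.
have mp i : i \in ks -> (0 < (fun _ : seq nat => m) i)%N by [].
rewrite (favqD ks (fun=> m) (fun D => c0 + al^-1 * 4 * Ih D) (fun D => al^-1 * 2 * cu * Sh D)).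
rewrite (favqD ks (fun=> m) (fun=> c0) (fun D => al^-1 * 4 * Ih D)) (favq_cst c0 Z0 mp).
rewrite (favqZ ks (fun=> m) (al^-1 * 4) Ih) (favqZ ks (fun=> m) (al^-1 * 2 * cu) Sh).
have bI D : bm (fun x => (fO G K (uu D) (ww D) x - eta x) ^+ 2).
  by apply: bm_sqr; apply: bmB; [exact: bm_fO|exact: bm_eta].
have hI : favq ks (fun=> m) Ih Z0 <= 2 * (K%:R * u2) + 2 * eps0 ^+ 2.
  have [bfav ->] := favq_I ks (fun=> m) Z0 bI.
  rewrite -(I_cst muC (2 * (K%:R * u2) + 2 * eps0 ^+ 2)); apply: I_le => //; first exact: bm_cst.
  move=> x Cx; rewrite etaE.
  exact: (outer_approx p0 k1 L2 kd1 kd2 K1 a10 a20 m0 mg0 W0 A0 dl10 dl20 Wa Aa m1 m2 dl2A t0 tn tA tW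
    pp0 Cf0 fs fF Cx).
have hS : favq ks (fun=> m) Sh Z0 <= K%:R * u2.
  exact: (outer_norm L p0 k1 K1 a10 a20 m0 mg0 W0 A0 dl10 dl20 Wa Aa m1 m2 fF).
have c10 : 0 <= al^-1 * 4 by rewrite mulr_ge0.
have c20 : 0 <= al^-1 * 2 * cu by rewrite mulr_ge0// mulr_ge0.
apply: (le_trans (lerD (lerD (lexx c0) (ler_wpM2l c10 hI)) (ler_wpM2l c20 hS))).
by rewrite /c0 le_eqVlt; apply/orP; left; apply/eqP; ring.
Qed.

End Risk.

(** * Choice of the parameters *)

Lemma bracket_algebra (R : realType) (b k e c z E e3 cU c4 : R) :
  b <= (42 + 32 * e3) * z -> k <= cU * z -> e <= E * z -> c <= (2 + c4) * cU * z ->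
  b + 8 * k + 8 * e + 2 * c <= (42 + 32 * e3 + 8 * cU + 8 * E + 2 * ((2 + c4) * cU)) * z.
Proof. by lra. Qed.

Lemma u2_algebra (R : realType) (K n z e8 r0 nj F : R) : 0 < K -> 0 < n -> 0 <= z -> 0 <= e8 ->
  0 <= r0 -> z * n ^+ 7 <= K -> nj ^+ 2 <= e8 * n ^+ 2 ->
  K * ((F * nj / K) ^+ 2 * (r0 * z)) <= F ^+ 2 * e8 * r0 / n ^+ 5.
Proof.
move=> K0 n0 z0 e80 r00 Kn NJ2.
have -> : K * ((F * nj / K) ^+ 2 * (r0 * z)) = (F ^+ 2 * nj ^+ 2 * r0 * z) / K.
  by field; rewrite gt_eqF.
rewrite ler_pdivrMr//.
apply: (@le_trans _ _ (F ^+ 2 * e8 * r0 / n ^+ 5 * (z * n ^+ 7))); last first.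
  rewrite ler_wpM2l// divr_ge0 ?exprn_ge0 ?(ltW n0)// mulr_ge0// mulr_ge0// sqr_ge0//.
have -> : F ^+ 2 * e8 * r0 / n ^+ 5 * (z * n ^+ 7) = F ^+ 2 * (e8 * n ^+ 2) * r0 * z.
  by field; rewrite gt_eqF.
by rewrite ler_wpM2r// ler_wpM2r// ler_wpM2l// sqr_ge0.
Qed.

(** From p >= 1/2 the approximation error is at most of order x^(-1/2), so its square is of order
    1/x = n^(-tau); p <= 1 bounds c^p by c. *)
Lemma powR_mesh (R : realType) (c h x p : R) : 1 <= c -> 0 <= h -> h <= x^-1 -> 1 <= x ->
  2^-1 <= p <= 1 -> (c * h) `^ p <= c * (x `^ 2^-1)^-1.
Proof.
move=> c1 h0 hx x1 /andP[p1 p2]; have c0 : 0 <= c by lra.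
have p0 : 0 <= p by lra.
have x0 : 0 < x by lra.
rewrite powRM//; apply: ler_pM; rewrite ?powR_ge0//.
  by rewrite -[leRHS]powRr1// ler_powR.
apply: (@le_trans _ _ (x^-1 `^ p)).
  by apply: ge0_ler_powR => //; rewrite nnegrE invr_ge0 ltW.
rewrite -powR_inv1 ?(ltW x0)// -powRrM -powRN ler_powR//.
by rewrite mulN1r lerN2.
Qed.

Section Rate.
Variables (R : realType) (kappa L d1 d2 n K Ln T : nat).
Hypotheses (k1 : (1 <= kappa)%N) (L2 : (2 <= L)%N) (kd1 : (kappa <= d1)%N) (kd2 : (kappa <= d2)%N).
Local Notation X := (xsp R d1 d2).
Local Notation C := (@cube R d1 d2).
Variable mu : probability X R.
Hypothesis muC : mu C = 1%E.
Variables (f : 'M[R]_kappa -> R) (p Cf Fm : R).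
Hypotheses (p12 : 2^-1 <= p <= 1) (Cf0 : 0 < Cf) (fs : smooth_patch p Cf f).
Hypothesis fF : forall u : 'M[R]_kappa, (forall a b, 0 <= u a b <= 1) -> `|f u| <= Fm.
Hypothesis eta01 : forall x, C x -> 0 <= avg_pool f x <= 1.
Variables (c2 c3 c4 c5 Cs Ct : R) (q : nat).
Hypotheses (c20 : 0 < c2) (c30 : 0 < c3) (c40 : 0 < c4) (c50 : 0 < c5) (c45 : 1 <= 2 * c4 * c5).
Hypothesis Cs1 : 1 <= Cs.
Hypothesis HCs : forall z : R, exists c, `|c| <= Cs /\
    forall h, `|sigmoid (z + h) - sigmoid z - c * h| <= Cs * h ^+ 2.
Hypothesis Ct1 : 1 <= Ct.
Hypothesis Htaylor : forall z : R, exists p : {poly R}, [/\ (size p <= (q * q).+1)%N,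
    forall i, `|p`_i| <= Ct &
    forall h, `|h| <= 1 -> `|sigmoid (z + h) - p.[h]| <= Ct * `|h| ^+ q.+1].
(** [x] stands for n^tau, [y] for a small power of n that absorbs all polylogarithmic factors, and
    [sx] for sqrt x; the resulting rate is y^(2 d + 1) / sx. *)
Variables (x y sx : R).
Local Notation d := (kappa ^ 2)%N.
Local Notation nR := (n%:R : R).
Local Notation KR := (K%:R : R).
Local Notation LR := (Ln%:R : R).
Local Notation TR := (T%:R : R).
Local Notation nk := ((nin kappa)%:R : R).
Local Notation l := (ln (n%:R : R)).
(** [cb] and [cw] add to the initial ranges the distance (2 c5 + 3) l^2 of [sqrtTlam] that the
    descent can travel. *)
Definition cb : R := c2 + 2 * c5 + 3.
Definition cw : R := c3 + 2 * c5 + 3.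
Definition UU : R := Num.sqrt c4^-1.
Definition BB : R := cb * l ^+ 2.
Definition PP : R := netP kappa Cs BB L.
Definition cq : R := 15 * (1 + UU) ^+ 2 + 2 * c4 * (1 + UU).
Definition ccP : R := 2 * cq + 4 * (4 * c5 + 6).
Definition DD : R := ((DL L q).+1 ^ d)%N%:R.
Definition LL : R := Lam kappa q Ct BB ^+ L.
Definition a1 : R := c3 * l ^+ 2 * x.
Definition a2 : R := c2 * l ^+ 2.
Hypotheses (x1 : 1 <= x) (nx : nR = x ^+ d.+1) (y1 : 1 <= y) (sxE : sx = x `^ 2^-1).
Hypotheses (ll1 : 1 <= l) (Kn : nR ^+ (2 * d + 7) <= KR) (LnK : KR * Num.sqrt KR <= LR).
Hypothesis T1 : c5 * l * LR <= TR <= c5 * l * LR + 1.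
Hypothesis FP : ccP * PP ^+ 2 * l <= nR.
Hypothesis FL : (d%:R * cw + UU * L%:R) * (LL * l ^+ 2) <= y.
Hypothesis F6 : 2 * nR * Num.sqrt KR <= y ^+ q.
Hypothesis F7 : 4 * DD * UU * (Ct + 1) <= nR.
Hypothesis F8 : DD * ln (n ^ 2 * K).+1%:R <= y.
Hypotheses (F9a : 3 <= c2 / (16 * nk) * l) (F9b : 3 <= c3 / 16 * l) (F9c : 8 * nk <= nR).
Hypothesis F9d : a2 ^+ L.-1 + 1 <= nR.
Local Notation lam := (LR^-1).

Lemma n_ge1 : 1 <= nR. Proof. by rewrite nx exprn_ege1. Qed.
Lemma n_nat_gt0 : (0 < n)%N. Proof. by have := n_ge1; rewrite ler1n. Qed.
Lemma n_real_gt0 : 0 < nR. Proof. by rewrite ltr0n n_nat_gt0. Qed.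
Lemma x_gt0 : 0 < x. Proof. exact: lt_le_trans x1. Qed.
Lemma ln_n_gt0 : 0 < l. Proof. exact: lt_le_trans ll1. Qed.
Lemma ln_sq_ge1 : 1 <= l ^+ 2. Proof. exact: exprn_ege1. Qed.
Lemma K_ge1 : 1 <= KR. Proof. by apply: le_trans Kn; rewrite exprn_ege1 ?n_ge1. Qed.
Lemma K_gt0 : (0 < K)%N. Proof. by have := K_ge1; rewrite ler1n. Qed.

Lemma sqrtK_n : nR <= Num.sqrt KR.
Proof.
rewrite -[leLHS]ger0_norm ?(ltW n_real_gt0)// -sqrtr_sqr ler_wsqrtr// (le_trans _ Kn)//.
by rewrite ler_weXn2l ?n_ge1// (leq_trans _ (leq_addl _ 7)).
Qed.

Lemma n_Ln : nR <= LR.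
Proof.
apply: le_trans LnK; apply: (le_trans sqrtK_n); rewrite ler_peMl ?sqrtr_ge0// K_ge1//.
Qed.
Lemma Ln_gt0 : 0 < LR. Proof. exact: lt_le_trans n_real_gt0 n_Ln. Qed.
Lemma lam_gt0 : 0 < lam. Proof. by rewrite invr_gt0 Ln_gt0. Qed.
Lemma Tlam : TR * lam <= c5 * l + 1.
Proof.
have /andP[_ h] := T1; rewrite ler_pdivrMr ?Ln_gt0// (le_trans h)// mulrDl mul1r lerD2l.
exact: le_trans n_ge1 n_Ln.
Qed.

Lemma sqrt_le1D (z : R) : 0 <= z -> Num.sqrt z <= z + 1.
Proof.
move=> z0; have z10 : 0 <= z + 1 by lra.
by rewrite -[leRHS]ger0_norm// -sqrtr_sqr ler_wsqrtr//; nra.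
Qed.

Lemma sqrtTlam : Num.sqrt (2 * TR * lam) <= (2 * c5 + 3) * l ^+ 2.
Proof.
have z0 : 0 <= 2 * TR * lam by rewrite mulr_ge0 ?(ltW lam_gt0)// mulr_ge0.
apply: (le_trans (sqrt_le1D z0)); rewrite -mulrA.
have h := Tlam; have h2 : l <= l ^+ 2 by rewrite expr2 ler_peMl// ltW// ln_n_gt0.
have h3 : c5 * l <= c5 * l ^+ 2 by rewrite ler_wpM2l// ltW.
by move: h h3 ln_sq_ge1; set a := TR * lam; set b := c5 * l; lra.
Qed.

Lemma UU_gt0 : 0 < UU. Proof. by rewrite sqrtr_gt0 invr_gt0. Qed.
Lemma cq_ge : 2 * c4 <= cq.
Proof.
have U0 := UU_gt0; rewrite /cq.
have : 0 <= 15 * (1 + UU) ^+ 2 by rewrite mulr_ge0 ?sqr_ge0.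
by have := mulr_ge0 (ltW c40) (ltW U0); lra.
Qed.
Lemma B_ge1 : 1 <= BB.
Proof. by rewrite /BB mulr_ege1 ?ln_sq_ge1// /cb; move: c20 c50; lra. Qed.
Lemma PP_ge1 : 1 <= PP. Proof. exact: netP_ge1 (le_trans ler01 B_ge1). Qed.

Lemma PP_n : 2 * cq * PP ^+ 2 <= nR /\ 4 * (4 * c5 + 6) * l * PP ^+ 2 <= nR.
Proof.
have q0 : 0 <= cq by have := cq_ge; move: c40; lra.
have P0 : 0 <= PP ^+ 2 by exact: sqr_ge0.
have lm : 0 <= l - 1 by rewrite subr_ge0.
have h1 := mulr_ge0 (mulr_ge0 q0 P0) lm.
have h2 : 0 <= cq * PP ^+ 2 by rewrite mulr_ge0.
have h3 : 0 <= c5 * (PP ^+ 2 * l) by rewrite mulr_ge0 ?(ltW c50)// mulr_ge0// ltW// ln_n_gt0.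
have h4 : 0 <= PP ^+ 2 * l by rewrite mulr_ge0// ltW// ln_n_gt0.
by move: FP h1 h2 h3 h4; rewrite /ccP; move: (cq) (PP ^+ 2) => a b; move=> *; split; nra.
Qed.

(** The curvature is at most cq * PP^2 * K, where 2 * cq * PP^2 <= n <= sqrt K; so twice the
    curvature is at most K^(3/2), hence at most L_n. *)
Lemma Qlam : Qc K c4 PP UU * lam <= 2^-1.
Proof.
have U0 := UU_gt0; have P1 := PP_ge1; have K1 := K_ge1.
have q0 : 0 <= cq by have := cq_ge; move: c40; lra.
have PK : 1 <= PP ^+ 2 * KR by rewrite mulr_ege1// exprn_ege1.
rewrite ler_pdivrMr ?Ln_gt0//.
apply: (@le_trans _ _ (cq * (PP ^+ 2 * KR))).
  rewrite /Qc /cq [leRHS]mulrDl -[15 * _ * _ * KR]mulrA lerD2l ler_peMr//.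
  by rewrite mulr_ge0// ?mulr_ge0 ?(ltW c40)//; move: U0; lra.
have [h _] := PP_n.
have : KR * (2 * cq * PP ^+ 2) <= KR * Num.sqrt KR.
  by rewrite ler_wpM2l// (le_trans h sqrtK_n).
move=> h'; have := le_trans h' LnK; move: (cq) (PP ^+ 2) (KR) (LR) => a b c e; lra.
Qed.

Lemma c4lam : 2 * c4 * lam <= 1.
Proof.
rewrite ler_pdivrMr ?Ln_gt0// mul1r; apply: le_trans n_Ln.
have [h _] := PP_n; apply: le_trans h.
have P1 : 1 <= PP ^+ 2 by rewrite exprn_ege1// PP_ge1.
have q0 := cq_ge; have : cq <= cq * PP ^+ 2 by rewrite ler_peMr//; move: c40 q0; lra.
by move: c40 q0; set z := cq * PP ^+ 2; rewrite -[2 * cq * _]mulrA -/z; lra.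
Qed.

Lemma c4U : c4 * UU ^+ 2 = 1.
Proof. by rewrite /UU sqr_sqrtr ?invr_ge0 ?(ltW c40)// mulfV// gt_eqF. Qed.

Lemma weights_le_B : a2 + Num.sqrt (2 * TR * lam) <= BB.
Proof. by have := sqrtTlam; rewrite /a2 /BB /cb; move: (Num.sqrt _) => z; lra. Qed.

(** The contraction over all steps is at most exp (-2 c4 c5 ln n), and this is where c5 >= 1 / (2
    c4) gives 1/n. *)
Lemma contraction_le : (1 - 2 * c4 * lam) ^+ T <= nR^-1.
Proof.
have c0 := c4lam; have e0 : 0 <= 1 - 2 * c4 * lam by rewrite subr_ge0.
apply: (@le_trans _ _ (expR (- (2 * c4 * lam)) ^+ T)).
  by rewrite lerXn2r ?nnegrE ?expR_ge0// (le_trans _ (expR_ge1Dx _)).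
rewrite -expRM_natl -[leRHS](lnK (x := nR^-1)) ?posrE ?invr_gt0 ?n_real_gt0//.
rewrite ler_expR lnV ?posrE ?n_real_gt0// mulrN lerN2.
have /andP[h _] := T1.
have : 2 * c4 * lam * (c5 * l * LR) <= 2 * c4 * lam * TR.
  by rewrite ler_wpM2l// mulr_ge0 ?(ltW lam_gt0)// mulr_ge0// ltW.
have -> : 2 * c4 * lam * (c5 * l * LR) = 2 * c4 * c5 * l by field; rewrite gt_eqF ?Ln_gt0.
have : l <= 2 * c4 * c5 * l by rewrite ler_peMl// ltW// ln_n_gt0.
by rewrite [TR * _]mulrC; exact: le_trans.
Qed.

Definition W1 : R := cw * l ^+ 2 * x.
Lemma weights_le_W1 : a1 + Num.sqrt (2 * TR * lam) <= W1.
Proof.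
have h := sqrtTlam; have l2 := ln_sq_ge1.
have : (2 * c5 + 3) * l ^+ 2 <= (2 * c5 + 3) * l ^+ 2 * x.
  by rewrite ler_peMr// mulr_ge0// ?(le_trans ler01 l2)//; move: c50; lra.
move: h; rewrite /a1 /W1 /cw; move: (Num.sqrt _) (l ^+ 2) => z w; lra.
Qed.
Lemma cw_gt0 : 0 < cw. Proof. by rewrite /cw; move: c30 c50; lra. Qed.
Lemma W1_ge0 : 0 <= W1.
Proof. by rewrite /W1 mulr_ge0 ?(ltW x_gt0)// mulr_ge0 ?sqr_ge0// ltW// cw_gt0. Qed.

(** One factor [y] absorbs the polylogarithmic growth through the layers by [FL], the other makes
    the variation on a cell at most 1/y. *)
Definition mm : nat := (Num.truncn (x * y ^+ 2)).+1.
Lemma mm_itv : x * y ^+ 2 <= mm%:R <= x * y ^+ 2 + 1.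
Proof.
have z0 : 0 <= x * y ^+ 2 by rewrite mulr_ge0 ?sqr_ge0// ltW// x_gt0.
by have /andP[h1 h2] := truncn_itv z0; rewrite /mm (ltW h2)/= -natr1 lerD2r.
Qed.
Lemma mm_gt0 : (0 < mm)%N. Proof. by []. Qed.

Lemma LL_ge1 : 1 <= LL.
Proof. by rewrite exprn_ege1// Lam_ge1// B_ge1. Qed.

Lemma y_gt0 : 0 < y. Proof. exact: lt_le_trans y1. Qed.

Lemma LV' : LL * v1 kappa mm W1 <= y^-1.
Proof.
have /andP[h _] := mm_itv; have mR : 0 < mm%:R :> R by rewrite ltr0n.
have L1 := LL_ge1; have L0 : 0 <= LL by lra.
rewrite /v1 card_pix mulrA mulrA ler_pdivrMr// [leRHS]mulrC ler_pdivlMr ?y_gt0//.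
apply: le_trans h; rewrite /W1.
have -> : LL * d%:R * (cw * l ^+ 2 * x) * y = x * (d%:R * cw * (LL * l ^+ 2) * y) by ring.
rewrite ler_wpM2l ?(ltW x_gt0)// expr2 ler_wpM2r ?(ltW y_gt0)//.
apply: le_trans FL; rewrite mulrDl lerDl mulr_ge0//; first by rewrite mulr_ge0// ltW// UU_gt0.
by rewrite mulr_ge0// sqr_ge0.
Qed.

Lemma LV : Lam kappa q Ct BB ^+ L * v1 kappa mm W1 <= 1.
Proof. by apply: (le_trans LV'); rewrite invf_le1 ?y_gt0. Qed.

Lemma U1_gt0 : 0 < Num.sqrt KR * UU.
Proof. by rewrite mulr_gt0 ?UU_gt0// sqrtr_gt0 (lt_le_trans ltr01 K_ge1). Qed.

Definition lev : nat := (n ^ 2 * K)%N.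
Lemma lev_gt0 : (0 < lev)%N. Proof. by rewrite muln_gt0 expn_gt0 n_nat_gt0 K_gt0. Qed.

(** Half of 1/n goes to each error. The Taylor error is at most sqrt K / y^q, which [F6] controls
    through the order [q]; the quantization error is small thanks to n^2 K levels. *)
Lemma covB : Num.sqrt KR * UU * (L%:R * Lam kappa q Ct BB ^+ L * XX kappa L q mm Ct BB W1)
   + ((DL L q).+1 ^ kappa ^ 2)%N%:R * (2 * Amax Ct (Num.sqrt KR * UU) / lev%:R) <= nR^-1.
Proof.
have n0 := n_real_gt0; have y0' := y_gt0; have K0 : 0 < KR by exact: lt_le_trans K_ge1.
have sK0 : 0 < Num.sqrt KR by rewrite sqrtr_gt0.
have L1 := LL_ge1; have L0 : 0 <= LL by lra.
have h1 : Num.sqrt KR * UU * (L%:R * Lam kappa q Ct BB ^+ L * XX kappa L q mm Ct BB W1) <= (2 * nR)^-1.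
  rewrite /XX -/LL.
  have v0 : 0 <= LL * v1 kappa mm W1 by rewrite mulr_ge0// v1_ge0// W1_ge0.
  have e1 : (LL * v1 kappa mm W1) ^+ q.+1 <= (y ^+ q.+1)^-1.
    by rewrite -exprVn lerXn2r ?nnegrE ?invr_ge0 ?(ltW y0')// LV'.
  have e2 : UU * L%:R * LL <= y.
    apply: le_trans FL; rewrite mulrDl.
    have U0 := ltW UU_gt0.
    have : UU * L%:R * LL <= UU * L%:R * (LL * l ^+ 2).
      by rewrite ler_wpM2l ?mulr_ge0// ler_peMr// ln_sq_ge1.
    have : 0 <= d%:R * cw * (LL * l ^+ 2).
      apply: mulr_ge0; last by apply: mulr_ge0 => //; exact: sqr_ge0.
      by apply: mulr_ge0 => //; exact: ltW cw_gt0.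
    by move: (UU * L%:R * LL) (d%:R * cw * (LL * l ^+ 2)) (UU * L%:R * (LL * l ^+ 2)) => a b c; lra.
  have -> : Num.sqrt KR * UU * (L%:R * LL * (LL * v1 kappa mm W1) ^+ q.+1) =
     Num.sqrt KR * ((UU * L%:R * LL) * (LL * v1 kappa mm W1) ^+ q.+1) by ring.
  apply: (@le_trans _ _ (Num.sqrt KR * (y * (y ^+ q.+1)^-1))).
    rewrite ler_wpM2l ?(ltW sK0)// ler_pM// ?exprn_ge0//.
    by rewrite mulr_ge0// mulr_ge0// ltW// UU_gt0.
  have -> : y * (y ^+ q.+1)^-1 = (y ^+ q)^-1.
    by rewrite exprS invfM mulVKf// gt_eqF.
  rewrite -[leRHS]mul1r ler_pdivrMr ?exprn_gt0// mulrAC ler_pdivlMr ?mulr_gt0// mul1r.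
  by move: F6; rewrite mulrC.
have h2 : ((DL L q).+1 ^ kappa ^ 2)%N%:R * (2 * Amax Ct (Num.sqrt KR * UU) / lev%:R) <= (2 * nR)^-1.
  rewrite -/DD /Amax /lev natrM natrX.
  have -> : DD * (2 * (Num.sqrt KR * UU * (Ct + 1)) / (nR ^+ 2 * KR)) =
     (4 * DD * UU * (Ct + 1)) * (Num.sqrt KR / (2 * nR ^+ 2 * KR)).
    by field; rewrite !gt_eqF.
  apply: (@le_trans _ _ (nR * (Num.sqrt KR / (2 * nR ^+ 2 * KR)))).
    by rewrite ler_wpM2r// divr_ge0 ?(ltW sK0)// mulr_ge0 ?(ltW K0)// mulr_ge0 ?sqr_ge0.
  have -> : nR * (Num.sqrt KR / (2 * nR ^+ 2 * KR)) = (2 * nR)^-1 * (Num.sqrt KR / KR).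
    by field; rewrite !gt_eqF.
  rewrite ler_piMr ?invr_ge0 ?mulr_ge0// ?(ltW n0)// ler_pdivrMr// mul1r.
  rewrite -[leRHS](sqr_sqrtr (ltW K0)) expr2 ler_peMr ?(ltW sK0)//.
  exact: le_trans n_ge1 sqrtK_n.
have -> : nR^-1 = (2 * nR)^-1 + (2 * nR)^-1 by field; rewrite gt_eqF.
exact: lerD.
Qed.


Definition mg : nat := (Num.truncn x).+1.
Lemma mg_itv : x <= mg%:R <= x + 1.
Proof. by have /andP[h1 h2] := truncn_itv (ltW x_gt0); rewrite /mg (ltW h2)/= -natr1 lerD2r. Qed.
Lemma mg_gt0 : (0 < mg)%N. Proof. by []. Qed.

(** The slopes, [AA] here and a1 / 4 in the first layer, leave room for the boxes inside the initial
    ranges. [dl2] is a fixed fraction of [a2], so later layers cost constants. [dl1] may not grow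
    with [x], as the margin of a first-layer unit is of order l^2 only; hence 8 * a1 / dl1 is of
    order [x]. With [tol_exp] = n^(-3) the tails remain of order 1/n after multiplication by the
    number of bump terms and by the layer factor of [F9d], each O(n). *)
Definition AA : R := a2 / (2 * nk).
Definition dl2 : R := AA / (8 * nk).
Definition dl1 : R := c3 * l ^+ 2 / (16 * (d%:R + 1)).
Definition tol_exp : R := (nR ^+ 3)^-1.

Lemma nk_ge1 : 1 <= nk. Proof. by rewrite ler1n /nin muln_gt0 expn_gt0 k1. Qed.
Lemma nk_gt0 : 0 < nk. Proof. exact: lt_le_trans nk_ge1. Qed.
Lemma ln_sq_gt0 : 0 < l ^+ 2. Proof. exact: lt_le_trans ln_sq_ge1. Qed.
Lemma a1_gt0 : 0 < a1. Proof. by rewrite /a1 mulr_gt0 ?x_gt0// mulr_gt0// ln_sq_gt0. Qed.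
Lemma a2_gt0 : 0 < a2. Proof. by rewrite /a2 mulr_gt0// ln_sq_gt0. Qed.
Lemma AA_gt0 : 0 < AA. Proof. by rewrite /AA divr_gt0 ?a2_gt0// mulr_gt0// nk_gt0. Qed.
Lemma dl2_gt0 : 0 < dl2. Proof. by rewrite /dl2 divr_gt0 ?AA_gt0// mulr_gt0// nk_gt0. Qed.
Lemma dim_gt0 : 0 < d%:R + 1 :> R. Proof. by rewrite ltr_wpDl. Qed.
Lemma c3l_gt0 : 0 < c3 * l ^+ 2. Proof. exact: mulr_gt0 c30 ln_sq_gt0. Qed.
Lemma dl1_gt0 : 0 < dl1.
Proof. by apply: divr_gt0; [exact: c3l_gt0|apply: mulr_gt0 => //; exact: dim_gt0]. Qed.

Lemma box1_sub : 2 * (a1 / 4) + dl1 <= a1.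
Proof.
have h : dl1 <= c3 * l ^+ 2 / 2.
  have d16 : 0 < 16 * (d%:R + 1) :> R by apply: mulr_gt0 => //; exact: dim_gt0.
  rewrite /dl1 ler_wpM2l ?(ltW c3l_gt0)// lef_pV2 ?posrE//.
  by have := ler0n R d; move: (d%:R : R) => z; lra.
have : c3 * l ^+ 2 <= a1 by rewrite /a1 ler_peMr// ltW// c3l_gt0.
by move: h; set z := c3 * l ^+ 2; move: dl1 a1 => u v; lra.
Qed.

Lemma box2_sub : nk * AA + dl2 <= a2.
Proof.
have n0 := nk_gt0; have n1 := nk_ge1; have a0 := a2_gt0.
have -> : nk * AA = a2 / 2 by rewrite /AA; field; rewrite gt_eqF.
have h1 : AA <= a2 / 2.
  by rewrite /AA ler_wpM2l ?(ltW a0)// lef_pV2 ?posrE ?mulr_gt0//; lra.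
have h2 : dl2 <= AA.
  by rewrite /dl2 ler_pdivrMr ?mulr_gt0// ler_peMr ?(ltW AA_gt0)//; lra.
by move: h1 h2; lra.
Qed.

Lemma dl2A : dl2 * (8 * nk) <= AA.
Proof. by rewrite /dl2 divfK// gt_eqF// mulr_gt0// nk_gt0. Qed.

Lemma tol_exp_ge0 : 0 <= tol_exp. Proof. by rewrite invr_ge0 exprn_ge0. Qed.

Lemma n_le_exp k : (0 < k)%N -> nR <= nR ^+ k.
Proof. by case: k => // k _; rewrite exprS ler_peMr// exprn_ege1// n_ge1. Qed.

Lemma tol_exp_small : tol_exp * (8 * nk) <= 1.
Proof.
rewrite /tol_exp mulrC ler_pdivrMr ?exprn_gt0 ?n_real_gt0// mul1r (le_trans F9c)// n_le_exp//.
Qed.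

Lemma expR_le_tol z : 3 * l <= z -> expR (- z) <= tol_exp.
Proof.
move=> h; rewrite /tol_exp -exprVn -[nR^-1](lnK (x := nR^-1)) ?posrE ?invr_gt0 ?n_real_gt0//.
rewrite -expRM_natl ler_expR lnV ?posrE ?n_real_gt0// mulrN lerN2 //.
Qed.

Lemma tol_exp_outer : expR (- (AA / 8)) <= tol_exp.
Proof.
apply: expR_le_tol; have := ler_wpM2r (ltW ln_n_gt0) F9a.
have -> : c2 / (16 * nk) * l * l = AA / 8 by rewrite /AA /a2; field; rewrite gt_eqF ?nk_gt0.
by [].
Qed.

Lemma tol_exp_inner : expR (- (a1 / 4 * hh R mg - ((#|pix kappa|)%:R + 1) * dl1)) <= tol_exp.
Proof.
apply: expR_le_tol; rewrite card_pix.
have -> : (d%:R + 1) * dl1 = c3 * l ^+ 2 / 16 by rewrite /dl1; field; rewrite gt_eqF ?dim_gt0.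
have mR : 0 < mg%:R :> R by rewrite ltr0n.
have /andP[_ h2] := mg_itv.
have h3 : c3 * l ^+ 2 / 8 <= a1 / 4 * hh R mg.
  rewrite /hh ler_pdivlMr// /a1.
  have : c3 * l ^+ 2 / 8 * mg%:R <= c3 * l ^+ 2 / 8 * (2 * x).
    rewrite ler_wpM2l ?divr_ge0 ?(ltW c3l_gt0)//.
    by move: h2 x1; lra.
  by move: (c3 * l ^+ 2) => z; lra.
have := ler_wpM2r (ltW ln_n_gt0) F9b.
have -> : c3 / 16 * l * l = c3 * l ^+ 2 / 16 by ring.
by move: h3; set z := c3 * l ^+ 2; set w := _ * hh R mg; lra.
Qed.

(** The number of digits does not enter the final bound, so it may be as large as the windows and
    the rounding require. *)
Lemma digits_ex : exists m, [/\ (0 < m)%N, 4 * a1 <= dl1 * m%:R, 4 * a2 <= dl2 * m%:R &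
  (K * size (idx kappa L))%:R * (2 * (a1 + a2) / m%:R) ^+ 2 <= 1].
Proof.
set s := (K * size (idx kappa L))%N.
have a10 := a1_gt0; have a20 := a2_gt0.
pose z1 := 4 * a1 / dl1; pose z2 := 4 * a2 / dl2; pose z3 := 2 * (a1 + a2) * s%:R.
have z10 : 0 <= z1.
  by apply: divr_ge0; [apply: mulr_ge0 => //; exact: ltW|exact: ltW dl1_gt0].
have z20 : 0 <= z2.
  by apply: divr_ge0; [apply: mulr_ge0 => //; exact: ltW|exact: ltW dl2_gt0].
have z30 : 0 <= z3 by rewrite mulr_ge0// mulr_ge0// addr_ge0// ltW.
pose m := (Num.truncn (z1 + z2 + z3)).+1.
have zz : 0 <= z1 + z2 + z3 by rewrite !addr_ge0.
have /andP[_ hm] := truncn_itv zz; rewrite -/m in hm.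
have mR : 0 < m%:R :> R by rewrite ltr0n.
exists m; split => //.
- by rewrite [leRHS]mulrC -ler_pdivrMr ?dl1_gt0// -/z1; move: hm z20 z30; lra.
- by rewrite [leRHS]mulrC -ler_pdivrMr ?dl2_gt0// -/z2; move: hm z10 z30; lra.
case: (posnP s) => [->|s0]; first by rewrite mul0r.
have sR : 1 <= s%:R :> R by rewrite ler1n.
have h : 2 * (a1 + a2) / m%:R <= s%:R^-1.
  rewrite ler_pdivrMr// [leRHS]mulrC ler_pdivlMr ?(lt_le_trans ltr01)//.
  by rewrite -/z3; move: hm z10 z20; lra.
have h0 : 0 <= 2 * (a1 + a2) / m%:R by rewrite divr_ge0// mulr_ge0// addr_ge0// ltW.
apply: (@le_trans _ _ (s%:R * s%:R^-1 ^+ 2)).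
  by rewrite ler_wpM2l// lerXn2r ?nnegrE ?invr_ge0.
rewrite expr2 mulrA mulfV ?mul1r ?invf_le1//; last by rewrite gt_eqF// (lt_le_trans ltr01).
by rewrite (lt_le_trans ltr01).
Qed.

Lemma cu_le : cu kappa L n c4 Cs lam BB T <= (2 + c4) * nR ^+ 2.
Proof.
rewrite /cu -/PP.
have h1 : 4 * TR * lam + 2 <= (4 * c5 + 6) * l.
  by have := Tlam; rewrite -mulrA; move: ll1 (mulr_gt0 c50 ln_n_gt0); move: (TR * lam) => z; lra.
have P0 : 0 <= PP ^+ 2 by exact: sqr_ge0.
have h2 : 4 * PP ^+ 2 * (4 * TR * lam + 2) <= nR.
  have [_ h] := PP_n; apply: le_trans h.
  have -> : 4 * (4 * c5 + 6) * l * PP ^+ 2 = 4 * PP ^+ 2 * ((4 * c5 + 6) * l) by ring.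
  by rewrite ler_wpM2l// mulr_ge0.
have n1 := n_ge1.
have h3 : (1 + nR) * (4 * PP ^+ 2 * (4 * TR * lam + 2)) <= (1 + nR) * nR.
  by rewrite ler_wpM2l// addr_ge0.
have h4 : nR <= nR ^+ 2 by exact: n_le_exp.
have h5 : c4 * 1 <= c4 * nR ^+ 2 by rewrite ler_wpM2l ?(ltW c40)// exprn_ege1.
have e3 : (1 + nR) * nR = nR + nR ^+ 2 by ring.
by rewrite e3 in h3; move: h3 h4 h5; set z := (1 + nR) * _; move: (nR ^+ 2) => w; lra.
Qed.

Definition Cu : R := Fm ^+ 2 * (8 ^+ d) ^+ 2 *
  ((128 * (d%:R + 1)) ^+ N1 kappa * (128 * nk ^+ 2) ^+ N2 kappa L).

Lemma Cu_ge0 : 0 <= Cu.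
Proof.
apply: mulr_ge0; first by apply: mulr_ge0; exact: sqr_ge0.
apply: mulr_ge0; apply: exprn_ge0; apply: mulr_ge0 => //.
all: first [exact: sqr_ge0 | exact: (ltW dim_gt0)].
Qed.

Lemma NJ_le : NJ R kappa mg <= (8 * x) ^+ d.
Proof.
rewrite /NJ card_pix lerXn2r ?nnegrE ?mulr_ge0 ?(ltW x_gt0)//.
have /andP[_ h2] := mg_itv; rewrite -addn2 natrD.
by move: h2 x1; lra.
Qed.

(** [rho] is of order x^N1 = n^(2 d), the squared number of terms is O(n^2), and K is at least n^(2
    d + 7). Five powers of n remain, two of which are spent on [cu]. *)
Lemma Ku2_le : KR * u2 kappa L K a1 a2 mg dl1 dl2 Fm <= Cu / nR ^+ 5.
Proof.
have K0 : 0 < KR by exact: lt_le_trans K_ge1.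
have n0 := n_real_gt0; have xx0 := x_gt0; have nk0 := nk_gt0; have l20 := ln_sq_gt0; have dd0 := dim_gt0.
have e1 : 8 * a1 / dl1 = 128 * (d%:R + 1) * x.
  rewrite /a1 /dl1; move: (d%:R : R) dd0 (l ^+ 2) l20 => dR dR0 z zz0.
  by field; rewrite !gt_eqF.
have e2 : 8 * a2 / dl2 = 128 * nk ^+ 2.
  have a0 := a2_gt0; rewrite /dl2 /AA; move: (nk) nk0 (a2) a0 => k kk0 w w0.
  by field; rewrite !gt_eqF.
pose r0 : R := (128 * (d%:R + 1)) ^+ N1 kappa * (128 * nk ^+ 2) ^+ N2 kappa L.
have r00 : 0 <= r0.
  by apply: mulr_ge0; apply: exprn_ge0; apply: mulr_ge0 => //; try exact: sqr_ge0; try exact: ltW.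
have rE : rho kappa L a1 a2 dl1 dl2 = r0 * x ^+ N1 kappa.
  by rewrite /rho e1 e2 exprMn /r0 mulrAC.
have xN : x ^+ N1 kappa = nR ^+ (2 * d).
  by rewrite nx -exprM /N1 /nin; congr (_ ^+ _); rewrite mulnC.
have NJ0 : 0 <= NJ R kappa mg by rewrite exprn_ge0// mulr_ge0.
have NJ2 : NJ R kappa mg ^+ 2 <= (8 ^+ d) ^+ 2 * nR ^+ 2.
  apply: (@le_trans _ _ (((8 * x) ^+ d) ^+ 2)).
    by rewrite lerXn2r ?nnegrE ?exprn_ge0 ?mulr_ge0 ?(ltW xx0)// NJ_le.
  rewrite exprMn exprMn ler_wpM2l ?sqr_ge0// lerXn2r ?nnegrE ?exprn_ge0 ?(ltW xx0)//.
  by rewrite nx ler_weXn2l.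
have Kn' := Kn; rewrite exprD in Kn'.
rewrite /u2 rE xN /Cu -/r0.
have z0 : 0 <= nR ^+ (2 * d) by rewrite exprn_ge0.
have e80 : 0 <= (8 ^+ d) ^+ 2 :> R by exact: sqr_ge0.
move: (nR ^+ (2 * d)) z0 Kn' => z z0 Kn'.
move: ((8 ^+ d) ^+ 2 : R) e80 NJ2 => e8 e80 NJ2.
move: (NJ R kappa mg) NJ0 NJ2 => nj NJ0 NJ2.
move: r0 r00 {rE} => r0 r00.
exact: (u2_algebra Fm K0 n0 z0 e80 r00 Kn' NJ2).
Qed.

Lemma sx_itv : 1 <= sx <= x.
Proof.
rewrite sxE; apply/andP; split.
  by rewrite -[leLHS](powRr0 x) ler_powR// invr_ge0.
have h : 2^-1 <= 1 :> R by lra.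
by rewrite -[leRHS]powRr1 ?(ltW x_gt0)// ler_powR.
Qed.
Lemma sx_sq : sx ^+ 2 = x.
Proof. by rewrite sxE -powR_mulrn ?powR_ge0// -powRrM mulVf// powRr1// ltW// x_gt0. Qed.

Lemma HH_le : HH kappa mg p Cf <= Cf * (2 * kappa%:R) * sx^-1.
Proof.
have /andP[pp1 pp2] := p12; have p0 : 0 <= p by rewrite (le_trans _ pp1)// invr_ge0.
have /andP[m1 _] := mg_itv; have mR : 0 < mg%:R :> R by rewrite ltr0n.
have kR : 1 <= 2 * kappa%:R :> R.
  have : 1 <= kappa%:R :> R by rewrite ler1n.
  lra.
have hx : hh R mg <= x^-1 by rewrite /hh lef_pV2 ?posrE ?x_gt0.
have h0 : 0 <= hh R mg by rewrite invr_ge0.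
rewrite /HH -[leRHS]mulrA sxE; apply: ler_wpM2l; first exact: ltW.
exact: powR_mesh kR h0 hx x1 p12.
Qed.

Definition Ce : R := 12 ^+ d * (Cf * (2 * kappa%:R)) + 8 ^+ d * (2 * Fm) + Fm * (2 ^+ d + 1).

Lemma sup_ge0 : 0 <= Fm.
Proof. by apply: le_trans (fF (u := 0) _) => // a b; rewrite mxE lexx ler01. Qed.

Lemma x_le_n : x <= nR.
Proof. by rewrite nx exprS ler_peMr ?(ltW x_gt0)// exprn_ege1. Qed.

Lemma eps_le : 0 <= eps0 kappa L mg AA tol_exp p Cf Fm <= Ce / sx.
Proof.
have F0 := sup_ge0; have n0 := n_real_gt0; have xx0 := x_gt0.
have /andP[s1 sx'] := sx_itv; have s0 : 0 < sx by exact: lt_le_trans s1.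
have ni : nR^-1 <= sx^-1 by rewrite lef_pV2 ?posrE// (le_trans sx' x_le_n).
have t0 := tol_exp_ge0.
have t2E : t2 kappa L AA tol_exp = (a2 ^+ L.-1 + 1) * tol_exp.
  have e : 2 * nk * AA = a2 by rewrite /AA; field; rewrite gt_eqF ?nk_gt0.
  by rewrite /t2 e mulrDl mul1r.
have a20 := ltW a2_gt0.
have t20 : 0 <= t2 kappa L AA tol_exp by rewrite t2E mulr_ge0// addr_ge0// exprn_ge0.
have HH0 : 0 <= HH kappa mg p Cf by rewrite mulr_ge0 ?powR_ge0// ltW.
have m0 : 0 <= (2 * mg.+2%:R) ^+ #|pix kappa| :> R by rewrite exprn_ge0// mulr_ge0.
apply/andP; split.
  rewrite /eps0 !addr_ge0//.
  - by rewrite mulr_ge0// exprn_ge0.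
  - by rewrite mulr_ge0// mulr_ge0// mulr_ge0.
  - by rewrite mulr_ge0// mulr_ge0// addr_ge0// exprn_ge0.
have tn1 : tol_exp <= nR^-1 by rewrite /tol_exp lef_pV2 ?posrE ?exprn_gt0// n_le_exp.
rewrite /eps0 /Ce [leRHS]mulrDl [X in _ <= X + _]mulrDl; apply: lerD; first apply: lerD.
- by rewrite card_pix -mulrA ler_wpM2l ?exprn_ge0// HH_le.
- apply: (@le_trans _ _ (8 ^+ d * (2 * Fm) * nR^-1)); last first.
    by rewrite ler_wpM2l// mulr_ge0 ?exprn_ge0// mulr_ge0.
  have -> : 8 ^+ d * (2 * Fm) * nR^-1 = 8 ^+ d * nR * (2 * Fm) * (nR * tol_exp).
    by rewrite /tol_exp; field; rewrite gt_eqF.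
  rewrite ler_pM// ?mulr_ge0//.
    rewrite ler_wpM2r ?mulr_ge0//; apply: (le_trans NJ_le).
    by rewrite exprMn ler_wpM2l ?exprn_ge0// nx ler_weXn2l.
  by rewrite t2E ler_wpM2r.
- rewrite card_pix mulrA ler_pM// ?mulr_ge0 ?addr_ge0 ?exprn_ge0//.
  exact: le_trans tn1 ni.
Qed.

(** There are at most (3 x y^2)^d cells; the number of coefficients per cell times the logarithm of
    the number of levels is at most [y] by [F8]. *)
Lemma NN_le : ln (NN R kappa L q mm lev) <= 3 ^+ d * x ^+ d * y ^+ (2 * d + 1).
Proof.
have xx0 := x_gt0; have yy0 := y_gt0.
have v1 : 1 <= lev.+1%:R :> R by rewrite ler1n.
have lv0 : 0 <= ln (lev.+1%:R : R) by exact: ln_ge0.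
rewrite /NN card_code natrX lnXn ?(lt_le_trans ltr01)// -[leLHS]mulr_natl natrM natrX -[leLHS]mulrA.
have -> : 3 ^+ d * x ^+ d * y ^+ (2 * d + 1) = (3 * (x * y ^+ 2)) ^+ d * y.
  by rewrite exprMn exprMn -exprM exprD expr1 !mulrA.
rewrite ler_pM ?exprn_ge0 ?mulr_ge0//.
rewrite lerXn2r ?nnegrE ?mulr_ge0 ?sqr_ge0 ?(ltW xx0) ?(ltW yy0)//.
have /andP[_ h] := mm_itv; rewrite -natr1.
have : 1 <= x * y ^+ 2 by rewrite mulr_ege1// exprn_ege1.
by move: h; lra.
Qed.

Definition Crate : R := 1 + (42 + 32 * 3 ^+ d) + 8 * Cu + 8 * Ce ^+ 2 + 2 * ((2 + c4) * Cu).

Theorem rate_bound (p0 : pix kappa) :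
  (cnn_error mu (avg_pool f) n L K (archM kappa L) (archk kappa L) c4 a1 a2 lam T <=
   (rst mu (avg_pool f) + Crate * (y ^+ (2 * d + 1) / sx))%:E)%E.
Proof.
have [m [m0 m1 m2 mr]] := digits_ex.
have /andP[pp1 _] := p12; have pp0 : 0 <= p by rewrite (le_trans _ pp1)// invr_ge0.
have pgt : 0 < p by rewrite (lt_le_trans _ pp1)// invr_gt0.
have /andP[s1 sx'] := sx_itv; have s0 : 0 < sx by exact: lt_le_trans s1.
(* With al = x^(-1/2) the two terms al and al^-1 / x of the risk bound coincide. *)
have al0 : 0 < sx^-1 by rewrite invr_gt0.
have w40 : 0 <= a1 / 4 by rewrite divr_ge0// ltW// a1_gt0.
have am1 : a1 <= a1 + a2 by rewrite lerDl ltW// a2_gt0.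
have am2 : a2 <= a1 + a2 by rewrite lerDr ltW// a1_gt0.
have meta : measurable_fun C (avg_pool f : X -> R) by exact: measurable_avg_pool fs.
have := error_bound k1 L2 kd1 kd2 K_gt0 n_nat_gt0 muC meta eta01 c40 Cs1 HCs B_ge1 (ltW UU_gt0) lam_gt0 Qlam
  c4lam c4U weights_le_B contraction_le mm_gt0 lev_gt0 Ct1 W1_ge0 Htaylor weights_le_W1 LV U1_gt0 covB p0 a1_gt0 a2_gt0 m0 mg_gt0 w40 AA_gt0 dl1_gt0
  dl2_gt0 box1_sub box2_sub m1 m2 dl2A tol_exp_ge0 tol_exp_small tol_exp_outer tol_exp_inner pp0 (ltW Cf0) fs fF erefl am1 am2 mr al0.
move=> h; apply: (le_trans h); rewrite lee_fin -addrA lerD2l invrK.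
have xx0 := x_gt0; have n0 := n_real_gt0; have n1 := n_ge1.
set Y := y ^+ (2 * d + 1).
have Y1 : 1 <= Y by rewrite exprn_ege1.
have xn : nR^-1 <= x^-1 by rewrite lef_pV2 ?posrE// x_le_n.
have xi0 : 0 < x^-1 by rewrite invr_gt0.
have Yx : x^-1 <= Y / x by rewrite ler_peMl// ltW.
have Cu0 := Cu_ge0.
have b1 : (42 + 32 * ln (NN R kappa L q mm lev)) / nR <= (42 + 32 * 3 ^+ d) * (Y / x).
  rewrite ler_pdivrMr//.
  have -> : (42 + 32 * 3 ^+ d) * (Y / x) * nR = 42 * (x ^+ d * Y) + 32 * (3 ^+ d * x ^+ d * Y).
    by rewrite nx exprS; field; rewrite gt_eqF.
  rewrite lerD//; last by rewrite ler_wpM2l// NN_le.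
  by rewrite -[leLHS]mulr1 ler_wpM2l// mulr_ege1// exprn_ege1.
have b2 : KR * u2 kappa L K a1 a2 mg dl1 dl2 Fm <= Cu * (Y / x).
  apply: (le_trans Ku2_le); rewrite ler_wpM2l// (le_trans _ Yx)// (le_trans _ xn)//.
  by rewrite lef_pV2 ?posrE ?exprn_gt0// n_le_exp.
have K20 : 0 <= KR * u2 kappa L K a1 a2 mg dl1 dl2 Fm.
  rewrite mulr_ge0//; exact: (u2_ge0 L K p0 k1 a1_gt0 a2_gt0 m0 mg_gt0 w40 AA_gt0 dl1_gt0 dl2_gt0 box1_sub box2_sub m1 m2 Fm).
have b3 : eps0 kappa L mg AA tol_exp p Cf Fm ^+ 2 <= Ce ^+ 2 * (Y / x).
  have /andP[e0 e1] := eps_le.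
  apply: (@le_trans _ _ ((Ce / sx) ^+ 2)).
    by rewrite lerXn2r ?nnegrE// (le_trans e0 e1).
  by rewrite exprMn exprVn sx_sq ler_wpM2l ?sqr_ge0.
have b4 : cu kappa L n c4 Cs lam BB T * (KR * u2 kappa L K a1 a2 mg dl1 dl2 Fm) <= (2 + c4) * Cu * (Y / x).
  apply: (@le_trans _ _ ((2 + c4) * nR ^+ 2 * (Cu / nR ^+ 5))).
    apply: (@le_trans _ _ ((2 + c4) * nR ^+ 2 * (KR * u2 kappa L K a1 a2 mg dl1 dl2 Fm))).
      by rewrite ler_wpM2r// cu_le.
    by rewrite ler_wpM2l ?Ku2_le// mulr_ge0 ?sqr_ge0// addr_ge0// ltW.
  have -> : (2 + c4) * nR ^+ 2 * (Cu / nR ^+ 5) = (2 + c4) * Cu * (nR ^+ 3)^-1.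
    by field; rewrite gt_eqF.
  rewrite ler_wpM2l//; first by rewrite mulr_ge0// addr_ge0// ltW.
  rewrite (le_trans _ Yx)// (le_trans _ xn)//.
  by rewrite lef_pV2 ?posrE ?exprn_gt0// n_le_exp.
have sY : sx^-1 <= Y / sx by rewrite ler_peMl// ltW.
have eY : sx * (Y / x) = Y / sx by rewrite -sx_sq; field; rewrite gt_eqF.
set b1l := _ / nR in b1 *; set kl := KR * _ in b2 b4 *; set el := eps0 _ _ _ _ _ _ _ _ ^+ 2 in b3 *.
set cl := cu _ _ _ _ _ _ _ _ * kl in b4 *.
have bb := bracket_algebra b1 b2 b3 b4.
apply: (le_trans (lerD sY (ler_wpM2l (ltW s0) bb))).
rewrite mulrCA eY /Crate le_eqVlt; apply/orP; left; apply/eqP; ring.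
Qed.

End Rate.

(** * Asymptotics *)

Section Eventually.
Variable R : realType.

Lemma near_ln (c : R) : \forall n \near \oo, c <= ln (n%:R : R).
Proof.
near=> n.
have h : expR c <= n%:R by near: n; exact: nbhs_infty_ger.
have n0 : 0 < n%:R :> R by exact: lt_le_trans (expR_gt0 c) h.
by rewrite -(expRK c) ler_ln ?posrE ?expR_gt0.
Unshelve. all: by end_near. Qed.

(** Writing n^de as the power k + 1 of exp (de ln n / (k + 1)) bounds it below by a multiple of (ln
    n)^(k + 1); the extra logarithm beats [C]. *)
Lemma near_polylog (C de : R) k : 0 < de ->
  \forall n \near \oo, C * ln (n%:R : R) ^+ k <= n%:R `^ de.
Proof.
move=> de0; pose c := (de / k.+1%:R) ^+ k.+1.
have c0 : 0 < c by rewrite exprn_gt0// divr_gt0.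
near=> n.
have h : C / c <= ln (n%:R : R) by near: n; exact: near_ln.
have l0 : 0 <= ln (n%:R : R) by near: n; exact: near_ln.
have n0 : 0 < n%:R :> R by near: n; exact: nbhs_infty_gtr.
apply: (@le_trans _ _ (c * ln (n%:R : R) ^+ k.+1)).
  by rewrite exprS mulrA ler_wpM2r ?exprn_ge0// mulrC -ler_pdivrMr.
have -> : n%:R `^ de = expR (de * ln n%:R / k.+1%:R) ^+ k.+1.
  rewrite -expRM_natl /powR gt_eqF//; congr expR.
  by rewrite [RHS]mulrC divfK// pnatr_eq0.
rewrite /c -exprMn lerXn2r ?nnegrE ?expR_ge0 ?mulr_ge0 ?invr_ge0 ?(ltW de0)//.
rewrite mulrAC (le_trans _ (expR_ge1Dx _))// lerDr//.
Unshelve. all: by end_near. Qed.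

Lemma powRD_gt (a r s : R) : 0 < a -> a `^ (r + s) = a `^ r * a `^ s.
Proof. by move=> a0; rewrite /powR !gt_eqF// mulrDl expRD. Qed.

Lemma powR32 (a : R) : 0 < a -> a `^ (3 / 2) = a * Num.sqrt a.
Proof.
move=> a0; have -> : 3 / 2 = 1 + 2^-1 :> R by lra.
by rewrite powRD_gt// powRr1 ?powR12_sqrt// ltW.
Qed.

Lemma ccP_ge0 (c4 c5 : R) : 0 < c4 -> 0 < c5 -> 0 <= ccP c4 c5.
Proof.
move=> c40 c50; have U0 := sqrtr_ge0 (c4^-1); rewrite /ccP /cq /UU.
have := sqr_ge0 (1 + Num.sqrt c4^-1).
have := mulr_ge0 (ltW c40) U0.
by move: ((1 + Num.sqrt c4^-1) ^+ 2) => w; lra.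
Qed.

Lemma succ_le_mul (a b n : R) : a <= b -> 1 <= b -> 2 <= n -> a + 1 <= n * b.
Proof. by move=> *; nra. Qed.

(** Polynomial growth in [B] means polylogarithmic growth in n, since [B] is a multiple of (ln
    n)^2. *)
Lemma netP_poly kappa (Cs : R) r : 1 <= Cs -> exists c e, 1 <= c /\
  forall B, 1 <= B -> netP kappa Cs B r <= c * B ^+ e.
Proof.
move=> C1; elim: r => [|r [c [e [c1 H]]]].
  by exists 1, 0%N; split => // B _; rewrite mulr1.
case: r H => [|r] H.
  exists (netP kappa Cs 1 1), 0%N; split; first exact: netP_ge1.
  by move=> B _; rewrite mulr1.
pose k : R := (nin kappa)%:R; have k0 : 0 <= k by [].
exists (5 * Cs * ((4 * k + 1) * c) ^+ 2), (e.+1 * 2)%N; split.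
  have h : 1 <= ((4 * k + 1) * c) ^+ 2 by rewrite exprn_ege1// mulr_ege1//; lra.
  by rewrite mulr_ege1// mulr_ege1//; lra.
move=> B B1; have B0 : 0 <= B by lra.
have p1 := netP_ge1 kappa r.+1 C1 B0; have pH := H B B1.
have -> : netP kappa Cs B r.+2 =
  5 * Cs * (k * (B * netP kappa Cs B r.+1 + 2 * netP kappa Cs B r.+1 + 1) + 1) ^+ 2 by [].
move: (netP kappa Cs B r.+1) p1 pH => p p1 pH.
have z1 : 1 <= c * B ^+ e by exact: le_trans pH.
rewrite [B ^+ (_ * 2)]exprM -[leRHS]mulrA -exprMn [B ^+ e.+1]exprS.
have -> : (4 * k + 1) * c * (B * B ^+ e) = (4 * k + 1) * (c * B ^+ e * B) by ring.
move: (c * B ^+ e) z1 pH => z z1 pH.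
have C50 : 0 <= 5 * Cs by lra.
rewrite ler_wpM2l//.
have zB : z <= z * B by rewrite ler_peMr//; lra.
have pB : B * p <= z * B by rewrite mulrC ler_wpM2r.
have s1 : B * p + 2 * p + 1 <= 4 * (z * B) by lra.
have s0 : 0 <= B * p + 2 * p + 1 by have := mulr_ge0 B0 (le_trans ler01 p1); lra.
have s2 := ler_wpM2l k0 s1; have s3 := mulr_ge0 k0 s0.
rewrite lerXn2r ?nnegrE//.
- by rewrite addr_ge0.
- by rewrite mulr_ge0//; lra.
- by rewrite mulrDl mul1r; lra.
Qed.

Lemma unif_exp_le1 (a : R) (h : R -> \bar R) : (forall v, 0 <= h v)%E -> (forall v, h v <= 1)%E ->
  (unif_exp a h <= 1)%E.
Proof.
move=> h0 h1; case: (ltP 0 a) => a0; last by rewrite /unif_exp ltNge a0 /=; exact: h1.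
apply: (le_trans (@unif_exp_le R a 1 h (fun=> 1) a0 isT _ _ _)) => //.
by rewrite big_ord1 invr1 mulr1.
Qed.

Lemma init_exp_le1 l (G : wvec R -> \bar R) w : (forall w, 0 <= G w)%E -> (forall w, G w <= 1)%E ->
  (init_exp l G w <= 1)%E.
Proof.
move=> G0 G1; elim: l w => [|[i a] l IH] w /=; first exact: G1.
by apply: unif_exp_le1 => v; [exact: init_exp_ge0|exact: IH].
Qed.

Lemma smooth_bounded kappa (p C : R) (f : 'M[R]_kappa -> R) : 0 <= p -> 0 <= C -> smooth_patch p C f ->
  exists F, forall u : 'M[R]_kappa, (forall a b, 0 <= u a b <= 1) -> `|f u| <= F.
Proof.
move=> p0 C0 fs; exists (`|f 0| + C * kappa%:R `^ p) => u u01.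
have z01 (a b : 'I_kappa) : 0 <= (0 : 'M[R]_kappa) a b <= 1 by rewrite mxE lexx ler01.
have -> : f u = f 0 + (f u - f 0) by rewrite addrC subrK.
rewrite (le_trans (ler_normD _ _))// lerD2l (le_trans (fs u 0 u01 z01))// ler_wpM2l//.
apply: ge0_ler_powR => //; rewrite ?nnegrE ?sqrtr_ge0//.
have k0 : 0 <= kappa%:R :> R by [].
rewrite -[leRHS]ger0_norm// -sqrtr_sqr ler_wsqrtr// pair_big/=.
apply: (@le_trans _ _ (\sum_(q : 'I_kappa * 'I_kappa) 1)).
  apply: ler_sum => q _; rewrite mxE subr0.
  by have /andP[h1 h2] := u01 q.1 q.2; rewrite exprn_ile1.
by rewrite sumr_const card_prod card_ord mulnn natrX.
Qed.

End Eventually.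

(** * Bayes lower bound and trivial upper bounds *)

Section TrivialBounds.
Variables (R : realType) (d1 d2 : nat) (mu : probability (xsp R d1 d2) R) (eta : xsp R d1 d2 -> R).
Local Notation C := (@cube R d1 d2).
Hypotheses (muC : mu C = 1%E) (meta : measurable_fun C eta) (eta01 : forall x, C x -> 0 <= eta x <= 1).

Lemma rst_le_risk g : ((rst mu eta)%:E <= risk mu eta g)%E.
Proof.
rewrite /rst -(I_EFin muC (bmin meta eta01)).
apply: ge0_le_integral_nomeas => x Cx; have /andP[e0 e1] := eta01 Cx; rewrite lee_fin.
  by rewrite le_min e0 subr_ge0.
by case: ifP => _; rewrite ge_min lexx ?orbT.
Qed.

Lemma risk_le1 g : (risk mu eta g <= 1)%E.
Proof.
have -> : (1 = \int[mu]_(x in C) (1 : R)%:E :> \bar R)%E.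
  by rewrite (I_EFin muC (bm_cst _ _ 1)) (I_cst muC).
apply: ge0_le_integral_nomeas => x Cx; have /andP[e0 e1] := eta01 Cx; rewrite lee_fin.
  by case: ifP => _ //; rewrite subr_ge0.
by case: ifP => _ //; rewrite lerBlDr lerDl.
Qed.

Lemma cnn_error_le1 n L K M kk c4 a1 a2 lam T : (cnn_error mu eta n L K M kk c4 a1 a2 lam T <= 1)%E.
Proof.
apply: init_exp_le1 => w; first by apply: sample_exp_ge0 => // s; exact: risk_ge0.
have := @sample_exp_le R d1 d2 mu muC eta meta eta01 nat [::] n
  (fun s => risk mu eta (fun x => (2^-1 <= cnn L K M kk (iter T (gd_step (Fn L K M kk c4 s) lam) w) x)%R))
  1 (fun=> 0) (fun=> 0) (fun _ _ => 0) (fun b => bm_cst _ _ 0) (fun _ b => bm_cst _ _ 0)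
  (fun s => risk_ge0 _ eta01 _).
move=> h; apply: (le_trans (h _)).
  by move=> s _ _; rewrite big_nil addr0 big1// addr0; exact: risk_le1.
rewrite big_nil addr0 /Ey (_ : (fun x => _) = (fun=> 0)); last by apply/funext => x; rewrite !mulr0 addr0.
by rewrite (I_cst muC) mulr0 addr0.
Qed.

End TrivialBounds.

Theorem theorem1 (R : realType) (kappa : nat) (p : R) (f : 'M[R]_kappa -> R)
    (L : nat) (K Ln : nat -> nat) (c2 c3 c4 c5 : R) :
  (1 <= kappa)%N ->
  2^-1 <= p <= 1 ->
  (exists C : R, 0 < C /\ smooth_patch p C f) ->
  (2 <= L)%N ->
  (fun n : nat => (K n)%:R / (n%:R : R) ^+ (2 * kappa ^ 2 + 7)) @ \oo --> +oo ->
  (exists rho : R, 0 < rho /\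
     (fun n : nat => (K n)%:R / (n%:R : R) `^ rho) @ \oo --> 0%R) ->
  (forall n : nat,
     (ln (n%:R : R)) ^+ (6 * L + 2) * (K n)%:R `^ (3 / 2) <= (Ln n)%:R) ->
  0 < c2 -> 0 < c3 -> 0 < c4 ->
  (2 * c4)^-1 <= c5 ->
  forall eps : R, 0 < eps ->
  exists c6 : R, 0 < c6 /\
  forall (d1 d2 : nat) (mu : probability (xsp R d1 d2) R),
    (1 < d1)%N -> (1 < d2)%N -> (kappa <= minn d1 d2)%N ->
    mu (@cube R d1 d2) = 1%E ->
    (forall x, @cube R d1 d2 x -> 0 <= avg_pool f x <= 1) ->
    forall n : nat, (1 <= n)%N ->
    let tau : R := (1 + (kappa ^ 2)%:R)^-1 in
    let lambda : R := (Ln n)%:R^-1 in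
    let tn : nat := `|Num.ceil (c5 * ln (n%:R : R) * (Ln n)%:R)|%N in
    let err := cnn_error mu (avg_pool f) n L (K n) (archM kappa L) (archk kappa L)
                 c4 (c3 * (ln (n%:R : R)) ^+ 2 * (n%:R : R) `^ tau)
                 (c2 * (ln (n%:R : R)) ^+ 2) lambda tn in
    forall g : xsp R d1 d2 -> bool, measurable_fun setT g ->
      (err - risk mu (avg_pool f) g
         <= (c6 * (n%:R : R) `^ (- (2 * (kappa ^ 2)%:R + 2)^-1 + eps))%:E)%E.
Proof.
move=> k1 p12 [Cf [Cf0 fs]] L2 hK [rho [rho0 hrho]] hLn c20 c30 c40 c45' eps eps0.
have /andP[p1 _] := p12; have p0 : 0 < p by rewrite (lt_le_trans _ p1)// invr_gt0.
have [Fm fF] := smooth_bounded (ltW p0) (ltW Cf0) fs.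
have c50 : 0 < c5 by apply: lt_le_trans c45'; rewrite invr_gt0 mulr_gt0.
have c45 : 1 <= 2 * c4 * c5 by rewrite mulrC -ler_pdivrMr ?mulr_gt0// mul1r.
have [Cs [Cs1 HCs]] := sigmoid_taylor1 R.
set d := (kappa ^ 2)%N.
(* With y = n^ga the rate y^(2 d + 1) / sqrt x becomes n^(eps - tau / 2). *)
pose ga : R := eps / (2 * d + 1)%N%:R.
have ga0 : 0 < ga by rewrite divr_gt0// ltr0n addn1.
(* The Taylor order makes y^q at least n^(2 + rho / 2), which exceeds 2 n sqrt K because eventually
   K <= n^rho and n >= 2. *)
pose q := (Num.truncn ((2 + rho / 2) / ga)).+1.
have qga : 2 + rho / 2 <= ga * q%:R.
  have z0 : 0 <= (2 + rho / 2) / ga by rewrite divr_ge0 ?(ltW ga0)// addr_ge0// divr_ge0// ltW.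
  by have /andP[_ /ltW] := truncn_itv z0; rewrite ler_pdivrMr// => h; rewrite [leRHS]mulrC.
have [Ct [Ct1 Htaylor]] := sigmoid_taylor R q.
have [cP [eP [cP1 HP]]] := netP_poly kappa L Cs1.
pose be : R := - (2 * d%:R + 2)^-1 + eps.
(* The dimensions and the law are quantified inside the eventuality, so the threshold on n does not
   depend on them. *)
have main : \forall n \near \oo, forall (d1 d2 : nat) (mu : probability (xsp R d1 d2) R),
    (kappa <= d1)%N -> (kappa <= d2)%N -> mu (@cube R d1 d2) = 1%E ->
    (forall x, @cube R d1 d2 x -> 0 <= avg_pool f x <= 1) ->
    (cnn_error mu (avg_pool f) n L (K n) (archM kappa L) (archk kappa L)
       c4 (c3 * (ln (n%:R : R)) ^+ 2 * (n%:R : R) `^ ((1 + d%:R)^-1))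
       (c2 * (ln (n%:R : R)) ^+ 2) (Ln n)%:R^-1
       `|Num.ceil (c5 * ln (n%:R : R) * (Ln n)%:R)|%N
     <= (rst mu (avg_pool f) + Crate kappa L Cf Fm c4 * n%:R `^ be)%:E)%E.
  have hcst (c : R) : \forall n \near \oo, c <= n%:R :> R by exact: nbhs_infty_ger.
  have hK1 : \forall n \near \oo, 1 <= (K n)%:R / (n%:R : R) ^+ (2 * d + 7).
    by move/cvgryPge: hK => /(_ 1).
  have hK2 : \forall n \near \oo, `|0 - (K n)%:R / (n%:R : R) `^ rho| <= 1.
    by move/cvgrPdist_le: hrho => /(_ 1 ltr01).
  have F9d' := near_polylog (c2 ^+ L.-1 + 1) (L.-1 * 2) (@ltr01 R).
  have FP' := near_polylog (ccP c4 c5 * (cP * cb c2 c5 ^+ eP) ^+ 2) (2 * eP * 2).+1 (@ltr01 R).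
  have FL' := near_polylog ((d%:R * cw c3 c5 + UU c4 * L%:R) *
     (Ct * (Q1 q)%:R * (nin kappa)%:R * cb c2 c5) ^+ L) (2 * L + 2) ga0.
  have F8' := near_polylog (DD R kappa L q * (3 + rho)) 1 ga0.
  near=> n.
  have ll1 : 1 <= ln (n%:R : R) by near: n; exact: near_ln.
  have n2 : 2 <= n%:R :> R by near: n; exact: hcst.
  have nK1 : 1 <= (K n)%:R / (n%:R : R) ^+ (2 * d + 7) by near: n; exact: hK1.
  have nK2 : `|0 - (K n)%:R / (n%:R : R) `^ rho| <= 1 by near: n; exact: hK2.
  have nFP : ccP c4 c5 * (cP * cb c2 c5 ^+ eP) ^+ 2 * ln (n%:R : R) ^+ (2 * eP * 2).+1 <= n%:R `^ 1.
    by near: n; exact: FP'.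
  have nFL : (d%:R * cw c3 c5 + UU c4 * L%:R) *
     (Ct * (Q1 q)%:R * (nin kappa)%:R * cb c2 c5) ^+ L * ln (n%:R : R) ^+ (2 * L + 2) <= n%:R `^ ga.
    by near: n; exact: FL'.
  have F7 : 4 * DD R kappa L q * UU c4 * (Ct + 1) <= n%:R by near: n; exact: hcst.
  have nF8 : DD R kappa L q * (3 + rho) * ln (n%:R : R) ^+ 1 <= n%:R `^ ga by near: n; exact: F8'.
  have nF9a : 3 / (c2 / (16 * (nin kappa)%:R)) <= ln (n%:R : R) by near: n; exact: near_ln.
  have nF9b : 3 / (c3 / 16) <= ln (n%:R : R) by near: n; exact: near_ln.
  have F9c : 8 * (nin kappa)%:R <= n%:R :> R by near: n; exact: hcst.
  have nF9d : (c2 ^+ L.-1 + 1) * ln (n%:R : R) ^+ (L.-1 * 2) <= n%:R `^ 1 by near: n; exact: F9d'.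
  move=> d1 d2 mu kd1 kd2 muC eta01.
  set l := ln (n%:R : R) in ll1 nFP nFL nF8 nF9a nF9b nF9d *.
  set nR : R := n%:R in n2 nK1 nK2 nFP nFL F7 nF8 F9c nF9d *.
  set KR : R := (K n)%:R in nK1 nK2 *.
  have l0 : 0 < l by exact: lt_le_trans ll1.
  have n1 : 1 <= nR by rewrite (le_trans _ n2)// ler1n.
  have n0 : 0 < nR by exact: lt_le_trans ltr01 n1.
  have KR0 : 0 <= KR by [].
  have Kn : nR ^+ (2 * d + 7) <= KR.
    by move: nK1; rewrite ler_pdivlMr ?exprn_gt0// mul1r.
  have Krho : KR <= nR `^ rho.
    move: nK2; rewrite sub0r normrN ger0_norm ?divr_ge0 ?powR_ge0//.
    by rewrite ler_pdivrMr ?powR_gt0// mul1r.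
  pose x := nR `^ ((1 + d%:R)^-1); pose y := nR `^ ga.
  have pow1 (r : R) : 0 <= r -> 1 <= nR `^ r by move=> r0; rewrite -[leLHS](powRr0 nR) ler_powR.
  have x1 : 1 <= x by apply: pow1; rewrite invr_ge0 addr_ge0.
  have y1 : 1 <= y by apply: pow1; exact: ltW.
  have powX (r : R) k : (nR `^ r) ^+ k = nR `^ (r * k%:R).
    by rewrite -powR_mulrn ?powR_ge0// -powRrM.
  have dpos : 0 < 1 + d%:R :> R by rewrite ltr_pwDl.
  have nx : nR = x ^+ d.+1.
    by rewrite /x powX -natr1 [d%:R + 1]addrC mulVf ?gt_eqF// powRr1// ltW.
  have LnK : KR * Num.sqrt KR <= (Ln n)%:R.
    apply: le_trans (hLn n).
    have -> : KR `^ (3 / 2) = KR * Num.sqrt KR.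
      by apply: powR32; apply: lt_le_trans Kn; rewrite exprn_gt0.
    by rewrite ler_peMl ?mulr_ge0 ?sqrtr_ge0// exprn_ege1.
  have T1 : c5 * l * (Ln n)%:R <= `|Num.ceil (c5 * l * (Ln n)%:R)|%N%:R <= c5 * l * (Ln n)%:R + 1.
    have z0 : 0 <= c5 * l * (Ln n)%:R by rewrite mulr_ge0// mulr_ge0// ltW.
    have /andP[h1 h2] := ceil_itv (c5 * l * (Ln n)%:R).
    have c0 : 0 <= Num.ceil (c5 * l * (Ln n)%:R).
      by rewrite -(ler_int R) (le_trans z0 h2).
    rewrite natr_absz ger0_norm// h2 /=.
    by rewrite -lerBlDr; apply: ltW; move: h1; rewrite intrB.
  have lk k : 1 <= l ^+ k by rewrite exprn_ege1.
  have cb3 : 3 <= cb c2 c5 by rewrite /cb lerDr addr_ge0 ?mulr_ge0 ?(ltW c20) ?(ltW c50).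
  have B1 : 1 <= BB n c2 c5.
    by rewrite /BB -/l mulr_ege1// (le_trans _ cb3)// ler1n.
  have FP : ccP c4 c5 * PP kappa L n c2 c5 Cs ^+ 2 * l <= nR.
    have h := nFP; rewrite powRr1 ?(ltW n0)// in h; apply: le_trans h.
    have P0 : 0 <= PP kappa L n c2 c5 Cs.
      by apply: le_trans (netP_ge1 kappa L Cs1 (le_trans ler01 B1)).
    have h := HP _ B1; rewrite -/(PP kappa L n c2 c5 Cs) in h.
    have e : cP * BB n c2 c5 ^+ eP = cP * cb c2 c5 ^+ eP * l ^+ (2 * eP).
      by rewrite /BB -/l exprMn exprM mulrA.
    rewrite e in h.
    have cc0 := ccP_ge0 c40 c50.
    rewrite [l ^+ _.+1]exprSr [l ^+ (_ * 2)]exprM [leRHS]mulrA ler_wpM2r ?(ltW l0)//.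
    rewrite -[leRHS]mulrA ler_wpM2l// -exprMn.
    by rewrite lerXn2r ?nnegrE// (le_trans P0 h).
  have FL : (d%:R * cw c3 c5 + UU c4 * L%:R) * (LL kappa L n c2 c5 Ct q * l ^+ 2) <= y.
    apply: le_trans nFL.
    have -> : LL kappa L n c2 c5 Ct q =
        (Ct * (Q1 q)%:R * (nin kappa)%:R * cb c2 c5) ^+ L * l ^+ (2 * L).
      by rewrite /LL /Lam /BB -/l [_ * (cb c2 c5 * _)]mulrA exprMn -exprM.
    by rewrite exprD !mulrA.
  have sKr : Num.sqrt KR <= nR `^ (rho / 2).
    by rewrite -powR12_sqrt// powRrM; apply: ge0_ler_powR; rewrite ?nnegrE ?powR_ge0 ?invr_ge0.
  have F6 : 2 * nR * Num.sqrt KR <= y ^+ q.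
    rewrite /y powX (@le_trans _ _ (nR `^ (2 + rho / 2)))//; last by rewrite ler_powR.
    rewrite powRD_gt// powR_mulrn ?(ltW n0)// expr2.
    by rewrite ler_pM ?mulr_ge0 ?sqrtr_ge0 ?(ltW n0)// ler_wpM2r ?(ltW n0).
  have F8 : DD R kappa L q * ln (n ^ 2 * K n).+1%:R <= y.
    have D0 : 0 <= DD R kappa L q by exact: ler0n.
    apply: le_trans nF8; rewrite -[leRHS]mulrA ler_wpM2l//.
    rewrite expr1 /l -/nR -ln_powR ler_ln ?posrE ?powR_gt0//.
    have -> : (n ^ 2 * K n).+1%:R = nR ^+ 2 * KR + 1 :> R by rewrite -natr1 natrM natrX.
    have -> : 3 + rho = 1 + (2 + rho) by ring.
    have -> : nR `^ (1 + (2 + rho)) = nR * (nR ^+ 2 * nR `^ rho).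
      by rewrite powRD_gt// powRr1 ?(ltW n0)// powRD_gt// powR_mulrn// ltW.
    have h1 : nR ^+ 2 * KR <= nR ^+ 2 * nR `^ rho by rewrite ler_wpM2l// sqr_ge0.
    have h2 : 1 <= nR ^+ 2 * nR `^ rho by rewrite mulr_ege1 ?exprn_ege1// pow1// ltW.
    exact: succ_le_mul h1 h2 n2.
  have F9a : 3 <= c2 / (16 * (nin kappa)%:R) * l.
    have k0 : 0 < c2 / (16 * (nin kappa)%:R).
      by rewrite divr_gt0// mulr_gt0// ltr0n /nin muln_gt0 expn_gt0 k1.
    by rewrite mulrC -ler_pdivrMr.
  have F9b : 3 <= c3 / 16 * l.
    have k0 : 0 < c3 / 16 by rewrite divr_gt0.
    by rewrite mulrC -ler_pdivrMr.
  have F9d : a2 n c2 ^+ L.-1 + 1 <= nR.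
    have h := nF9d; rewrite powRr1 ?(ltW n0)// in h; apply: le_trans h.
    by rewrite /a2 -/l exprMn -exprM mulnC mulrDl mul1r lerD2l.
  have kp : (0 < kappa)%N by [].
  have := rate_bound k1 L2 kd1 kd2 muC p12 Cf0 fs fF eta01 c20 c30 c40 c50 c45 Cs1 HCs Ct1 Htaylor
    x1 nx y1 (erefl (x `^ 2^-1)) ll1 Kn LnK T1 FP FL F6 F7 F8 F9a F9b F9c F9d (Ordinal kp, Ordinal kp).
  suff -> : y ^+ (2 * d + 1) / x `^ 2^-1 = nR `^ be by move=> h; exact: h.
  rewrite /y powX /ga divfK ?pnatr_eq0 ?addn1// /x -powRrM -powRN -powRD_gt//.
  have e2 : 2 * d%:R + 2 = (1 + d%:R) * 2 :> R by ring.
  by rewrite /be e2 invfM [eps - _]addrC.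
have [N0 _ HN0] := main.
(* The second summand serves the finitely many n below [N0]: there the error is at most 1, while
   N0.+1 / n >= 1 and the exponent [be] is at least -1. *)
exists (`|Crate kappa L Cf Fm c4| + N0.+1%:R).
have N00 : 0 < N0.+1%:R :> R by [].
split; first by rewrite ltr_wpDl.
move=> d1 d2 mu _ _ kd muC eta01 n n1 tau lambda tn err g _.
have [kd1 kd2] : (kappa <= d1)%N /\ (kappa <= d2)%N by move: kd; rewrite leq_min => /andP[].
have nR1 : 1 <= n%:R :> R by rewrite ler1n.
have meta : measurable_fun (@cube R d1 d2) (avg_pool f : xsp R d1 d2 -> R).
  exact: measurable_avg_pool fs.
have rr := rst_le_risk muC meta eta01 g.
have b0 : 0 <= n%:R `^ be :> R by exact: powR_ge0.
case: (leqP N0 n) => hn.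
  have h := HN0 n hn d1 d2 mu kd1 kd2 muC eta01.
  apply: (le_trans (leeB h rr)); rewrite -EFinB lee_fin addrC addKr.
  rewrite ler_wpM2r// (le_trans (ler_norm _))// lerDl//.
have e1 : (err <= 1)%E by exact: cnn_error_le1.
have r0 : (0 <= risk mu (avg_pool f) g)%E by exact: risk_ge0.
apply: (le_trans (leeB e1 r0)); rewrite sube0 lee_fin.
apply: (@le_trans _ _ (N0.+1%:R * n%:R `^ be)); last by rewrite ler_wpM2r// lerDr.
apply: (@le_trans _ _ (N0.+1%:R * n%:R `^ (- 1))).
  rewrite powR_inv1// ler_pdivlMr ?(lt_le_trans ltr01)// mul1r ler_nat ltnW//.
  by rewrite ltnS ltnW.
rewrite ler_wpM2l// ler_powR// /be.
have : (2 * d%:R + 2)^-1 <= 1 :> R by rewrite invf_le1//; have := ler0n R d; move: (d%:R : R) => z; lra.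
by move: eps0; lra.
Unshelve. all: by end_near. Qed.
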